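(* Let $\alpha>-1$. The Beurling-type theorem holds for $T_z$ on $A^2_\alpha$ if and only if $\alpha\le 1$.
   Context: $\mathbb D=\{z\in\mathbb C:|z|<1\}$. For $\alpha>-1$, the weighted Bergman space $A^2_\alpha=A^2_\alpha(\mathbb D)$ is the Hilbert space of holomorphic $f$ on $\mathbb D$ with $\|f\|_\alpha^2=\int_{\mathbb D}|f(z)|^2(\alpha+1)(1-|z|^2)^\alpha dA(z)<\infty$, where $dA=\frac{dx\,dy}{\pi}$. $T_z f(z)=zf(z)$ is the shift operator. The Beurling-type theorem is said to hold for a bounded operator $T$ on a Hilbert space $\mathcal H$ if every closed $T$-invariant subspace $\mathcal M$ of $\mathcal H$ satisfies $\mathcal M=[\mathcal M\ominus T\mathcal M]_T$, where $\mathcal M\ominus T\mathcal M$ is the orthogonal complement of $T\mathcal M$ in $\mathcal M$ and $[\mathcal E]_T=\overline{\operatorname{span}}\{T^n f:n\ge0,\ f\in\mathcal E\}$. *)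

(* Defs.v *)
From mathcomp Require Import all_boot all_order all_algebra.
From mathcomp Require Import all_classical all_reals all_analysis.
From mathcomp Require Export complex.
Import Order.TTheory GRing.Theory Num.Theory.
Import numFieldNormedType.Exports.

Set Implicit Arguments.
Unset Strict Implicit.
Unset Printing Implicit Defensive.

Local Open Scope classical_set_scope.
Local Open Scope complex_scope.
Local Open Scope ring_scope.

(* A Hilbert space is presented as a set H of vectors of an ambient complex
   vector space V, together with a function ip : V -> V -> R[i] whose restriction
   to H is the inner product.  Closures and closed subspaces are relative to H. *)
Section Beurling.
Context {R : realType} {V : lmodType R[i]}.
Variables (H : set V) (ip : V -> V -> R[i]) (T : V -> V).

Definition ip_norm (v : V) : R := Num.sqrt (complex.Re (ip v v)).

Definition hclosure (A : set V) : set V :=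
  [set v | H v /\
    forall e : R, 0 < e -> exists2 u, A u & ip_norm (v - u) < e].

Definition closed_subspace (M : set V) : Prop :=
  [/\ M `<=` H, M 0,
      (forall (a : R[i]) (u v : V), M u -> M v -> M (a *: u + v))
    & hclosure M `<=` M].

Definition lin_span (A : set V) : set V :=
  [set v | exists (n : nat) (a : 'I_n -> R[i]) (u : 'I_n -> V),
    (forall i, A (u i)) /\ v = \sum_(i < n) a i *: u i].

Definition ominus (M N : set V) : set V :=
  [set v | M v /\ forall u, N u -> ip v u = 0].

Definition generated (E : set V) : set V :=
  hclosure (lin_span [set iter n T v | n in [set: nat] & v in E]).

Definition Beurling_type : Prop :=
  forall M : set V, closed_subspace M -> T @` M `<=` M ->
    M = generated (ominus M (T @` M)).

End Beurling.

Section Bergman.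
Context {R : realType}.
Implicit Types (alpha : R) (f g : R[i] -> R[i]^o) (z : R[i]).

Definition disc : set R[i] := [set z | `|z| < 1].

Definition holomorphic_on_disc f : Prop :=
  forall z, disc z -> derivable (f : R[i]^o -> R[i]^o) z 1.

Definition cplx (p : R * R) : R[i] := p.1 +i* p.2.

Definition plane_measure : {measure set (measurableTypeR R * measurableTypeR R) -> \bar R} :=
  (@lebesgue_measure R \x @lebesgue_measure R)%E.

(* Density of (alpha + 1) (1 - |z|^2)^alpha dA with respect to dx dy. *)
Definition bergman_weight alpha z : R :=
  (alpha + 1) * (1 - Normc.normc z ^+ 2) `^ alpha / pi.

Definition bergman_sqnorm alpha f : \bar R :=
  (\int[plane_measure]_(p in cplx @^-1` disc)
    (Normc.normc (f (cplx p)) ^+ 2 * bergman_weight alpha (cplx p))%:E)%E.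

(* Functions on the disc are represented by their extension by 0, so that
   two elements of the space are equal iff they agree on the disc. *)
Definition bergman alpha : set (R[i] -> R[i]^o) :=
  [set f | [/\ holomorphic_on_disc f, (forall z, ~ disc z -> f z = 0)
             & (bergman_sqnorm alpha f < +oo)%E]].

Definition disc_integral (h : R[i] -> R) : R :=
  Rintegral plane_measure (cplx @^-1` disc) (h \o cplx).

Definition bergman_ip alpha f g : R[i] :=
  let h z : R[i] := f z * (g z : R[i])^* in
  disc_integral (fun z => complex.Re (h z) * bergman_weight alpha z) +i*
  disc_integral (fun z => complex.Im (h z) * bergman_weight alpha z).

Definition shift_op f : R[i] -> R[i]^o := fun z => z * f z.

Lemma bergman_ip_normE alpha f :
  bergman_ip alpha f f = (fine (bergman_sqnorm alpha f))%:C.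
Proof.
have E z : (f z * (f z : R[i])^* : R[i]) = (Normc.normc (f z) ^+ 2)%:C.
  by rewrite -normCK rmorphXn.
rewrite /bergman_ip /disc_integral /Rintegral /bergman_sqnorm.
set a := fine _; set b := fine _; set c := fine _.
have -> : a = c by congr fine; apply: eq_integral => p _ /=; rewrite E.
suff -> : b = 0 by [].
rewrite /b -[RHS]/(fine 0%E) -(integral0 plane_measure (cplx @^-1` disc)).
by congr fine; apply: eq_integral => p _ /=; rewrite E /= mul0r.
Qed.

End Bergman.

(* Main.v *)
Require Import Defs.
From mathcomp Require Import all_boot all_order all_algebra.
From mathcomp Require Import all_classical all_reals all_analysis.
From mathcomp Require Import measurable_realfun ring lra.
Import Order.TTheory GRing.Theory Num.Theory.
Import numFieldNormedType.Exports Normc.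

Set Implicit Arguments.
Unset Strict Implicit.
Unset Printing Implicit Defensive.

Local Open Scope classical_set_scope.
Local Open Scope complex_scope.
Local Open Scope ring_scope.

(** Taylor expansion identifies A^2_alpha with the space of sequences whose
    weights are w_n = n! / (a + 1)_n, where a = alpha + 1, and T_z with the
    shift T.

    If a <= 2, let M be closed and T-invariant, E the orthocomplement of T M in
    M, and v in M orthogonal to every T^n E.  Projecting repeatedly onto T M
    gives v = sum_(k < N) T^k e_k + T^N x_N with e_k in E.  For 0 <= r <= 1 put
    u = sum_(k < N) r^(k^2) T^k e_k + r^(N^2) T^N x_N.  Positivity of the form
    (k^2 + l^2) w_m - (k - l)^2 w_(m - min(k, l)) makes |u| nondecreasing in r,
    so |u| <= |v|.  With r = 1 - 1/(N + 1) the vectors u tend weakly to v, while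
    <u, v> = r^(N^2) <v, v> tends to 0; hence v = 0.

    If a > 2, choose q slightly larger than a/2 and let F = (1 - z)^(-q), which
    is not in the space.  Consider the invariant subspaces generated by
    sum_(k < N) F_k z^k + c_n z^n with c_n^2 w_n = c and n much larger than N.
    If the Beurling-type theorem holds, the function representing f |-> f(0) in
    such a subspace generates it, hence has no zero on [0, 1).  In the limit
    N -> oo this yields psi >= 0 on [0, 1) such that h = F psi is in the space
    and <F / (1 - x z), h> + c psi(x) = 1 for 0 <= x < 1.  The inner product is
    the integral of h against a positive kernel, and comparing the kernels for
    x and for x -> 1 shows that psi is bounded below near 1 when c is large.
    Then h x^q (1 - x)^(a - q - 1) is at least a multiple of
    (1 - x)^(a - 2 q - 1), which is not integrable: a contradiction. *)

(** * Absolutely convergent real series *)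

(** If a <= 2, the exponents k^2 are chosen to fit the orthogonality. Differentiating |u|^2 in r
    produces the coefficients k^2 + l^2. Since e_k is orthogonal to T^(l - k) e_l, the terms with (k
    - l)^2 w_(m - min(k, l)) sum to zero over m and may be subtracted freely. For each m there
    remains a finite quadratic form, and its positivity reduces to a one-step inequality whose
    determinant has a leading term with the factor 2 - a.

    If a > 2, the coefficient c_n has three uses. It makes the multiplication bounded below, so that
    its range is a closed invariant subspace. It is so large that the cross terms with the other
    coefficients are negligible. And since w_(n + k) / w_n tends to 1, its own contribution tends to
    the unweighted product of psi and g with factor c, which is c psi(x) for g = 1 / (1 - x z). The
    exponent satisfies a < 2 q < a + 1: the upper bound keeps F / (1 - x z) square summable for w,
    the lower one forces the final divergence. The parameter c stays free until the very end. *)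

Section Sums.
Context {R : realType}.
Implicit Types u v : nat -> R.

Definition ssum u : R := limn (series u).
Definition asum u : Prop := cvgn (series (fun k => `|u k|)).

Lemma asum_cvg u : asum u -> series u @ \oo --> ssum u.
Proof. by move=> h; apply: normed_cvg. Qed.

Lemma asum_le u v : (forall k, `|u k| <= v k) -> asum v -> asum u.
Proof.
move=> uv hv; apply: (@series_le_cvg _ _ (fun k => `|v k|)) => //.
by move=> k; apply: le_trans (uv k) (ler_norm _).
Qed.

Lemma asum_bnd u B : (forall N, \sum_(k < N) `|u k| <= B) -> asum u.
Proof.
move=> hB; apply: nondecreasing_is_cvgn.
  by apply: nondecreasing_series => k _ _.
by exists B => _ [N _ <-]; rewrite seriesEord; apply: hB.
Qed.

Lemma ssum_leB u B : asum u -> (forall N, \sum_(k < N) u k <= B) -> ssum u <= B.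
Proof.
move=> hu hB; apply: limr_le; first exact: (cvgP _ (asum_cvg hu)).
by near=> N; rewrite seriesEord; apply: hB.
Unshelve. all: by end_near. Qed.

Lemma eq_ssum u v : u =1 v -> ssum u = ssum v.
Proof. by move=> /funext ->. Qed.

Lemma eq_asum u v : asum u -> u =1 v -> asum v.
Proof. by move=> h /funext <-. Qed.

Lemma asum_norm u : asum u -> asum (fun k => `|u k|).
Proof.
by move=> hu; rewrite /asum; under eq_fun do rewrite normr_id.
Qed.

Lemma asumD u v : asum u -> asum v -> asum (fun k => u k + v k).
Proof.
move=> hu hv; apply: (@asum_le _ (fun k => `|u k| + `|v k|)).
  by move=> k; apply: ler_normD.
have := is_cvg_seriesD hu hv; rewrite /asum.
by congr (cvgn (series _)); apply/funext => k /=; rewrite [in RHS]ger0_norm ?addr_ge0.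
Qed.

Lemma ssumD u v : asum u -> asum v -> ssum (fun k => u k + v k) = ssum u + ssum v.
Proof.
by move=> /asum_cvg/cvgP hu /asum_cvg/cvgP hv; rewrite /ssum -lim_seriesD.
Qed.

Lemma ssum_part u N : asum u -> (forall k, 0 <= u k) -> \sum_(k < N) u k <= ssum u.
Proof.
move=> /asum_cvg/cvgP hu h.
have := nondecreasing_cvgn_le (nondecreasing_series (P := xpredT) (m := 0) (fun n _ _ => h n)) hu N.
by rewrite big_mkord.
Qed.

Lemma asumZ a u : asum u -> asum (fun k => a * u k).
Proof.
move=> hu; apply: (@asum_bnd _ (`|a| * ssum (fun k => `|u k|))) => N.
under eq_bigr do rewrite normrM.
by rewrite -mulr_sumr ler_wpM2l // ssum_part //; exact: asum_norm.
Qed.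

Lemma ssumZ a u : asum u -> ssum (fun k => a * u k) = a * ssum u.
Proof. by move=> /asum_cvg/cvgP hu; rewrite /ssum -[RHS]lim_seriesZ. Qed.

Lemma asumN u : asum u -> asum (fun k => - u k).
Proof. by move=> hu; apply: (eq_asum (@asumZ (-1) u hu)) => k; rewrite mulN1r. Qed.

Lemma ssumN u : asum u -> ssum (fun k => - u k) = - ssum u.
Proof.
by move=> hu; rewrite -mulN1r -ssumZ//; apply: eq_ssum => k; rewrite mulN1r.
Qed.

Lemma asumB u v : asum u -> asum v -> asum (fun k => u k - v k).
Proof. by move=> hu hv; apply: asumD => //; apply: asumN. Qed.

Lemma ssumB u v : asum u -> asum v -> ssum (fun k => u k - v k) = ssum u - ssum v.
Proof. by move=> hu hv; rewrite ssumD ?ssumN//; apply: asumN. Qed.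

Lemma ssum_le u v : asum u -> asum v -> (forall k, u k <= v k) -> ssum u <= ssum v.
Proof.
move=> /asum_cvg/cvgP hu /asum_cvg/cvgP hv h; exact: lim_series_le.
Qed.

Lemma ssum0 : ssum (fun=> 0) = 0.
Proof.
apply/cvg_lim => //; apply: cvg_near_cst; near=> n.
by rewrite seriesEord /= big1.
Unshelve. all: by end_near. Qed.

Lemma asum0 : asum (fun=> 0).
Proof. by apply: (@asum_bnd _ 0) => N; rewrite big1 // => i _; rewrite normr0. Qed.

Lemma ssum_ge0 u : asum u -> (forall k, 0 <= u k) -> 0 <= ssum u.
Proof. by move=> hu h; rewrite -ssum0; apply: ssum_le => //; exact: asum0. Qed.

Lemma ssum_term u n : asum u -> (forall k, 0 <= u k) -> u n <= ssum u.
Proof.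
move=> hu h; apply: le_trans (ssum_part n.+1 hu h).
by rewrite big_ord_recr /= lerDr sumr_ge0.
Qed.

Lemma ssum_norm u : asum u -> `|ssum u| <= ssum (fun k => `|u k|).
Proof.
move=> hu; rewrite ler_norml; apply/andP; split; last first.
  by apply: ssum_le => //; [exact: asum_norm|move=> k; apply: ler_norm].
rewrite -ssumN; last exact: asum_norm.
apply: ssum_le => //; first by apply/asumN/asum_norm.
by move=> k; rewrite lerNl ler_normr lexx orbT.
Qed.

Lemma asumS u : asum u -> asum (fun k => u k.+1).
Proof.
move=> hu; apply: (@asum_bnd _ (ssum (fun k => `|u k|))) => N.
apply: le_trans (ssum_part N.+1 (asum_norm hu) _) => //.
by rewrite big_ord_recl /= lerDr.
Qed.

Lemma ssum_recl u : asum u -> ssum u = u 0%N + ssum (fun k => u k.+1).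
Proof.
move=> hu; apply/cvg_lim => //; rewrite -(cvg_shiftS (series u)) /=.
have -> : (fun n => series u n.+1) = (fun n => u 0%N + series (fun k => u k.+1) n).
  by apply/funext => n /=; rewrite !seriesEord /= big_ord_recl.
by apply: cvgD; [exact: cvg_cst|apply/asum_cvg/asumS].
Qed.

Lemma asum_recl u : asum (fun k => u k.+1) -> asum u.
Proof.
move=> hu; apply: (@asum_bnd _ (`|u 0%N| + ssum (fun k => `|u k.+1|))) => -[|N].
  by rewrite big_ord0 addr_ge0 // ssum_ge0 //; exact: asum_norm.
by rewrite big_ord_recl lerD2l; apply: (ssum_part N (asum_norm hu)).
Qed.

Lemma asum_shift u n : asum u -> asum (fun k => u (n + k)%N).
Proof.
elim: n => [//|n IH] hu; apply: (eq_asum (asumS (IH hu))) => k.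
by rewrite addnS.
Qed.

Lemma ssum_split u n : asum u ->
  ssum u = \sum_(k < n) u k + ssum (fun k => u (n + k)%N).
Proof.
move=> hu; elim: n => [|n IH]; first by rewrite big_ord0 add0r.
rewrite IH big_ord_recr /= -addrA (@ssum_recl (fun k => u (n + k)%N)); last exact: asum_shift.
by rewrite addn0; congr (_ + (_ + _)); apply: eq_ssum => k; rewrite addnS.
Qed.

Lemma ssum_tail u : asum u -> ssum (fun k => u (n + k)%N) @[n --> \oo] --> 0.
Proof.
move=> hu.
have -> : (fun n => ssum (fun k => u (n + k)%N)) = (fun n => ssum u - series u n).
  apply/funext => n; rewrite (ssum_split n hu) seriesEord /=.
  by rewrite addrAC subrr add0r.
rewrite -(subrr (ssum u)); apply: cvgB; [exact: cvg_cst|exact: asum_cvg].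
Qed.

Lemma asum_fin u n : (forall k, (n <= k)%N -> u k = 0) -> asum u.
Proof.
move=> h; apply: (@asum_bnd _ (\sum_(k < n) `|u k|)) => N.
have [Nn|nN] := leqP N n.
  rewrite -(subnK Nn) addnC big_split_ord /= lerDl.
  by apply: sumr_ge0.
rewrite -(subnK (ltnW nN)) addnC big_split_ord /= [X in _ + X]big1 ?addr0 // => i _.
by rewrite h ?normr0 // leq_addr.
Qed.

Lemma ssum_fin u n : (forall k, (n <= k)%N -> u k = 0) -> ssum u = \sum_(k < n) u k.
Proof.
move=> h; rewrite (ssum_split n (asum_fin h)) -[RHS]addr0; congr (_ + _).
by rewrite -ssum0; apply: eq_ssum => k; rewrite h ?leq_addr.
Qed.

(** Dominated convergence for series along an arbitrary proper filter: besides sequences, it is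
    applied to the neighbourhoods of a point in [exists_psi] and to an ultrafilter in
    [limit_equation]. *)
Lemma tannery (T : Type) (F : set_system T) {FF : ProperFilter F}
    (u : T -> nat -> R) (l v : nat -> R) :
  asum v -> (\forall n \near F, forall k, `|u n k| <= v k) ->
  (forall k, u n k @[n --> F] --> l k) -> ssum (u n) @[n --> F] --> ssum l.
Proof.
move=> hv huv hl.
have lv k : `|l k| <= v k.
  have h : `|u n k| @[n --> F] --> `|l k| by apply: cvg_norm.
  rewrite -(cvg_lim _ h) //; apply: limr_le; first exact: (cvgP _ h).
  by apply: filterS huv.
have hal := asum_le lv hv.
apply/cvgrPdist_le => /= e e0.
have e4 : 0 < e / 3 by lra.
(* Past this N the majorant has a tail of at most e / 3, which bounds the tails of [l] and of [u n]
   alike. *)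
have [N _ hN] := (cvgrPdist_le _ _).1 (ssum_tail hv) _ e4.
have := hN N (leqnn N); rewrite sub0r normrN => {}hN.
have hs : \sum_(k < N) u n k @[n --> F] --> \sum_(k < N) l k.
  elim: {hN}N => [|N IH]; first by under eq_fun do rewrite big_ord0; rewrite big_ord0; exact: cvg_cst.
  by under eq_fun do rewrite big_ord_recr; rewrite big_ord_recr; apply: cvgD.
have hs' := (cvgrPdist_le _ _).1 hs _ e4.
near=> n.
have uv : forall k, `|u n k| <= v k by near: n; exact: huv.
have hun := asum_le uv hv.
have h1 : `|\sum_(k < N) l k - \sum_(k < N) u n k| <= e / 3 by near: n; exact: hs'.
rewrite (ssum_split N hal) (ssum_split N hun).
have tl (w : nat -> R) : (forall k, `|w k| <= v k) ->
    `|ssum (fun k => w (N + k)%N)| <= e / 3.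
  move=> wv; have hw := asum_le wv hv.
  have h2 := ssum_norm (@asum_shift w N hw).
  apply: (le_trans h2).
  apply: le_trans hN; apply: le_trans (ler_norm _).
  by apply: ssum_le => //; [apply/asum_norm/asum_shift|exact: asum_shift].
have /ler_normlP[] := h1; have /ler_normlP[] := tl _ uv; have /ler_normlP[] := tl _ lv.
by move=> ? ? ? ? ? ?; rewrite ler_norml; apply/andP; split; lra.
Unshelve. all: by end_near. Qed.

Lemma asum_geo x : `|x| < 1 -> asum (fun k => x ^+ k).
Proof.
move=> x1; have := @is_cvg_geometric_series R 1 `|x|; rewrite normr_id => /(_ x1).
by rewrite /asum; congr (cvgn (series _)); apply/funext => k /=; rewrite mul1r normrX.
Qed.

Lemma ssum_geo x : `|x| < 1 -> ssum (fun k => x ^+ k) = (1 - x)^-1.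
Proof.
move=> x1; apply/cvg_lim => //.
have := @cvg_geometric_series R 1 x x1; rewrite div1r.
by have -> : geometric 1 x = [eta GRing.exp x] by apply/funext => k /=; rewrite mul1r.
Qed.

Lemma asum_sqM u v : asum (fun k => u k ^+ 2) -> asum (fun k => v k ^+ 2) ->
  asum (fun k => u k * v k).
Proof.
move=> hu hv; apply: asum_le (asumD hu hv) => k.
rewrite normrM -(real_normK (num_real (u k))) -(real_normK (num_real (v k))).
have := sqr_ge0 (`|u k| - `|v k|); have := normr_ge0 (u k); have := normr_ge0 (v k).
nra.
Qed.

End Sums.

(** * Planar Lebesgue measure *)

Notation pushforward_measure :=
  measure_function_pushforward__canonical__measure_function_Measure.

Lemma mem_bset (T : Type) (P : T -> bool) q : (q \in [set p | P p]) = P q.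
Proof. by apply/idP/idP => [/set_mem|h] //; apply/mem_set. Qed.

Section PlaneMeasure.
Context {R : realType}.
Notation mu := (@lebesgue_measure R).
Notation mR := (measurableTypeR R).
Local Open Scope ereal_scope.

(** A measure that agrees with Lebesgue measure on half-open intervals equals it, and a times the
    image measure under x |-> a x + b does. *)
Lemma lebesgue_affine (a b : R) (A : set mR) : (0 < a)%R -> measurable A ->
  mu A = a%:E * pushforward mu (fun x : mR => (a * x + b)%R : mR) A.
Proof.
move=> a0 mA.
have mphi : measurable_fun [set: mR] (fun x : mR => (a * x + b)%R : R).
  by apply: measurable_funD => //; apply: measurable_funM.
have mphi' : @measurable_fun _ _ mR mR [set: mR] (fun x => a * x + b)%R := mphi.
pose phi := (fun x : mR => (a * x + b)%R : mR).
pose m : {measure set mR -> \bar R} := mscale (NngNum (ltW a0)) (pushforward_measure mu mphi').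
have -> : a%:E * pushforward mu (fun x : mR => (a * x + b)%R : mR) A
    = m A by [].
apply: lebesgue_measure_unique => // _ [[u v] _ <-].
change (mu `]u, v]%classic = a%:E * mu (phi @^-1` `]u, v]%classic)).
have -> : phi @^-1` `]u, v]%classic = `](u - b) / a, (v - b) / a]%classic%R.
  apply/seteqP; split => x /=; rewrite !in_itv /= => /andP[h1 h2].
    by rewrite ltr_pdivrMr // ler_pdivlMr // ltrBlDr lerBrDr (mulrC x); apply/andP.
  by move: h1 h2; rewrite ltr_pdivrMr // ler_pdivlMr // ltrBlDr lerBrDr (mulrC x) => ? ?; apply/andP.
rewrite !lebesgue_measure_itv /= !lte_fin ltr_pM2r ?invr_gt0 // ltrD2r.
case: ifP => _; last by rewrite mule0.
rewrite -!EFinD -EFinM; congr EFin.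
by field; rewrite gt_eqF.
Qed.

Lemma integral_affine (a b : R) (f : mR -> \bar R) : (0 < a)%R ->
  measurable_fun [set: mR] f -> (forall x, 0 <= f x) ->
  \int[mu]_x f x = a%:E * \int[mu]_x f (a * x + b)%R.
Proof.
move=> a0 mf f0.
have mphi : measurable_fun [set: mR] (fun x : mR => (a * x + b)%R : R).
  by apply: measurable_funD => //; apply: measurable_funM.
have mphi' : @measurable_fun _ _ mR mR [set: mR] (fun x => a * x + b)%R := mphi.
pose phi := (fun x : mR => (a * x + b)%R : mR).
pose m : {measure set mR -> \bar R} := mscale (NngNum (ltW a0)) (pushforward_measure mu mphi').
transitivity (\int[m]_x f x).
  by apply: eq_measure_integral => A mA _; exact: lebesgue_affine.
rewrite ge0_integral_mscale //=; congr (_ * _).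
by rewrite (@ge0_integral_pushforward _ _ mR mR R phi mphi' mu setT f).
Qed.

Definition pl : measurableType _ := (mR * mR)%type.
Notation nu := (@plane_measure R).

Lemma tonelli1 (f : pl -> \bar R) : measurable_fun [set: pl] f ->
  (forall p, 0 <= f p) -> \int[nu]_p f p = \int[mu]_x \int[mu]_y f (x, y).
Proof. by move=> mf f0; apply: (@fubini_tonelli1 _ _ mR mR R mu mu f mf f0). Qed.

Lemma tonelli2 (f : pl -> \bar R) : measurable_fun [set: pl] f ->
  (forall p, 0 <= f p) -> \int[nu]_p f p = \int[mu]_y \int[mu]_x f (x, y).
Proof. by move=> mf f0; apply: (@fubini_tonelli2 _ _ mR mR R mu mu f mf f0). Qed.

Lemma measurable_slice1 (f : pl -> \bar R) y : measurable_fun [set: pl] f ->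
  measurable_fun [set: mR] (fun x => f (x, y)).
Proof.
by move=> mf; apply: (measurableT_comp mf); apply: measurable_fun_pair.
Qed.

Lemma measurable_slice2 (f : pl -> \bar R) x : measurable_fun [set: pl] f ->
  measurable_fun [set: mR] (fun y => f (x, y)).
Proof.
by move=> mf; apply: (measurableT_comp mf); apply: measurable_fun_pair.
Qed.

(** On each horizontal line the shear is a translation, so Tonelli reduces it to
    [integral_affine]. *)
Lemma shear1 (t : R) (f : pl -> \bar R) : measurable_fun [set: pl] f ->
  (forall p, 0 <= f p) -> \int[nu]_p f ((p.1 + t * p.2)%R, p.2) = \int[nu]_p f p.
Proof.
move=> mf f0.
have ms : measurable_fun [set: pl] (fun p : pl => ((p.1 + t * p.2)%R, p.2) : pl).
  apply: measurable_fun_pair => //=.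
  by apply: measurable_funD => //; apply: measurable_funM.
rewrite (tonelli2 (measurableT_comp mf ms) (fun=> f0 _)) (tonelli2 mf f0).
apply: eq_integral => y _.
rewrite [RHS](integral_affine (a := 1) (t * y) ltr01 (measurable_slice1 y mf) (fun=> f0 _)) mul1e.
by apply: eq_integral => x _; rewrite /= mul1r.
Qed.

Lemma shear2 (t : R) (f : pl -> \bar R) : measurable_fun [set: pl] f ->
  (forall p, 0 <= f p) -> \int[nu]_p f (p.1, (p.2 + t * p.1)%R) = \int[nu]_p f p.
Proof.
move=> mf f0.
have ms : measurable_fun [set: pl] (fun p : pl => (p.1, (p.2 + t * p.1)%R) : pl).
  apply: measurable_fun_pair => //=.
  by apply: measurable_funD => //; apply: measurable_funM.
rewrite (tonelli1 (measurableT_comp mf ms) (fun=> f0 _)) (tonelli1 mf f0).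
apply: eq_integral => x _.
rewrite [RHS](integral_affine (a := 1) (t * x) ltr01 (measurable_slice2 x mf) (fun=> f0 _)) mul1e.
by apply: eq_integral => y _; rewrite /= mul1r.
Qed.

Definition prot (c s : R) (p : pl) : pl := ((c * p.1 - s * p.2)%R, (s * p.1 + c * p.2)%R).

Lemma measurable_prot c s : measurable_fun [set: pl] (prot c s).
Proof.
apply: measurable_fun_pair => //=.
  by apply: measurable_funB; apply: measurable_funM.
by apply: measurable_funD; apply: measurable_funM.
Qed.

(* A rotation is a product of three shears. *)
Lemma integral_prot (c s : R) (f : pl -> \bar R) : (c ^+ 2 + s ^+ 2 = 1)%R -> (s != 0)%R ->
  measurable_fun [set: pl] f -> (forall p, 0 <= f p) ->
  \int[nu]_p f (prot c s p) = \int[nu]_p f p.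
Proof.
(* For a rotation by theta this is t = - tan (theta / 2), the factor of the two outer shears. *)
move=> cs s0 mf f0; pose t := ((c - 1) / s)%R.
have ms1 : measurable_fun [set: pl] (fun p : pl => ((p.1 + t * p.2)%R, p.2) : pl).
  apply: measurable_fun_pair => //=.
  by apply: measurable_funD => //; apply: measurable_funM.
have ms2 : measurable_fun [set: pl] (fun p : pl => (p.1, (p.2 + s * p.1)%R) : pl).
  apply: measurable_fun_pair => //=.
  by apply: measurable_funD => //; apply: measurable_funM.
rewrite -(shear1 t mf f0) -(shear2 s (measurableT_comp mf ms1) (fun=> f0 _)).
rewrite -(shear1 t (measurableT_comp (measurableT_comp mf ms1) ms2) (fun=> f0 _)).
apply: eq_integral => p _ /=; congr f; rewrite /prot /=.
have s2 : (s ^+ 2 = 1 - c ^+ 2)%R by rewrite -cs; ring.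
have c2 : ((c - 1) * (c + 1) = - s ^+ 2)%R by rewrite s2; ring.
congr (_, _); rewrite /t.
  transitivity (p.1 * c + p.2 * ((c - 1) * (c + 1)) / s)%R; first by rewrite c2; field.
  by field.
by field.
Qed.

Lemma integral_pscale (a : R) (f : pl -> \bar R) : (0 < a)%R ->
  measurable_fun [set: pl] f -> (forall p, 0 <= f p) ->
  \int[nu]_p f p = (a ^+ 2)%:E * \int[nu]_p f ((a * p.1)%R, (a * p.2)%R).
Proof.
move=> a0 mf f0.
have ms : measurable_fun [set: pl] (fun p : pl => ((a * p.1)%R, (a * p.2)%R) : pl).
  by apply: measurable_fun_pair => //=; apply: measurable_funM.
have ms1 : measurable_fun [set: pl] (fun p : pl => ((a * p.1)%R, p.2) : pl).
  by apply: measurable_fun_pair => //=; apply: measurable_funM.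
rewrite (tonelli2 mf f0) (tonelli2 (measurableT_comp mf ms) (fun=> f0 _)).
have E y : \int[mu]_x f (x, y) = a%:E * \int[mu]_x f ((a * x)%R, y).
  rewrite (integral_affine 0 a0 (measurable_slice1 y mf) (fun=> f0 _)).
  by congr (_ * _); apply: eq_integral => x _; rewrite addr0.
have mG : measurable_fun [set: mR] (fun y : mR => \int[mu]_x f ((a * x)%R, y)).
  apply: (@measurable_fun_fubini_tonelli_G _ _ mR mR R mu (fun p : pl => f ((a * p.1)%R, p.2))) => //.
  exact: (measurableT_comp mf ms1).
have G0 y : 0 <= \int[mu]_x f ((a * x)%R, y) by apply: integral_ge0.
transitivity (\int[mu]_y (a%:E * \int[mu]_x f ((a * x)%R, y))).
  by apply: eq_integral => y _; exact: E.
rewrite (ge0_integralZl mu measurableT mG (fun x _ => G0 x)) ?lee_fin ?(ltW a0) //.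
rewrite (integral_affine 0 a0 mG G0) muleA -EFinM -expr2.
by congr (_ * _); apply: eq_integral => y _; rewrite addr0.
Qed.

Definition sqn (p : pl) : R := (p.1 ^+ 2 + p.2 ^+ 2)%R.

Lemma measurable_sqn : measurable_fun [set: pl] sqn.
Proof. by apply: measurable_funD; apply: measurable_funX. Qed.

Lemma sqn_ge0 p : (0 <= sqn p)%R.
Proof. by rewrite addr_ge0 ?sqr_ge0. Qed.

Lemma sqn_prot c s p : (c ^+ 2 + s ^+ 2 = 1)%R -> sqn (prot c s p) = sqn p.
Proof. by move=> cs; rewrite -[RHS]mul1r -cs /sqn /prot /=; ring. Qed.

Definition ball_area : \bar R := nu [set p | (sqn p <= 1)%R].

Lemma measurable_sqn_le s : measurable [set p : pl | (sqn p <= s)%R].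
Proof.
have := measurable_sqn measurableT (measurable_itv `]-oo, s]%R).
by rewrite setTI; congr measurable; apply/seteqP; split => p /=; rewrite in_itv.
Qed.

Lemma nu_sqn_scale s : (0 < s)%R -> nu [set p | (sqn p <= s)%R] = s%:E * ball_area.
Proof.
move=> s0; have r0 : (0 < Num.sqrt s)%R by rewrite sqrtr_gt0.
pose f (p : pl) : \bar R := (\1_[set p | (sqn p <= s)%R] p)%:E.
have mf : measurable_fun [set: pl] f.
  by apply/measurable_EFinP; apply: measurable_indic; exact: measurable_sqn_le.
have f0 p : 0 <= f p by rewrite lee_fin.
have := integral_pscale r0 mf f0; rewrite integral_indic //=; last exact: measurable_sqn_le.
rewrite setIT => ->; rewrite sqr_sqrtr ?ltW //; congr (_ * _).
rewrite /ball_area -[X in _ = nu X](setIT) -integral_indic //; last exact: measurable_sqn_le.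
apply: eq_integral => p _; rewrite /f !indicE; congr (_%:R%:E).
have E : (sqn (Num.sqrt s * p.1, Num.sqrt s * p.2) = s * sqn p)%R.
  by rewrite /sqn /= !exprMn sqr_sqrtr ?ltW // -mulrDr.
have E2 : (s * sqn p <= s)%R = (sqn p <= 1)%R by rewrite -[X in (_ <= X)%R]mulr1 ler_pM2l.
congr nat_of_bool.
by rewrite [LHS](mem_bset (fun p : pl => (sqn p <= s)%R)) E E2 [RHS]mem_bset.
Qed.

Lemma nu_rect (A B : set mR) : measurable A -> measurable B ->
  nu (A `*` B) = mu A * mu B.
Proof. by move=> mA mB; apply: (@product_measure1E _ _ mR mR R mu mu). Qed.

Lemma ball_area_fin : ball_area < +oo.
Proof.
pose B := [set p : pl | p.1 \in `[-1, 1]%R /\ p.2 \in `[-1, 1]%R].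
have BE : B = `[(-1)%R, 1%R]%classic `*` `[(-1)%R, 1%R]%classic by [].
apply: (@le_lt_trans _ _ (nu B)).
  apply: le_measure; rewrite ?inE; [exact: measurable_sqn_le| |].
    by rewrite BE; apply: measurableX.
  move=> p; rewrite /sqn /= => h; split; rewrite in_itv /= -ler_norml.
    by rewrite -(ler_pXn2r (ltn0Sn 1)) ?nnegrE // expr1n real_normK ?num_real // (le_trans _ h) // lerDl sqr_ge0.
  by rewrite -(ler_pXn2r (ltn0Sn 1)) ?nnegrE // expr1n real_normK ?num_real // (le_trans _ h) // lerDr sqr_ge0.
by rewrite BE nu_rect // !lebesgue_measure_itv /= lte_fin ifT ?ltry //; lra.
Qed.

Lemma ball_area_gt0 : 0 < ball_area.
Proof.
pose B := [set p : pl | p.1 \in `[0, 2^-1]%R /\ p.2 \in `[0, 2^-1]%R].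
have BE : B = `[0%R, 2^-1%R]%classic `*` `[0%R, 2^-1%R]%classic by [].
apply: (@lt_le_trans _ _ (nu B)).
  rewrite BE nu_rect // !lebesgue_measure_itv /= lte_fin ifT ?lte_fin ?invr_gt0 //.
apply: le_measure; rewrite ?inE; [|exact: measurable_sqn_le|].
  by rewrite BE; apply: measurableX.
by move=> p /= []; rewrite /sqn /= !in_itv /= => /andP[? ?] /andP[? ?]; nra.
Qed.

(** The area of the unit disc, kept as an unspecified positive constant that is absorbed in
    [kappa]. *)
Definition barea : R := fine ball_area.

Lemma bareaE : ball_area = barea%:E.
Proof. by rewrite fineK // ge0_fin_numE ?ball_area_fin // ltW // ball_area_gt0. Qed.

Lemma barea_gt0 : (0 < barea)%R.
Proof. by rewrite -lte_fin -bareaE ball_area_gt0. Qed.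

Lemma nu_sqn_le s : nu [set p | (sqn p <= s)%R] = (barea * Num.max s 0)%:E.
Proof.
have [s0|s0] := ltP 0%R s; first by rewrite nu_sqn_scale // bareaE -EFinM mulrC.
rewrite mulr0.
(* For s <= 0 the set lies in discs of arbitrarily small area. *)
suff h e : (0 < e)%R -> nu [set p | (sqn p <= s)%R] <= e%:E.
  by apply/eqP; rewrite eq_le measure_ge0 andbT; apply/lee_addgt0Pr => e e0; rewrite add0e h.
move=> e0; have d0 : (0 < e / barea)%R by rewrite divr_gt0 // barea_gt0.
apply: (@le_trans _ _ (nu [set p | (sqn p <= e / barea)%R])); last first.
  by rewrite nu_sqn_scale // bareaE -EFinM divfK // gt_eqF // barea_gt0.
apply: le_measure; rewrite ?inE; [exact: measurable_sqn_le..|].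
by move=> p /= h; apply: (le_trans h); apply: (le_trans s0); apply: ltW.
Qed.

(* Lebesgue measure is the image of planar measure by |z|^2 up to a factor,
   completed by Lebesgue measure on the negative half-line so that the
   uniqueness theorem on the whole line applies. *)
Lemma sqn_pushforward (A : set mR) : measurable A ->
  mu A = (barea^-1)%:E * nu (sqn @^-1` A) + mu (A `&` `]-oo, 0%R]).
Proof.
move=> mA.
have mphi : @measurable_fun _ _ pl mR [set: pl] sqn := measurable_sqn.
have b0 : (0 <= barea^-1)%R by rewrite invr_ge0 ltW // barea_gt0.
have mI : measurable (`]-oo, 0%R] : set mR) by exact: measurable_itv.
pose m : {measure set mR -> \bar R} :=
  measure_add (mscale (NngNum b0) (pushforward_measure nu mphi)) (mrestr mu mI).
have mE B : m B = (barea^-1)%:E * nu (sqn @^-1` B) + mu (B `&` `]-oo, 0%R]).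
  by rewrite [LHS](measure_addE _ _ B).
rewrite -mE; apply: lebesgue_measure_unique => // _ [[u v] _ <-]; rewrite mE /=.
have -> : sqn @^-1` `]u, v]%classic = [set p | (sqn p <= v)%R] `\` [set p | (sqn p <= u)%R].
  apply/seteqP; split => p /=; rewrite in_itv /=.
    by move=> /andP[h1 h2]; split => //; apply/negP; rewrite -ltNge.
  by move=> [h1 /negP]; rewrite -ltNge => h2; apply/andP.
have [uv|vu] := ltP u v; last first.
  rewrite (_ : _ `\` _ = set0); last first.
    by apply/seteqP; split => p //= [h1 h2]; apply: h2; apply: (le_trans h1).
  by rewrite set_itv_ge ?bnd_simp -?leNgt // set0I !measure0 mule0 adde0.
have -> : nu ([set p | (sqn p <= v)%R] `\` [set p | (sqn p <= u)%R]) =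
    nu [set p | (sqn p <= v)%R] - nu ([set p | (sqn p <= v)%R] `&` [set p | (sqn p <= u)%R]).
  apply: measureD; [exact: measurable_sqn_le..|].
  by apply: (@le_lt_trans _ _ (barea * Num.max v 0)%:E); rewrite ?ltry // -nu_sqn_le.
have -> : [set p | (sqn p <= v)%R] `&` [set p | (sqn p <= u)%R] = [set p | (sqn p <= u)%R].
  by apply/seteqP; split => p //= => [[]//|h]; split => //; apply: (le_trans h); apply: ltW.
rewrite !nu_sqn_le -EFinB -EFinM -mulrBr mulKf ?gt_eqF ?barea_gt0 //.
have -> : `]u, v]%classic `&` `]-oo, 0%R]%classic = `]u, Num.min v 0%R]%classic.
  apply/seteqP; split => x /=; rewrite !in_itv /= le_min.
    by move=> [/andP[-> ->] ->].
  by move=> /and3P[-> -> ->].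
rewrite !lebesgue_measure_itv /= !lte_fin uv.
by rewrite lt_min uv /=; case: ifPn => h; rewrite -!EFinD; congr EFin; move: h;
  rewrite -?leNgt; case: (ltP v 0%R) => h1; case: (ltP u 0%R) => h2 //= h; lra.
Qed.

(** This takes the place of polar coordinates. The half-line correction in [sqn_pushforward]
    disappears because D meets that half-line in at most the point 0. *)
Lemma integral_sqn (D : set mR) (g : mR -> \bar R) : measurable D ->
  D `<=` `[0%R, +oo[ -> measurable_fun D g -> (forall x, D x -> 0 <= g x) ->
  \int[nu]_(p in sqn @^-1` D) g (sqn p) = barea%:E * \int[mu]_(x in D) g x.
Proof.
move=> mD D0 mg g0.
have mphi : @measurable_fun _ _ pl mR [set: pl] sqn := measurable_sqn.
have b0 : (0 <= barea)%R by rewrite ltW // barea_gt0.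
rewrite -(@ge0_integral_pushforward _ _ pl mR R sqn mphi nu D g) //; last first.
  by move=> y; rewrite inE; exact: g0.
rewrite -[barea](_ : (NngNum b0)%:num = _) // -ge0_integral_mscale //.
apply: eq_measure_integral => A mA AD.
rewrite /mscale /= [X in _ = _ * X](sqn_pushforward mA) muleDr //; last first.
  by rewrite ge0_adde_def // inE ?mule_ge0 // lee_fin invr_ge0.
rewrite muleA -EFinM mulfV ?gt_eqF ?barea_gt0 // mul1e.
rewrite (_ : mu _ = 0) ?mule0 ?adde0 //.
apply/eqP; rewrite eq_le measure_ge0 andbT.
rewrite -(@lebesgue_measure_set1 R 0%R); apply: le_measure; rewrite ?inE //.
  by apply: measurableI.
by move=> x /= [/AD/D0]; rewrite /= !in_itv /= andbT => h1 h2; apply/le_anti/andP.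
Qed.

End PlaneMeasure.

(** * Beta integrals *)

Section BetaIntegral.
Context {R : realType}.
Notation mu := (@lebesgue_measure R).
Notation mR := (measurableTypeR R).
Implicit Types (a b x y : R).

Lemma is_derive_continuous (f : R -> R) x df : is_derive x 1 f df -> {for x, continuous f}.
Proof.
by move=> h; apply: differentiable_continuous; apply/derivable1_diffP; apply: ex_derive.
Qed.

Lemma FTC_smooth (f F : R -> R) a b : a < b ->
  (forall x, a <= x <= b -> is_derive x 1 F (f x)) ->
  (forall x, a <= x <= b -> {for x, continuous f}) ->
  (\int[mu]_(x in `[a, b]) (f x)%:E = (F b - F a)%:E)%E.
Proof.
move=> ab dF cf; rewrite EFinB; apply: continuous_FTC2 => //.
- by apply: continuous_in_subspaceT => x; rewrite inE /= in_itv /= => h; apply: cf.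
- have cF x : a <= x <= b -> F z @[z --> x] --> F x.
    by move=> h; have := is_derive_continuous (dF x h).
  split.
  + by move=> x; rewrite in_itv /= => /andP[h1 h2]; have := dF x; rewrite !ltW // => /(_ isT) h; apply: ex_derive.
  + by apply: cvg_at_right_filter; apply: cF; rewrite lexx ltW.
  + by apply: cvg_at_left_filter; apply: cF; rewrite lexx ltW.
- move=> x; rewrite in_itv /= => /andP[h1 h2]; have := dF x; rewrite !ltW // => /(_ isT) h.
  by rewrite derive1E; apply: derive_val.
Qed.

Lemma powR_le1 x a : 0 < x <= 1 -> 0 <= a -> x `^ a <= 1.
Proof.
move=> x1 a0; have := ger_powR x1 a0; rewrite powRr0; exact.
Qed.

Definition bker b a x := x `^ b * (1 - x) `^ a.

Lemma is_derive_pow1m a x : x < 1 ->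
  is_derive x 1 (fun x => (1 - x) `^ a) (- (a * (1 - x) `^ (a - 1))).
Proof.
move=> x1; have h : 0 < 1 - x by rewrite subr_gt0.
have := is_derive1_powR a h => h1.
have h2 : is_derive x 1 (fun x => 1 - x) (-1).
  have := is_deriveB (is_derive_cst (1 : R) x 1) (is_derive_id x 1).
  by rewrite sub0r.
have := @is_derive1_comp R (fun x => x `^ a) (fun x => 1 - x) x _ _ h1 h2.
by rewrite mulrN1 /comp.
Qed.

Lemma is_derive_bker b a x : 0 < x < 1 -> is_derive x 1 (bker b a)
   (b * bker (b - 1) a x - a * bker b (a - 1) x).
Proof.
move=> /andP[x0 x1].
have h1 := is_derive1_powR b x0; have h2 := is_derive_pow1m a x1.
have := is_deriveM h1 h2; rewrite /bker.
by move/is_derive_eq; apply; rewrite /GRing.scale /=; ring.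
Qed.

Lemma bker_ge0 b a x : 0 <= bker b a x.
Proof. by rewrite mulr_ge0 // powR_ge0. Qed.

Lemma measurable_bker b a : measurable_fun [set: R] (bker b a).
Proof.
apply: measurable_funM; first exact: measurable_powR.
have h : measurable_fun [set: R] (fun x : R => 1 - x) by apply: measurable_funB.
have := measurableT_comp (@measurable_powR R a) h.
exact.
Qed.

Lemma measurable_bkerE (D : set mR) b a : measurable_fun D (fun x : mR => (bker b a x)%:E).
Proof.
apply/measurable_EFinP; have h : @measurable_fun _ _ mR R [set: mR] (bker b a).
  exact: measurable_bker.
exact: measurable_funTS.
Qed.

Lemma continuous_bker b a x : 0 < x < 1 -> {for x, continuous (bker b a)}.
Proof. by move=> /(is_derive_bker b a)/is_derive_continuous. Qed.

Lemma bkerSl b a x : 0 < x -> bker (b + 1) a x = x * bker b a x.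
Proof. by move=> x0; rewrite /bker (@powRD _ x b 1) ?(gt_eqF x0) ?implybT // powRr1 ?ltW //; ring. Qed.

Lemma bkerSr b a x : x < 1 -> bker b (a + 1) x = (1 - x) * bker b a x.
Proof.
move=> x1; have h : 0 < 1 - x by rewrite subr_gt0.
by rewrite /bker (@powRD _ (1 - x) a 1) ?(gt_eqF h) ?implybT // powRr1 ?ltW //; ring.
Qed.

(** The shift by 3 gives [ep n] < 1/2, so that every [exh n] is a nondegenerate segment of the open
    unit interval, where [bker] is smooth. *)
Definition ep (n : nat) : R := n.+3%:R^-1.

Lemma ep_gt0 n : 0 < ep n. Proof. by rewrite invr_gt0. Qed.

Lemma ep_lt n : ep n < 2^-1.
Proof. by rewrite ltf_pV2 ?posrE // ltr_nat. Qed.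

Lemma ep_mono m n : (m <= n)%N -> ep n <= ep m.
Proof. by move=> mn; rewrite lef_pV2 ?posrE // ler_nat. Qed.

Definition exh (n : nat) : set R := `[ep n, 1 - ep n]%classic.

Lemma exh_lt n : ep n < 1 - ep n.
Proof. by have := ep_lt n; lra. Qed.

Lemma exhP n x : exh n x -> 0 < x < 1.
Proof.
rewrite /exh /= in_itv /= => /andP[h1 h2].
by have h := ep_gt0 n; apply/andP; split; lra.
Qed.

Lemma nondecreasing_exh : nondecreasing_seq exh.
Proof.
move=> m n mn; rewrite subsetEset => x; rewrite /exh /= !in_itv /= => /andP[h1 h2].
by have h := ep_mono mn; apply/andP; split; lra.
Qed.

Lemma bigcup_exh : \bigcup_n exh n = `]0%R, 1%R[%classic.
Proof.
apply/seteqP; split => x; first by move=> [n _ /exhP]; rewrite /= in_itv.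
rewrite /= in_itv /= => /andP[x0 x1].
have [n hn] : exists n, n.+1%:R^-1 < Num.min x (1 - x).
  have h : 0 < Num.min x (1 - x) by rewrite lt_min x0 subr_gt0.
  exists (Num.truncn (Num.min x (1 - x))^-1).
  by rewrite invf_plt ?posrE //; exact: truncnS_gt.
exists n => //; rewrite /exh /= in_itv /=.
have h : ep n <= n.+1%:R^-1 by rewrite /ep lef_pV2 ?posrE // ler_nat; apply: ltnW.
by move: hn h; set e := n.+1%:R^-1; rewrite lt_min => /andP[? ?] ?; apply/andP; split; lra.
Qed.

Lemma cvg_int_exh (f : R -> R) : measurable_fun (`]0%R, 1%R[%classic : set mR) (fun x : mR => (f x)%:E) ->
  (forall x, 0 < x < 1 -> 0 <= f x) ->
  (\int[mu]_(x in exh n) (f x)%:E @[n --> \oo] --> \int[mu]_(x in `]0%R, 1%R[) (f x)%:E)%E.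
Proof.
move=> mf f0; rewrite -bigcup_exh.
apply: ge0_nondecreasing_set_cvg_integral; first exact: nondecreasing_exh.
- by move=> n; exact: measurable_itv.
- move=> n; apply: (measurable_funS _ _ mf); first exact: measurable_itv.
  by move=> x /exhP; rewrite /= in_itv.
- by move=> n x /exhP h; rewrite lee_fin f0.
Qed.

(** The Beta function B(b + 1, a + 1). *)
Definition ib b a : R := fine (\int[mu]_(x in `]0%R, 1%R[) (bker b a x)%:E)%E.

Lemma bker_mono b a x : 0 <= b -> 0 < x < 1 -> bker b a x <= bker 0 a x.
Proof.
move=> b0 /andP[x0 x1]; rewrite /bker powRr0 mul1r ler_piMl ?powR_ge0 //.
by rewrite -(powRr0 x) ger_powR // x0 ltW.
Qed.

(** Domination by the kernel with b = 0, whose antiderivative - (1 - x)^(a + 1) / (a + 1) stays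
    bounded on the exhausting segments. *)
Lemma int_bker_fin b a : 0 <= b -> -1 < a ->
  (\int[mu]_(x in `]0%R, 1%R[) (bker b a x)%:E < +oo)%E.
Proof.
move=> b0 a1; have a10 : 0 < a + 1 by lra.
have mb c := @measurable_bkerE (`]0%R, 1%R[%classic : set mR) c a.
apply: (@le_lt_trans _ _ ((a + 1)^-1)%:E); last exact: ltry.
apply: (@le_trans _ _ (\int[mu]_(x in `]0%R, 1%R[) (bker 0 a x)%:E)%E).
  apply: ge0_le_integral => //.
  - by move=> x _; rewrite lee_fin bker_ge0.
  - by move=> x /=; rewrite in_itv /= => h; rewrite lee_fin bker_mono.
have := cvg_int_exh (mb 0) (fun x _ => bker_ge0 0 a x) => h.
rewrite -(cvg_lim _ h) //; apply: lime_le; first exact: (cvgP _ h).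
near=> n.
pose F (x : R) := - (a + 1)^-1 * (1 - x) `^ (a + 1).
have -> : (\int[mu]_(x in exh n) (bker 0 a x)%:E = (F (1 - ep n) - F (ep n))%:E)%E.
  apply: FTC_smooth => [|x h0|x h0]; first exact: exh_lt.
    have /andP[x0 x1] : 0 < x < 1 by apply: (@exhP n); rewrite /exh /= in_itv.
    have := is_deriveZ (- (a + 1)^-1) (is_derive_pow1m (a + 1) x1).
    rewrite /F; move/is_derive_eq; apply.
    rewrite /bker powRr0 mul1r addrK /GRing.scale /= mulrNN mulrA mulVf ?mul1r //.
    by rewrite gt_eqF.
  by apply: continuous_bker; apply: (@exhP n); rewrite /exh /= in_itv.
rewrite lee_fin /F.
have hn := ep_gt0 n; have hn2 := ep_lt n.
set u := _ `^ _; set v := _ `^ _.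
have u0 : 0 <= u by apply: powR_ge0.
have v1 : v <= 1.
  by apply: powR_le1; [apply/andP; split|]; lra.
have := a10; rewrite -invr_gt0; set w := (a + 1)^-1 => w0; nra.
Unshelve. all: by end_near. Qed.

Lemma ibE b a : 0 <= b -> -1 < a ->
  (\int[mu]_(x in `]0%R, 1%R[) (bker b a x)%:E)%E = (ib b a)%:E.
Proof.
move=> b0 a1; rewrite fineK // ge0_fin_numE ?int_bker_fin //.
by apply: integral_ge0 => x _; rewrite lee_fin bker_ge0.
Qed.

Lemma ib_gt0 b a : 0 <= b -> -1 < a -> 0 < ib b a.
Proof.
move=> b0 a1; rewrite -lte_fin -ibE //.
(* A lower bound for the kernel on [1/3, 2/3]; the sign of a decides at which endpoint (1 - x)^a is
   smallest. *)
pose c := (3^-1) `^ b * Num.min ((3^-1) `^ a) ((2/3) `^ a) : R.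
have c0 : 0 < c by rewrite mulr_gt0 ?lt_min ?powR_gt0 //; lra.
have : (0%:E < \int[mu]_(x in `[(3^-1)%R, (2/3)%R]) (cst c%:E x))%E.
  rewrite integral_cst // [X in (_ * X)%E]lebesgue_measure_itv /= lte_fin ifT; last lra.
  by rewrite -EFinD -EFinM lte_fin mulr_gt0 //; lra.
move/lt_le_trans; apply.
apply: (@le_trans _ _ (\int[mu]_(x in `[(3^-1)%R, (2/3)%R]) (bker b a x)%:E)%E).
  apply: ge0_le_integral => //.
  - by move=> x _; rewrite lee_fin ltW.
  - exact: measurable_bkerE.
  - move=> x /=; rewrite in_itv /= => /andP[h1 h2]; rewrite lee_fin /bker /c.
    apply: ler_pM; rewrite ?powR_ge0 // ?le_min ?powR_ge0 //.
      by apply: ge0_ler_powR; rewrite ?nnegrE //; lra.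
    have [a0|a0] := leP 0 a.
      rewrite ge_min; apply/orP; left.
      by apply: ge0_ler_powR; rewrite ?nnegrE //; lra.
    rewrite ge_min; apply/orP; right.
    rewrite -[a]opprK !(powRN _ (- a)) lef_pV2 ?posrE ?powR_gt0 //; try lra.
    by apply: ge0_ler_powR; rewrite ?nnegrE //; lra.
apply: ge0_subset_integral => //.
- exact: measurable_bkerE.
- by move=> x _; rewrite lee_fin bker_ge0.
- by move=> x /=; rewrite !in_itv /= => /andP[? ?]; apply/andP; split; lra.
Qed.

(** Integrate the derivative of x^(b + 1) (1 - x)^(a + 1) over [exh n]: both exponents are positive,
    so the boundary values tend to 0. *)
Lemma ib_rec b a : 0 <= b -> -1 < a -> (b + a + 2) * ib (b + 1) a = (b + 1) * ib b a.
Proof.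
move=> b0 a1.
have b10 : 0 <= b + 1 by lra.
have mb c := @measurable_bkerE (`]0%R, 1%R[%classic : set mR) c a.
have h0 := cvg_int_exh (mb b) (fun x _ => bker_ge0 b a x).
have h1 := cvg_int_exh (mb (b + 1)) (fun x _ => bker_ge0 (b + 1) a x).
rewrite (ibE b0 a1) in h0; rewrite (ibE b10 a1) in h1.
pose J c n := fine (\int[mu]_(x in exh n) (bker c a x)%:E)%E.
have {}h0 : J b n @[n --> \oo] --> ib b a by apply: fine_cvg h0.
have {}h1 : J (b + 1) n @[n --> \oo] --> ib (b + 1) a by apply: fine_cvg h1.
have JE c n : 0 <= c -> (\int[mu]_(x in exh n) (bker c a x)%:E = (J c n)%:E)%E.
  move=> c0; rewrite fineK // ge0_fin_numE; last first.
    by apply: integral_ge0 => x _; rewrite lee_fin bker_ge0.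
  apply: le_lt_trans (int_bker_fin c0 a1); apply: ge0_subset_integral => //.
  - by apply: measurable_itv.
  - by move=> x _; rewrite lee_fin bker_ge0.
  - by move=> x /exhP; rewrite /= in_itv.
pose F := bker (b + 1) (a + 1).
pose d n := F (1 - ep n) - F (ep n).
have key n : (b + 1) * J b n - (b + a + 2) * J (b + 1) n = d n.
  apply: EFin_inj.
  have <- : (\int[mu]_(x in exh n) ((b + 1) * bker b a x - (b + a + 2) * bker (b + 1) a x)%:E = (d n)%:E)%E.
    apply: FTC_smooth => [|x hx|x hx]; first exact: exh_lt.
      have /andP[x0 x1] : 0 < x < 1 by apply: (@exhP n); rewrite /exh /= in_itv.
      have h : 0 < x < 1 by rewrite x0.
      have := is_derive_bker (b + 1) (a + 1) h; move/is_derive_eq; apply.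
      by rewrite !addrK bkerSr // bkerSl //; ring.
    have h : 0 < x < 1 by apply: (@exhP n); rewrite /exh /= in_itv.
    by apply: (@cvgB _ R^o); apply: cvgM; try exact: cvg_cst; exact: continuous_bker.
  - have mI c : mu.-integrable (exh n) (EFin \o bker c a).
      apply: continuous_compact_integrable; first exact: segment_compact.
      apply: continuous_in_subspaceT => x; rewrite inE => /exhP; exact: continuous_bker.
    under eq_integral do rewrite EFinB !EFinM.
    rewrite integralB; last 3 first.
    + by apply: measurable_itv.
    + by apply: integrableZl => //; [exact: measurable_itv|exact: mI].
    + by apply: integrableZl => //; [exact: measurable_itv|exact: mI].
    rewrite !integralZl //; try exact: measurable_itv; try exact: mI.
    by rewrite !JE.
have dn : d n @[n --> \oo] --> 0.
  have ep0 : ep n @[n --> \oo] --> 0.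
    have := cvg_comp _ _ (cvg_addnr 2) (@cvg_harmonic R).
    by rewrite /comp /harmonic; under eq_fun do rewrite addn2.
  have pw c : 0 < c -> ep n `^ c @[n --> \oo] --> 0.
    move=> c0; apply: (cvg_at_rightP _ _ _).1 (powR_cvg0 c0) _ _.
    by split => // n; exact: ep_gt0.
  have b1 : 0 < b + 1 by lra.
  have a10 : 0 < a + 1 by lra.
  have bk c c' x : 0 <= c' -> 0 < x < 1 -> 0 <= x `^ c * (1 - x) `^ c' <= x `^ c.
    move=> c0 /andP[x0 x1]; rewrite mulr_ge0 ?powR_ge0 //= ler_piMr ?powR_ge0 //.
    by apply: powR_le1 => //; apply/andP; split; lra.
  have epI n : 0 < ep n < 1 by have := ep_gt0 n; have := ep_lt n => ? ?; apply/andP; split; lra.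
  rewrite -(subrr 0); apply: cvgB.
    apply: (squeeze_cvgr (f := fun=> 0) (h := fun n => ep n `^ (a + 1))); [|exact: cvg_cst|exact: pw].
    near=> n; rewrite /F /bker mulrC subKr; apply: bk => //; exact: ltW.
  apply: (squeeze_cvgr (f := fun=> 0) (h := fun n => ep n `^ (b + 1))); [|exact: cvg_cst|exact: pw].
  near=> n; rewrite /F /bker; apply: bk => //; exact: ltW.
have hd : d n @[n --> \oo] --> (b + 1) * ib b a - (b + a + 2) * ib (b + 1) a.
  under eq_fun do rewrite -key.
  by apply: (@cvgB _ R^o); apply: cvgM => //; exact: cvg_cst.
by apply/eqP; rewrite eq_sym -subr_eq0; apply/eqP; apply: (cvg_unique _ hd dn).
Unshelve. all: by end_near. Qed.

End BetaIntegral.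

(** * Complex numbers and power series *)

Section ComplexBasics.
Context {R : realType}.
Notation C := (R[i]).
Notation Re := (@complex.Re R).
Notation Im := (@complex.Im R).
Implicit Types z w : C.

Definition nsq z : R := Re z ^+ 2 + Im z ^+ 2.

Lemma cReM z w : Re (z * w) = Re z * Re w - Im z * Im w.
Proof. by case: z => ? ?; case: w. Qed.
Lemma cImM z w : Im (z * w) = Re z * Im w + Im z * Re w.
Proof. by case: z => ? ?; case: w. Qed.
Lemma cReD z w : Re (z + w) = Re z + Re w.
Proof. by case: z => ? ?; case: w. Qed.
Lemma cImD z w : Im (z + w) = Im z + Im w.
Proof. by case: z => ? ?; case: w. Qed.
Lemma cReN z : Re (- z) = - Re z. Proof. by case: z. Qed.
Lemma cImN z : Im (- z) = - Im z. Proof. by case: z. Qed.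
Lemma cReB z w : Re (z - w) = Re z - Re w. Proof. by rewrite cReD cReN. Qed.
Lemma cImB z w : Im (z - w) = Im z - Im w. Proof. by rewrite cImD cImN. Qed.
Lemma cReJ z : Re z^* = Re z. Proof. by case: z. Qed.
Lemma cImJ z : Im z^* = - Im z. Proof. by case: z. Qed.
Lemma cRe_sum (I : Type) (r : seq I) (P : pred I) (F : I -> C) :
  Re (\sum_(i <- r | P i) F i) = \sum_(i <- r | P i) Re (F i).
Proof. by apply: (big_morph Re) => //; exact: cReD. Qed.
Lemma cIm_sum (I : Type) (r : seq I) (P : pred I) (F : I -> C) :
  Im (\sum_(i <- r | P i) F i) = \sum_(i <- r | P i) Im (F i).
Proof. by apply: (big_morph Im) => //; exact: cImD. Qed.

Lemma C_eq z w : Re z = Re w -> Im z = Im w -> z = w.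
Proof. by case: z => ? ?; case: w => ? ? /= -> ->. Qed.

Lemma nsqM z w : nsq (z * w) = nsq z * nsq w.
Proof. by rewrite /nsq cReM cImM; ring. Qed.
Lemma nsqX z n : nsq (z ^+ n) = nsq z ^+ n.
Proof.
elim: n => [|n IH]; last by rewrite !exprS nsqM IH.
by rewrite !expr0 /nsq /= expr1n expr0n /= addr0.
Qed.
Lemma nsq_ge0 z : 0 <= nsq z. Proof. by rewrite addr_ge0 ?sqr_ge0. Qed.
Lemma nsq0 : nsq 0 = 0. Proof. by rewrite /nsq /= expr0n /= addr0. Qed.
Lemma nsq_eq0 z : nsq z = 0 -> z = 0.
Proof.
move/eqP; rewrite paddr_eq0 ?sqr_ge0 // !sqrf_eq0 => /andP[/eqP h1 /eqP h2].
exact: C_eq.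
Qed.
Lemma nsqN z : nsq (- z) = nsq z. Proof. by rewrite /nsq cReN cImN !sqrrN. Qed.
Lemma nsqJ z : nsq z^* = nsq z. Proof. by rewrite /nsq cReJ cImJ sqrrN. Qed.
Lemma nsqD z w : nsq (z + w) = nsq z + nsq w + 2 * Re (z * w^*).
Proof. by rewrite /nsq cReD cImD cReM cReJ cImJ; ring. Qed.
Lemma Re_mulJ z w : Re (z * w^*) = Re z * Re w + Im z * Im w.
Proof. by rewrite cReM cReJ cImJ; ring. Qed.
Lemma Im_mulJ z w : Im (z * w^*) = Im z * Re w - Re z * Im w.
Proof. by rewrite cImM cReJ cImJ; ring. Qed.
Lemma Re_mulJJ z : Re (z * z^*) = nsq z.
Proof. by rewrite Re_mulJ /nsq !expr2. Qed.

Lemma normc_nsq z : normc z ^+ 2 = nsq z.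
Proof. by case: z => x y; rewrite /normc /nsq /= sqr_sqrtr // addr_ge0 ?sqr_ge0. Qed.
Lemma normc_sqrt z : normc z = Num.sqrt (nsq z). Proof. by case: z. Qed.
Lemma normc_ge0 z : 0 <= normc z. Proof. by rewrite normc_sqrt sqrtr_ge0. Qed.
Lemma normcX z n : normc (z ^+ n) = normc z ^+ n.
Proof.
elim: n => [|n IH]; first by rewrite !expr0; exact: normc1.
by rewrite !exprS normcM IH.
Qed.
Lemma normc_conj z : normc z^* = normc z. Proof. by rewrite !normc_sqrt nsqJ. Qed.
Lemma Re_le_normc z : `|Re z| <= normc z.
Proof.
by rewrite normc_sqrt -sqrtr_sqr ler_wsqrtr // lerDl sqr_ge0.
Qed.
Lemma Im_le_normc z : `|Im z| <= normc z.
Proof.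
by rewrite normc_sqrt -sqrtr_sqr ler_wsqrtr // lerDr sqr_ge0.
Qed.
Lemma normc_le z : normc z <= `|Re z| + `|Im z|.
Proof.
rewrite -(ler_pXn2r (ltn0Sn 1)) ?nnegrE ?normc_ge0 ?addr_ge0 // normc_nsq /nsq.
rewrite -(real_normK (num_real (Re z))) -(real_normK (num_real (Im z))).
by have := normr_ge0 (Re z); have := normr_ge0 (Im z); nra.
Qed.
Lemma norm_normc z : `|z| = (normc z)%:C. Proof. by rewrite normc_def -normc_sqrt. Qed.

Lemma normc_lt1 z : (normc z < 1) = (nsq z < 1).
Proof.
by rewrite -normc_nsq -[in RHS](expr1n _ 2) ltr_pXn2r ?nnegrE ?normc_ge0.
Qed.
Lemma discE z : disc z = (nsq z < 1) :> Prop.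
Proof. by rewrite /disc /= norm_normc ltcE /= eqxx /= normc_lt1. Qed.

Definition cis (t : R) : C := cos t +i* sin t.

Lemma cisD s t : cis (s + t) = cis s * cis t.
Proof. by apply: C_eq; rewrite ?cReM ?cImM /= ?cosD ?sinD // addrC. Qed.
Lemma cis0 : cis 0 = 1. Proof. by rewrite /cis cos0 sin0. Qed.
Lemma cisX n t : cis t ^+ n = cis (t *+ n).
Proof.
elim: n => [|n IH]; first by rewrite mulr0n cis0 expr0.
by rewrite exprS IH mulrS cisD.
Qed.
Lemma cis_pi : cis pi = -1. Proof. by apply: C_eq; rewrite /= ?cospi ?sinpi // oppr0. Qed.
Lemma nsq_cis t : nsq (cis t) = 1. Proof. by rewrite /nsq /= cos2Dsin2. Qed.
(** Rotation by pi / (2 k), which applied twice multiplies z^k by -1. The angle pi / k itself would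
    have sine 0 for k = 1, which [integral_prot] excludes. *)
Lemma exists_flip k : (0 < k)%N -> exists c s : R,
  [/\ c ^+ 2 + s ^+ 2 = 1, s != 0 & ((c +i* s) ^+ 2) ^+ k = -1].
Proof.
move=> k0; pose t := pi / (2 * k)%:R : R.
exists (cos t), (sin t); split.
- exact: cos2Dsin2.
- have p0 := pi_gt0 R; rewrite gt_eqF // sin_gt0_pi //; apply/andP; split.
    by rewrite divr_gt0 // ltr0n muln_gt0.
  rewrite ltr_pdivrMr ?ltr0n ?muln_gt0 // ltr_pMr // ltr1n.
  exact: leq_pmulr.
- have tk : t *+ (2 * k) = pi; last by rewrite -exprM -/(cis t) cisX tk cis_pi.
  rewrite /t -(mulr_natr (pi / (2 * k)%:R)) divfK //.
  by rewrite pnatr_eq0 muln_eq0 /=; case: (k) k0.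
Qed.

End ComplexBasics.

(** * Orthogonality of monomials for a radial density *)

Section PolyNorm.
Context {R : realType}.
Notation C := (R[i]).
Notation Re := (@complex.Re R).
Notation Im := (@complex.Im R).
Notation nu := (@plane_measure R).
Notation pl := (@pl R).

Lemma nsq_cplx (p : pl) : nsq (cplx p) = sqn p. Proof. by []. Qed.
Lemma cplx_prot c s (p : pl) : cplx (prot c s p) = (c +i* s) * cplx p.
Proof. by apply: C_eq; rewrite ?cReM ?cImM /=; ring. Qed.

Lemma integral_prot_signed c s (h : pl -> \bar R) : c ^+ 2 + s ^+ 2 = 1 -> s != 0 ->
  measurable_fun [set: pl] h -> (\int[nu]_p h (prot c s p) = \int[nu]_p h p)%E.
Proof.
move=> cs s0 mh; rewrite integralE [RHS]integralE; congr (_ - _)%E.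
  have <- := integral_prot cs s0 (measurable_funepos mh) (fun p => funepos_ge0 h p).
  by apply: eq_integral => p _; rewrite funepos.unlock.
have <- := integral_prot cs s0 (measurable_funeneg mh) (fun p => funeneg_ge0 h p).
by apply: eq_integral => p _; rewrite funeneg.unlock.
Qed.

Lemma integral_flip c s (h : pl -> R) : c ^+ 2 + s ^+ 2 = 1 -> s != 0 ->
  measurable_fun [set: pl] h -> nu.-integrable setT (EFin \o h) ->
  (forall p, h (prot c s (prot c s p)) = - h p) -> (\int[nu]_p (h p)%:E = 0)%E.
Proof.
move=> cs s0 mh ih hh.
have mE : measurable_fun [set: pl] (EFin \o h) by exact/measurable_EFinP.
have F : (\int[nu]_p (h p)%:E)%E \is a fin_num by exact: integrable_fin_num.
have E : (\int[nu]_p (h p)%:E = - \int[nu]_p (h p)%:E)%E.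
  rewrite -{1}(integral_prot_signed cs s0 mE).
  rewrite -(integral_prot_signed cs s0 (measurableT_comp mE (measurable_prot c s))).
  rewrite -integralN; last by rewrite fin_num_adde_defl // fin_numN integrable_fin_num //; exact: integrable_funeneg.
  by apply: eq_integral => p _ /=; rewrite hh.
move: F E; case: (\int[nu]_p _)%E => // r _; rewrite -EFinN => -[] E.
by congr EFin; lra.
Qed.

Definition mC (f : pl -> C) := measurable_fun [set: pl] (fun p => Re (f p)) /\
  measurable_fun [set: pl] (fun p => Im (f p)).

Lemma mC_cst c : mC (fun=> c).
Proof. by split; exact: measurable_cst. Qed.
Lemma mC_cplx : mC (@cplx R).
Proof. by split; [exact: measurable_fst|exact: measurable_snd]. Qed.
Lemma mCM f g : mC f -> mC g -> mC (fun p => f p * g p).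
Proof.
move=> [f1 f2] [g1 g2]; split.
  by under eq_fun do rewrite cReM; apply: measurable_funB; apply: measurable_funM.
by under eq_fun do rewrite cImM; apply: measurable_funD; apply: measurable_funM.
Qed.
Lemma mCD f g : mC f -> mC g -> mC (fun p => f p + g p).
Proof.
move=> [f1 f2] [g1 g2]; split.
  by under eq_fun do rewrite cReD; apply: measurable_funD.
by under eq_fun do rewrite cImD; apply: measurable_funD.
Qed.
Lemma mCJ f : mC f -> mC (fun p => (f p)^*).
Proof.
move=> [f1 f2]; split; first by under eq_fun do rewrite cReJ.
by under eq_fun do rewrite cImJ; apply: measurable_funN.
Qed.
Lemma mCX f n : mC f -> mC (fun p => f p ^+ n).
Proof.
move=> mf; elim: n => [|n IH]; first by under eq_fun do rewrite expr0; apply: mC_cst.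
by under eq_fun do rewrite exprS; apply: mCM.
Qed.
Lemma mC_sum (f : nat -> pl -> C) N : (forall n, mC (f n)) -> mC (fun p => \sum_(n < N) f n p).
Proof.
move=> mf; elim: N => [|N IH]; first by under eq_fun do rewrite big_ord0; apply: mC_cst.
by under eq_fun do rewrite big_ord_recr; apply: mCD.
Qed.
Lemma mC_nsq f : mC f -> measurable_fun [set: pl] (fun p => nsq (f p)).
Proof. by move=> [f1 f2]; apply: measurable_funD; apply: measurable_funX. Qed.

Definition psum (c : nat -> C) N z : C := \sum_(n < N) c n * z ^+ n.

Lemma mC_psum c N : mC (fun p => psum c N (cplx p)).
Proof.
apply: (@mC_sum (fun n p => c n * cplx p ^+ n)) => n.
by apply: mCM; [exact: mC_cst|apply: mCX; exact: mC_cplx].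
Qed.

Variable rho : R -> R.
Hypotheses (mrho : measurable_fun [set: R] rho) (rho0 : forall s, 0 <= rho s)
  (rho1 : forall s, 1 <= s -> rho s = 0)
  (irho : (\int[nu]_p (rho (sqn p))%:E < +oo)%E).

Definition mom n : R := fine (\int[nu]_p (sqn p ^+ n * rho (sqn p))%:E)%E.

Lemma mrhos : measurable_fun [set: pl] (fun p : pl => rho (sqn p)).
Proof. exact: (measurableT_comp mrho (@measurable_sqn R)). Qed.

Lemma integrable_rho : nu.-integrable [set: pl] (fun p : pl => (rho (sqn p))%:E).
Proof.
apply/integrableP; split; first by apply/measurable_EFinP; exact: mrhos.
by under eq_integral do rewrite gee0_abs ?lee_fin //.
Qed.

Lemma integrable_dom (h : pl -> R) K : measurable_fun [set: pl] h ->
  (forall p, sqn p < 1 -> `|h p| <= K) ->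
  nu.-integrable [set: pl] (fun p : pl => (h p * rho (sqn p))%:E).
Proof.
move=> mh hK.
have i1 : nu.-integrable [set: pl] (fun p : pl => (K%:E * (rho (sqn p))%:E)%E).
  by apply: integrableZl => //; exact: integrable_rho.
apply: le_integrable i1 => //.
  by apply/measurable_EFinP; apply: measurable_funM => //; exact: mrhos.
move=> p _; rewrite -EFinM /= lee_fin !normrM.
have [p1|p1] := ltP (sqn p) 1; last by rewrite rho1 // normr0 !mulr0.
by rewrite ler_wpM2r //; apply: le_trans (ler_norm _); exact: hK.
Qed.

Lemma momE n : (\int[nu]_p (sqn p ^+ n * rho (sqn p))%:E = (mom n)%:E)%E.
Proof.
rewrite /mom fineK //; apply: integrable_fin_num => //.
apply: (@integrable_dom (fun p => sqn p ^+ n) 1).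
  by apply: measurable_funX; exact: measurable_sqn.
move=> p p1; rewrite ger0_norm ?exprn_ge0 ?sqn_ge0 //.
by apply: exprn_ile1; [exact: sqn_ge0|exact: ltW].
Qed.

Lemma mom_ge0 n : 0 <= mom n.
Proof.
rewrite /mom fine_ge0 //; apply: integral_ge0 => p _.
by rewrite lee_fin mulr_ge0 // exprn_ge0 // sqn_ge0.
Qed.

Definition cross (c : nat -> C) n m (p : pl) : R :=
  Re (c n * cplx p ^+ n * (c m * cplx p ^+ m)^*).

Lemma measurable_cross c n m : measurable_fun [set: pl] (cross c n m).
Proof.
suff [] : mC (fun p => c n * cplx p ^+ n * (c m * cplx p ^+ m)^*) by [].
have h k : mC (fun p => c k * cplx p ^+ k).
  by apply: mCM; [exact: mC_cst|apply: mCX; exact: mC_cplx].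
by apply: mCM => //; apply: mCJ.
Qed.

Lemma integrable_cross c n m :
  nu.-integrable [set: pl] (fun p : pl => (cross c n m p * rho (sqn p))%:E).
Proof.
apply: (@integrable_dom _ (normc (c n) * normc (c m))); first exact: measurable_cross.
move=> p p1; apply: (le_trans (Re_le_normc _)).
have p1' k : normc (cplx p) ^+ k <= 1.
  by apply: exprn_ile1; [exact: normc_ge0|rewrite ltW // normc_lt1 nsq_cplx].
rewrite !(normcM, normc_conj, normcX) ler_pM ?mulr_ge0 ?exprn_ge0 ?normc_ge0 //.
  by rewrite ler_piMr ?normc_ge0.
by rewrite ler_piMr ?normc_ge0.
Qed.

(** Two of the rotations from [exists_flip], with k = n - m, change the sign of the integrand and
    preserve the measure. *)
Lemma integral_cross_neq c n m : (m < n)%N ->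
  (\int[nu]_p (cross c n m p * rho (sqn p))%:E = 0)%E.
Proof.
move=> mn; have k0 : (0 < n - m)%N by rewrite subn_gt0.
have [a [b [ab b0 flip]]] := exists_flip (R := R) k0.
apply: (integral_flip ab b0).
- by apply: measurable_funM; [exact: measurable_cross|exact: mrhos].
- exact: integrable_cross.
- move=> p; rewrite /cross !cplx_prot !sqn_prot // -mulNr; congr (_ * _).
  set w := a +i* b; set z := cplx p.
  have wJ : w * w^* = 1.
    by apply: C_eq; rewrite ?Re_mulJJ ?Im_mulJ /nsq /=; [exact: ab|ring].
  have E : (w * (w * z)) ^+ n = - (w ^+ m) ^+ 2 * z ^+ n.
    rewrite mulrA -expr2 exprMn -(subnK (ltnW mn)) exprD flip mulN1r -!exprM mulnC.
    by rewrite mulNr.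
  have E2 : (w * (w * z)) ^+ m = (w ^+ m) ^+ 2 * z ^+ m.
    by rewrite mulrA -expr2 exprMn -!exprM mulnC.
  rewrite -cReN; congr (Re _).
  rewrite E E2 !rmorphM !rmorphXn /=.
  transitivity (- (c n * z ^+ n * ((c m)^* * (z^* ^+ m))) * ((w * w^*) ^+ m) ^+ 2).
    rewrite !exprMn; move: (w ^+ m) (w^* ^+ m) (z ^+ n) (z^* ^+ m) (c n) ((c m)^*) => *.
    by ring.
  by rewrite wJ !expr1n mulr1.
Qed.

Lemma cross_sym c n m p : cross c n m p = cross c m n p.
Proof. by rewrite /cross !Re_mulJ; ring. Qed.

Lemma cross_diag c n p : cross c n n p = nsq (c n) * sqn p ^+ n.
Proof. by rewrite /cross Re_mulJJ nsqM nsqX. Qed.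

Lemma nsq_psum c N p : nsq (psum c N (cplx p)) = \sum_(n < N) \sum_(m < N) cross c n m p.
Proof.
rewrite -Re_mulJJ /psum rmorph_sum mulr_suml cRe_sum; apply: eq_bigr => n _.
by rewrite mulr_sumr cRe_sum.
Qed.

Lemma integral_psum c N :
  (\int[nu]_p (nsq (psum c N (cplx p)) * rho (sqn p))%:E =
   (\sum_(n < N) nsq (c n) * mom n)%:E)%E.
Proof.
transitivity (\int[nu]_p (\sum_(n < N) \sum_(m < N) (cross c n m p * rho (sqn p))%:E))%E.
  apply: eq_integral => p _; rewrite nsq_psum mulr_suml -sumEFin.
  by apply: eq_bigr => n _; rewrite mulr_suml -sumEFin.
rewrite integral_sum //; last first.
  by move=> n; apply: integrable_sum => //= m _; exact: integrable_cross.
rewrite -sumEFin; apply: eq_bigr => n _.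
rewrite integral_sum //; last by move=> m; exact: integrable_cross.
rewrite (bigD1 n) //= big1 ?adde0 => [|m mn].
  transitivity (\int[nu]_p ((nsq (c n))%:E * (sqn p ^+ n * rho (sqn p))%:E))%E.
    by apply: eq_integral => p _; rewrite -EFinM cross_diag mulrA.
  rewrite ge0_integralZl ?momE // ?lee_fin ?nsq_ge0 //.
    apply/measurable_EFinP; apply: measurable_funM; last exact: mrhos.
    by apply: measurable_funX; exact: measurable_sqn.
  by move=> p _; rewrite lee_fin mulr_ge0 // exprn_ge0 // sqn_ge0.
have := mn; rewrite neq_ltn => /orP[h|h]; last first.
  by under eq_integral do rewrite cross_sym; exact: integral_cross_neq.
exact: integral_cross_neq.
Qed.

End PolyNorm.

(** * Complex series and power series on the unit disc *)

Section PowerSeries.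
Context {R : realType}.
Notation C := (R[i]).
Notation Re := (@complex.Re R).
Notation Im := (@complex.Im R).
Implicit Types (c : nat -> C) (z : C).

Definition csum (u : nat -> C) : C := ssum (fun k => Re (u k)) +i* ssum (fun k => Im (u k)).
Definition casum (u : nat -> C) : Prop := asum (fun k => normc (u k)).

Lemma casum_Re u : casum u -> asum (fun k => Re (u k)).
Proof. by apply: asum_le => k; exact: Re_le_normc. Qed.
Lemma casum_Im u : casum u -> asum (fun k => Im (u k)).
Proof. by apply: asum_le => k; exact: Im_le_normc. Qed.

Lemma casum_le (u : nat -> C) (v : nat -> R) : (forall k, normc (u k) <= v k) ->
  asum v -> casum u.
Proof. by move=> uv; apply: asum_le => k; rewrite ger0_norm ?normc_ge0. Qed.

Lemma csumD u v : casum u -> casum v -> csum (fun k => u k + v k) = csum u + csum v.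
Proof.
move=> hu hv; apply: C_eq; rewrite ?cReD ?cImD /=.
  by rewrite -ssumD; [apply: eq_ssum => k; rewrite cReD|exact: casum_Re..].
by rewrite -ssumD; [apply: eq_ssum => k; rewrite cImD|exact: casum_Im..].
Qed.

Lemma csumZ (a : C) u : casum u -> csum (fun k => a * u k) = a * csum u.
Proof.
move=> hu; have [hr hi] := (casum_Re hu, casum_Im hu).
apply: C_eq; rewrite ?cReM ?cImM /=.
  rewrite -!ssumZ // -ssumB; [|exact: asumZ..].
  by apply: eq_ssum => k; rewrite cReM.
rewrite -!ssumZ // -ssumD; [|exact: asumZ..].
by apply: eq_ssum => k; rewrite cImM.
Qed.

Lemma csumB u v : casum u -> casum v -> csum (fun k => u k - v k) = csum u - csum v.
Proof.
move=> hu hv; rewrite csumD //.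
  congr (_ + _); rewrite -mulN1r -csumZ //; congr csum.
  by apply/funext => k; rewrite mulN1r.
by apply: casum_le hv => k; rewrite normcN.
Qed.

Lemma casumS u : casum u -> casum (fun k => u k.+1).
Proof. exact: asumS. Qed.

Lemma csum_recl u : casum u -> csum u = u 0%N + csum (fun k => u k.+1).
Proof.
move=> hu; apply: C_eq; rewrite ?cReD ?cImD /= ssum_recl //.
  exact: casum_Re.
exact: casum_Im.
Qed.

(** The factor 2 comes from bounding the real and the imaginary part separately. *)
Lemma normc_csum u : casum u -> normc (csum u) <= 2 * ssum (fun k => normc (u k)).
Proof.
move=> hu; apply: (le_trans (normc_le _)); rewrite mulr_natl mulr2n /=.
apply: lerD.
  apply: le_trans (ssum_norm (casum_Re hu)) _.
  by apply: ssum_le => //; [apply: asum_norm; exact: casum_Re|move=> k; exact: Re_le_normc].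
apply: le_trans (ssum_norm (casum_Im hu)) _.
by apply: ssum_le => //; [apply: asum_norm; exact: casum_Im|move=> k; exact: Im_le_normc].
Qed.

Definition psval c z : C := csum (fun n => c n * z ^+ n).
Definition ps_ok c : Prop := forall r, 0 <= r < 1 -> asum (fun n => normc (c n) * r ^+ n).

Lemma ps_casum c z : ps_ok c -> nsq z < 1 -> casum (fun n => c n * z ^+ n).
Proof.
move=> hc z1; have := hc (normc z); rewrite normc_ge0 normc_lt1 => /(_ z1).
by apply: casum_le => k; rewrite normcM normcX.
Qed.

Lemma psum_Re c z N : Re (psum c N z) = \sum_(k < N) Re (c k * z ^+ k).
Proof. exact: cRe_sum. Qed.
Lemma psum_Im c z N : Im (psum c N z) = \sum_(k < N) Im (c k * z ^+ k).
Proof. exact: cIm_sum. Qed.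

Lemma psum_cvg_nsq c z : ps_ok c -> nsq z < 1 ->
  nsq (psum c N z) @[N --> \oo] --> nsq (psval c z).
Proof.
move=> hc z1; have hs := ps_casum hc z1.
have h1 : Re (psum c N z) @[N --> \oo] --> Re (psval c z).
  have := asum_cvg (casum_Re hs); rewrite seriesEord.
  by under eq_fun do rewrite -psum_Re.
have h2 : Im (psum c N z) @[N --> \oo] --> Im (psval c z).
  have := asum_cvg (casum_Im hs); rewrite seriesEord.
  by under eq_fun do rewrite -psum_Im.
by apply: cvgD; apply: cvgM.
Qed.

Lemma normc_psum_le c z r N : ps_ok c -> 0 <= r < 1 -> normc z <= r ->
  normc (psum c N z) <= ssum (fun n => normc (c n) * r ^+ n).
Proof.
move=> hc r1 zr; have r0 : 0 <= r by case/andP: r1.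
apply: le_trans (ssum_part N (hc _ r1) _); last first.
  by move=> k; rewrite mulr_ge0 ?normc_ge0 ?exprn_ge0.
elim: N => [|N IH]; first by rewrite /psum !big_ord0 normc0.
rewrite /psum !big_ord_recr /=; apply: (le_trans (le_normcD _ _)); apply: lerD => //.
by rewrite normcM normcX ler_wpM2l ?normc_ge0 // lerXn2r ?nnegrE ?normc_ge0.
Qed.

End PowerSeries.

(** * The weights and their square summable sequences *)

Section Weights.
Context {R : realType}.
Implicit Types a : R.

Fixpoint bw a n : R := if n is n'.+1 then bw a n' * n%:R / (n%:R + a) else 1.

Lemma bwS a n : bw a n.+1 = bw a n * n.+1%:R / (n.+1%:R + a). Proof. by []. Qed.

Lemma bw_gt0 a n : 0 < a -> 0 < bw a n.
Proof.
move=> a0; elim: n => [//|n IH]; rewrite bwS divr_gt0 ?mulr_gt0 ?ltr0n //.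
by rewrite addr_gt0 // ltr0n.
Qed.

Lemma bw_le a n : 0 < a -> bw a n.+1 <= bw a n.
Proof.
move=> a0; have n0 : 0 < n.+1%:R :> R by rewrite ltr0n.
rewrite bwS -mulrA ler_piMr ?(ltW (bw_gt0 _ a0)) //.
by rewrite ler_pdivrMr ?addr_gt0 // mul1r lerDl ltW.
Qed.

(* Since bw decays polynomially, it beats every geometric sequence. *)
Lemma bw_geo a th : 0 < a -> 0 < th < 1 -> exists2 k : R, 0 < k & forall n, k * th ^+ n <= bw a n.
Proof.
move=> a0 /andP[th0 th1].
(* From N on, the ratio of consecutive weights is at least th. *)
pose N := Num.truncn (a * th / (1 - th)).
have hN n : (N <= n)%N -> th <= n.+1%:R / (n.+1%:R + a).
  move=> Nn; have n0 : 0 < n.+1%:R :> R by rewrite ltr0n.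
  rewrite ler_pdivlMr ?addr_gt0 // mulrDr -lerBrDl -{1}(mul1r n.+1%:R) -mulrBl.
  have : a * th / (1 - th) < n.+1%:R.
    by apply: lt_le_trans (truncnS_gt _) _; rewrite ler_nat.
  by rewrite ltr_pdivrMr ?subr_gt0 // => h; rewrite mulrC (mulrC (1 - th)) ltW.
exists (bw a N); first exact: bw_gt0.
have mono : forall m n, (m <= n)%N -> bw a n <= bw a m.
  move=> m n; elim: n => [|n IH]; first by rewrite leqn0 => /eqP ->.
  rewrite leq_eqVlt => /predU1P[->//|]; rewrite ltnS => /IH; apply: le_trans; exact: bw_le.
move=> n; have [nN|Nn] := leqP n N.
  apply: le_trans (mono _ _ nN); rewrite ler_piMr ?(ltW (bw_gt0 _ a0)) //.
  by apply: exprn_ile1; apply: ltW.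
rewrite -(subnK (ltnW Nn)) addnC; elim: (n - N)%N => [|k IH].
  by rewrite addn0 ler_piMr ?(ltW (bw_gt0 _ a0)) //; apply: exprn_ile1; apply: ltW.
rewrite addnS bwS exprSr mulrA -[leRHS]mulrA; apply: ler_pM => //.
- by rewrite mulr_ge0 ?(ltW (bw_gt0 _ a0)) ?exprn_ge0 // ltW.
- exact: ltW.
- by apply: hN; rewrite leq_addr.
Qed.

Definition l2w (w : nat -> R) (c : nat -> R[i]) : Prop := asum (fun n => w n * nsq (c n)).

(** Each term satisfies |c_n| r^n <= w_n |c_n|^2 + r^(2 n) / w_n. With th strictly between r^2 and
    1, [bw_geo] bounds the second summand by a geometric sequence of ratio r^2 / th. *)
Lemma l2_ps_ok a c : 0 < a -> l2w (bw a) c -> ps_ok c.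
Proof.
move=> a0 hc r /andP[r0 r1].
have th1 : 0 < (r ^+ 2 + 1) / 2 < 1 by have := r0; have := r1; move=> ? ?; apply/andP; split; nra.
have [k k0 hk] := bw_geo a0 th1.
have [th thE] : exists th : R, th = (r ^+ 2 + 1) / 2 by eexists.
move: th1 hk; rewrite -thE => /andP[th0 th1] hk.
have q1 : `|r ^+ 2 / th| < 1.
  have h : 0 <= r ^+ 2 / th by rewrite divr_ge0 ?sqr_ge0 // ltW.
  by rewrite ger0_norm // ltr_pdivrMr // mul1r thE; nra.
apply: asum_le (asumD hc (@asumZ _ k^-1 _ (asum_geo q1))) => n.
have w0 := bw_gt0 n a0; have thn : 0 < th ^+ n by rewrite exprn_gt0.
rewrite ger0_norm ?mulr_ge0 ?normc_ge0 ?exprn_ge0 //.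
apply: le_trans (_ : bw a n * nsq (c n) + r ^+ n ^+ 2 / bw a n <= _); last first.
  rewrite lerD2l expr_div_n -exprM mulnC exprM [leRHS]mulrCA ler_wpM2l ?exprn_ge0 ?sqr_ge0 //.
  by rewrite -invfM lef_pV2 ?posrE ?mulr_gt0.
rewrite -normc_nsq; move: (normc (c n)) (r ^+ n) (bw a n) w0 => x y w w0.
have E : w * x ^+ 2 + y ^+ 2 / w - x * y = ((w * x - y / 2) ^+ 2 + 3/4 * y ^+ 2) / w.
  by field; rewrite gt_eqF.
rewrite -subr_ge0 E divr_ge0 ?(ltW w0) //.
by rewrite addr_ge0 ?sqr_ge0 // mulr_ge0 ?sqr_ge0 //; lra.
Qed.

End Weights.

Section Fatou.
Context d (T : measurableType d) (R : realType) (mu : {measure set T -> \bar R}).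
Local Open Scope ereal_scope.

(** It serves both halves of the norm formula, along partial sums for the upper bound and along
    truncation radii for the lower one, and later [Om0_le1]. *)
Lemma fatou_le (D : set T) (f : nat -> T -> \bar R) (g : T -> \bar R) B : measurable D ->
  (forall n, measurable_fun D (f n)) -> (forall n x, D x -> 0 <= f n x) ->
  (forall x, D x -> f n x @[n --> \oo] --> g x) ->
  (forall n, \int[mu]_(x in D) f n x <= B) -> \int[mu]_(x in D) g x <= B.
Proof.
move=> mD mf f0 fg hB.
have -> : \int[mu]_(x in D) g x = \int[mu]_(x in D) limn_einf (f^~ x).
  apply: eq_integral => x; rewrite inE => Dx.
  have h := fg _ Dx; rewrite is_cvg_limn_einfE; last exact: (cvgP _ h).
  by rewrite (cvg_lim _ h).
apply: (le_trans (fatou _ mD mf f0)).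
rewrite limn_einf_lim; apply: lime_le; first exact: is_cvg_einfs.
near=> n; apply: le_trans (hB n).
by apply: ereal_inf_lbound; exists n => /=.
Unshelve. all: by end_near. Qed.

End Fatou.

(** * The Bergman norm of a power series *)

Section NormFormula.
Context {R : realType}.
Notation C := (R[i]).
Notation nu := (@plane_measure R).
Notation mu := (@lebesgue_measure R).
Notation mR := (measurableTypeR R).
Notation pl := (@pl R).
Variable alpha : R.
Hypothesis halpha : -1 < alpha.

(** The Bergman density in the variable s = |z|^2, cut off at s < t. For t < 1 the partial sums of a
    power series are bounded on the support; t = 1 is the full density. *)
Definition rho (t s : R) : R :=
  if (0 <= s) && (s < t) then (alpha + 1) * (1 - s) `^ alpha / pi else 0.

Lemma alpha1_gt0 : 0 < alpha + 1. Proof. by have := halpha; lra. Qed.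

Lemma rho_ge0 t s : 0 <= rho t s.
Proof.
rewrite /rho; case: ifP => // _.
by rewrite divr_ge0 ?pi_ge0 // mulr_ge0 ?powR_ge0 // ltW // alpha1_gt0.
Qed.

Lemma measurable_rho t : measurable_fun [set: R] (rho t).
Proof.
have h0 : measurable_fun [set: R] (fun s : R => (alpha + 1) * (1 - s) `^ alpha / pi).
  apply: measurable_funM => //; apply: measurable_funM => //.
  have h : measurable_fun [set: R] (fun x : R => 1 - x) by apply: measurable_funB.
  have := measurableT_comp (@measurable_powR R alpha) h.
  exact.
apply: measurable_fun_ifT => //.
apply: measurable_and; first exact: measurable_fun_ler.
exact: measurable_fun_ltr.
Qed.

Lemma rho_ge1 t s : t <= 1 -> 1 <= s -> rho t s = 0.
Proof.
move=> t1 s1; rewrite /rho ifF //; apply/negbTE; rewrite negb_and orbC -leNgt.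
by rewrite (le_trans t1).
Qed.

Lemma rho_mono t s : t <= 1 -> rho t s <= rho 1 s.
Proof.
move=> t1; rewrite {1}/rho; case: ifP => [/andP[s0 st]|_]; last exact: rho_ge0.
by rewrite /rho s0 (lt_le_trans st).
Qed.

(** The squared Bergman norm of the constant 1. It is carried along as a positive factor, which
    [Beurling_transfer] tolerates. *)
Definition kappa : R := @barea R * ((alpha + 1) / pi) * ib 0 alpha.

Lemma kappa_gt0 : 0 < kappa.
Proof.
rewrite /kappa mulr_gt0 ?mulr_gt0 ?barea_gt0 ?invr_gt0 ?pi_gt0 ?alpha1_gt0 //.
by apply: ib_gt0.
Qed.

Lemma ib_bw n : ib n%:R alpha = ib 0 alpha * bw (alpha + 1) n.
Proof.
elim: n => [|n IH]; first by rewrite mulr1.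
have n0 : 0 <= n%:R :> R by [].
have := ib_rec n0 halpha; rewrite IH -natr1 => h.
have a0 := alpha1_gt0.
have d1 : 0 < n%:R + alpha + 2 by clear h IH; have := halpha; lra.
have d0 : n%:R + alpha + 2 != 0 by rewrite gt_eqF.
have d2 : 0 < n%:R + 1 + (alpha + 1) by clear h IH; lra.
rewrite bwS -natr1; apply: (mulfI d0); rewrite h.
by field; rewrite ?d0 ?gt_eqF.
Qed.

Lemma int_rho1 n : (\int[nu]_p (sqn p ^+ n * rho 1 (sqn p))%:E =
  (kappa * bw (alpha + 1) n)%:E)%E.
Proof.
pose g (s : R) : \bar R := (((alpha + 1) / pi)%:E * (bker n%:R alpha s)%:E)%E.
pose D : set mR := `[0%R, 1%R[%classic.
have mD : measurable D by exact: measurable_itv.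
have k0 : 0 <= (alpha + 1) / pi :> R.
  by rewrite divr_ge0 ?pi_ge0 // ltW // alpha1_gt0.
transitivity (\int[nu]_(p in (@sqn R) @^-1` D) g (sqn p))%E.
  rewrite [RHS]integral_mkcond; apply: eq_integral => p _.
  rewrite /patch /g /bker /rho; have s0 := sqn_ge0 p.
  have -> : (p \in (@sqn R) @^-1` D) = (sqn p < 1).
    apply/idP/idP => [/set_mem|h].
      by rewrite /D /= in_itv /= => /andP[].
    by apply/mem_set; rewrite /D /= in_itv /= s0.
  rewrite s0 /=; case: ifP => // _; last by rewrite mulr0.
  by rewrite powR_mulrn // -EFinM; congr EFin; ring.
rewrite integral_sqn //; first last.
- by move=> x _; rewrite /g -EFinM lee_fin mulr_ge0 // bker_ge0.
- by apply: measurable_funeM; exact: measurable_bkerE.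
- by move=> x; rewrite /D /= !in_itv /= => /andP[-> _].
rewrite ge0_integralZl ?lee_fin //; last 2 first.
- exact: measurable_bkerE.
- by move=> x _; rewrite lee_fin bker_ge0.
rewrite -(@integral_itv_obnd_cbnd _ 0 (BLeft 1)); last exact: measurable_bkerE.
rewrite ibE // ib_bw -!EFinM; congr EFin; rewrite /kappa; ring.
Qed.

Lemma int_rho_fin t : t <= 1 -> (\int[nu]_p (rho t (sqn p))%:E < +oo)%E.
Proof.
move=> t1; apply: (@le_lt_trans _ _ (\int[nu]_p (sqn p ^+ 0 * rho 1 (sqn p))%:E)%E).
  apply: ge0_le_integral => //.
  - by move=> p _; rewrite lee_fin rho_ge0.
  - by apply/measurable_EFinP; apply: mrhos; exact: measurable_rho.
  - apply/measurable_EFinP; apply: measurable_funM; last by apply: mrhos; exact: measurable_rho.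
    by apply: measurable_funX; exact: measurable_sqn.
  - by move=> p _; rewrite lee_fin expr0 mul1r rho_mono.
by rewrite int_rho1 ltry.
Qed.

Lemma mom_rho1 n : mom (rho 1) n = kappa * bw (alpha + 1) n.
Proof. by rewrite /mom int_rho1. Qed.

Lemma bergman_sqnorm_rho (f : C -> C^o) :
  (bergman_sqnorm alpha f = \int[nu]_p (nsq (f (cplx p)) * rho 1 (sqn p))%:E)%E.
Proof.
rewrite /bergman_sqnorm integral_mkcond; apply: eq_integral => p _.
rewrite /patch /rho sqn_ge0 /=.
have -> : (p \in (@cplx R) @^-1` disc) = (sqn p < 1).
  apply/idP/idP => [/set_mem|h].
    by rewrite /= discE nsq_cplx.
  by apply/mem_set; rewrite /= discE nsq_cplx.
case: ifP => // _; last by rewrite mulr0.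
by rewrite normc_nsq /bergman_weight normc_nsq nsq_cplx.
Qed.

Section Series.
Variables (f : C -> C^o) (c : nat -> C).
Hypotheses (hc : ps_ok c) (hf : forall z, nsq z < 1 -> f z = psval c z).

Let a := alpha + 1.

Lemma psum_rho_cvg t (p : pl) : t <= 1 ->
  (nsq (psum c N (cplx p)) * rho t (sqn p))%:E @[N --> \oo] -->
  (nsq (f (cplx p)) * rho t (sqn p))%:E.
Proof.
move=> t1; apply: cvg_EFin; first by near=> N.
rewrite /comp /=.
have [p1|p1] := ltP (sqn p) 1; last first.
  by have E := rho_ge1 t1 p1; apply: cvg_near_cst; near=> N; rewrite E !mulr0.
apply: cvgM; last exact: cvg_cst.
by rewrite hf ?nsq_cplx //; apply: psum_cvg_nsq; rewrite ?nsq_cplx.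
Unshelve. all: by end_near. Qed.

Lemma measurable_psum_rho t N :
  measurable_fun [set: pl] (fun p : pl => (nsq (psum c N (cplx p)) * rho t (sqn p))%:E).
Proof.
apply/measurable_EFinP; apply: measurable_funM; last by apply: mrhos; exact: measurable_rho.
by apply: mC_nsq; exact: mC_psum.
Qed.

Lemma measurable_f_rho t : t <= 1 ->
  measurable_fun [set: pl] (fun p : pl => (nsq (f (cplx p)) * rho t (sqn p))%:E).
Proof.
move=> t1.
apply: (@emeasurable_fun_cvg _ _ _ _ (fun N p => (nsq (psum c N (cplx p)) * rho t (sqn p))%:E)).
  by move=> N; exact: measurable_psum_rho.
by move=> p _; exact: psum_rho_cvg.
Qed.

Lemma bergman_sqnorm_le B : (forall N, \sum_(n < N) bw a n * nsq (c n) <= B) ->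
  (bergman_sqnorm alpha f <= (kappa * B)%:E)%E.
Proof.
move=> hB; rewrite bergman_sqnorm_rho.
apply: (@fatou_le _ _ R nu setT (fun N (p : pl) => (nsq (psum c N (cplx p)) * rho 1 (sqn p))%:E)) => //.
- by move=> N; exact: measurable_psum_rho.
- by move=> N p _; rewrite lee_fin mulr_ge0 ?nsq_ge0 ?rho_ge0.
- by move=> p _; exact: psum_rho_cvg.
- move=> N; rewrite (integral_psum (measurable_rho 1) (rho_ge0 1) (fun s => @rho_ge1 1 s (lexx 1)) (int_rho_fin (lexx 1))).
  rewrite lee_fin; apply: le_trans (_ : kappa * (\sum_(n < N) bw a n * nsq (c n)) <= _).
    by rewrite mulr_sumr ler_sum // => n _; rewrite mom_rho1 /a; lra.
  by rewrite ler_pM2l ?kappa_gt0.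
Qed.

(** On |z|^2 < t all partial sums are at most S in modulus, so dominated convergence applies; the
    integrals of their squares increase with the degree. *)
Lemma psum_le_rho t N : 0 < t < 1 ->
  ((\sum_(n < N) nsq (c n) * mom (rho t) n)%:E <=
   \int[nu]_p (nsq (f (cplx p)) * rho t (sqn p))%:E)%E.
Proof.
move=> /andP[t0 t1]; have t1' := ltW t1.
have ip M := integral_psum (measurable_rho t) (rho_ge0 t) (fun s => @rho_ge1 t s t1') (int_rho_fin t1') c M.
have r1 : 0 <= Num.sqrt t < 1 by rewrite sqrtr_ge0 /= -[ltRHS]sqrtr1 ltr_sqrt.
pose S := ssum (fun n => normc (c n) * Num.sqrt t ^+ n).
have S0 : 0 <= S.
  by apply: ssum_ge0; [exact: hc|move=> k; rewrite mulr_ge0 ?normc_ge0 ?exprn_ge0 ?sqrtr_ge0].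
have irho := integrable_rho (measurable_rho t) (rho_ge0 t) (int_rho_fin t1').
have dom (p : pl) : forall n, setT p -> (`|(nsq (psum c n (cplx p)) * rho t (sqn p))%:E| <=
    (S ^+ 2)%:E * (rho t (sqn p))%:E)%E.
  move=> n _; rewrite -EFinM gee0_abs ?lee_fin ?mulr_ge0 ?nsq_ge0 ?rho_ge0 //.
  rewrite /rho; case: ifP => [/andP[_ pt]|_]; last by rewrite !mulr0.
  apply: ler_wpM2r; first by rewrite divr_ge0 ?pi_ge0 // mulr_ge0 ?powR_ge0 // ltW // alpha1_gt0.
  rewrite -normc_nsq lerXn2r ?nnegrE ?normc_ge0 //.
  by apply: normc_psum_le => //; rewrite normc_sqrt nsq_cplx ler_wsqrtr // ltW.
have [_ _ dc] := @dominated_convergence _ _ _ nu setT measurableT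
  (fun N (p : pl) => (nsq (psum c N (cplx p)) * rho t (sqn p))%:E)
  (fun p : pl => (nsq (f (cplx p)) * rho t (sqn p))%:E)
  (fun p : pl => ((S ^+ 2)%:E * (rho t (sqn p))%:E)%E)
  (measurable_psum_rho t) (measurable_f_rho t1')
  (aeW _ (fun p _ => @psum_rho_cvg t p t1'))
  (integrableZl measurableT (S ^+ 2) irho)
  (aeW _ dom).
rewrite -(cvg_lim _ dc) //; apply: lime_ge; first exact: (cvgP _ dc).
near=> M => /=; rewrite ip lee_fin.
have NM : (N <= M)%N by near: M; exact: nbhs_infty_ge.
rewrite -(subnK NM) addnC big_split_ord /= lerDl sumr_ge0 // => i _.
by rewrite mulr_ge0 ?nsq_ge0 // mom_ge0 // => s; exact: rho_ge0.
Unshelve. all: by end_near. Qed.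

(** The partial sums have no evident majorant on the whole disc. Hence the truncation to |z|^2 < t
    first, and Fatou for the finite sum as t tends to 1. *)
Lemma bergman_sqnorm_ge N :
  ((kappa * \sum_(n < N) bw a n * nsq (c n))%:E <= bergman_sqnorm alpha f)%E.
Proof.
pose t (k : nat) : R := 1 - @ep R k.
have t01 k : 0 < t k < 1.
  by have := @ep_gt0 R k; have := @ep_lt R k; rewrite /t => ? ?; apply/andP; split; lra.
pose h s (p : pl) := (\sum_(n < N) nsq (c n) * (sqn p ^+ n * rho s (sqn p)))%:E.
have mterm n s : measurable_fun [set: pl] (fun p : pl => (sqn p ^+ n * rho s (sqn p))).
  apply: measurable_funM; last by apply: mrhos; exact: measurable_rho.
  by apply: measurable_funX; exact: measurable_sqn.
have ih s : s <= 1 -> (\int[nu]_p h s p = (\sum_(n < N) nsq (c n) * mom (rho s) n)%:E)%E.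
  move=> s1; rewrite /h; under eq_integral do rewrite -sumEFin.
  rewrite ge0_integral_sum //; last 2 first.
  - move=> n; apply/measurable_EFinP; apply: measurable_funM => //; exact: mterm.
  - by move=> n p _; rewrite lee_fin !mulr_ge0 ?nsq_ge0 ?rho_ge0 // exprn_ge0 // sqn_ge0.
  rewrite -sumEFin; apply: eq_bigr => n _.
  under eq_integral do rewrite EFinM.
  rewrite ge0_integralZl ?lee_fin ?nsq_ge0 //; last 2 first.
  - by apply/measurable_EFinP; exact: mterm.
  - by move=> p _; rewrite lee_fin !mulr_ge0 ?rho_ge0 // exprn_ge0 // sqn_ge0.
  by rewrite (momE (measurable_rho s) (rho_ge0 s) (fun u => @rho_ge1 s u s1) (int_rho_fin s1)).
have -> : ((kappa * \sum_(n < N) bw a n * nsq (c n))%:E = \int[nu]_p h 1%R p)%E.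
  rewrite ih //; congr EFin; rewrite mulr_sumr; apply: eq_bigr => n _.
  by rewrite mom_rho1 /a; ring.
apply: (@fatou_le _ _ R nu setT (fun k (p : pl) => h (t k) p)) => //.
- move=> k; apply/measurable_EFinP; apply: measurable_sum => n.
  by apply: measurable_funM => //; exact: mterm.
- move=> k p _; rewrite lee_fin sumr_ge0 // => n _.
  by rewrite !mulr_ge0 ?nsq_ge0 ?rho_ge0 // exprn_ge0 // sqn_ge0.
- move=> p _; have [p1|p1] := ltP (sqn p) 1; last first.
    have E s : s <= 1 -> h s p = 0%E.
      by move=> s1; rewrite /h big1 // => n _; rewrite rho_ge1 // !mulr0.
    apply: cvg_near_cst; near=> k.
    by have /andP[_ /ltW tk] := t01 k; rewrite !E.
  (* Pointwise the sequence is eventually constant: the cut-off at t k stops mattering once t k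
     exceeds |z|^2. *)
  apply: cvg_near_cst; have d0 : 0 < 1 - sqn p by rewrite subr_gt0.
  have ep0 : @ep R n @[n --> \oo] --> 0.
    have := cvg_comp _ _ (cvg_addnr 2) (@cvg_harmonic R).
    by rewrite /comp /harmonic; under eq_fun do rewrite addn2.
  near=> k; have hk : @ep R k < 1 - sqn p by near: k; exact: (cvgr_lt _ ep0 _ d0).
  have E : rho (t k) (sqn p) = rho 1 (sqn p).
    by rewrite /rho p1 (_ : sqn p < t k) //; rewrite /t; lra.
  by rewrite /h E.
- move=> k; have /andP[_ /ltW tk] := t01 k.
  rewrite (ih _ tk); apply: (le_trans (psum_le_rho N (t01 k))).
  rewrite bergman_sqnorm_rho; apply: ge0_le_integral => //.
  + by move=> p _; rewrite lee_fin mulr_ge0 ?nsq_ge0 ?rho_ge0.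
  + exact: measurable_f_rho.
  + exact: measurable_f_rho.
  + by move=> p _; rewrite lee_fin ler_wpM2l ?nsq_ge0 // rho_mono.
Unshelve. all: by end_near. Qed.

End Series.

End NormFormula.

(** * The Cauchy formula *)

Section RiemannIntegral.
Context {R : realType}.
Notation mu := (@lebesgue_measure R).
Implicit Types (g h : R -> R) (a b x y K : R).

Definition RI g a b : R := \int[mu]_(x in `[a, b]) g x.
Definition con g a b : Prop := forall x, a <= x <= b -> {for x, continuous g}.

Lemma con_integrable g a b : con g a b -> mu.-integrable `[a, b] (EFin \o g).
Proof.
move=> h; apply: continuous_compact_integrable; first exact: segment_compact.
by apply: continuous_in_subspaceT => x; rewrite inE /= in_itv /=; exact: h.
Qed.

Lemma RI_D g h a b : con g a b -> con h a b ->
  RI (fun x => g x + h x) a b = RI g a b + RI h a b.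
Proof. by move=> cg ch; rewrite /RI RintegralD //; exact: con_integrable. Qed.

Lemma RI_B g h a b : con g a b -> con h a b ->
  RI (fun x => g x - h x) a b = RI g a b - RI h a b.
Proof. by move=> cg ch; rewrite /RI RintegralB //; exact: con_integrable. Qed.

Lemma RI_Z k g a b : con g a b -> RI (fun x => k * g x) a b = k * RI g a b.
Proof. by move=> cg; rewrite /RI RintegralZl //; exact: con_integrable. Qed.

Lemma eq_RI g h a b : (forall x, a <= x <= b -> g x = h x) -> RI g a b = RI h a b.
Proof.
by move=> e; apply: eq_Rintegral => x; rewrite inE /= in_itv /=; exact: e.
Qed.

Lemma RI_cst k a b : a <= b -> RI (fun=> k) a b = k * (b - a).
Proof.
move=> ab; rewrite /RI Rintegral_cst // [X in fine X]lebesgue_measure_itv /= lte_fin.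
case: ltP => h; first by rewrite -EFinD.
have -> : a = b by apply/le_anti; rewrite ab h.
by rewrite subrr mulr0.
Qed.

Lemma RI_bound g a b K : a <= b -> con g a b -> (forall x, a <= x <= b -> `|g x| <= K) ->
  `|RI g a b| <= K * (b - a).
Proof.
move=> ab cg gK.
have ig := con_integrable cg.
apply: (le_trans (le_normr_Rintegral _ ig)) => //.
rewrite -(RI_cst K ab); apply: le_Rintegral => //.
- have := integrable_abse ig; apply: eq_integrable => // x _.
- by apply: (@con_integrable (fun=> K)) => x _; exact: cst_continuous.
Qed.

Lemma RI_split g a m b : a <= m <= b -> con g a b -> RI g a b = RI g a m + RI g m b.
Proof.
move=> /andP[am mb] cg; have ig := con_integrable cg.
have := @Rintegral_itvB R g (BLeft a) (BRight b) m ig.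
rewrite !bnd_simp => /(_ am mb) h; apply/eqP; rewrite addrC -subr_eq /RI h.
rewrite -Rintegral_itv_obnd_cbnd //.
by apply: integrableS ig => //; apply: subset_itvr; rewrite bnd_simp.
Qed.

Lemma RI_FTC F g a b : a <= b ->
  (forall x, a <= x <= b -> is_derive x 1 F (g x)) -> con g a b -> RI g a b = F b - F a.
Proof.
rewrite le_eqVlt => /predU1P[<-|ab] dF cg; last by rewrite /RI /Rintegral (FTC_smooth ab dF cg).
by rewrite /RI set_itv1 Rintegral_set1 subrr.
Qed.

End RiemannIntegral.

(** * Additive functions of rectangles that are locally small *)

Section Bisection.
Context {R : realType}.
Variable B : R -> R -> R -> R -> R.
Variables (a b c d : R).
Hypotheses (ab : a <= b) (cd : c <= d).
Hypothesis Bt : forall t1 m t2 s1 s2, a <= t1 -> t1 <= m -> m <= t2 -> t2 <= b ->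
  c <= s1 -> s1 <= s2 -> s2 <= d -> B t1 t2 s1 s2 = B t1 m s1 s2 + B m t2 s1 s2.
Hypothesis Bs : forall t1 t2 s1 m s2, a <= t1 -> t1 <= t2 -> t2 <= b ->
  c <= s1 -> s1 <= m -> m <= s2 -> s2 <= d -> B t1 t2 s1 s2 = B t1 t2 s1 m + B t1 t2 m s2.
Hypothesis Bloc : forall t0 s0, a <= t0 <= b -> c <= s0 <= d -> forall e, 0 < e ->
  exists2 r : R, 0 < r & forall t1 t2 s1 s2, a <= t1 -> t1 <= t0 -> t0 <= t2 -> t2 <= b ->
    c <= s1 -> s1 <= s0 -> s0 <= s2 -> s2 <= d -> t2 - t1 < r -> s2 - s1 < r ->
    `|B t1 t2 s1 s2| <= e * (t2 - t1 + (s2 - s1)) ^+ 2.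

Definition rect : Type := (R * R * (R * R))%type.
Definition BQ (q : rect) := B q.1.1 q.1.2 q.2.1 q.2.2.
Definition okQ (q : rect) := [/\ a <= q.1.1, q.1.1 <= q.1.2, q.1.2 <= b &
  [/\ c <= q.2.1, q.2.1 <= q.2.2 & q.2.2 <= d]].
Definition subQ (p q : rect) := [/\ q.1.1 <= p.1.1, p.1.2 <= q.1.2,
  q.2.1 <= p.2.1 & p.2.2 <= q.2.2] /\
  (p.1.2 - p.1.1 = (q.1.2 - q.1.1) / 2 /\ p.2.2 - p.2.1 = (q.2.2 - q.2.1) / 2).

(** If all four quarters failed, additivity would contradict the triangle inequality. [cid] puts the
    choice in a form that [bseq0] can iterate. *)
Lemma bisect_step (q : rect) : okQ q ->
  {p : rect | [/\ okQ p, subQ p q & `|BQ q| <= 4 * `|BQ p|]}.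
Proof.
move=> okq; apply: cid.
case: q okq => [[t1 t2] [s1 s2]] [/= h1 h2 h3 [/= h4 h5 h6]].
pose m := (t1 + t2) / 2; pose n := (s1 + s2) / 2.
have tm1 : t1 <= m by rewrite /m; lra.
have tm2 : m <= t2 by rewrite /m; lra.
have sm1 : s1 <= n by rewrite /n; lra.
have sm2 : n <= s2 by rewrite /n; lra.
have E : B t1 t2 s1 s2 = (B t1 m s1 n + B t1 m n s2) + (B m t2 s1 n + B m t2 n s2).
  rewrite (Bt h1 tm1 tm2 h3 h4 h5 h6); congr (_ + _); apply: Bs => //.
    exact: le_trans tm2 h3.
  exact: le_trans h1 tm1.
have [k1|k1] := leP (`|B t1 t2 s1 s2|) (4 * `|B t1 m s1 n|).
  by exists (t1, m, (s1, n)); split => //; rewrite /okQ /subQ /=; split => //;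
     rewrite ?(le_trans tm2) ?(le_trans sm2) //; split; rewrite /m /n; lra.
have [k2|k2] := leP (`|B t1 t2 s1 s2|) (4 * `|B t1 m n s2|).
  exists (t1, m, (n, s2)); split => //; rewrite /okQ /subQ /=; split => //;
     rewrite ?(le_trans tm2) ?(le_trans h4) //; split; rewrite /m /n; lra.
have [k3|k3] := leP (`|B t1 t2 s1 s2|) (4 * `|B m t2 s1 n|).
  exists (m, t2, (s1, n)); split => //; rewrite /okQ /subQ /=; split => //;
     rewrite ?(le_trans h1) ?(le_trans sm2) //; split; rewrite /m /n; lra.
have [k4|k4] := leP (`|B t1 t2 s1 s2|) (4 * `|B m t2 n s2|).
  exists (m, t2, (n, s2)); split => //; rewrite /okQ /subQ /=; split => //;
     rewrite ?(le_trans h1) ?(le_trans h4) //; split; rewrite /m /n; lra.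
exfalso; have := ler_normD (B t1 m s1 n + B t1 m n s2) (B m t2 s1 n + B m t2 n s2).
have := ler_normD (B t1 m s1 n) (B t1 m n s2); have := ler_normD (B m t2 s1 n) (B m t2 n s2).
rewrite -E; lra.
Qed.

(** The validity proof travels with the rectangle, so that plain [iter] produces the nested
    sequence. *)
Definition bseq0 (x : {q : rect | okQ q}) : {q : rect | okQ q} :=
  let s := bisect_step (svalP x) in
  exist _ (sval s) (let: And3 h _ _ := svalP s in h).

(** Goursat's argument: after n bisections |B| has lost at most a factor 4^n, while the local
    estimate at the common point of the nested rectangles gives e times a multiple of 4^(- n). *)
Lemma bisect_eq0 : B a b c d = 0.
Proof.
have ok0 : okQ (a, b, (c, d)) by split.
pose Q n : rect := sval (iter n bseq0 (exist _ _ ok0)).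
have okn n : okQ (Q n) by exact: svalP.
have stp n : subQ (Q n.+1) (Q n) /\ `|BQ (Q n)| <= 4 * `|BQ (Q n.+1)|.
  by rewrite /Q iterS /bseq0 /=; case: (bisect_step _) => p [].
have BQn n : `|B a b c d| <= 4 ^+ n * `|BQ (Q n)|.
  elim: n => [|n IH]; first by rewrite expr0 mul1r.
  apply: (le_trans IH); rewrite exprSr -mulrA ler_wpM2l ?exprn_ge0 //.
  by have [] := stp n.
have szt n : (Q n).1.2 - (Q n).1.1 = (b - a) * 2^-1 ^+ n.
  elim: n => [|n IH]; first by rewrite mulr1.
  by have [[_ [-> _]] _] := stp n; rewrite IH exprSr mulrA.
have szs n : (Q n).2.2 - (Q n).2.1 = (d - c) * 2^-1 ^+ n.
  elim: n => [|n IH]; first by rewrite mulr1.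
  by have [[_ [_ ->]] _] := stp n; rewrite IH exprSr mulrA.
have ndt : nondecreasing_seq (fun n => (Q n).1.1).
  by apply/nondecreasing_seqP => n; have [[[]]] := stp n.
have nds : nondecreasing_seq (fun n => (Q n).2.1).
  by apply/nondecreasing_seqP => n; have [[[]]] := stp n.
have nit : nonincreasing_seq (fun n => (Q n).1.2).
  by apply/nonincreasing_seqP => n; have [[[]]] := stp n.
have nis : nonincreasing_seq (fun n => (Q n).2.2).
  by apply/nonincreasing_seqP => n; have [[[]]] := stp n.
have crosst m n : (Q m).1.1 <= (Q n).1.2.
  have [_ h _ _] := okn (maxn m n).
  apply: le_trans (ndt _ _ (leq_maxl m n)) _; apply: (le_trans h).
  exact: nit (leq_maxr m n).
have crosss m n : (Q m).2.1 <= (Q n).2.2.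
  have [_ _ _ [_ h _]] := okn (maxn m n).
  apply: le_trans (nds _ _ (leq_maxl m n)) _; apply: (le_trans h).
  exact: nis (leq_maxr m n).
pose t0 := sup (range (fun n => (Q n).1.1)); pose s0 := sup (range (fun n => (Q n).2.1)).
have t0l n : (Q n).1.1 <= t0.
  by apply: ub_le_sup; [exists (Q 0%N).1.2 => _ [k _ <-]; exact: crosst|exists n].
have t0r n : t0 <= (Q n).1.2.
  by apply: ge_sup; [exists (Q 0%N).1.1, 0%N|move=> _ [k _ <-]; exact: crosst].
have s0l n : (Q n).2.1 <= s0.
  by apply: ub_le_sup; [exists (Q 0%N).2.2 => _ [k _ <-]; exact: crosss|exists n].
have s0r n : s0 <= (Q n).2.2.
  by apply: ge_sup; [exists (Q 0%N).2.1, 0%N|move=> _ [k _ <-]; exact: crosss].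
have ht0 : a <= t0 <= b by rewrite (t0l 0%N) (t0r 0%N).
have hs0 : c <= s0 <= d by rewrite (s0l 0%N) (s0r 0%N).
(* The summand 1 keeps S positive for a degenerate rectangle. *)
pose S := b - a + (d - c) + 1.
have S0 : 0 < S by rewrite /S; lra.
apply/eqP; rewrite -normr_le0; apply/ler_addgt0Pr => e e0; rewrite add0r.
have e1 : 0 < e / S ^+ 2 by rewrite divr_gt0 // exprn_gt0.
have [r r0 hr] := Bloc ht0 hs0 e1.
have [n hn] : exists n, S * 2^-1 ^+ n < r.
  have h : S * 2^-1 ^+ n @[n --> \oo] --> S * 0.
    by apply: cvgM; [exact: cvg_cst|apply: cvg_expr; rewrite ger0_norm //; lra].
  rewrite mulr0 in h.
  have [n _ hn] := cvgr_lt _ h _ r0.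
  by exists n; apply: hn => /=.
have p0 : 0 < 2^-1 ^+ n :> R by rewrite exprn_gt0.
have [k1 k2 k3 [k4 k5 k6]] := okn n.
have := hr _ _ _ _ k1 (t0l n) (t0r n) k3 k4 (s0l n) (s0r n) k6.
rewrite szt szs => h.
have {h} h := h _ _; apply: (le_trans (BQn n)).
have hab : (b - a) * 2^-1 ^+ n < r by apply: le_lt_trans hn; rewrite ler_pM2r // /S; lra.
have hcd : (d - c) * 2^-1 ^+ n < r by apply: le_lt_trans hn; rewrite ler_pM2r // /S; lra.
apply: le_trans (_ : 4 ^+ n * (e / S ^+ 2 * (S * 2^-1 ^+ n) ^+ 2) <= _).
  rewrite ler_wpM2l ?exprn_ge0 //; apply: (le_trans (h hab hcd)).
  rewrite ler_wpM2l ?(ltW e1) // -mulrDl lerXn2r ?nnegrE ?mulr_ge0 ?(ltW p0) ?(ltW S0) //.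
    by rewrite /S in S0 *; lra.
  by rewrite ler_pM2r // /S; lra.
rewrite exprMn -exprM mulnC exprM (_ : 2^-1 ^+ 2 = 4^-1); last by field.
rewrite [X in 4 ^+ n * X](_ : _ = e * (4^-1 ^+ n)); last by field; rewrite gt_eqF.
by rewrite mulrCA -exprMn mulfV // expr1n mulr1.
Qed.

End Bisection.

(** * Complex differentiability and continuity along real paths *)

Section Holomorphic.
Context {R : realType}.
Notation C := (R[i]).
Notation Re := (@complex.Re R).
Notation Im := (@complex.Im R).

Lemma holo_approx (f : C -> C^o) z : holomorphic_on_disc f -> nsq z < 1 ->
  exists l : C, forall e : R, 0 < e -> exists2 d : R, 0 < d & forall w : C, normc (w - z) < d ->
    normc (f w - f z - l * (w - z)) <= e * normc (w - z).
Proof.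
move=> hf z1; have := hf z; rewrite discE => /(_ z1) /cvg_ex [l hl].
exists l => e e0; have eC : 0 < e%:C :> C by rewrite ltcR.
move/cvgrPdist_le : hl => /(_ _ eC).
rewrite /dnbhs near_withinE => /nbhs_normP [d /= d0 H].
(* Radii of balls in R[i] are themselves elements of R[i]; being positive, d has imaginary part
   0. *)
have dE : d = (Re d)%:C by move: d0; rewrite ltcE /= => /andP[/eqP h _]; apply: C_eq.
exists (Re d); first by rewrite -ltcR -dE.
move=> w wd; have [->|wz] := eqVneq w z.
  by rewrite !subrr mulr0 subr0 normc0 mulr0.
have wz0 : w - z != 0 by rewrite subr_eq0.
have := H (w - z); rewrite /= add0r normrN norm_normc {1}dE ltcR => /(_ wd wz0).
rewrite /GRing.scale /= mulr1 subrK norm_normc lecR => h.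
have -> : f w - f z - l * (w - z) = - ((l - (w - z)^-1 * (f w - f z)) * (w - z)).
  by field.
by rewrite normcN normcM ler_wpM2r ?normc_ge0.
Qed.

Definition ccont (g : R -> C) (x : R) :=
  Re (g y) @[y --> x] --> Re (g x) /\ Im (g y) @[y --> x] --> Im (g x).

Lemma ccont_cst (c : C) x : ccont (fun=> c) x.
Proof. by split; exact: cvg_cst. Qed.

Lemma ccontD g h x : ccont g x -> ccont h x -> ccont (fun x => g x + h x) x.
Proof.
move=> [g1 g2] [h1 h2]; split.
  by rewrite cReD; under eq_fun do rewrite cReD; apply: cvgD.
by rewrite cImD; under eq_fun do rewrite cImD; apply: cvgD.
Qed.

Lemma ccontN g x : ccont g x -> ccont (fun x => - g x) x.
Proof.
move=> [g1 g2]; split.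
  by rewrite cReN; under eq_fun do rewrite cReN; apply: cvgN.
by rewrite cImN; under eq_fun do rewrite cImN; apply: cvgN.
Qed.

Lemma ccontM g h x : ccont g x -> ccont h x -> ccont (fun x => g x * h x) x.
Proof.
move=> [g1 g2] [h1 h2]; split.
  by rewrite cReM; under eq_fun do rewrite cReM; apply: cvgB; apply: cvgM.
by rewrite cImM; under eq_fun do rewrite cImM; apply: cvgD; apply: cvgM.
Qed.

Lemma ccontX g n x : ccont g x -> ccont (fun x => g x ^+ n) x.
Proof.
move=> cg; elim: n => [|n IH]; first by under eq_fun do rewrite expr0; exact: ccont_cst.
by under eq_fun do rewrite exprS; exact: ccontM.
Qed.

Lemma ccontV g x : ccont g x -> g x != 0 -> ccont (fun x => (g x)^-1) x.
Proof.
move=> [g1 g2] gx; have n0 : nsq (g x) != 0 by apply: contra gx => /eqP/nsq_eq0 ->.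
have cn : (nsq (g y))^-1 @[y --> x] --> (nsq (g x))^-1.
  by apply: cvgV => //; apply: cvgD; apply: cvgM.
have E y : (g y)^-1 = (g y)^* * ((nsq (g y))^-1)%:C.
  by apply: C_eq; case: (g y) => u v /=; rewrite /nsq /= ?mulr0 ?subr0 ?add0r ?mulNr.
have ER y : Re (g y)^-1 = Re (g y) * (nsq (g y))^-1 by rewrite E cReM cReJ /= mulr0 subr0.
have EI y : Im (g y)^-1 = - Im (g y) * (nsq (g y))^-1 by rewrite E cImM cImJ /= mulr0 add0r.
split.
  by rewrite ER; under eq_fun do rewrite ER; exact: cvgM.
by rewrite EI; under eq_fun do rewrite EI; apply: cvgM => //; exact: cvgN.
Qed.

Lemma ccont_cis x : ccont (fun t => cis t) x.
Proof. by split; [exact: continuous_cos|exact: continuous_sin]. Qed.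

Lemma ccont_real (g : R -> R) x : {for x, continuous g} -> ccont (fun x => (g x)%:C) x.
Proof. by move=> cg; split => //; exact: cvg_cst. Qed.

Lemma ccont_holo (f : C -> C^o) g x : holomorphic_on_disc f -> nsq (g x) < 1 ->
  ccont g x -> ccont (fun x => f (g x)) x.
Proof.
move=> hf gx [g1 g2].
have [l hl] := holo_approx hf gx.
have key e : 0 < e -> \forall y \near x, normc (f (g y) - f (g x)) <= e.
  move=> e0; have [d d0 hd] := hl 1 ltr01.
  pose K := normc l + 1.
  have K0 : 0 < K by rewrite ltr_wpDl ?normc_ge0.
  pose m := Num.min d (e / K) / 2.
  have m0 : 0 < m by rewrite divr_gt0 // lt_min d0 divr_gt0.
  have mm : m + m = Num.min d (e / K) by rewrite /m -splitr.
  near=> y.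
  have n1 : `|Re (g x) - Re (g y)| < m by near: y; exact: ((cvgrPdist_lt _ _).1 g1 _ m0).
  have n2 : `|Im (g x) - Im (g y)| < m by near: y; exact: ((cvgrPdist_lt _ _).1 g2 _ m0).
  have n3 : normc (g y - g x) < Num.min d (e / K).
    apply: (le_lt_trans (normc_le _)); rewrite cReB cImB -mm distrC [X in _ + X]distrC.
    exact: ltrD.
  move: n3; rewrite lt_min => /andP[n3 n4].
  have := hd _ n3; rewrite mul1r => n5.
  rewrite -(subrK (l * (g y - g x)) (f (g y) - f (g x))).
  apply: (le_trans (le_normcD _ _)); rewrite normcM.
  move: n4; rewrite ltr_pdivlMr // /K => n4.
  by move: n4 n5; move: (normc (_ - _)) (normc l) (normc _) => *; nra.
split; apply/cvgrPdist_le => /= e e0; have := key e e0; apply: filterS => y hy.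
  by rewrite distrC -cReB; apply: le_trans (Re_le_normc _) hy.
by rewrite distrC -cImB; apply: le_trans (Im_le_normc _) hy.
Unshelve. all: by end_near. Qed.

Lemma cis_lip (s t : R) : normc (cis s - cis t) <= 2 * `|s - t|.
Proof.
have L (F G : R -> R) : (forall x : R, is_derive x (1 : R) F (G x)) -> (forall x, `|G x| <= 1) ->
    `|F s - F t| <= `|s - t|.
  move=> dF hG; wlog st : s t / t <= s => [hw|].
    by case: (leP t s) => [|/ltW] st; [exact: hw|rewrite distrC (distrC s); exact: hw].
  move: st; rewrite le_eqVlt => /predU1P[->|ts]; first by rewrite !subrr !normr0.
  have cF : {within `[t, s], continuous F}.
    by apply: derivable_within_continuous => x _; apply: ex_derive.
  have [x _ ->] := MVT ts (fun x _ => dF x) cF.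
  by rewrite normrM ler_piMl.
apply: (le_trans (normc_le _)); rewrite cReB cImB /= mulr_natl mulr2n; apply: lerD.
  apply: (L _ (fun x => - sin x)) => x; rewrite normrN.
  by rewrite ler_norml sin_geN1 sin_le1.
apply: (L _ cos) => x.
by rewrite ler_norml cos_geN1 cos_le1.
Qed.

End Holomorphic.

(** * The Cauchy formula on a circle, by contraction to an interior point *)

Section Goursat.
Context {R : realType}.
Notation C := (R[i]).
Notation Re := (@complex.Re R).
Notation Im := (@complex.Im R).
Variables (f : C -> C^o) (z : C) (r : R).
Hypotheses (hf : holomorphic_on_disc f) (zr : normc z < r) (r1 : r < 1).

Let r0 : 0 < r. Proof. exact: le_lt_trans (normc_ge0 z) zr. Qed.
Let zeta : C := z / r%:C.
Let u (s : R) : C := r%:C * cis s - z.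
Let kap (s : R) : C := (1 - zeta * cis (- s))^-1.
Let w (t s : R) : C := z + t%:C * u s.
(** With w = z + t u(s) and [kap] = r e^(i s) / u(s), the form X dt + Y ds is the imaginary part of
    f(w) dw / (w - z). *)
Let X (t s : R) : R := Im (f (w t s)) / t.
Let Y (t s : R) : R := Re (f (w t s) * kap s).

Lemma normc_cis (s : R) : normc (cis s) = 1.
Proof. by rewrite normc_sqrt nsq_cis sqrtr1. Qed.

Lemma normc_realC (x : R) : normc (x%:C) = `|x|.
Proof. by rewrite /normc /= expr0n /= addr0 sqrtr_sqr. Qed.

Let q := normc zeta.

Lemma q_lt1 : 0 <= q < 1.
Proof.
rewrite /q normc_ge0 /zeta normcM normcV normc_realC gtr0_norm //.
by rewrite ltr_pdivrMr // mul1r.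
Qed.

Lemma kden_ge (s : R) : 1 - q <= normc (1 - zeta * cis (- s)).
Proof.
have := le_normcD (1 - zeta * cis (- s)) (zeta * cis (- s)).
rewrite subrK normc1 normcM normc_cis mulr1 /q; lra.
Qed.

Lemma kden_neq0 (s : R) : 1 - zeta * cis (- s) != 0.
Proof.
apply/eqP => h; have := kden_ge s; rewrite h normc0.
by have /andP[_] := q_lt1; lra.
Qed.

Let K := (1 - q)^-1.
Lemma K_gt0 : 0 < K.
Proof. by rewrite invr_gt0 subr_gt0; case/andP: q_lt1. Qed.

Lemma kap_le s : normc (kap s) <= K.
Proof.
have h : 0 < 1 - q by rewrite subr_gt0; case/andP: q_lt1.
rewrite /kap normcV lef_pV2 ?posrE //; first exact: kden_ge.
exact: lt_le_trans h (kden_ge s).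
Qed.

Lemma u_kap s : u s * kap s = r%:C * cis s.
Proof.
have E : u s = r%:C * cis s * (1 - zeta * cis (- s)).
  rewrite mulrBr mulr1 /u; congr (_ - _).
  transitivity (r%:C * zeta * (cis s * cis (- s))); last by ring.
  rewrite -cisD subrr cis0 mulr1 /zeta mulrC divfK //.
  by apply/eqP => -[/eqP]; rewrite gt_eqF.
by rewrite E /kap mulfK // kden_neq0.
Qed.

Lemma normc_w t s : 0 <= t <= 1 -> nsq (w t s) < 1.
Proof.
move=> /andP[t0 t1]; rewrite -normc_lt1; apply: le_lt_trans r1.
have -> : w t s = (1 - t)%:C * z + t%:C * (r%:C * cis s).
  by rewrite /w /u rmorphB /=; ring.
apply: (le_trans (le_normcD _ _)).
rewrite !normcM !normc_realC normc_cis mulr1 (gtr0_norm r0) !ger0_norm ?subr_ge0 //.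
by have := ltW zr; nra.
Qed.

Lemma u_le s : normc (u s) <= 2.
Proof.
apply: (le_trans (le_normcD _ _)).
rewrite normcN normcM normc_realC normc_cis mulr1 (gtr0_norm r0).
by have := zr; have := r1; lra.
Qed.

Lemma w_dist t s t0 s0 : 0 <= t0 <= 1 ->
  normc (w t s - w t0 s0) <= 2 * (`|t - t0| + `|s - s0|).
Proof.
move=> /andP[h0 h1].
have -> : w t s - w t0 s0 = (t - t0)%:C * u s + t0%:C * (r%:C * (cis s - cis s0)).
  by rewrite /w /u rmorphB /=; ring.
apply: (le_trans (le_normcD _ _)); rewrite !normcM !normc_realC mulrDr.
apply: lerD; first by rewrite mulrC ler_wpM2r // u_le.
have h := cis_lip s s0.
apply: le_trans h; rewrite mulrA ler_piMl ?normc_ge0 //.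
by rewrite (gtr0_norm r0) ger0_norm // mulr_ile1 // ltW.
Qed.

Lemma ccont_kap s : ccont kap s.
Proof.
apply: ccontV; last exact: kden_neq0.
apply: ccontD; first exact: ccont_cst.
apply: ccontN; apply: ccontM; first exact: ccont_cst.
split.
  apply: (@cvg_comp _ _ _ (fun y : R => - y) (@cos R)); last exact: continuous_cos.
  by apply: cvgN; exact: cvg_id.
apply: (@cvg_comp _ _ _ (fun y : R => - y) (@sin R)); last exact: continuous_sin.
by apply: cvgN; exact: cvg_id.
Qed.

Lemma ccont_u s : ccont u s.
Proof.
apply: ccontD; last exact: ccont_cst.
by apply: ccontM; [exact: ccont_cst|exact: ccont_cis].
Qed.

Lemma contY t a b : 0 <= t <= 1 -> con (Y t) a b.
Proof.
move=> t1 s _; suff [] : ccont (fun s => f (w t s) * kap s) s by [].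
apply: ccontM; last exact: ccont_kap.
apply: ccont_holo => //; first exact: normc_w.
by apply: ccontD; [exact: ccont_cst|apply: ccontM; [exact: ccont_cst|exact: ccont_u]].
Qed.

Lemma contX s a b : 0 < a -> b <= 1 -> con (X ^~ s) a b.
Proof.
move=> a0 b1 t /andP[h1 h2]; have t0 := lt_le_trans a0 h1.
have [_ h] : ccont (fun t => f (w t s)) t.
  apply: ccont_holo => //; first by apply: normc_w; rewrite ltW //= (le_trans h2).
  apply: ccontD; first exact: ccont_cst.
  apply: ccontM; last exact: ccont_cst.
  by apply: ccont_real; exact: cvg_id.
by apply: cvgM => //; apply: cvgV; rewrite ?gt_eqF //; exact: cvg_id.
Qed.

(** The integral of X dt + Y ds along the boundary of a rectangle. *)
Let B t1 t2 s1 s2 :=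
  RI (fun s => Y t2 s - Y t1 s) s1 s2 - RI (fun t => X t s2 - X t s1) t1 t2.

Section Rect.
Variable a : R.
Hypotheses (a0 : 0 < a) (a1 : a <= 1).

Let in01 t : a <= t -> t <= 1 -> 0 <= t <= 1.
Proof. by move=> h ->; rewrite andbT (le_trans _ h) // ltW. Qed.

Lemma con_subY t1 t2 s1 s2 : 0 <= t1 <= 1 -> 0 <= t2 <= 1 ->
  con (fun s => Y t2 s - Y t1 s) s1 s2.
Proof. by move=> h1 h2 s hs; apply: cvgB; [apply: contY h2 s hs|apply: contY h1 s hs]. Qed.

Lemma con_subX t1 t2 s1 s2 : a <= t1 -> t2 <= 1 -> con (fun t => X t s2 - X t s1) t1 t2.
Proof.
move=> h1 h2 t ht; have t10 := lt_le_trans a0 h1.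
by apply: cvgB; [exact: (@contX s2 t1 t2 t10 h2 t ht)|exact: (@contX s1 t1 t2 t10 h2 t ht)].
Qed.

Lemma B_split_t t1 m t2 s1 s2 : a <= t1 -> t1 <= m -> m <= t2 -> t2 <= 1 ->
  B t1 t2 s1 s2 = B t1 m s1 s2 + B m t2 s1 s2.
Proof.
move=> h1 h2 h3 h4.
have i1 : 0 <= t1 <= 1 by apply: in01; rewrite // (le_trans h2) // (le_trans h3).
have i2 : 0 <= m <= 1 by apply: in01; [rewrite (le_trans h1)|rewrite (le_trans h3)].
have i3 : 0 <= t2 <= 1 by apply: in01; rewrite // (le_trans h1) // (le_trans h2).
rewrite /B (@RI_split _ (fun t => X t s2 - X t s1) t1 m t2) ?h2 //; last exact: con_subX.
have -> : RI (fun s => Y t2 s - Y t1 s) s1 s2 =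
    RI (fun s => (Y m s - Y t1 s) + (Y t2 s - Y m s)) s1 s2.
  by apply: eq_RI => s _; ring.
by rewrite RI_D; [ring|exact: con_subY..].
Qed.

Lemma B_split_s t1 t2 s1 m s2 : a <= t1 -> t1 <= t2 -> t2 <= 1 -> s1 <= m -> m <= s2 ->
  B t1 t2 s1 s2 = B t1 t2 s1 m + B t1 t2 m s2.
Proof.
move=> h1 h2 h3 h4 h5.
have i1 : 0 <= t1 <= 1 by apply: in01; rewrite // (le_trans h2).
have i3 : 0 <= t2 <= 1 by apply: in01; rewrite // (le_trans h1).
rewrite /B (@RI_split _ _ s1 m s2) ?h4 //; last exact: con_subY.
have -> : RI (fun t => X t s2 - X t s1) t1 t2 =
    RI (fun t => (X t m - X t s1) + (X t s2 - X t m)) t1 t2.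
  by apply: eq_RI => s _; ring.
rewrite (@RI_D _ (fun t => X t m - X t s1) (fun t => X t s2 - X t m)); [|exact: con_subX..].
by ring.
Qed.

Lemma is_derive_Imcis (l : C) (x : R) :
  is_derive x (1 : R) (fun s => Im (l * cis s)) (Re (l * cis x)).
Proof.
have -> : (fun s => Im (l * cis s)) = (fun s => Re l * sin s + Im l * cos s).
  by apply/funext => s; rewrite cImM.
have h1 := is_deriveZ (Re l) (is_derive_sin x); have h2 := is_deriveZ (Im l) (is_derive_cos x).
have := is_deriveD h1 h2; move/is_derive_eq; apply.
by rewrite cReM /= /GRing.scale /=; ring.
Qed.

Lemma con_cis (l : C) b c : con (fun s => Re (l * cis s)) b c.
Proof.
move=> x _; suff [] : ccont (fun s => l * cis s) x by [].
by apply: ccontM; [exact: ccont_cst|exact: ccont_cis].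
Qed.

(** Replace f by its affine approximation at w t0 s0. The constant part cancels between opposite
    sides; the linear part contributes (t2 - t1) (F s2 - F s1) to both integrals in [B] and cancels
    as well. Only the remainder E is left. *)
Lemma B_local t0 s0 : a <= t0 <= 1 -> forall e, 0 < e ->
  exists2 d : R, 0 < d & forall t1 t2 s1 s2, a <= t1 -> t1 <= t0 -> t0 <= t2 -> t2 <= 1 ->
    s1 <= s0 -> s0 <= s2 -> t2 - t1 < d -> s2 - s1 < d ->
    `|B t1 t2 s1 s2| <= e * (t2 - t1 + (s2 - s1)) ^+ 2.
Proof.
move=> /andP[at0 t01] e e0.
have i0 : 0 <= t0 <= 1 by exact: in01.
have [l hl] := holo_approx hf (normc_w s0 i0).
(* The two error terms carry the constants 4 K, from the bound on [kap], and 4 / a, from the factor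
   1 / t in X. *)
pose L := 4 * (K + a^-1).
have ai : 0 < a^-1 by rewrite invr_gt0.
have K0 := K_gt0.
have L0 : 0 < L by rewrite /L; lra.
have e1 : 0 < e / L by rewrite divr_gt0.
have [d d0 hd] := hl _ e1.
exists (d / 4); first by lra.
move=> t1 t2 s1 s2 h1 h2 h3 h4 h5 h6 h7 h8.
pose D := t2 - t1 + (s2 - s1).
have D0 : 0 <= D by rewrite /D; lra.
have i1 : 0 <= t1 <= 1 by apply: in01; rewrite // (le_trans h2).
have i2 : 0 <= t2 <= 1 by apply: in01; rewrite // (le_trans at0).
pose E t s : C := f (w t s) - f (w t0 s0) - l * (w t s - w t0 s0).
have hE t s : t1 <= t <= t2 -> s1 <= s <= s2 -> normc (E t s) <= e / L * (2 * D).
  move=> /andP[k1 k2] /andP[k3 k4].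
  have n1 : normc (w t s - w t0 s0) <= 2 * D.
    apply: (le_trans (w_dist t s s0 i0)); rewrite ler_pM2l // /D.
    by apply: lerD; rewrite ler_norml; apply/andP; split; lra.
  apply: le_trans (hd _ _) _; last by rewrite ler_wpM2l // ltW.
  by apply: (le_lt_trans n1); rewrite /D; lra.
pose c0 := f (w t0 s0) + l * (z - w t0 s0) : C.
have fE t s : f (w t s) = c0 + l * (t%:C * u s) + E t s :> C.
  by rewrite /E /c0 /w; ring.
pose F (s : R) := Im (l * r%:C * cis s).
have dF s : is_derive s (1 : R) F (Re (l * r%:C * cis s)) by exact: is_derive_Imcis.
have s12 : s1 <= s2 by exact: le_trans h5 h6.
have t12 : t1 <= t2 by exact: le_trans h2 h3.
have IY : `|RI (fun s => Y t2 s - Y t1 s) s1 s2 - (t2 - t1) * (F s2 - F s1)|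
    <= 2 * K * (e / L * (2 * D)) * (s2 - s1).
  rewrite -(RI_FTC s12 (fun s _ => dF s) (@con_cis _ _ _)) -RI_Z; last exact: con_cis.
  have cZ : con (fun s => (t2 - t1) * Re (l * r%:C * cis s)) s1 s2.
    by move=> s hs; apply: cvgM; [exact: cvg_cst|exact: (con_cis (l := l * r%:C) hs)].
  rewrite -RI_B //; last exact: con_subY.
  apply: RI_bound => //.
    by move=> s hs; apply: cvgB; [exact: (con_subY i1 i2 hs)|exact: cZ].
  move=> s hs.
  have -> : Y t2 s - Y t1 s - (t2 - t1) * Re (l * r%:C * cis s) =
      Re ((E t2 s - E t1 s) * kap s).
    have YE t : Y t s = Re (c0 * kap s) + t * Re (l * r%:C * cis s) + Re (E t s * kap s).
      rewrite /Y fE !mulrDl !cReD; congr (_ + _ + _).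
      rewrite (_ : l * (t%:C * u s) * kap s = t%:C * (l * (u s * kap s))); last by ring.
      by rewrite u_kap cReM /= mul0r subr0 mulrA.
    by rewrite (mulrBl (kap s)) cReB !YE; ring.
  apply: (le_trans (Re_le_normc _)); rewrite normcM mulrC -mulrA [leRHS]mulrCA.
  apply: ler_pM; rewrite ?normc_ge0 ?kap_le //.
  apply: (le_trans (le_normcD _ _)); rewrite normcN (_ : 2 * (e / L * (2 * D)) = e / L * (2 * D) + e / L * (2 * D)); last by ring.
  by apply: lerD; apply: hE => //; rewrite ?lexx ?t12.
have IX : `|RI (fun t => X t s2 - X t s1) t1 t2 - (t2 - t1) * (F s2 - F s1)|
    <= 2 * a^-1 * (e / L * (2 * D)) * (t2 - t1).
  rewrite [(t2 - t1) * _]mulrC -RI_cst //.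
  rewrite -RI_B //; [|exact: con_subX|by move=> t _; exact: cvg_cst].
  apply: RI_bound => //.
    by move=> t ht; apply: cvgB; [exact: (con_subX h1 h4 ht)|exact: cvg_cst].
  move=> t ht; have tpos : 0 < t by case/andP: ht => k1 _; rewrite (lt_le_trans a0) // (le_trans h1).
  have -> : X t s2 - X t s1 - (F s2 - F s1) = Im (E t s2 - E t s1) / t.
    have XE s : X t s = (Im c0 - t * Im (l * z) + t * F s + Im (E t s)) / t.
      rewrite /X fE cImD (cImD c0); congr ((_ + _) / t); rewrite -addrA; congr (_ + _).
      rewrite (_ : l * (t%:C * u s) = t%:C * (l * r%:C * cis s - l * z)); last by rewrite /u; ring.
      by rewrite cImM /= cImB mul0r addr0 /F; ring.
    by rewrite !XE cImB; field; rewrite gt_eqF.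
  rewrite normrM normfV (gtr0_norm tpos) mulrC -mulrA [leRHS]mulrCA.
  apply: ler_pM; rewrite ?invr_ge0 ?(ltW tpos) //.
    by rewrite lef_pV2 ?posrE //; case/andP: ht => k1 _; rewrite (le_trans h1).
  apply: (le_trans (Im_le_normc _)).
  apply: (le_trans (le_normcD _ _)); rewrite normcN (_ : 2 * (e / L * (2 * D)) = e / L * (2 * D) + e / L * (2 * D)); last by ring.
  by apply: lerD; apply: hE => //; rewrite ?lexx ?s12.
rewrite /B; set A1 := RI _ _ _ in IY *; set A2 := RI _ _ _ in IX *.
have -> : A1 - A2 = (A1 - (t2 - t1) * (F s2 - F s1)) - (A2 - (t2 - t1) * (F s2 - F s1)) by ring.
apply: (le_trans (ler_normB _ _)); apply: (le_trans (lerD IY IX)).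
have -> : e * D ^+ 2 = 4 * K * (e / L) * D * D + 4 * a^-1 * (e / L) * D * D.
  have LE : L * (e / L) = e by rewrite mulrC divfK // gt_eqF.
  by rewrite -{1}LE; move: (e / L) => y; rewrite /L; ring.
have eD : 0 <= e / L * D by rewrite mulr_ge0 // ltW.
have st : s2 - s1 <= D by rewrite /D; lra.
have tt : t2 - t1 <= D by rewrite /D; lra.
apply: lerD.
  rewrite (_ : 2 * K * _ * _ = (4 * K) * (e / L * D) * (s2 - s1)); last by ring.
  rewrite (_ : 4 * K * _ * _ * _ = (4 * K) * (e / L * D) * D); last by ring.
  by rewrite ler_wpM2l // mulr_ge0 //; lra.
rewrite (_ : 2 * a^-1 * _ * _ = (4 * a^-1) * (e / L * D) * (t2 - t1)); last by ring.
rewrite (_ : 4 * a^-1 * _ * _ * _ = (4 * a^-1) * (e / L * D) * D); last by ring.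
by rewrite ler_wpM2l // mulr_ge0 //; lra.
Qed.

(** The sides s = 0 and s = 2 pi cancel by periodicity, so the two remaining sides agree. *)
Lemma J_eq : RI (Y 1) 0 (2 * pi) = RI (Y a) 0 (2 * pi).
Proof.
have p0 := pi_gt0 R.
have cd : 0 <= 2 * pi :> R by lra.
have B0 : B a 1 0 (2 * pi) = 0.
  apply: (@bisect_eq0 _ B a 1 0 (2 * pi) a1 cd).
  - by move=> *; exact: B_split_t.
  - by move=> *; exact: B_split_s.
  - move=> t0 s0 ht _ e e0; have [d d0 hd] := B_local s0 ht e0.
    by exists d => // t1 t2 s1 s2 *; exact: hd.
move: B0; rewrite /B.
have -> : RI (fun t => X t (2 * pi) - X t 0) a 1 = 0.
  rewrite (eq_RI (h := fun=> 0)); first by rewrite RI_cst // mul0r.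
  move=> t _; rewrite /X /w /u.
  have -> : cis (2 * pi) = cis 0 :> C by rewrite mulr_natl /cis cos2pi sin2pi cos0 sin0.
  by rewrite subrr.
have i1 : 0 <= (1 : R) <= 1 by rewrite ler01 lexx.
have ia : 0 <= a <= 1 by rewrite a1 ltW.
rewrite subr0 RI_B; [|exact: contY i1|exact: contY ia].
by move/eqP; rewrite subr_eq0 => /eqP.
Qed.

End Rect.

(** As a tends to 0, the curve w a s shrinks to z and Y a tends to Re (f z * kap s) uniformly in
    s. *)
Lemma cauchy_formula :
  RI (fun s => Re (f (r%:C * cis s) * kap s)) 0 (2 * pi) = RI (fun s => Re (f z * kap s)) 0 (2 * pi).
Proof.
have p0 := pi_gt0 R.
have cd : 0 <= 2 * pi :> R by lra.
have -> : RI (fun s => Re (f (r%:C * cis s) * kap s)) 0 (2 * pi) = RI (Y 1) 0 (2 * pi).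
  by apply: eq_RI => s _; rewrite /Y /w mul1r /u addrC subrK.
have z1 : nsq z < 1 by rewrite -normc_lt1 (lt_trans zr).
have [l hl] := holo_approx hf z1.
have [d d0 hd] := hl 1 ltr01.
have K0 := K_gt0.
pose M := normc l + 1.
have M0 : 0 < M by rewrite ltr_wpDl ?normc_ge0.
have cz : con (fun s => Re (f z * kap s)) 0 (2 * pi).
  move=> x _; suff [] : ccont (fun s => f z * kap s) x by [].
  by apply: ccontM; [exact: ccont_cst|exact: ccont_kap].
apply/eqP; rewrite -subr_eq0 -normr_le0; apply/ler_addgt0Pr => e e0; rewrite add0r.
pose N := M * 2 * K * (2 * pi).
have N0 : 0 < N by rewrite !mulr_gt0.
pose a := Num.min (Num.min 1 (d / 4)) (e / N).
have a0 : 0 < a by rewrite !lt_min ltr01 !divr_gt0.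
have a1 : a <= 1 by rewrite !ge_min lexx.
have ad : a <= d / 4 by rewrite !ge_min lexx orbT.
have ae : a <= e / N by rewrite ge_min lexx orbT.
have i1 : 0 <= a <= 1 by rewrite a1 ltW.
rewrite (J_eq a0 a1) -RI_B //; last exact: contY.
apply: (@le_trans _ _ (M * (2 * a) * K * (2 * pi - 0))); last first.
  have -> : M * (2 * a) * K * (2 * pi - 0) = a * N by rewrite subr0 /N; ring.
  by rewrite -ler_pdivlMr.
apply: RI_bound => //; first by move=> s hs; apply: cvgB; [exact: (contY i1 hs)|exact: cz].
move=> s _; rewrite /Y -cReB -mulrBl; apply: (le_trans (Re_le_normc _)).
rewrite normcM ler_pM ?normc_ge0 ?kap_le //.
have wz : normc (w a s - z) <= 2 * a.
  rewrite /w addrC addKr normcM normc_realC (gtr0_norm a0) mulrC ler_wpM2r ?u_le //.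
  exact: ltW.
have := hd (w a s); rewrite mul1r => h.
have {}h := h (le_lt_trans wz _).
have n1 : normc (f (w a s) - f z - l * (w a s - z)) <= normc (w a s - z) by apply: h; lra.
rewrite -(subrK (l * (w a s - z)) (f (w a s) - f z)).
apply: (le_trans (le_normcD _ _)); rewrite normcM.
apply: (@le_trans _ _ (M * normc (w a s - z))); last by rewrite ler_pM2l.
by rewrite /M mulrDl mul1r addrC lerD2l.
Qed.

End Goursat.

(** * Taylor expansion *)

Section Taylor.
Context {R : realType}.
Notation C := (R[i]).
Notation Re := (@complex.Re R).
Notation Im := (@complex.Im R).

Lemma ccont_cisN n (s : R) : ccont (fun s => cis (- s) ^+ n) s.
Proof.
apply: ccontX; split.
  apply: (@cvg_comp _ _ _ (fun y : R => - y) (@cos R)); last exact: continuous_cos.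
  by apply: cvgN; exact: cvg_id.
apply: (@cvg_comp _ _ _ (fun y : R => - y) (@sin R)); last exact: continuous_sin.
by apply: cvgN; exact: cvg_id.
Qed.

Lemma con_Re (g : R -> C) a b : (forall s, ccont g s) -> con (fun s => Re (g s)) a b.
Proof. by move=> hg s _; have [] := hg s. Qed.

Lemma con_Im (g : R -> C) a b : (forall s, ccont g s) -> con (fun s => Im (g s)) a b.
Proof. by move=> hg s _; have [] := hg s. Qed.

Definition CI (g : R -> C) : C :=
  RI (fun s => Re (g s)) 0 (2 * pi) +i* RI (fun s => Im (g s)) 0 (2 * pi).

Lemma twopi_ge0 : 0 <= 2 * pi :> R.
Proof. by have := pi_gt0 R; lra. Qed.

Lemma CI_Z (a : C) g : (forall s, ccont g s) -> CI (fun s => a * g s) = a * CI g.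
Proof.
move=> hg; have h1 := @con_Re g 0 (2 * pi) hg; have h2 := @con_Im g 0 (2 * pi) hg.
have cZ k h : con h 0 (2 * pi) -> con (fun s => k * h s) 0 (2 * pi).
  by move=> ch s hs; apply: cvgM; [exact: cvg_cst|exact: ch].
apply: C_eq; rewrite ?cReM ?cImM /= -!RI_Z //.
  by rewrite -RI_B; [apply: eq_RI => s _; rewrite cReM|exact: cZ..].
by rewrite -RI_D; [apply: eq_RI => s _; rewrite cImM|exact: cZ..].
Qed.

Lemma CI_D g h : (forall s, ccont g s) -> (forall s, ccont h s) ->
  CI (fun s => g s + h s) = CI g + CI h.
Proof.
move=> hg hh; apply: C_eq; rewrite ?cReD ?cImD /=.
  by rewrite -RI_D; [apply: eq_RI => s _; rewrite cReD|exact: con_Re..].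
by rewrite -RI_D; [apply: eq_RI => s _; rewrite cImD|exact: con_Im..].
Qed.

Lemma CI_sum N (g : nat -> R -> C) : (forall n s, ccont (g n) s) ->
  CI (fun s => \sum_(n < N) g n s) = \sum_(n < N) CI (g n).
Proof.
move=> hg; elim: N => [|N IH].
  rewrite big_ord0; under [fun s => _]funext do rewrite big_ord0.
  by apply: C_eq; rewrite /= RI_cst ?mul0r // twopi_ge0.
rewrite big_ord_recr /= -IH -CI_D //.
  by congr CI; apply/funext => s; rewrite big_ord_recr.
move=> s; elim: N {IH} => [|N IH]; first by under [fun s => _]funext do rewrite big_ord0; exact: ccont_cst.
by under [fun s => _]funext do rewrite big_ord_recr; exact: ccontD.
Qed.

Lemma CI_bound g M : (forall s, ccont g s) -> (forall s, normc (g s) <= M) ->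
  normc (CI g) <= 2 * (M * (2 * pi)).
Proof.
move=> hg gM; have tp := twopi_ge0; apply: (le_trans (normc_le _)).
rewrite mulr_natl mulr2n -[2 * pi]subr0 /=; apply: lerD.
  apply: RI_bound => // [|s _]; first exact: con_Re.
  exact: le_trans (Re_le_normc _) (gM s).
apply: RI_bound => // [|s _]; first exact: con_Im.
exact: le_trans (Im_le_normc _) (gM s).
Qed.

Lemma RI_cis0 (c : C) k : RI (fun s => Re (c * cis (- s) ^+ k.+1)) 0 (2 * pi) = 0.
Proof.
pose n : R := - k.+1%:R.
pose F (s : R) := n^-1 * Im (c * cis (n * s)).
have n0 : n != 0 by rewrite oppr_eq0 pnatr_eq0.
have dF (s : R) : is_derive s (1 : R) F (Re (c * cis (- s) ^+ k.+1)).
  have h1 := is_derive_Imcis c (n * s).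
  have h2 : is_derive s (1 : R) (fun s => n * s) n.
    have := is_deriveZ n (is_derive_id s (1 : R)).
    by move/is_derive_eq; apply; rewrite /GRing.scale /= mulr1.
  have h3 := @is_derive1_comp R (fun s => Im (c * cis s)) (fun s => n * s) s _ _ h1 h2.
  have := is_deriveZ n^-1 h3.
  move/is_derive_eq; apply; rewrite cisX (_ : - s *+ k.+1 = n * s); last by rewrite /n -(mulr_natr (- s)) !mulNr mulrC.
  rewrite /GRing.scale /=.
  by rewrite mulrCA mulVf // mulr1.
rewrite (RI_FTC twopi_ge0 (fun s _ => dF s)); last first.
  by apply: con_Re => s; apply: ccontM; [exact: ccont_cst|exact: ccont_cisN].
have E : cis (n * (2 * pi)) = cis (n * 0) :> C.
  have nE : n * (2 * pi) = - (2 * pi) *+ k.+1.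
    by rewrite /n -(mulr_natr (- (2 * pi))) !mulNr mulrC.
  rewrite mulr0 cis0 nE -cisX.
  have -> : cis (- (2 * pi)) = 1 :> C; last by rewrite expr1n.
  by apply: C_eq; rewrite /= ?cosN ?sinN mulr_natl ?cos2pi ?sin2pi ?oppr0.
by rewrite /F E subrr.
Qed.

Lemma CI_cis0 (c : C) k : CI (fun s => c * cis (- s) ^+ k.+1) = 0.
Proof.
apply: C_eq; rewrite /= ?RI_cis0 //.
apply: etrans (RI_cis0 (- 'i%C * c) k); apply: eq_RI => s _.
by rewrite -mulrA cReM /=; ring.
Qed.

(** 2 pi times the k-th Fourier coefficient. *)
Definition bk (h : R -> C) k : C := CI (fun s => h s * cis (- s) ^+ k).

Lemma ccont_bk (h : R -> C) k (s : R) : (forall s, ccont h s) -> ccont (fun s => h s * cis (- s) ^+ k) s.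
Proof. by move=> hh; apply: ccontM => //; exact: ccont_cisN. Qed.

Lemma bk_bound h M k : (forall s, ccont h s) -> (forall s, normc (h s) <= M) ->
  normc (bk h k) <= 2 * (M * (2 * pi)).
Proof.
move=> hh hM; apply: CI_bound => [s|s]; first exact: ccont_bk.
by rewrite normcM normcX normc_cis expr1n mulr1.
Qed.

Lemma casum_bounded (b : nat -> C) M (z : C) : (forall k, normc (b k) <= M) -> normc z < 1 ->
  casum (fun k => b k * z ^+ k).
Proof.
move=> hb z1; apply: (@casum_le _ _ (fun k => M * normc z ^+ k)).
  by move=> k; rewrite normcM normcX ler_wpM2r ?exprn_ge0 ?normc_ge0.
by apply: asumZ; apply: asum_geo; rewrite ger0_norm ?normc_ge0.
Qed.

(** A finite geometric sum splits off the remainder [E N], whose integral is at most a constant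
    times |z|^N. *)
Lemma kap_series h M (z : C) : (forall s, ccont h s) -> (forall s, normc (h s) <= M) ->
  normc z < 1 ->
  CI (fun s => h s * (1 - z * cis (- s))^-1) = psval (bk h) z.
Proof.
move=> hh hM z1.
have nz s : normc (z * cis (- s)) = normc z by rewrite normcM normc_cis mulr1.
have den s : 1 - normc z <= normc (1 - z * cis (- s)).
  have := le_normcD (1 - z * cis (- s)) (z * cis (- s)).
  by rewrite subrK normc1 nz; lra.
have d0 : 0 < 1 - normc z by rewrite subr_gt0.
have dn s : 1 - z * cis (- s) != 0.
  by apply/eqP => E; have := den s; rewrite E normc0; lra.
have hc := casum_bounded (fun k => bk_bound k hh hM) z1.
have cz s : ccont (fun s => 1 - z * cis (- s)) s.
  apply: ccontD; first exact: ccont_cst.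
  by apply: ccontN; apply: ccontM; [exact: ccont_cst|exact: (ccont_cisN 1)].
pose E N s := (z * cis (- s)) ^+ N * (h s * (1 - z * cis (- s))^-1).
have cE N s : ccont (E N) s.
  apply: ccontM.
    by apply: ccontX; apply: ccontM; [exact: ccont_cst|exact: (ccont_cisN 1)].
  by apply: ccontM => //; apply: ccontV.
have split N : CI (fun s => h s * (1 - z * cis (- s))^-1) = psum (bk h) N z + CI (E N).
  have -> : psum (bk h) N z = CI (fun s => \sum_(n < N) z ^+ n * (h s * cis (- s) ^+ n)).
    rewrite (@CI_sum N (fun n s => z ^+ n * (h s * cis (- s) ^+ n))).
      by apply: eq_bigr => n _; rewrite CI_Z; [rewrite mulrC|move=> s; exact: ccont_bk].
    by move=> n s; apply: ccontM; [exact: ccont_cst|exact: ccont_bk].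
  rewrite -CI_D //; last first.
    move=> s; elim: N => [|N IH]; first by under [fun s => _]funext do rewrite big_ord0; exact: ccont_cst.
    under [fun s => _]funext do rewrite big_ord_recr; apply: ccontD => //.
    by apply: ccontM; [exact: ccont_cst|exact: ccont_bk].
  congr CI; apply/funext => s; rewrite /E.
  have -> : \sum_(n < N) z ^+ n * (h s * cis (- s) ^+ n) = h s * \sum_(n < N) (z * cis (- s)) ^+ n.
    by rewrite mulr_sumr; apply: eq_bigr => n _; rewrite exprMn mulrCA.
  have -> : \sum_(n < N) (z * cis (- s)) ^+ n = (1 - (z * cis (- s)) ^+ N) / (1 - z * cis (- s)).
    apply: (mulIf (dn s)); rewrite divfK // mulrC.
    have := subrXX (1 : C) (z * cis (- s)) N; rewrite expr1n => ->; congr (_ * _).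
    by apply: eq_bigr => n _; rewrite expr1n mul1r.
  by ring.
have M0 : 0 <= M by apply: le_trans (hM 0); exact: normc_ge0.
have Eb N : normc (CI (E N)) <= normc z ^+ N * (2 * (M / (1 - normc z) * (2 * pi))).
  apply: le_trans (_ : 2 * (normc z ^+ N * (M / (1 - normc z)) * (2 * pi)) <= _); last by rewrite -mulrA mulrCA.
  apply: CI_bound => // s; rewrite /E normcM normcX nz ler_wpM2l ?exprn_ge0 ?normc_ge0 //.
  rewrite normcM normcV ler_pM ?normc_ge0 ?invr_ge0 ?normc_ge0 //.
  by rewrite lef_pV2 ?posrE // (lt_le_trans d0).
have E0 : normc z ^+ N * (2 * (M / (1 - normc z) * (2 * pi))) @[N --> \oo] --> 0.
  rewrite -(mul0r (2 * (M / (1 - normc z) * (2 * pi)))).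
  by apply: cvgM; [apply: cvg_expr; rewrite ger0_norm ?normc_ge0|exact: cvg_cst].
(* Here p stands for the real or the imaginary part. *)
have lim (p : C -> R) : (forall x, `|p x| <= normc x) -> (forall x y, p (x + y) = p x + p y) ->
    p (psum (bk h) N z) @[N --> \oo] --> p (psval (bk h) z) ->
    p (CI (fun s => h s * (1 - z * cis (- s))^-1)) = p (psval (bk h) z).
  move=> p1 pD hp.
  suff hq : p (psum (bk h) N z) @[N --> \oo] --> p (CI (fun s => h s * (1 - z * cis (- s))^-1)).
    exact: (cvg_unique _ hq hp).
  apply/cvgrPdist_le => /= e e0.
  move/cvgrPdist_le : (E0) => /(_ e e0) hE.
  near=> N; rewrite (split N) pD addrAC subrr add0r; apply: (le_trans (p1 _)).
  apply: (le_trans (Eb N)); near: N.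
  apply: filterS hE => N.
  by rewrite sub0r normrN; apply: le_trans; exact: ler_norm.
apply: C_eq.
  apply: lim => [x|x y|]; [exact: Re_le_normc|exact: cReD|].
  have := asum_cvg (casum_Re hc); rewrite seriesEord.
  by under eq_fun do rewrite -psum_Re.
apply: lim => [x|x y|]; [exact: Im_le_normc|exact: cImD|].
have := asum_cvg (casum_Im hc); rewrite seriesEord.
by under eq_fun do rewrite -psum_Im.
Unshelve. all: by end_near. Qed.

Lemma kap_const (c z : C) : normc z < 1 ->
  CI (fun s => c * (1 - z * cis (- s))^-1) = (2 * pi)%:C * c.
Proof.
move=> z1; rewrite (kap_series (h := fun=> c) (M := normc c)) //; last by move=> s; exact: ccont_cst.
have hb k : normc (bk (fun=> c) k) <= 2 * (normc c * (2 * pi)).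
  by apply: bk_bound => // s; exact: ccont_cst.
rewrite /psval csum_recl; last exact: casum_bounded hb z1.
rewrite [X in _ + X](_ : _ = 0) ?addr0.
  rewrite expr0 mulr1 /bk; apply: C_eq => /=.
    rewrite (eq_RI (h := fun=> Re c)); last by move=> s _; rewrite expr0 mulr1.
    by rewrite RI_cst ?twopi_ge0 // cReM /= mul0r !subr0 mulrC.
  rewrite (eq_RI (h := fun=> Im c)); last by move=> s _; rewrite expr0 mulr1.
  by rewrite RI_cst ?twopi_ge0 // cImM /= mul0r addr0 subr0 mulrC.
have E k : bk (fun=> c) k.+1 * z ^+ k.+1 = 0 by rewrite /bk CI_cis0 mul0r.
by rewrite /csum; under eq_ssum do rewrite E; under [X in _ +i* X]eq_ssum do rewrite E; rewrite ssum0.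
Qed.

(** What Cauchy's estimate gives at a single radius; absolute convergence follows at every smaller
    radius. *)
Definition ps_bnd (c : nat -> C) (r : R) : Prop := exists M, forall k, normc (c k) * r ^+ k <= M.

Lemma ps_bnd_asum c r t : ps_bnd c r -> 0 <= t < r -> asum (fun k => normc (c k) * t ^+ k).
Proof.
move=> [M hM] /andP[t0 tr]; have r0 := le_lt_trans t0 tr.
apply: (@asum_le _ _ (fun k => M * (t / r) ^+ k)).
  move=> k; rewrite ger0_norm ?mulr_ge0 ?normc_ge0 ?exprn_ge0 //.
  rewrite expr_div_n mulrA ler_pdivlMr ?exprn_gt0 // mulrAC ler_wpM2r ?exprn_ge0 //.
apply: asumZ; apply: asum_geo; rewrite ger0_norm ?divr_ge0 // ?ltW //.
by rewrite ltr_pdivrMr // mul1r.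
Qed.

Lemma ps_bnd_casum c r (z : C) : ps_bnd c r -> normc z < r -> casum (fun k => c k * z ^+ k).
Proof.
move=> hc zr; have h : 0 <= normc z < r by rewrite normc_ge0.
apply: casum_le (ps_bnd_asum hc h) => k; by rewrite normcM normcX.
Qed.

Lemma local_taylor (f : C -> C^o) r : holomorphic_on_disc f -> 0 < r < 1 ->
  exists c, ps_bnd c r /\ forall z, normc z < r -> f z = psval c z.
Proof.
move=> hf /andP[r0 r1].
have in1 s : nsq (r%:C * cis s) < 1.
  by rewrite -normc_lt1 normcM normc_cis normc_realC mulr1 gtr0_norm.
pose h (s : R) : C := f (r%:C * cis s).
have hh s : ccont h s.
  by apply: ccont_holo => //; apply: ccontM; [exact: ccont_cst|exact: ccont_cis].
have [M hM] : exists M, forall s, normc (h s) <= M.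
  have bnd (g : R -> R) : (forall s, {for s, continuous g}) -> exists M, forall s, 0 <= s <= 2 * pi -> `|g s| <= M.
    move=> cg; have cN : {within `[0, 2 * pi], continuous (fun s => `|g s|)}.
      by apply: continuous_subspaceT => s; apply: cvg_norm; exact: cg.
    have [m _ hm] := EVT_max (twopi_ge0) cN.
    by exists `|g m| => s hs; apply: hm; rewrite in_itv.
  have [M1 h1] := bnd (fun s => Re (h s)) (fun s => (hh s).1).
  have [M2 h2] := bnd (fun s => Im (h s)) (fun s => (hh s).2).
  exists (M1 + M2) => s.
  (* Periodicity moves s into [0, 2 pi], where the extreme value theorem bounds both components. *)
  have [t t2 ->] : exists2 t, 0 <= t <= 2 * pi & h s = h t.
    have p2 : 0 < 2 * pi :> R by have := pi_gt0 R; lra.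
    pose n := Num.floor (s / (2 * pi)).
    have := floor_itv (s / (2 * pi)); rewrite -/n => /andP[n1 n2].
    exists (s - n%:~R * (2 * pi)).
      move: n1 n2; rewrite ler_pdivlMr // ltr_pdivrMr // intrD.
      by move: (n%:~R : R) (2 * pi) => m P n1 n2; apply/andP; split; lra.
    rewrite /h; congr (f (_ * _)).
    have P (m : nat) (x : R) : cis (x + m%:R * (2 * pi)) = cis x :> C.
      rewrite cisD (mulr_natl (2 * pi)) -cisX (_ : cis (2 * pi) = 1) ?expr1n ?mulr1 //.
      by rewrite mulr_natl /cis cos2pi sin2pi.
    case: (n) => m; first by rewrite -[in LHS](subrK (m%:R * (2 * pi)) s) P.
    by rewrite NegzE mulrNz mulNr opprK P.
  by apply: (le_trans (normc_le _)); apply: lerD; [exact: h1|exact: h2].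
pose b := bk h; pose c k := (2 * pi)^-1%:C * b k / r%:C ^+ k.
have rC : r%:C != 0 :> C by apply/eqP => -[/eqP]; rewrite gt_eqF.
have p2 : 0 < 2 * pi :> R by have := pi_gt0 R; lra.
have p2C : (2 * pi)%:C != 0 :> C by apply/eqP => -[/eqP]; rewrite gt_eqF.
exists c; split.
  exists ((2 * pi)^-1 * (2 * (M * (2 * pi)))) => k.
  rewrite /c !normcM normcV normcX !normc_realC (gtr0_norm r0) mulfVK ?expf_neq0 ?gt_eqF //.
  by rewrite gtr0_norm ?invr_gt0 // ler_wpM2l ?invr_ge0 ?(ltW p2) //; exact: bk_bound.
move=> z zr; have z1 : normc (z / r%:C) < 1.
  by rewrite normcM normcV normc_realC gtr0_norm // ltr_pdivrMr // mul1r.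
suff E : (2 * pi)%:C * f z = psval b (z / r%:C).
  apply: (mulfI p2C); rewrite E /psval -csumZ.
    congr csum; apply/funext => k; rewrite /c expr_div_n.
    have pC : (2 * pi)%:C * ((2 * pi)^-1)%:C = 1 :> C by rewrite -rmorphM /= mulfV ?gt_eqF.
    by rewrite !mulrA pC mul1r mulrAC.
  have hb := casum_bounded (fun k => bk_bound k hh hM) z1.
  have hb' : casum (fun k => (2 * pi)^-1%:C * (b k * (z / r%:C) ^+ k)).
    apply: (casum_le (v := fun k => (2 * pi)^-1 * normc (b k * (z / r%:C) ^+ k))).
      by move=> k; rewrite normcM normc_realC gtr0_norm ?invr_gt0.
    by apply: asumZ.
  rewrite (_ : (fun k => _) = (fun k => (2 * pi)^-1%:C * (b k * (z / r%:C) ^+ k))) //.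
  by apply/funext => k; rewrite /c expr_div_n; ring.
rewrite -(kap_const (f z) z1) -(kap_series hh hM z1).
have zr' := zr.
apply/esym; apply: C_eq; first by rewrite /=; apply: cauchy_formula.
(* [cauchy_formula] speaks of real parts only; applied to - i f it yields the imaginary part. *)
have hg : holomorphic_on_disc (fun z => - 'i%C * f z : C^o).
  by move=> x xd; apply: derivableZ; exact: hf.
have := cauchy_formula hg zr r1; rewrite /= => e.
apply: etrans (_ : RI (fun s => Re (- 'i%C * f (r%:C * cis s) * (1 - z / r%:C * cis (- s))^-1)) 0 (2 * pi) = _).
  by apply: eq_RI => s _; rewrite -mulrA [in RHS]cReM /=; ring.
have RI' (x : C) : Re (- 'i%C * x) = Im x by rewrite cReM /=; ring.
by rewrite e; apply: eq_RI => s _; apply: etrans (RI' _); congr (complex.Re _); exact: (esym (mulrA _ _ _)).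
Qed.

Lemma psval_recl c r (z : C) : ps_bnd c r -> normc z < r ->
  psval c z = c 0%N + z * psval (fun k => c k.+1) z.
Proof.
move=> hc zr; have h := ps_bnd_casum hc zr.
rewrite /psval csum_recl // expr0 mulr1; congr (_ + _).
have [->|z0] := eqVneq z 0.
  rewrite mul0r; have E k : c k.+1 * 0 ^+ k.+1 = 0 by rewrite expr0n mulr0.
  rewrite /csum; under eq_ssum do rewrite E; under [X in _ +i* X]eq_ssum do rewrite E.
  by rewrite ssum0.
rewrite -csumZ; first by congr csum; apply/funext => k; rewrite exprS mulrCA.
have nz : normc z != 0 by apply/eqP => /eq0_normc /eqP; apply/negP.
apply: (casum_le (v := fun k => (normc z)^-1 * normc (c k.+1 * z ^+ k.+1))).
  by move=> k; rewrite !normcM !normcX exprS [leRHS]mulrCA mulKf.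
by apply: asumZ; exact: casumS h.
Qed.

Lemma ps_bndS c r : 0 < r -> ps_bnd c r -> ps_bnd (fun k => c k.+1) r.
Proof.
move=> r0 [M hM]; exists (M / r) => k; rewrite ler_pdivlMr //.
by rewrite -mulrA -exprSr.
Qed.

(** The point z = 0 is left out of the hypothesis so that the induction on n can divide by z; the
    constant coefficient is recovered as a limit. *)
Lemma psval_eq0 c r : 0 < r -> ps_bnd c r ->
  (forall z : C, z != 0 -> normc z < r -> psval c z = 0) -> forall n, c n = 0.
Proof.
have key c' : ps_bnd c' r -> (forall z : C, z != 0 -> normc z < r -> psval c' z = 0) -> 0 < r ->
    c' 0%N = 0.
  move=> hc h r0; pose t := r / 2.
  have t0 : 0 < t by rewrite divr_gt0.
  have tr : 0 <= t < r by rewrite ltW //= /t; lra.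
  have hS := ps_bnd_asum (ps_bndS r0 hc) tr.
  pose S := ssum (fun k => normc (c' k.+1) * t ^+ k).
  have S0 : 0 <= S by apply: ssum_ge0 => // k; rewrite mulr_ge0 ?normc_ge0 ?exprn_ge0 // ltW.
  apply: eq0_normc; apply/le_anti; rewrite normc_ge0 andbT; apply/ler_addgt0Pr => e e0; rewrite add0r.
  pose d := Num.min t (e / (2 * S + 1)).
  have S1 : 0 < 2 * S + 1 by lra.
  have d0 : 0 < d by rewrite lt_min t0 divr_gt0.
  have dt : d <= t by rewrite ge_min lexx.
  have de : d <= e / (2 * S + 1) by rewrite ge_min lexx orbT.
  have dC : d%:C != 0 :> C by apply/eqP => -[/eqP]; rewrite gt_eqF.
  have nd : normc d%:C = d by rewrite normc_realC gtr0_norm.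
  have dr : normc d%:C < r by rewrite nd; case/andP: tr => _; apply: le_lt_trans.
  have := psval_recl hc dr; rewrite (h _ dC dr) => /esym/eqP; rewrite addr_eq0 => /eqP ->.
  rewrite normcN normcM nd.
  have cs := ps_bnd_casum (ps_bndS r0 hc) dr.
  have n1 : normc (psval (fun k => c' k.+1) d%:C) <= 2 * S.
    apply: (le_trans (normc_csum cs)); rewrite ler_pM2l //; apply: ssum_le => // k.
    by rewrite normcM normcX nd ler_wpM2l ?normc_ge0 // lerXn2r ?nnegrE ?(ltW d0) ?(ltW t0).
  apply: (@le_trans _ _ (e / (2 * S + 1) * (2 * S))).
    by apply: ler_pM; rewrite ?normc_ge0 ?(ltW d0).
  by rewrite -mulrA ler_piMr ?(ltW e0) // mulrC ler_pdivrMr // mul1r; lra.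
move=> r0 hc h n; elim: n c hc h => [|n IH] c hc h; first exact: key.
apply: (IH (fun k => c k.+1)); first exact: ps_bndS.
move=> z z0 zr; have := psval_recl hc zr; rewrite h // (key c) // add0r => /esym/eqP.
by rewrite mulf_eq0 (negbTE z0) => /eqP.
Qed.

Lemma ps_ok_bnd (c : nat -> C) r : ps_ok c -> 0 <= r < 1 -> ps_bnd c r.
Proof.
move=> hc r1; exists (ssum (fun k => normc (c k) * r ^+ k)) => k; have /andP[r0 _] := r1.
apply: (@ssum_term _ (fun k => normc (c k) * r ^+ k)); first exact: hc.
by move=> j; rewrite mulr_ge0 ?normc_ge0 ?exprn_ge0.
Qed.

Lemma psval_inj (c d : nat -> C) r : 0 < r -> ps_bnd c r -> ps_bnd d r ->
  (forall z : C, normc z < r -> psval c z = psval d z) -> c = d.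
Proof.
move=> r0 hc hd h; apply/funext => n; apply/eqP; rewrite -subr_eq0; apply/eqP.
move: n; apply: (@psval_eq0 (fun n => c n - d n) r) => //.
  have [[M hM] [N hN]] := (hc, hd); exists (M + N) => k.
  apply: le_trans (lerD (hM k) (hN k)); rewrite -mulrDl ler_wpM2r ?exprn_ge0 ?(ltW r0) //.
  by apply: (le_trans (le_normcD _ _)); rewrite normcN.
move=> z _ zr; rewrite /psval; under [fun n => _]funext do rewrite mulrBl.
rewrite csumB; [|exact: ps_bnd_casum hc zr|exact: ps_bnd_casum hd zr].
by have := h z zr; rewrite /psval => ->; rewrite subrr.
Qed.

Theorem taylor (f : C -> C^o) : holomorphic_on_disc f ->
  exists2 c, ps_ok c & forall z, nsq z < 1 -> f z = psval c z.
Proof.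
move=> hf; have h2 : 0 < (2^-1 : R) < 1 by apply/andP; split; lra.
have [c [bc hc]] := local_taylor hf h2.
(* By uniqueness the expansion at radius r has the coefficients found at radius 1/2, so one sequence
   serves all radii. *)
have key r : 2^-1 <= r -> r < 1 -> ps_bnd c r /\ forall z, normc z < r -> f z = psval c z.
  move=> r2 r1; have r01 : 0 < r < 1 by rewrite r1 andbT; lra.
  have [d [bd hd]] := local_taylor hf r01.
  suff -> : c = d by [].
  apply: (@psval_inj c d 2^-1) => //.
    have [M hM] := bd; exists M => k; apply: le_trans (hM k).
    by rewrite ler_wpM2l ?normc_ge0 // lerXn2r ?nnegrE //; lra.
  by move=> z zr; rewrite -hc // -hd // (lt_le_trans zr).
exists c.
  move=> r /andP[r0 r1].
  pose s := Num.max 2^-1 ((r + 1) / 2).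
  have s2 : 2^-1 <= s by rewrite le_max lexx.
  have s1 : s < 1 by rewrite gt_max; apply/andP; split; lra.
  have rs : r < s by rewrite lt_max; apply/orP; right; lra.
  have [b _] := key s s2 s1.
  by apply: (ps_bnd_asum b); rewrite r0.
move=> z; rewrite -normc_lt1 => z1.
pose s := Num.max 2^-1 ((normc z + 1) / 2).
have s2 : 2^-1 <= s by rewrite le_max lexx.
have s1 : s < 1 by rewrite gt_max; apply/andP; split; lra.
have rs : normc z < s by rewrite lt_max; apply/orP; right; lra.
have [_ h] := key s s2 s1; exact: h.
Qed.

End Taylor.

(** * The sequence model of the Bergman space *)

Section Holo.
Context {R : realType}.
Notation C := (R[i]).
Notation Re := (@complex.Re R).
Notation Im := (@complex.Im R).

Lemma holo_of_approx (f : C -> C^o) (z l : C) :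
  (forall e : R, 0 < e -> exists2 d : R, 0 < d & forall w : C, normc (w - z) < d ->
    normc (f w - f z - l * (w - z)) <= e * normc (w - z)) ->
  derivable (f : C^o -> C^o) z 1.
Proof.
move=> h; apply/cvg_ex; exists (l : C^o).
apply/cvgrPdist_le => /= e e0.
have eE : e = (Re e)%:C by move: e0; rewrite ltcE /= => /andP[/eqP h1 _]; apply: C_eq.
have e0' : 0 < Re e by rewrite -ltcR -eE.
have [d d0 hd] := h _ e0'.
rewrite /dnbhs near_withinE; apply/nbhs_normP; exists d%:C; first by rewrite /= ltcR.
move=> t /= td t0; move: td; rewrite add0r normrN norm_normc ltcR => td.
have := hd (t + z); rewrite addrK => /(_ td) h1.
rewrite /GRing.scale /= mulr1 norm_normc eE lecR.
have -> : l - t^-1 * (f (t + z) - f z) = - t^-1 * (f (t + z) - f z - l * t).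
  by field.
have nt : 0 < normc t.
  by rewrite lt_neqAle normc_ge0 andbT eq_sym; apply/eqP => /eq0_normc/eqP; apply/negP.
by rewrite normcM normcN normcV mulrC ler_pdivrMr.
Qed.

(** Since [bw 2 n] = 2 / ((n + 1) (n + 2)), [bw_geo] bounds n^2 th^n, and r / th < 1 still lies in
    the range of [ps_ok]. *)
Lemma asum_nsq_geo (c : nat -> C) r : ps_ok c -> 0 < r < 1 ->
  asum (fun n => normc (c n) * (n%:R ^+ 2 * r ^+ n)).
Proof.
move=> hc /andP[r0 r1]; pose th := (r + 1) / 2.
have th1 : 0 < th < 1 by rewrite /th; apply/andP; split; lra.
have [k k0 hk] := bw_geo (ltr0Sn R 1) th1.
have bw2 n : bw 2 n = 2 / ((n%:R + 1) * (n%:R + 2)) :> R.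
  elim: n => [|n IH]; first by rewrite /= !add0r mul1r divff.
  rewrite bwS IH -[n.+1%:R]natr1; have : 0 <= n%:R :> R by [].
  by move: (n%:R : R) => x x0; field; rewrite !gt_eqF //; lra.
have rth : 0 <= r / th < 1.
  case/andP: th1 => t0 t1; rewrite divr_ge0 ?(ltW r0) ?(ltW t0) //=.
  by rewrite ltr_pdivrMr // mul1r /th; lra.
apply: asum_le (@asumZ _ (2 / k) _ (hc _ rth)) => n.
have th0 : 0 < th ^+ n by rewrite exprn_gt0 //; case/andP: th1.
rewrite ger0_norm ?mulr_ge0 ?normc_ge0 ?sqr_ge0 ?exprn_ge0 ?(ltW r0) //.
rewrite [leRHS]mulrCA ler_wpM2l ?normc_ge0 // expr_div_n mulrA.
rewrite ler_pdivlMr // mulrAC ler_wpM2r ?exprn_ge0 ?(ltW r0) //.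
rewrite ler_pdivlMr // mulrC; have := hk n; rewrite bw2.
have n0 : 0 <= n%:R :> R by [].
have p0 : 0 < (n%:R + 1) * (n%:R + 2) :> R by rewrite mulr_gt0 //; lra.
rewrite ler_pdivlMr // => h; apply: le_trans h; rewrite mulrA mulrAC ler_wpM2l ?mulr_ge0 ?(ltW k0) ?(ltW th0) //.
by rewrite expr2; nra.
Qed.

(** The factor r^2 on the left spares the exponent n - 2 on the right, which would be truncated for
    n < 2. *)
Lemma taylor2 (w z : C) r n : 0 < r -> normc w <= r -> normc z <= r ->
  normc (w ^+ n - z ^+ n - n%:R * z ^+ n.-1 * (w - z)) * r ^+ 2 <= n%:R ^+ 2 * r ^+ n * normc (w - z) ^+ 2.
Proof.
move=> r0 wr zr; elim: n => [|n IH].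
  by rewrite !expr0 subrr mul0r mul0r subrr normc0 mul0r expr0n /= !mul0r.
have nn : normc (n%:R : C) = n%:R.
  by rewrite -(rmorph_nat (real_complex R)) normc_realC ger0_norm.
case: n IH nn => [|n] IH nn.
  rewrite !expr1 !expr0 !mul1r subrr normc0 mul0r !mulr_ge0 ?exprn_ge0 ?normc_ge0 //; exact: ltW.
have -> : w ^+ n.+2 - z ^+ n.+2 - n.+2%:R * z ^+ n.+2.-1 * (w - z) =
   w * (w ^+ n.+1 - z ^+ n.+1 - n.+1%:R * z ^+ n.+1.-1 * (w - z)) + n.+1%:R * z ^+ n * (w - z) ^+ 2.
  by rewrite /= !exprS -[n.+2%:R]natr1; ring.
set D := _ - _ - _ in IH *.
apply: (@le_trans _ _ ((normc w * normc D + n.+1%:R * normc z ^+ n * normc (w - z) ^+ 2) * r ^+ 2)).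
  rewrite ler_wpM2r ?sqr_ge0 //; apply: (le_trans (le_normcD _ _)).
  by rewrite !normcM !normcX nn.
set d := normc (w - z) in IH *.
have h1 : normc w * (normc D * r ^+ 2) <= r * (n.+1%:R ^+ 2 * r ^+ n.+1 * d ^+ 2).
  by apply: ler_pM => //; rewrite ?normc_ge0 // mulr_ge0 ?normc_ge0 ?sqr_ge0.
have h2 : normc z ^+ n * r ^+ 2 <= r ^+ n.+2.
  by rewrite -[n.+2]addn2 exprD ler_wpM2r ?sqr_ge0 // lerXn2r ?nnegrE ?normc_ge0 ?(ltW r0).
rewrite mulrDl -[X in X + _]mulrA; apply: (le_trans (lerD h1 (lexx _))).
have -> : n.+1%:R * normc z ^+ n * d ^+ 2 * r ^+ 2 = n.+1%:R * d ^+ 2 * (normc z ^+ n * r ^+ 2) by ring.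
have d2 : 0 <= d ^+ 2 by rewrite sqr_ge0.
apply: (@le_trans _ _ (r * (n.+1%:R ^+ 2 * r ^+ n.+1 * d ^+ 2) + n.+1%:R * d ^+ 2 * r ^+ n.+2)).
  by rewrite lerD2l; apply: ler_wpM2l h2; apply: mulr_ge0.
rewrite -[n.+2%:R]natr1 (exprS r n.+1).
have m0 : 0 <= n.+1%:R :> R by [].
have rn : 0 <= r ^+ n.+1 by rewrite exprn_ge0 ?ltW.
rewrite -subr_ge0.
set m : R := n.+1%:R in m0 *; set q := r ^+ n.+1 in rn *.
rewrite (_ : _ - _ = (m + 1) * (r * q * d ^+ 2)); last by ring.
by apply: mulr_ge0; [lra|apply: mulr_ge0 => //; apply: mulr_ge0 => //; exact: ltW].
Qed.

Definition ext (c : nat -> C) : C -> C^o := fun z => if nsq z < 1 then psval c z else 0.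

Lemma extE c z : nsq z < 1 -> ext c z = psval c z.
Proof. by rewrite /ext => ->. Qed.

Lemma ext0 c z : ~ disc z -> ext c z = 0.
Proof. by rewrite discE /ext => /negP/negbTE ->. Qed.

(** The derivative l is the termwise one. The quadratic remainders from [taylor2] are summable, so
    the total error is a constant times |w - z|^2. *)
Lemma ext_holo c : ps_ok c -> holomorphic_on_disc (ext c).
Proof.
move=> hc z; rewrite discE -normc_lt1 => z1.
pose r := (normc z + 1) / 2.
have zr : normc z < r by rewrite /r; lra.
have r1 : 0 < r < 1 by have n0 := normc_ge0 z; apply/andP; rewrite /r; split; lra.
have /andP[r0 r1'] := r1.
have hs := asum_nsq_geo hc r1.
pose l := csum (fun n => c n * (n%:R * z ^+ n.-1)).
have nn n : normc (n%:R : C) = n%:R.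
  by rewrite -(rmorph_nat (real_complex R)) normc_realC ger0_norm.
have hl : casum (fun n => c n * (n%:R * z ^+ n.-1)).
  apply: (casum_le (v := fun n => r^-1 * (normc (c n) * (n%:R ^+ 2 * r ^+ n)))); last exact: asumZ.
  move=> n; rewrite !normcM nn normcX [leRHS]mulrCA ler_wpM2l ?normc_ge0 //.
  case: n => [|n]; first by rewrite mul0r expr0n /= mul0r mulr0.
  rewrite (exprS r n) [leRHS]mulrCA [r^-1 * _]mulKf ?gt_eqF //=.
  apply: ler_pM; rewrite ?exprn_ge0 ?normc_ge0 //.
    by rewrite expr2 ler_peMr // ler1n.
  by rewrite lerXn2r ?nnegrE ?normc_ge0 ?(ltW r0) ?(ltW zr).
pose K := 2 * (r ^+ 2)^-1 * ssum (fun n => normc (c n) * (n%:R ^+ 2 * r ^+ n)) + 1.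
have S0 : 0 <= ssum (fun n => normc (c n) * (n%:R ^+ 2 * r ^+ n)).
  by apply: ssum_ge0 => // n; rewrite !mulr_ge0 ?normc_ge0 ?exprn_ge0 ?sqr_ge0 ?(ltW r0).
have r20 : 0 < r ^+ 2 by rewrite exprn_gt0.
have K0 : 0 < K by rewrite /K ltr_wpDl // !mulr_ge0 // invr_ge0 ltW.
apply: (@holo_of_approx _ _ l) => e e0.
exists (Num.min (r - normc z) (e / K)); first by rewrite lt_min subr_gt0 zr divr_gt0.
move=> w; rewrite lt_min => /andP[w1 w2].
have wr : normc w < r.
  by rewrite -(subrK z w); apply: (le_lt_trans (le_normcD _ _)); lra.
have nw1 : nsq w < 1 by rewrite -normc_lt1 (lt_trans wr).
have nz1 : nsq z < 1 by rewrite -normc_lt1.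
have cw := ps_casum hc nw1; have cz := ps_casum hc nz1.
rewrite !extE //.
pose D n := c n * (w ^+ n - z ^+ n - n%:R * z ^+ n.-1 * (w - z)).
have DE : psval c w - psval c z - l * (w - z) = csum D.
  rewrite /psval -csumB; [|exact: cw|exact: cz].
  rewrite mulrC /l -csumZ // -csumB.
  - by congr csum; apply/funext => n; rewrite /D; ring.
  - apply: (casum_le (v := fun n => normc (c n * w ^+ n) + normc (c n * z ^+ n))).
      by move=> n; apply: (le_trans (le_normcD _ _)); rewrite normcN.
    by apply: asumD; [exact: cw|exact: cz].
  - apply: (casum_le (v := fun n => normc (w - z) * normc (c n * (n%:R * z ^+ n.-1)))).
      by move=> n; rewrite normcM.
    exact: asumZ.
pose v n := (normc (w - z) ^+ 2 * (r ^+ 2)^-1) * (normc (c n) * (n%:R ^+ 2 * r ^+ n)).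
have Dv n : normc (D n) <= v n.
  rewrite /D normcM /v [leRHS]mulrCA ler_wpM2l ?normc_ge0 //.
  rewrite [leRHS]mulrAC ler_pdivlMr // [leRHS]mulrC; apply: taylor2 => //; exact: ltW.
have hv : asum v by exact: asumZ.
have hD : casum D by exact: casum_le hv.
rewrite DE; apply: (le_trans (normc_csum hD)).
apply: (@le_trans _ _ (2 * ssum v)).
  by rewrite ler_pM2l //; apply: ssum_le.
rewrite /v ssumZ //; apply: (@le_trans _ _ (K * normc (w - z) * normc (w - z))).
  rewrite (_ : 2 * _ = (2 * (r ^+ 2)^-1 * ssum (fun n => normc (c n) * (n%:R ^+ 2 * r ^+ n))) * normc (w - z) ^+ 2); last by ring.
  by rewrite -[leRHS]mulrA -[normc _ * normc _]expr2 ler_wpM2r ?sqr_ge0 // /K lerDl.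
by rewrite ler_wpM2r ?normc_ge0 // mulrC -ler_pdivlMr // ltW.
Qed.

End Holo.

Section SequenceModel.
Context {R : realType}.
Notation C := (R[i]).
Notation Re := (@complex.Re R).
Notation Im := (@complex.Im R).
Notation nu := (@plane_measure R).
Notation pl := (@pl R).

Definition dot (w : nat -> R) (u v : nat -> C) : R := ssum (fun n => w n * Re (u n * (v n)^*)).
(** The imaginary part of an inner product is the real part of the product with - i u. This lets the
    estimates run on the real form [dot] alone. *)
Definition lip (w : nat -> R) (u v : nat -> C^o) : C :=
  dot w u v +i* dot w (fun n => - 'i * u n) v.
Definition sshift (u : nat -> C^o) : nat -> C^o := fun n => if n is n'.+1 then u n' else 0.

Lemma l2w_lin w a (u v : nat -> C^o) : (forall n, 0 <= w n) -> l2w w u -> l2w w v -> l2w w (a *: u + v).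
Proof.
move=> w0 hu hv; apply: (@asum_le _ _ (fun n => 2 * nsq a * (w n * nsq (u n)) + 2 * (w n * nsq (v n)))).
  move=> n; rewrite ger0_norm ?mulr_ge0 ?nsq_ge0 //.
  have -> : (a *: u + v) n = a * u n + v n by [].
  have := nsq_ge0 (a * u n - v n); rewrite nsqD nsqN nsqM.
  have -> : Re (a * u n * (- v n)^*) = - Re (a * u n * (v n)^*).
    by rewrite rmorphN mulrN cReN.
  move=> h; have : nsq (a * u n + v n) <= 2 * nsq a * nsq (u n) + 2 * nsq (v n).
    by rewrite nsqD nsqM; lra.
  move/(ler_wpM2l (w0 n)) => h1; apply: le_trans h1 _; rewrite le_eqVlt; apply/orP; left; apply/eqP; ring.
by apply: asumD; apply: asumZ.
Qed.

Lemma ext_lin a (u v : nat -> C^o) : ps_ok u -> ps_ok v -> ext (a *: u + v) = a *: ext u + ext v.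
Proof.
move=> hu hv; apply/funext => z.
have -> : (a *: ext u + ext v) z = a * ext u z + ext v z by [].
rewrite /ext; case: ifP => [z1|_]; last by rewrite mulr0 addr0.
have [cu cv] := (ps_casum hu z1, ps_casum hv z1).
have cau : casum (fun n => a * (u n * z ^+ n)).
  by apply: (casum_le (v := fun n => normc a * normc (u n * z ^+ n))); [move=> n; rewrite normcM|exact: asumZ].
rewrite /psval -csumZ // -csumD //.
by congr csum; apply/funext => n /=; rewrite mulrA -mulrDl.
Qed.

Lemma l2w_shift w u : (forall n, 0 <= w n.+1 <= w n) -> l2w w u -> l2w w (sshift u).
Proof.
move=> hw hu; apply: asum_recl => /=; apply: asum_le hu => n.
have /andP[w0 w1] := hw n; rewrite ger0_norm ?mulr_ge0 ?nsq_ge0 //.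
by rewrite ler_wpM2r ?nsq_ge0.
Qed.

Lemma ps_ok_shift u : ps_ok u -> ps_ok (sshift u).
Proof.
move=> hu r r1; apply: asum_recl => /=.
by apply: (eq_asum (@asumZ _ r _ (hu r r1))) => n; rewrite exprS mulrCA.
Qed.

Lemma ext_shift u : ps_ok u -> ext (sshift u) = shift_op (ext u).
Proof.
move=> hu; apply/funext => z; rewrite /shift_op /ext; case: ifP => [z1|_]; last by rewrite mulr0.
rewrite /psval csum_recl; last exact: (ps_casum (ps_ok_shift hu)).
rewrite mul0r add0r -csumZ; last exact: ps_casum.
by congr csum; apply/funext => n; rewrite exprS mulrCA.
Qed.

Variable alpha : R.
Hypothesis halpha : -1 < alpha.
Let w := bw (alpha + 1).

Let alpha1 : 0 < alpha + 1. Proof. by have := halpha; lra. Qed.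
Let w0 n : 0 <= w n. Proof. by rewrite ltW // bw_gt0. Qed.

Lemma bergman_sqnorm_ext u : l2w w u ->
  bergman_sqnorm alpha (ext u) = (kappa alpha * ssum (fun n => w n * nsq (u n)))%:E.
Proof.
move=> hu; have ok := l2_ps_ok alpha1 hu.
have hf z : nsq z < 1 -> ext u z = psval u z by exact: extE.
have t0 n : 0 <= w n * nsq (u n) by rewrite mulr_ge0 ?nsq_ge0.
have le := bergman_sqnorm_le halpha ok hf (fun N => ssum_part N hu t0).
apply/eqP; rewrite eq_le le /=.
have ge := bergman_sqnorm_ge halpha ok hf.
have [x xE] : exists x, bergman_sqnorm alpha (ext u) = x%:E.
  move: le (ge 0%N); case: (bergman_sqnorm _ _) => [x _ _|//|//]; by exists x.
rewrite xE lee_fin mulrC -ler_pdivlMr ?kappa_gt0 //; apply: ssum_leB => // N.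
by rewrite ler_pdivlMr ?kappa_gt0 // mulrC -lee_fin -xE.
Qed.

Lemma ext_bergman u : l2w w u -> bergman alpha (ext u).
Proof.
move=> hu; have ok := l2_ps_ok alpha1 hu; split; first exact: ext_holo.
  by move=> z; exact: ext0.
by rewrite bergman_sqnorm_ext // ltry.
Qed.

Lemma bergman_ext f : bergman alpha f -> exists2 u, l2w w u & f = ext u.
Proof.
move=> [fh f0 fn]; have [u ok hf] := taylor fh; exists u; last first.
  apply/funext => z; rewrite /ext; case: ifP => [|z1]; first exact: hf.
  by apply: f0; rewrite discE z1.
have ge := bergman_sqnorm_ge halpha ok hf.
have [x xE] : exists x, bergman_sqnorm alpha f = x%:E.
  move: fn (ge 0%N); case: (bergman_sqnorm _ _) => [x _ _|//|//]; by exists x.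
apply: (@asum_bnd _ _ (x / kappa alpha)) => N.
rewrite ler_pdivlMr ?kappa_gt0 // mulrC -lee_fin -xE; apply: le_trans (ge N).
rewrite lee_fin ler_pM2l ?kappa_gt0 //; apply: ler_sum => n _.
by rewrite ger0_norm ?mulr_ge0 ?nsq_ge0.
Qed.

Lemma bergman_intr u : l2w w u ->
  nu.-integrable [set: pl] (EFin \o (fun p : pl => nsq (ext u (cplx p)) * rho alpha 1 (sqn p))).
Proof.
move=> hu; have ok := l2_ps_ok alpha1 hu.
have hf z : nsq z < 1 -> ext u z = psval u z by exact: extE.
apply/integrableP; split; first exact: (measurable_f_rho alpha ok hf (lexx 1)).
under eq_integral do rewrite gee0_abs ?lee_fin ?mulr_ge0 ?nsq_ge0 ?rho_ge0 //=.
by rewrite -bergman_sqnorm_rho bergman_sqnorm_ext // ltry.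
Qed.

(** Polarisation: both sides are a quarter of the difference of the squared norms of u + v and u -
    v. *)
Lemma bergman_dot u v : l2w w u -> l2w w v ->
  disc_integral (fun z => Re (ext u z * (ext v z)^*) * bergman_weight alpha z) = kappa alpha * dot w u v.
Proof.
move=> hu hv.
have hD : l2w w (u + v) by rewrite -[u]scale1r; apply: l2w_lin.
have hB : l2w w (u - v) by rewrite addrC -scaleN1r; apply: l2w_lin.
have [ou ov] := (l2_ps_ok alpha1 hu, l2_ps_ok alpha1 hv).
have eD : ext (u + v) = ext u + ext v by rewrite -{1}[u]scale1r ext_lin // scale1r.
have eB : ext (u - v) = ext u - ext v by rewrite addrC -scaleN1r ext_lin // scaleN1r addrC.
pose g t (p : pl) := nsq (ext t (cplx p)) * rho alpha 1 (sqn p).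
have I t : l2w w t -> Rintegral nu [set: pl] (g t) = kappa alpha * ssum (fun n => w n * nsq (t n)).
  by move=> ht; rewrite /Rintegral -bergman_sqnorm_rho bergman_sqnorm_ext.
have -> : disc_integral (fun z => Re (ext u z * (ext v z)^*) * bergman_weight alpha z) =
    Rintegral nu [set: pl] (fun p => 4^-1 * (g (u + v) p - g (u - v) p)).
  rewrite /disc_integral /Rintegral integral_mkcond; congr fine; apply: eq_integral => p _.
  rewrite /patch /g /rho sqn_ge0 /=.
  have -> : (p \in (@cplx R) @^-1` disc) = (sqn p < 1).
    apply/idP/idP => [/set_mem|h].
      by rewrite /= discE nsq_cplx.
    by apply/mem_set; rewrite /= discE nsq_cplx.
  case: ifP => // _; last by rewrite !mulr0 subr0 mulr0.
  congr EFin; rewrite /bergman_weight normc_nsq nsq_cplx -mulrBl [RHS]mulrA; congr (_ * _).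
  rewrite eD eB; have -> : (ext u + ext v) (cplx p) = ext u (cplx p) + ext v (cplx p) by [].
  have -> : (ext u - ext v) (cplx p) = ext u (cplx p) + - ext v (cplx p) by [].
  rewrite !nsqD nsqN rmorphN mulrN cReN.
  by field.
rewrite RintegralZl //; last first.
  by apply: (@integrableB _ _ _ nu setT measurableT _ _ (bergman_intr hD) (bergman_intr hB)).
rewrite RintegralB //; [|exact: bergman_intr|exact: bergman_intr].
rewrite !I // -mulrBr mulrCA; congr (_ * _).
rewrite -ssumB // -ssumZ; last by apply: asumB.
apply: eq_ssum => n.
have -> : (u + v) n = u n + v n by [].
have -> : (u - v) n = u n + - v n by [].
rewrite !nsqD nsqN rmorphN mulrN cReN.
by field.
Qed.

Lemma bergman_lip u v : l2w w u -> l2w w v ->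
  bergman_ip alpha (ext u) (ext v) = (kappa alpha)%:C * lip w u v.
Proof.
move=> hu hv.
have l0 : l2w w (0 : nat -> C^o) by apply: (eq_asum asum0) => n; rewrite nsq0 mulr0.
have hi : l2w w (fun n => - 'i * u n).
  have -> : (fun n => - 'i * u n) = - 'i *: (u : nat -> C^o) + 0 by rewrite addr0.
  exact: l2w_lin.
have ei z : ext (fun n => - 'i * u n) z = - 'i * ext u z.
  have -> : (fun n => - 'i * u n) = - 'i *: (u : nat -> C^o) + 0 by rewrite addr0.
  rewrite ext_lin; [|exact: (l2_ps_ok alpha1 hu)|exact: (l2_ps_ok alpha1 l0)].
  have -> : ext (0 : nat -> C^o) = 0.
    apply/funext => y; rewrite /ext /psval; case: ifP => // _.
    have -> : (fun n => (0 : nat -> C^o) n * y ^+ n) = (fun=> 0) by apply/funext => n; rewrite mul0r.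
    by rewrite /csum ssum0.
  by rewrite addr0.
apply: C_eq; rewrite ?cReM ?cImM /= ?mul0r ?subr0 ?addr0.
  exact: bergman_dot.
rewrite -bergman_dot //; congr disc_integral; apply/funext => z; congr (_ * _).
rewrite ei -mulrA cReM /=; ring.
Qed.

End SequenceModel.

(** * Transport of the Beurling-type property along a similarity *)

Section Transfer.
Context {R : realType}.
Notation C := (R[i]).

Definition lin_closed (V : lmodType C) (H : set V) : Prop :=
  H 0 /\ forall (a : C) (u v : V), H u -> H v -> H (a *: u + v).

Lemma lin_closedD (V : lmodType C) (H : set V) u v : lin_closed H -> H u -> H v -> H (u + v).
Proof. by move=> [_ h] hu hv; rewrite -[u]scale1r; apply: h. Qed.
Lemma lin_closedZ (V : lmodType C) (H : set V) (a : C) u : lin_closed H -> H u -> H (a *: u).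
Proof. by move=> [h0 h] hu; rewrite -[_ *: _]addr0; apply: h. Qed.
Lemma lin_closedN (V : lmodType C) (H : set V) u : lin_closed H -> H u -> H (- u).
Proof. by move=> hH hu; rewrite -scaleN1r; apply: lin_closedZ. Qed.
Lemma lin_closedB (V : lmodType C) (H : set V) u v : lin_closed H -> H u -> H v -> H (u - v).
Proof. by move=> hH hu hv; apply: lin_closedD => //; apply: lin_closedN. Qed.
Lemma lin_closed_sum (V : lmodType C) (H : set V) n (u : 'I_n -> V) :
  lin_closed H -> (forall i, H (u i)) -> H (\sum_(i < n) u i).
Proof. by move=> hH hu; apply: (big_ind H) => //; [case: hH|move=> *; exact: lin_closedD]. Qed.

Lemma generated_sub (V : lmodType C) (H : set V) ip (T : V -> V) (M E : set V) :
  closed_subspace H ip M -> T @` M `<=` M -> E `<=` M -> generated H ip T E `<=` M.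
Proof.
move=> [MH M0 Ml Mc] TM EM v [Hv hv]; apply: Mc; split => // e e0.
have [u [n [a [x [xE ->]]]] ux] := hv e e0; exists (\sum_(i < n) a i *: x i) => //.
have lM : lin_closed M by split.
apply: lin_closed_sum => // i; apply: lin_closedZ => //.
have [k _ [y Ey <-]] := xE i; elim: k => [|k IH] /=; first exact: EM.
by apply: TM; exists (iter k T y).
Qed.

Variables (V' V : lmodType C) (H' : set V') (H : set V).
Variables (ip' : V' -> V' -> C) (ip : V -> V -> C) (T' : V' -> V') (T : V -> V).
Variables (Phi : V' -> V) (k : R).
Hypotheses (k0 : 0 < k) (lH' : lin_closed H') (TH' : forall u, H' u -> H' (T' u)).
Hypotheses (PhiH : forall u, H' u -> H (Phi u)).
Hypotheses (Phi_surj : forall v, H v -> exists2 u, H' u & v = Phi u).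
Hypotheses (Phi_lin : forall (a : C) u v, H' u -> H' v -> Phi (a *: u + v) = a *: Phi u + Phi v).
Hypotheses (Phi_ip : forall u v, H' u -> H' v -> ip (Phi u) (Phi v) = k%:C * ip' u v).
Hypotheses (PhiT : forall u, H' u -> Phi (T' u) = T (Phi u)).

Let Phi0 : Phi 0 = 0.
Proof.
have [h0 _] := lH'; have := @Phi_lin (-1) 0 0 h0 h0.
by rewrite scaler0 addr0 scaleN1r addNr.
Qed.

Let Phi_norm u : H' u -> ip_norm ip (Phi u) = Num.sqrt k * ip_norm ip' u.
Proof.
by move=> hu; rewrite /ip_norm Phi_ip // cReM /= mul0r subr0 sqrtrM // ltW.
Qed.

Let PhiB u v : H' u -> H' v -> Phi (u - v) = Phi u - Phi v.
Proof. by move=> hu hv; rewrite addrC -scaleN1r Phi_lin // scaleN1r addrC. Qed.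

Let sk0 : 0 < Num.sqrt k. Proof. by rewrite sqrtr_gt0. Qed.

(** M is pulled back to M'. Norms are multiplied by sqrt k under Phi, so approximations within e /
    sqrt k are carried to approximations within e. The other inclusion is [generated_sub]. *)
Lemma Beurling_transfer : Beurling_type H' ip' T' -> Beurling_type H ip T.
Proof.
move=> B M cM TM; have [MH M0 Ml Mc] := cM.
pose M' : set V' := [set u | H' u /\ M (Phi u)].
have cM' : closed_subspace H' ip' M'.
  split; first by move=> u [].
  - by split; [case: lH'|rewrite Phi0].
  - by move=> a u v [hu mu] [hv mv]; split; [apply: lH'.2|rewrite Phi_lin //; apply: Ml].
  move=> v [hv h]; split => //; apply: Mc; split; first exact: PhiH.
  move=> e e0; have [u [hu mu] uv] := h (e / Num.sqrt k) (divr_gt0 e0 sk0).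
  exists (Phi u) => //; rewrite -PhiB // Phi_norm; last exact: lin_closedB.
  by rewrite mulrC -ltr_pdivlMr.
have TM' : T' @` M' `<=` M'.
  move=> _ [u [hu mu] <-]; split; first exact: TH'.
  by rewrite PhiT //; apply: TM; exists (Phi u).
have EE v : ominus ip' M' (T' @` M') v -> ominus ip M (T @` M) (Phi v).
  move=> [[hv mv] ov]; split => // _ [w Mw <-].
  have [u hu uE] := Phi_surj (MH _ Mw); rewrite uE -PhiT // Phi_ip; [|by []|exact: TH'].
  by rewrite ov ?mulr0 //; exists u => //; split => //; rewrite -uE.
apply/seteqP; split; last first.
  by apply: generated_sub => // v [].
move=> v Mv; have [u hu uE] := Phi_surj (MH _ Mv).
have : M' u by split; rewrite -?uE.
rewrite (B M' cM' TM') => -[_ h]; split; first exact: MH.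
move=> e e0; have [u' [n [a [x [xE u'E]]]] uu'] := h (e / Num.sqrt k) (divr_gt0 e0 sk0).
have xH i : H' (x i).
  have [j _ [y [[hy _] _] <-]] := xE i; elim: j => [//|j IH] /=; exact: TH'.
have hu' : H' u' by rewrite u'E; apply: lin_closed_sum => // i; apply: lin_closedZ.
exists (Phi u'); last first.
  rewrite uE -PhiB // Phi_norm; last exact: lin_closedB.
  by rewrite mulrC -ltr_pdivlMr.
exists n, a, (fun i => Phi (x i)); split.
  move=> i; have [j _ [y Ey <-]] := xE i; exists j => //; exists (Phi y); first exact: EE.
  have hy : H' y by case: Ey => -[].
  suff [] : H' (iter j T' y) /\ iter j T (Phi y) = Phi (iter j T' y) by [].
  elim: j => [//|j [IH1 IH2]] /=; split; first exact: TH'.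
  by rewrite IH2 PhiT.
rewrite u'E; clear u'E uu' hu' xE; elim: n a x xH => [|n IH] a x xH; first by rewrite !big_ord0.
rewrite !big_ord_recl Phi_lin //; last first.
  by apply: lin_closed_sum => // i; apply: lin_closedZ.
by congr (_ + _); exact: IH.
Qed.

End Transfer.

(** * Equivalence of the Bergman space and its sequence model *)

Section BergmanSequence.
Context {R : realType}.
Variable alpha : R.
Hypothesis halpha : -1 < alpha.
Let w := bw (alpha + 1).

Let alpha1 : 0 < alpha + 1. Proof. by have := halpha; lra. Qed.
Let w0 n : 0 <= w n. Proof. by rewrite ltW // bw_gt0. Qed.
Let w1 n : 0 <= w n.+1 <= w n. Proof. by rewrite w0 /= bw_le. Qed.

Lemma lin_closed_l2w : lin_closed (l2w w : set (nat -> R[i]^o)).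
Proof.
split; first by apply: (eq_asum (@asum0 R)) => n; rewrite nsq0 mulr0.
by move=> a u v; exact: l2w_lin.
Qed.

Lemma ext_inj u v : l2w w u -> l2w w v -> ext u = ext v -> u = v.
Proof.
move=> hu hv uv; have h2 : 0 < (2^-1 : R) < 1 by apply/andP; split; lra.
case/andP: (h2) => h20 h21.
have b t : l2w w t -> ps_bnd t 2^-1.
  by move=> ht; apply: (ps_ok_bnd (l2_ps_ok alpha1 ht)); rewrite (ltW h20).
apply: (psval_inj h20 (b _ hu) (b _ hv)) => z z1.
have z2 : nsq z < 1 by rewrite -normc_lt1 (lt_trans z1).
by rewrite -!extE // uv.
Qed.

Theorem Beurling_bergman_seq : Beurling_type (bergman alpha) (bergman_ip alpha) shift_op <->
  Beurling_type (l2w w : set (nat -> R[i]^o)) (lip w) sshift.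
Proof.
have k0 := kappa_gt0 halpha.
have ok u : l2w w u -> ps_ok u by move=> hu; exact: (l2_ps_ok alpha1 hu).
split; last first.
  apply: (@Beurling_transfer R _ _ _ _ _ _ _ _ (@ext R) (kappa alpha)) => //.
  - exact: lin_closed_l2w.
  - by move=> u; exact: l2w_shift.
  - by move=> u; exact: ext_bergman.
  - by move=> f; exact: bergman_ext.
  - by move=> a u v hu hv; rewrite ext_lin //; exact: ok.
  - by move=> u v hu hv; rewrite bergman_lip.
  - by move=> u hu; rewrite ext_shift //; exact: ok.
(* The inverse of [ext], by choice; 0 is a default value outside the Bergman space. *)
pose Psi (f : R[i] -> R[i]^o) : nat -> R[i]^o :=
  xget 0 [set u | l2w w u /\ f = ext u].
have PsiP f : bergman alpha f -> l2w w (Psi f) /\ f = ext (Psi f).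
  move=> /(bergman_ext halpha)[u hu fu]; rewrite /Psi.
  by case: xgetP => [y _ //|h]; have := h u; case.
have Psi_ext u : l2w w u -> Psi (ext u) = u.
  by move=> hu; have [h1 h2] := PsiP _ (ext_bergman halpha hu); apply: ext_inj.
have lB : lin_closed (bergman alpha : set (R[i] -> R[i]^o)).
  split.
    have -> : (0 : R[i] -> R[i]^o) = ext (0 : nat -> R[i]^o).
      apply/funext => y; rewrite /ext /psval; case: ifP => // _.
      have -> : (fun n => (0 : nat -> R[i]^o) n * y ^+ n) = (fun=> 0) by apply/funext => n; rewrite mul0r.
      by rewrite /csum ssum0.
    by apply: ext_bergman => //; case: lin_closed_l2w.
  move=> a f g /PsiP[h1 ->] /PsiP[h2 ->]; rewrite -ext_lin; [|exact: ok..].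
  by apply: ext_bergman => //; exact: lin_closed_l2w.2.
apply: (@Beurling_transfer R _ _ _ _ _ _ _ _ Psi (kappa alpha)^-1) => //.
- by rewrite invr_gt0.
- move=> f /(bergman_ext halpha)[u hu ->]; rewrite -ext_shift; last exact: ok.
  by apply: ext_bergman => //; exact: l2w_shift.
- by move=> f /PsiP[].
- by move=> u hu; exists (ext u); [exact: ext_bergman|rewrite Psi_ext].
- move=> a f g /PsiP[h1 E1] /PsiP[h2 E2]; rewrite {1}E1 {1}E2 -ext_lin; [|exact: ok..].
  by rewrite Psi_ext //; exact: lin_closed_l2w.2.
- move=> f g /PsiP[h1 E1] /PsiP[h2 E2]; rewrite {2}E1 {2}E2 bergman_lip //.
  by rewrite mulrA -rmorphM mulVf ?gt_eqF // mul1r.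
- move=> f /PsiP[h1 E1]; rewrite {1}E1 -ext_shift; last exact: ok.
  by rewrite Psi_ext //; exact: l2w_shift.
Qed.

End BergmanSequence.

(** * Weighted sequence spaces *)

Section SequenceHilbert.
Context {R : realType}.
Notation C := (R[i]).
Notation Re := (@complex.Re R).
Notation Im := (@complex.Im R).
Notation V := (nat -> C^o).
Variable w : nat -> R.
Hypothesis hw : forall n, 0 < w n.
Notation H := (l2w w : set V).
Implicit Types u v x y : V.

Let w0 n : 0 <= w n. Proof. exact: ltW. Qed.

Lemma lin_closedH : lin_closed H.
Proof.
split; first by apply: (eq_asum (@asum0 R)) => n; rewrite nsq0 mulr0.
by move=> a u v; exact: l2w_lin.
Qed.

Lemma l2wD u v : H u -> H v -> H (u + v).
Proof. exact: (lin_closedD lin_closedH). Qed.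
Lemma l2wB u v : H u -> H v -> H (u - v).
Proof. exact: (lin_closedB lin_closedH). Qed.
Lemma l2wN u : H u -> H (- u).
Proof. exact: (lin_closedN lin_closedH). Qed.
Lemma l2wZ (a : C) u : H u -> H (a *: u).
Proof. exact: (@lin_closedZ _ _ _ a u lin_closedH). Qed.

Lemma normr_Re_mulJ (z t : C) : 2 * `|Re (z * t^*)| <= nsq z + nsq t.
Proof.
have h1 := nsq_ge0 (z + t); have h2 := nsq_ge0 (z - t).
move: h1 h2; rewrite !nsqD nsqN rmorphN mulrN cReN => h1 h2.
by rewrite -[X in X * _]ger0_norm // -normrM ler_norml; apply/andP; split; lra.
Qed.

Lemma asum_dot u v : H u -> H v -> asum (fun n => w n * Re (u n * (v n)^*)).
Proof.
move=> hu hv; apply: asum_le (asumD hu hv) => n.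
rewrite normrM ger0_norm // -mulrDr ler_wpM2l //.
by have := normr_Re_mulJ (u n) (v n); have := normr_ge0 (Re (u n * (v n)^*)); lra.
Qed.

Lemma dotC u v : dot w u v = dot w v u.
Proof. by apply: eq_ssum => n; rewrite !Re_mulJ; ring. Qed.

Lemma dotDl u v x : H u -> H v -> H x -> dot w (u + v) x = dot w u x + dot w v x.
Proof.
move=> hu hv hx; rewrite /dot -ssumD; [|exact: asum_dot..].
by apply: eq_ssum => n; have -> : (u + v) n = u n + v n by []; rewrite mulrDl cReD mulrDr.
Qed.

Lemma dotNl u x : H u -> H x -> dot w (- u) x = - dot w u x.
Proof.
move=> hu hx; rewrite /dot -ssumN; last exact: asum_dot.
by apply: eq_ssum => n; have -> : (- u) n = - u n by []; rewrite mulNr cReN mulrN.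
Qed.

Lemma dotBl u v x : H u -> H v -> H x -> dot w (u - v) x = dot w u x - dot w v x.
Proof.
by move=> hu hv hx; rewrite dotDl ?dotNl //; exact: l2wN.
Qed.

Lemma dotZl (r : R) u x : H u -> H x -> dot w (r%:C *: u) x = r * dot w u x.
Proof.
move=> hu hx; rewrite /dot -ssumZ; last exact: asum_dot.
by apply: eq_ssum => n; have -> : (r%:C *: u) n = r%:C * u n by []; rewrite -mulrA cReM /=; ring.
Qed.

Lemma dotDr u v x : H u -> H v -> H x -> dot w x (u + v) = dot w x u + dot w x v.
Proof. by move=> *; rewrite dotC dotDl // ![dot w x _]dotC. Qed.
Lemma dotBr u v x : H u -> H v -> H x -> dot w x (u - v) = dot w x u - dot w x v.
Proof. by move=> *; rewrite dotC dotBl // ![dot w x _]dotC. Qed.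
Lemma dotZr (r : R) u x : H u -> H x -> dot w x (r%:C *: u) = r * dot w x u.
Proof. by move=> *; rewrite dotC dotZl // dotC. Qed.

Lemma dotE u : dot w u u = ssum (fun n => w n * nsq (u n)).
Proof. by apply: eq_ssum => n; rewrite Re_mulJJ. Qed.

Lemma dot_ge0 u : H u -> 0 <= dot w u u.
Proof. by move=> hu; rewrite dotE ssum_ge0 // => n; rewrite mulr_ge0 ?nsq_ge0. Qed.

Lemma dot_coef u n : H u -> w n * nsq (u n) <= dot w u u.
Proof.
move=> hu; rewrite dotE; apply: (@ssum_term _ (fun n => w n * nsq (u n))) => // k.
by rewrite mulr_ge0 ?nsq_ge0.
Qed.

Lemma dot_eq0 u : H u -> dot w u u <= 0 -> u = 0.
Proof.
move=> hu h; apply/funext => n; apply: nsq_eq0; apply/eqP; rewrite eq_le nsq_ge0 andbT.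
by rewrite -(pmulr_rle0 _ (hw n)); apply: le_trans h; exact: dot_coef.
Qed.

Lemma dotDD u v : H u -> H v -> dot w (u + v) (u + v) = dot w u u + 2 * dot w u v + dot w v v.
Proof.
move=> hu hv; have huv : H (u + v) by exact: l2wD.
by rewrite dotDl // !dotDr // [dot w v u]dotC; ring.
Qed.

Lemma dotBB u v : H u -> H v -> dot w (u - v) (u - v) = dot w u u - 2 * dot w u v + dot w v v.
Proof.
move=> hu hv; have huv : H (u - v) by exact: l2wB.
by rewrite dotBl // !dotBr // [dot w v u]dotC; ring.
Qed.

(** The discriminant inequality with a slack e: it yields Cauchy-Schwarz, and in
    [projection_closure] it measures how far an approximate minimiser is from satisfying the
    orthogonality. *)
Lemma quad_disc (b c e : R) : 0 <= c -> 0 <= e ->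
  (forall s, - e <= s ^+ 2 * c - 2 * s * b) -> b ^+ 2 <= e * c.
Proof.
move=> c0 e0 h; have [c1|c1] := ltP 0 c.
  have := h (b / c); have -> : (b / c) ^+ 2 * c - 2 * (b / c) * b = - (b ^+ 2 / c).
    by field; rewrite gt_eqF.
  by rewrite lerN2 ler_pdivrMr.
have {c0}c0 : c = 0 by apply/eqP; rewrite eq_le c1.
have [->|b0] := eqVneq b 0; first by rewrite expr0n /= mulr_ge0 // c0.
have := h ((e + 1) / (2 * b)); rewrite c0 mulr0 sub0r lerN2.
have -> : 2 * ((e + 1) / (2 * b)) * b = e + 1 by field.
by move=> ?; exfalso; lra.
Qed.

Lemma dot_cs u v : H u -> H v -> dot w u v ^+ 2 <= dot w u u * dot w v v.
Proof.
move=> hu hv; apply: quad_disc => [||s]; [exact: dot_ge0..|].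
have hsv : H (s%:C *: v) by exact: l2wZ.
have := dot_ge0 (l2wB hu hsv); rewrite dotBB // !dotZr // dotZl //; lra.
Qed.

(** Each coordinate is a Cauchy sequence. The Cauchy bound survives the coordinatewise limit in
    every finite sum, uniformly in its length, hence in the whole series. *)
Lemma seq_complete (u : nat -> V) : (forall k, H (u k)) ->
  (forall e : R, 0 < e -> exists K, forall j k, (K <= j)%N -> (K <= k)%N -> dot w (u j - u k) (u j - u k) <= e) ->
  exists2 v : V, H v & forall e : R, 0 < e -> exists K, forall k, (K <= k)%N -> dot w (u k - v) (u k - v) <= e.
Proof.
move=> hu hc.
have cv (f : C -> R) : (forall z t : C, f (z - t) = f z - f t) -> (forall z, f z ^+ 2 <= nsq z) ->
    forall n, cvgn (fun k => f (u k n)).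
  move=> fB fn n; apply/cauchy_cvgP/cauchy_exP => /= e e0.
  have e1 : 0 < w n * (e / 2) ^+ 2 by rewrite mulr_gt0 // exprn_gt0 // divr_gt0.
  have [K hK] := hc _ e1; exists (f (u K n)); exists K => // k /= Kk.
  rewrite /ball /= -fB.
  have := le_trans (@dot_coef (u K - u k) n (l2wB (hu K) (hu k))) (hK K k (leqnn K) Kk).
  rewrite ler_pM2l // => h; have := le_trans (fn _) h.
  have -> : (u K - u k) n = u K n - u k n by [].
  have e20 : 0 <= e / 2 by rewrite divr_ge0 // ltW.
  rewrite -[X in X <= _]real_normK ?num_real // ler_pXn2r ?nnegrE // => h2; apply: (le_lt_trans h2).
  by rewrite ltr_pdivrMr //; lra.
have cR : forall n, cvgn (fun k => Re (u k n)).
  by apply: cv; [exact: cReB|move=> z; rewrite lerDl sqr_ge0].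
have cI : forall n, cvgn (fun k => Im (u k n)).
  by apply: cv; [exact: cImB|move=> z; rewrite lerDr sqr_ge0].
pose v : V := fun n => limn (fun k => Re (u k n)) +i* limn (fun k => Im (u k n)).
have fin N e K : (forall j k, (K <= j)%N -> (K <= k)%N -> dot w (u j - u k) (u j - u k) <= e) ->
    forall j, (K <= j)%N -> \sum_(n < N) w n * nsq (u j n - v n) <= e.
  move=> hK j Kj; pose g k := \sum_(n < N) w n * nsq (u j n - u k n).
  have cg : g k @[k --> \oo] --> \sum_(n < N) w n * nsq (u j n - v n).
    apply: cvg_big => [|n _]; [exact: add_continuous|apply: cvgMr]; rewrite /nsq cReB cImB /=.
    under eq_fun do rewrite cReB cImB.
    by apply: cvgD; apply: (@cvg_comp _ _ _ _ (fun x : R => x ^+ 2) _ _ _ _ (@exprn_continuous _ 2 _));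
      (apply: cvgB; [exact: cvg_cst|]); [exact: cR|exact: cI].
  rewrite -(cvg_lim _ cg) //; apply: limr_le; first exact: (cvgP _ cg).
  near=> k; apply: le_trans (hK j k Kj _); last by near: k; exists K.
  rewrite dotE; apply: (@ssum_part _ (fun n => w n * nsq ((u j - u k) n))); first exact: l2wB.
  by move=> n; rewrite mulr_ge0 ?nsq_ge0.
have hv K j e : (forall j k, (K <= j)%N -> (K <= k)%N -> dot w (u j - u k) (u j - u k) <= e) -> (K <= j)%N -> H (u j - v).
  move=> hK Kj; apply: (@asum_bnd _ _ e) => N.
  under eq_bigr do rewrite ger0_norm ?mulr_ge0 ?nsq_ge0 //.
  exact: (fin N e K hK j Kj).
have Hv : H v.
  have [K hK] := hc 1 ltr01; rewrite -(subKr (u K) v); apply: l2wB => //.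
  exact: (hv K K 1 hK (leqnn K)).
exists v => // e /hc[K hK]; exists K => k Kk; rewrite dotE; apply: ssum_leB.
  exact: (hv K k e hK Kk).
by move=> N; apply: (fin N e K hK k Kk).
Unshelve. all: by end_near. Qed.

Lemma ip_norm_lip u : ip_norm (lip w) u = Num.sqrt (dot w u u).
Proof. by []. Qed.

Lemma closed_lim (M : set V) u : closed_subspace H (lip w) M -> H u ->
  (forall e : R, 0 < e -> exists2 v, M v & dot w (u - v) (u - v) <= e) -> M u.
Proof.
move=> [MH M0 Ml Mc] hu h; apply: Mc; split => // e e0.
have [v Mv uv] := h ((e / 2) ^+ 2) (exprn_gt0 _ (divr_gt0 e0 (ltr0Sn R 1))); exists v => //.
rewrite ip_norm_lip; have e20 : 0 <= e / 2 by rewrite divr_ge0 // ltW.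
apply: (@le_lt_trans _ _ (e / 2)); last by rewrite ltr_pdivrMr //; lra.
by rewrite -(ger0_norm e20) -sqrtr_sqr ler_wsqrtr.
Qed.

(** M is only linear here: the nearest point m is a limit of points of M. This form is applied to
    the span of the T^n E, before taking its closure. *)
Lemma projection_closure (M : set V) x : lin_closed M -> M `<=` H -> H x ->
  exists m, [/\ H m, (forall e : R, 0 < e -> exists2 y, M y & dot w (m - y) (m - y) <= e)
    & forall y, M y -> dot w (x - m) y = 0].
Proof.
move=> lM MH hx; have [M0 Ml] := lM.
pose D : set R := [set dot w (x - y) (x - y) | y in M].
have D0 : lbound D 0 by move=> _ [y My <-]; apply: dot_ge0; apply: l2wB => //; exact: MH.
have hD : has_inf D by split; [exists (dot w (x - 0) (x - 0)), 0|exists 0].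
pose d := inf D.
have dle y : M y -> d <= dot w (x - y) (x - y).
  by move=> My; apply: ge_inf; [exists 0|exists y].
have hy k : exists y, M y /\ dot w (x - y) (x - y) < d + k.+1%:R^-1.
  have k0 : 0 < k.+1%:R^-1 :> R by rewrite invr_gt0.
  by have [_ [y My <-] h] := inf_adherent k0 hD; exists y.
have [y yP] := choice hy; have My k : M (y k) by have [] := yP k.
have Hy k : H (y k) by apply: MH.
have Hxy k : H (x - y k) by exact: l2wB.
have cau e : 0 < e -> exists K, forall j k, (K <= j)%N -> (K <= k)%N ->
    dot w (y j - y k) (y j - y k) <= e.
  move=> e0; pose K := Num.truncn (4 / e); exists K => j k Kj Kk.
  have hK i : (K <= i)%N -> i.+1%:R^-1 <= e / 4.
    move=> Ki; rewrite -[e / 4]invrK lef_pV2 ?posrE ?invr_gt0 ?divr_gt0 // invf_div.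
    by apply: (le_trans (ltW (truncnS_gt _))); rewrite ler_nat ltnS.
  have hj := hK _ Kj; have hk := hK _ Kk.
  (* Parallelogram law: the midpoint lies in M, so its squared distance to x is at least d. *)
  pose m := 2^-1%:C *: (y j + y k).
  have Mm : M m by apply: lin_closedZ => //; exact: lin_closedD.
  have Hm : H (x - m) by apply: l2wB => //; exact: MH.
  have := dle _ Mm.
  have -> : x - m = 2^-1%:C *: ((x - y j) + (x - y k)).
    apply/funext => n; rewrite /m.
    have -> : (x - 2^-1%:C *: (y j + y k)) n = x n - 2^-1%:C * (y j n + y k n) by [].
    have -> : (2^-1%:C *: (x - y j + (x - y k))) n = 2^-1%:C * (x n - y j n + (x n - y k n)) by [].
    by apply: C_eq; rewrite ?cReB ?cImB ?cReM ?cImM ?cReD ?cImD ?cReB ?cImB ?cReN ?cImN /=; field.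
  have E : y j - y k = (x - y k) - (x - y j) by rewrite opprB [RHS]addrC addrA subrK.
  have HS : H (x - y j + (x - y k)) by exact: l2wD.
  have HS2 := @l2wZ 2^-1%:C _ HS.
  rewrite dotZl // dotZr // E.
  rewrite (@dotDD (x - y j)) // (@dotBB (x - y k) (x - y j)) // [dot w (x - y k) (x - y j)]dotC.
  have bound i : i.+1%:R^-1 <= e / 4 -> dot w (x - y i) (x - y i) <= d + e / 4.
    by move=> hi; rewrite (le_trans (ltW (yP i).2)) // lerD2l.
  by have := bound _ hj; have := bound _ hk; clear; lra.
have [m Hm my] := seq_complete Hy cau.
exists m; split => // [e /my[K hK]|z Mz].
  exists (y K) => //.
  have -> : m - y K = - (y K - m) by rewrite opprB.
  have HK := l2wB (Hy K) Hm; have HN := l2wN HK.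
  by rewrite dotNl // dotC dotNl // opprK; exact: hK.
have Hz := MH _ Mz.
have dz := dot_ge0 Hz; apply/eqP; rewrite -sqrf_eq0; apply/eqP/le_anti/andP; split; last exact: sqr_ge0.
apply/ler_addgt0Pr => e e0; rewrite add0r.
(* The 4 arises from squaring a sum of two terms, each with square at most e' |z|^2. *)
pose e' := e / (4 * (dot w z z + 1)).
have p0 : 0 < 4 * (dot w z z + 1) by rewrite mulr_gt0 // ltr_wpDl.
have e'0 : 0 < e' by rewrite divr_gt0.
have [K hK] := my _ e'0.
pose k := maxn K (Num.truncn e'^-1).
have hk : k.+1%:R^-1 <= e'.
  rewrite -[e']invrK lef_pV2 ?posrE ?invr_gt0 //.
  by apply: (le_trans (ltW (truncnS_gt _))); rewrite ler_nat ltnS leq_maxr.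
(* y_k minimises the distance to x only up to e', hence is orthogonal to z only in this quantitative
   sense. *)
have h1 : dot w (x - y k) z ^+ 2 <= e' * dot w z z.
  apply: quad_disc => // [|s]; first exact: ltW.
  have My' : M (y k + s%:C *: z) by apply: lin_closedD => //; exact: lin_closedZ.
  have Hs : H (s%:C *: z) by exact: l2wZ.
  have := dle _ My'; rewrite opprD addrA dotBB // !dotZr // dotZl //.
  have : dot w (x - y k) (x - y k) <= d + e' by rewrite (le_trans (ltW (yP k).2)) // lerD2l.
  by clear; lra.
have h2 : dot w (y k - m) z ^+ 2 <= e' * dot w z z.
  apply: (le_trans (dot_cs (l2wB (Hy k) Hm) Hz)); rewrite ler_wpM2r //.
  by apply: hK; rewrite leq_maxl.
have -> : x - m = (x - y k) + (y k - m) by rewrite addrA subrK.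
rewrite dotDl //; last exact: l2wB.
have : 4 * (e' * dot w z z) <= e.
  have : e' * (4 * (dot w z z + 1)) = e by rewrite divfK // gt_eqF.
  by clear -e'0; lra.
by move: h1 h2; move: (dot w _ z) (dot w _ z) (e' * _) => b1 b2 c h1 h2 h3; nra.
Qed.

Lemma projection (M : set V) x : closed_subspace H (lip w) M -> H x ->
  exists2 m, M m & forall y, M y -> dot w (x - m) y = 0.
Proof.
move=> cM hx; have [MH M0 Ml _] := cM.
have [|m [Hm my mx]] := projection_closure _ MH hx; first by split.
by exists m => //; apply: closed_lim.
Qed.

End SequenceHilbert.

(** * The case alpha <= 1 *)

Section WeightForm.
Context {R : realType}.

(* A Lyapunov function for the recursion in n: by [Z_step] its increments are
   dominated by those of the quadratic form. *)
Definition Z (A B C V U : R) : R :=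
  (A + C) * V ^+ 2 - (A - C) * V * U + (A - 2 * B + C) / 2 * U ^+ 2.

Lemma Z_ge0 (al n A B C V U : R) : 0 < al -> 0 < n -> 0 <= A -> B = A * n / (n + al) ->
  C = B * (n + 1) / (n + 1 + al) -> 0 <= Z A B C V U.
Proof.
move=> a0 n0 A0 -> ->.
have p1 : 0 < n + al by rewrite addr_gt0.
have p2 : 0 < n + 1 + al by rewrite !addr_gt0.
(* Over the common denominator (n + al) (n + 1 + al), A x, A y and A z are A + C, A - C and A - 2 B
   + C. *)
pose x := 2 * n ^+ 2 + 2 * n + 2 * al * n + al ^+ 2 + al.
pose y := al * (2 * n + 1 + al).
pose z := al * (al + 1).
set Zq := Z _ _ _ _ _; have -> : Zq = A / ((n + al) * (n + 1 + al)) * (x * V ^+ 2 - y * V * U + z / 2 * U ^+ 2).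
  by rewrite /Zq /Z /x /y /z; field; rewrite !gt_eqF.
apply: mulr_ge0; first by rewrite divr_ge0 // mulr_ge0 // ltW.
have x0 : 0 < x by rewrite /x; nra.
rewrite -(pmulr_rge0 _ x0).
have -> : x * (x * V ^+ 2 - y * V * U + z / 2 * U ^+ 2) = (x * V - y / 2 * U) ^+ 2 +
    al / 4 * (4 * n ^+ 2 + 4 * n * (1 + al) + (1 + al) ^+ 2 * al) * U ^+ 2.
  by rewrite /x /y /z; field.
rewrite addr_ge0 ?sqr_ge0 // mulr_ge0 ?sqr_ge0 // mulr_ge0 //; first by rewrite divr_ge0 // ltW.
by rewrite !addr_ge0 // !mulr_ge0 ?sqr_ge0 //; lra.
Qed.

(* The symmetric 3x3 form left after extracting the positive factor; eliminating U and
   then V' = V + S/2 leaves the determinant 16 (2 - al) v^2 / (al + 2) + 4 (al + 1) (3 - al) v, v = u n. *)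
Lemma Z_step (al n A B C D S V0 U : R) : 0 < al -> al <= 2 -> 0 < n -> 0 <= A -> B = A * n / (n + al) ->
  C = B * (n + 1) / (n + 1 + al) -> D = C * (n + 2) / (n + 2 + al) ->
  Z B C D (V0 + S) (U + 2 * V0 + S) - Z A B C V0 U <=
    2 * S * (C * (U + 2 * V0 + S) - B * U).
Proof.
move=> a0 a2 n0 A0 -> -> ->; rewrite -subr_ge0.
have p1 : 0 < n + al by rewrite addr_gt0.
have p2 : 0 < n + 1 + al by rewrite !addr_gt0.
have p3 : 0 < n + 2 + al by rewrite !addr_gt0.
have p4 : 0 < al + 2 by lra.
pose V := V0 + S / 2; pose u := n + al + 2; pose t := (al + 1) * (al + 2).
pose vv := 8 * (2 - al) * u * n / (al + 2) + 2 * t.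
pose sv := - (al + 1) * (2 * u - al - 2).
pose ss := 2 * u * n + t / 2.
pose lin := U + S / 2 + (3 - 4 * u / (al + 2)) * V.
set Lq := (X in 0 <= X).
have -> : Lq = A * al / (4 * (n + al) * (n + 1 + al) * (n + 2 + al)) *
    (2 * t * lin ^+ 2 + (vv * V ^+ 2 + 2 * sv * V * S + ss * S ^+ 2)).
  by rewrite /Lq /Z /lin /vv /sv /ss /V /u /t; field; rewrite !gt_eqF.
have u0 : 0 < u by rewrite /u; lra.
have t0 : 0 < t by rewrite /t mulr_gt0 //; lra.
apply: mulr_ge0; first by rewrite divr_ge0 ?mulr_ge0 // ltW.
apply: addr_ge0; first by rewrite mulr_ge0 ?sqr_ge0 // mulr_ge0 // ltW.
have v0 : 0 < u * n by rewrite mulr_gt0.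
have vv0 : 0 < vv.
  rewrite /vv; apply: ltr_wpDl; last by rewrite mulr_gt0.
  by apply: divr_ge0 (ltW p4); rewrite -mulrA; apply: mulr_ge0 (ltW v0); lra.
rewrite -(pmulr_rge0 _ vv0).
have -> : vv * (vv * V ^+ 2 + 2 * sv * V * S + ss * S ^+ 2) = (vv * V + sv * S) ^+ 2 +
   (16 * (2 - al) * (u * n) ^+ 2 / (al + 2) + 4 * (al + 1) * (3 - al) * (u * n)) * S ^+ 2.
  by rewrite /vv /sv /ss /t /u; field; rewrite !gt_eqF.
rewrite addr_ge0 ?sqr_ge0 // mulr_ge0 ?sqr_ge0 // addr_ge0 //.
  by rewrite divr_ge0 ?(ltW p4) // mulr_ge0 ?sqr_ge0 // mulr_ge0 //; lra.
by rewrite mulr_ge0 ?(ltW v0) // mulr_ge0 //; lra.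
Qed.

Variable al : R.
Hypotheses (a0 : 0 < al) (a2 : al <= 2).
Notation w := (bw al).

Section Form.
Variable c : nat -> R.
(** S, V, U are the moments of c of order 0, 1, 2 about the moving end point n. They satisfy
    first-order recursions in n, so (S, V, U) is the state on which the induction runs; D is the
    part of the form that carries the weights w (maxn i j). *)
Let S n := \sum_(j < n.+1) c j.
Let V n := \sum_(j < n.+1) c j * (n%:R - j%:R).
Let U n := \sum_(j < n.+1) c j * (n%:R - j%:R) ^+ 2.
Let D n := \sum_(i < n.+1) \sum_(j < n.+1) (i%:R - j%:R) ^+ 2 * w (maxn i j) * (c i * c j).

Let SS n : S n.+1 = S n + c n.+1. Proof. by rewrite /S big_ord_recr. Qed.
Let VS n : V n.+1 = V n + S n.
Proof.
rewrite /V /S big_ord_recr /= subrr mulr0 addr0 -big_split /=.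
by apply: eq_bigr => j _; rewrite -[n.+1%:R]natr1; ring.
Qed.
Let US n : U n.+1 = U n + 2 * V n + S n.
Proof.
rewrite /U /V /S big_ord_recr /= subrr expr0n /= mulr0 addr0 mulr_sumr -!big_split /=.
by apply: eq_bigr => j _; rewrite -[n.+1%:R]natr1; ring.
Qed.
Let DS n : D n.+1 = D n + 2 * w n.+1 * c n.+1 * U n.+1.
Proof.
have UE : U n.+1 = \sum_(j < n.+1) c j * (n.+1%:R - j%:R) ^+ 2.
  by rewrite /U big_ord_recr /= subrr expr0n /= mulr0 addr0.
rewrite /D big_ord_recr /=; under eq_bigr do rewrite big_ord_recr /=.
rewrite big_split /= -!addrA; congr (_ + _).
rewrite [X in _ + X]big_ord_recr /= subrr expr0n /= !mul0r addr0 UE.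
rewrite -big_split mulr_sumr /=; apply: eq_bigr => j _.
have jn : (j <= n.+1)%N by rewrite ltnW.
by rewrite (maxn_idPr jn) (maxn_idPl jn) bwS; ring.
Qed.

(** Induction on a stronger bound: the difference of the two sides dominates [Z] at the current
    moments, and [Z_ge0] concludes. The base case m = 0 reduces to al (3 - al) >= 0. *)
Lemma form_ge0 n : D n <= 2 * w n * S n * U n.
Proof.
suff h m : Z (w m) (w m.+1) (w m.+2) (V m.+1) (U m.+1) <= 2 * w m.+1 * S m.+1 * U m.+1 - D m.+1.
  case: n => [|n].
    by rewrite /D /U !big_ord1 subrr expr0n /= !mul0r !mulr0.
  rewrite -subr_ge0; apply: le_trans (h n); apply: (@Z_ge0 al n.+1%:R); rewrite ?natr1 //; exact: ltW (bw_gt0 n a0).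
elim: m => [|m IH].
  have S1 : S 1 = c 0 + c 1 by rewrite /S !big_ord_recl big_ord0 addr0.
  have U1 : U 1 = c 0.
    by rewrite /U !big_ord_recl big_ord0 /= addr0 subrr subr0 expr0n expr1n /= mulr0 addr0 mulr1.
  have V1 : V 1 = c 0.
    by rewrite /V !big_ord_recl big_ord0 /= addr0 subrr subr0 mulr0 addr0 mulr1.
  have D0 : D 0 = 0 by rewrite /D !big_ord1 subrr expr0n /= !mul0r.
  rewrite DS D0 S1 U1 V1 /Z !bwS /= add0r !mul1r.
  rewrite -subr_ge0; set x := (X in 0 <= X).
  have a1 : 0 < 1 + al by rewrite addr_gt0.
  have a3 : 0 < 2 + al by rewrite addr_gt0.
  have -> : x = al * (3 - al) / (2 * (1 + al) * (2 + al)) * c 0 ^+ 2.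
    by rewrite /x; field; rewrite !gt_eqF.
  rewrite mulr_ge0 ?sqr_ge0 // divr_ge0 // ?mulr_ge0 ?ltW //.
  by rewrite subr_gt0 (le_lt_trans a2) // ltr_nat.
have E2 : m.+1%:R + 1 = m.+2%:R :> R by rewrite natr1.
have E3 : m.+1%:R + 2 = m.+3%:R :> R by rewrite -natrD addn2.
have := @Z_step al m.+1%:R (w m) (w m.+1) (w m.+2) (w m.+3) (S m.+1) (V m.+1) (U m.+1) a0 a2 (ltr0Sn _ _)
  (ltW (bw_gt0 m a0)).
rewrite E2 E3 => /(_ erefl erefl erefl); rewrite -VS -US (SS m.+1) (DS m.+1); move: IH.
move: (S m.+1) (c m.+2) (U m.+2) (U m.+1) (D m.+1) (w m.+2) (w m.+1) (Z _ _ _ _ _) (Z _ _ _ _ _) => s x u u' d w1 w2 z z'.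
by lra.
Qed.

End Form.

(** Reading the indices backwards turns w (m - minn k l) into w (maxn i j) and k^2 into (m - i)^2,
    which is the setting of [form_ge0]. *)
Lemma form_ge0' (x : nat -> R) m :
  0 <= \sum_(k < m.+1) \sum_(l < m.+1)
    ((k%:R ^+ 2 + l%:R ^+ 2) * w m - (k%:R - l%:R) ^+ 2 * w (m - minn k l)) * (x k * x l).
Proof.
have := form_ge0 (fun i => x (m - i)%N) m; rewrite -subr_ge0.
have rev (F : nat -> R) : \sum_(j < m.+1) F j = \sum_(j < m.+1) F (m - j)%N.
  by rewrite (reindex_inj rev_ord_inj) /=; apply: eq_bigr => j _; rewrite subSS.
congr (0 <= _).
rewrite (rev (fun i => \sum_(l < m.+1) ((i%:R ^+ 2 + l%:R ^+ 2) * w m - (i%:R - l%:R) ^+ 2 * w (m - minn i l)) * (x i * x l))).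
have E (i j : 'I_m.+1) : (m - minn (m - i) (m - j) = maxn i j)%N.
  have := ltn_ord i; have := ltn_ord j; rewrite !ltnS => hj hi.
  have [ij|ij] := leqP i j.
    by rewrite (minn_idPr _) ?leq_sub2l // subKn // ?(maxn_idPr _).
  by rewrite (minn_idPl _) ?leq_sub2l ?(ltnW ij) // subKn // (maxn_idPl _) // ltnW.
transitivity (\sum_(i < m.+1) \sum_(j < m.+1) (((m%:R - i%:R) ^+ 2 + (m%:R - j%:R) ^+ 2) * w m
   - (i%:R - j%:R) ^+ 2 * w (maxn i j)) * (x (m - i)%N * x (m - j)%N)); last first.
  apply: eq_bigr => i _; rewrite (rev (fun l => ((_%:R ^+ 2 + l%:R ^+ 2) * w m - (_%:R - l%:R) ^+ 2 * w (m - minn _ l)) * (_ * x l))).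
  apply: eq_bigr => j _; have [hi hj] : (i <= m)%N /\ (j <= m)%N by split; rewrite -ltnS.
  rewrite E (natrB _ hi) (natrB _ hj).
  by congr ((_ - _ * _) * _); ring.
have -> : 2 * w m * (\sum_(j < m.+1) x (m - j)%N) * (\sum_(j < m.+1) x (m - j)%N * (m%:R - j%:R) ^+ 2) =
  \sum_(i < m.+1) \sum_(j < m.+1) ((m%:R - i%:R) ^+ 2 + (m%:R - j%:R) ^+ 2) * w m * (x (m - i)%N * x (m - j)%N).
  transitivity (\sum_(i < m.+1) \sum_(j < m.+1) (m%:R - i%:R) ^+ 2 * w m * (x (m - i)%N * x (m - j)%N) +
     \sum_(i < m.+1) \sum_(j < m.+1) (m%:R - j%:R) ^+ 2 * w m * (x (m - i)%N * x (m - j)%N)).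
    rewrite [X in X + _]exchange_big /=.
    have -> : \sum_(j < m.+1) \sum_(i < m.+1) (m%:R - i%:R) ^+ 2 * w m * (x (m - i)%N * x (m - j)%N) =
       \sum_(i < m.+1) \sum_(j < m.+1) (m%:R - j%:R) ^+ 2 * w m * (x (m - i)%N * x (m - j)%N).
      by apply: eq_bigr => i _; apply: eq_bigr => j _; ring.
    rewrite -mulr2n -[RHS]mulr_natl -[LHS]mulrA -[LHS]mulrA; congr (2 * _).
    rewrite mulrCA mulr_suml; apply: eq_bigr => i _; rewrite !mulr_sumr.
    by apply: eq_bigr => j _; ring.
  rewrite -big_split; apply: eq_bigr => i _; rewrite -big_split; apply: eq_bigr => j _ /=; ring.
rewrite -sumrB; apply: eq_bigr => i _; rewrite -sumrB; apply: eq_bigr => j _; ring.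
Qed.

End WeightForm.

Section MoreSums.
Context {R : realType}.

Lemma ssum_sum (f : nat -> nat -> R) K : (forall k, asum (f k)) ->
  asum (fun n => \sum_(k < K) f k n) /\
  ssum (fun n => \sum_(k < K) f k n) = \sum_(k < K) ssum (f k).
Proof.
move=> hf; elim: K => [|K [IH1 IH2]].
  split; first by apply: (eq_asum (@asum0 R)) => n; rewrite big_ord0.
  by rewrite big_ord0 -[RHS](@ssum0 R); apply: eq_ssum => n; rewrite big_ord0.
have E n : \sum_(k < K) f k n + f K n = \sum_(k < K.+1) f k n by rewrite big_ord_recr.
split; first by apply: (eq_asum (asumD IH1 (hf K))) => n; rewrite E.
by rewrite big_ord_recr /= -IH2 -ssumD //; apply: eq_ssum => n; rewrite E.
Qed.

Lemma asum_unshift (f : nat -> R) k : asum (fun j => f (k + j)%N) -> asum f.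
Proof.
elim: k f => [//|k IH] f h; apply: asum_recl; apply: IH.
by apply: (eq_asum h) => j; rewrite addSn.
Qed.

Lemma sum_supp (F : nat -> R) K J : (forall k, (K <= k)%N || (J <= k)%N -> F k = 0) ->
  \sum_(k < K) F k = \sum_(k < J) F k.
Proof.
move=> h; rewrite -(@ssum_fin _ F K) ?(@ssum_fin _ F J) // => k hk; apply: h; rewrite hk ?orbT //.
Qed.

End MoreSums.

(** * The contraction inequality for orthogonal expansions *)

Section Contractivity.
Context {R : realType}.
Notation C := (R[i]).
Notation Re := (@complex.Re R).
Notation Im := (@complex.Im R).
Notation V := (nat -> C^o).
Variable al : R.
Hypotheses (a0 : 0 < al) (a2 : al <= 2).
Notation w := (bw al).
Notation H := (l2w w : set V).
Notation T := (@sshift R).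
Implicit Types u v x : V.

Let hw n : 0 < w n. Proof. exact: bw_gt0. Qed.

Lemma l2_shift u : H u -> H (T u).
Proof. by apply: l2w_shift => n; rewrite (ltW (hw _)); apply: bw_le. Qed.
Lemma l2_iter k u : H u -> H (iter k T u).
Proof. by move=> hu; elim: k => //= k; exact: l2_shift. Qed.

Lemma iter_sshift k u n : iter k T u n = if (k <= n)%N then u (n - k)%N else 0.
Proof.
by elim: k n => [|k IH] [|n] //=; rewrite IH.
Qed.

Lemma iter_lin k (a : C) u v : iter k T (a *: u + v) = a *: iter k T u + iter k T v.
Proof.
apply/funext => n.
have -> : (a *: iter k T u + iter k T v) n = a * iter k T u n + iter k T v n by [].
by rewrite !iter_sshift; case: ifP => // _; rewrite mulr0 addr0.
Qed.

Lemma iter_sshift0 k : iter k T 0 = 0.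
Proof. by apply/funext => n; rewrite iter_sshift; case: ifP. Qed.

Lemma iterZ k (a : C) u : iter k T (a *: u) = a *: iter k T u.
Proof. by have := iter_lin k a u 0; rewrite iter_sshift0 !addr0. Qed.

Section Deriv.
Variables (y : nat -> V) (K : nat).
Hypotheses (Hy : forall k, H (y k)) (y0 : forall k, (K <= k)%N -> y k = 0).
Hypothesis orth : forall k l, (k < l)%N -> dot w (y k) (iter (l - k) T (y l)) = 0.

Let x k n : C := iter k T (y k) n.
Let g k l n : R := Re (x k n * (x l n)^*).

Let x0 k n : (K <= k)%N || (n < k)%N -> x k n = 0.
Proof.
rewrite /x iter_sshift; case/orP => [/y0 ->|]; first by case: ifP.
by rewrite ltnNge => /negbTE ->.
Qed.

Let gC k l n : g k l n = g l k n.
Proof. by rewrite /g !Re_mulJ; ring. Qed.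

Let g0 k l n : x k n = 0 -> g k l n = 0.
Proof. by rewrite /g => ->; rewrite mul0r. Qed.

(** Reading the series from index k on undoes the common shift T^k; the terms below k vanish. *)
Let o_le k l : (k <= l)%N -> asum (fun n => w (n - k) * g k l n) /\
  ssum (fun n => w (n - k) * g k l n) = dot w (y k) (iter (l - k) T (y l)).
Proof.
move=> kl; have E j : w j * Re (y k j * (iter (l - k) T (y l) j)^*) = w (k + j - k) * g k l (k + j).
  rewrite addKn /g /x !iter_sshift leq_addr addKn.
  by rewrite leq_subLR; case: ifP => // h; rewrite subnBA // [(j + k)%N]addnC.
have A : asum (fun n => w (n - k) * g k l n).
  apply: (@asum_unshift _ _ k).
  have h := asum_dot hw (@Hy k) (@l2_iter (l - k) _ (@Hy l)).
  by apply: (eq_asum h) => j; rewrite E.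
split => //; rewrite (ssum_split k A) big1 ?add0r; first by apply: eq_ssum => j; rewrite -E.
by move=> i _; rewrite g0 ?mulr0 // x0 // ltn_ord orbT.
Qed.

Let o_min k l : asum (fun n => w (n - minn k l) * g k l n) /\
  (k != l -> ssum (fun n => w (n - minn k l) * g k l n) = 0).
Proof.
wlog kl : k l / (k <= l)%N => [hwl|].
  case/orP: (leq_total k l) => [kl|lk]; first exact: hwl.
  have [h1 h2] := hwl l k lk; rewrite minnC eq_sym.
  by split => [|/h2 <-]; [apply: (eq_asum h1) => n|apply: eq_ssum => n]; rewrite gC.
rewrite (minn_idPl kl); have [h1 h2] := o_le kl; split => // nkl.
by rewrite h2 orth // ltn_neqAle nkl.
Qed.

(** By [orth] the terms with (k - l)^2 w (n - minn k l) vanish for k <> l after summation over n, so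
    the double sum equals the series of the [f k l n]. For each fixed n, [form_ge0'] applies to the
    real and to the imaginary parts of the coefficients. *)
Lemma contract_deriv : 0 <= \sum_(k < K) \sum_(l < K)
  (k%:R ^+ 2 + l%:R ^+ 2) * dot w (iter k T (y k)) (iter l T (y l)).
Proof.
pose f k l n := ((k%:R ^+ 2 + l%:R ^+ 2) * w n - (k%:R - l%:R) ^+ 2 * w (n - minn k l)) * g k l n.
have hg k l : asum (fun n => w n * g k l n).
  have h := asum_dot hw (@l2_iter k _ (@Hy k)) (@l2_iter l _ (@Hy l)).
  by apply: h.
have hf k l : asum (f k l) /\ ssum (f k l) =
    (k%:R ^+ 2 + l%:R ^+ 2) * dot w (iter k T (y k)) (iter l T (y l)).
  have [h1 h2] := o_min k l.
  have A1 := @asumZ _ (k%:R ^+ 2 + l%:R ^+ 2) _ (hg k l).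
  have A2 := @asumZ _ ((k%:R - l%:R) ^+ 2) _ h1.
  have E n : (k%:R ^+ 2 + l%:R ^+ 2) * (w n * g k l n) - (k%:R - l%:R) ^+ 2 * (w (n - minn k l) * g k l n) = f k l n.
    by rewrite /f; ring.
  split; first by apply: (eq_asum (asumB A1 A2)) => n; rewrite E.
  rewrite -(eq_ssum E) ssumB // !ssumZ //; have [->|kl] := eqVneq k l.
    by rewrite subrr expr0n /= mul0r subr0.
  by rewrite h2 // mulr0 subr0.
have hs k := ssum_sum K (fun l => (hf k l).1).
have [h1 h2] := ssum_sum K (fun k => (hs k).1).
have -> : \sum_(k < K) \sum_(l < K) (k%:R ^+ 2 + l%:R ^+ 2) * dot w (iter k T (y k)) (iter l T (y l)) =
    ssum (fun n => \sum_(k < K) \sum_(l < K) f k l n).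
  by rewrite h2; apply: eq_bigr => k _; rewrite (hs k).2; apply: eq_bigr => l _; rewrite (hf k l).2.
apply: ssum_ge0 => // n.
have f0 k l : (K <= k)%N || (n < k)%N -> f k l n = 0.
  by move=> h; rewrite /f g0 ?mulr0 // x0.
have f0' k l : (K <= l)%N || (n < l)%N -> f k l n = 0.
  by move=> h; rewrite /f gC g0 ?mulr0 // x0.
(* At index n only k, l <= n contribute, so both sums may run up to n, the range of [form_ge0']. *)
rewrite (@sum_supp _ (fun k => \sum_(l < K) f k l n) K n.+1); last first.
  by move=> k h; rewrite big1 // => l _; rewrite f0.
under eq_bigr => k _ do rewrite (@sum_supp _ (fun l => f k l n) K n.+1 (f0' k)).
have := addr_ge0 (form_ge0' a0 a2 (fun k => Re (x k n)) n) (form_ge0' a0 a2 (fun k => Im (x k n)) n).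
rewrite -big_split /=; congr (0 <= _); apply: eq_bigr => k _; rewrite -big_split /=.
by apply: eq_bigr => l _; rewrite -mulrDr /f /g Re_mulJ.
Qed.

End Deriv.

Lemma H_sum n (u : nat -> V) : (forall k, H (u k)) -> H (\sum_(k < n) u k).
Proof. by move=> hu; apply: (lin_closed_sum (lin_closedH hw)). Qed.

Lemma dot_suml n (u : nat -> V) v : (forall k, H (u k)) -> H v ->
  dot w (\sum_(k < n) u k) v = \sum_(k < n) dot w (u k) v.
Proof.
move=> hu hv; elim: n => [|n IH].
  rewrite !big_ord0 -[RHS](@ssum0 R); apply: eq_ssum => n.
  by have -> : (0 : V) n = 0 by []; rewrite mul0r mulr0.
by rewrite !big_ord_recr /= (dotDl hw) ?IH //; exact: H_sum.
Qed.

Lemma dot_sum n (u : nat -> V) : (forall k, H (u k)) ->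
  dot w (\sum_(k < n) u k) (\sum_(k < n) u k) = \sum_(k < n) \sum_(l < n) dot w (u k) (u l).
Proof.
move=> hu; have hs := @H_sum n _ hu; rewrite dot_suml //; apply: eq_bigr => k _.
by rewrite dotC dot_suml //; apply: eq_bigr => l _; rewrite dotC.
Qed.

(** The left side is a polynomial in r. Its derivative at s, multiplied by s to restore the
    exponents k^2 + l^2, is the sum in [contract_deriv] for the rescaled vectors s^(k^2) y_k, whose
    orthogonality is inherited. *)
Lemma sshift_contract (y : nat -> V) K r : (forall k, H (y k)) -> (forall k, (K <= k)%N -> y k = 0) ->
  (forall k l, (k < l)%N -> dot w (y k) (iter (l - k) T (y l)) = 0) -> 0 <= r <= 1 ->
  dot w (\sum_(k < K) (r ^+ (k ^ 2))%:C *: iter k T (y k)) (\sum_(k < K) (r ^+ (k ^ 2))%:C *: iter k T (y k))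
   <= dot w (\sum_(k < K) iter k T (y k)) (\sum_(k < K) iter k T (y k)).
Proof.
move=> Hy y0 orth /andP[r0 r1].
pose A k l := dot w (iter k T (y k)) (iter l T (y l)).
pose p : {poly R} := \sum_(k < K) \sum_(l < K) A k l *: 'X^(k ^ 2 + l ^ 2).
have HT k : H (iter k T (y k)) by exact: l2_iter.
have pE s : dot w (\sum_(k < K) (s ^+ (k ^ 2))%:C *: iter k T (y k))
    (\sum_(k < K) (s ^+ (k ^ 2))%:C *: iter k T (y k)) = p.[s].
  rewrite (@dot_sum K (fun k => (s ^+ (k ^ 2))%:C *: iter k T (y k))); last first.
    by move=> k; exact: (l2wZ hw).
  rewrite /p horner_sum; apply: eq_bigr => k _; rewrite horner_sum; apply: eq_bigr => l _.
  rewrite (dotZl hw) //; last exact: (l2wZ hw).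
  by rewrite (dotZr hw) // hornerZ hornerXn exprD /A; ring.
have -> : \sum_(k < K) iter k T (y k) = \sum_(k < K) ((1 : R) ^+ (k ^ 2))%:C *: iter k T (y k).
  by apply: eq_bigr => k _; rewrite expr1n scale1r.
rewrite !pE; apply: (@polyrcf.ler_hornerW R 0 1 p); rewrite ?in_itv /= ?r0 ?r1 ?ler01 ?lexx //.
move=> s; rewrite in_itv /= => /andP[s0 s1].
rewrite -(pmulr_rge0 _ s0).
pose y' k : V := (s ^+ (k ^ 2))%:C *: y k.
have Hy' k : H (y' k) by exact: (l2wZ hw).
have y'0 k : (K <= k)%N -> y' k = 0 by move=> /y0; rewrite /y' => ->; rewrite scaler0.
have orth' k l : (k < l)%N -> dot w (y' k) (iter (l - k) T (y' l)) = 0.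
  move=> kl; have hi := @l2_iter (l - k) _ (Hy l).
  by rewrite /y' iterZ (dotZl hw) ?(dotZr hw) ?orth ?mulr0 //; exact: (l2wZ hw).
have := contract_deriv Hy' y'0 orth'; congr (0 <= _).
rewrite /p raddf_sum /= horner_sum mulr_sumr; apply: eq_bigr => k _.
rewrite raddf_sum /= horner_sum mulr_sumr; apply: eq_bigr => l _.
rewrite derivZ derivXn hornerZ hornerMn hornerXn mulrnAr /y' !iterZ (dotZl hw) //; last exact: (l2wZ hw).
rewrite (dotZr hw) // -/(A k l) -[X in s * X]mulr_natr.
have -> : k%:R ^+ 2 + l%:R ^+ 2 = (k ^ 2 + l ^ 2)%:R :> R by rewrite natrD !natrX.
have [->|h] := posnP (k ^ 2 + l ^ 2); first by rewrite mulr0 mulr0 mul0r.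
have E : s * s ^+ (k ^ 2 + l ^ 2).-1 = s ^+ (k ^ 2) * s ^+ (l ^ 2) by rewrite -exprS prednK // exprD.
move: E; move: (s ^+ (k ^ 2)) (s ^+ (l ^ 2)) (s ^+ (k ^ 2 + l ^ 2).-1) ((k ^ 2 + l ^ 2)%:R : R) => X Y Z N E.
by transitivity (N * A k l * (s * Z)); [rewrite E|]; ring.
Qed.

End Contractivity.

Section SpanClosed.
Context {R : realType}.

Lemma lin_closed_span (V : lmodType R[i]) (A : set V) : lin_closed (lin_span A).
Proof.
split; first by exists 0%N, (fun=> 0), (fun=> 0); split; [case|rewrite big_ord0].
move=> a _ _ [n [b [u [uA ->]]]] [m [c [v [vA ->]]]].
exists (n + m)%N, (fun i => match fintype.split i with inl j => a * b j | inr j => c j end),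
  (fun i => match fintype.split i with inl j => u j | inr j => v j end); split.
  by move=> i; case: (fintype.split i) => j.
rewrite big_split_ord /= scaler_sumr; congr (_ + _); apply: eq_bigr => j _.
  by rewrite (unsplitK (inl j)) scalerA.
by rewrite (unsplitK (inr j)).
Qed.

Lemma lin_span_in (V : lmodType R[i]) (A : set V) v : A v -> lin_span A v.
Proof.
by move=> Av; exists 1%N, (fun=> 1), (fun=> v); split => //; rewrite big_ord1 scale1r.
Qed.

(** A Bernoulli-type bound (1 - x)^n <= 1 / (1 + n x), used with n = N^2 and x = 1 / (N + 1). *)
Lemma exp1m_le (x : R) n : 0 <= x <= 1 -> (1 - x) ^+ n * (1 + n%:R * x) <= 1.
Proof.
move=> /andP[x0 x1]; elim: n => [|n IH]; first by rewrite expr0 mul0r addr0 mul1r.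
apply: le_trans IH; rewrite exprS -mulrA mulrCA ler_wpM2l ?exprn_ge0 ?subr_ge0 //.
by rewrite -[n.+1%:R]natr1; have n0 : 0 <= n%:R :> R by []; nra.
Qed.

End SpanClosed.

(** * The Beurling-type theorem for al <= 2 *)

Section BeurlingLe.
Context {R : realType}.
Notation C := (R[i]).
Notation Re := (@complex.Re R).
Notation Im := (@complex.Im R).
Notation V := (nat -> C^o).
Variable al : R.
Hypotheses (a0 : 0 < al).
Notation w := (bw al).
Notation H := (l2w w : set V).
Notation T := (@sshift R).
Notation closedM := (closed_subspace H (lip w)).

Let hw n : 0 < w n. Proof. exact: bw_gt0. Qed.

(** N is a complex subspace, so orthogonality for the real form may be tested on i u as well. *)
Lemma lip_eq0 (e : V) (N : set V) : H e -> N `<=` H -> lin_closed N ->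
  (forall u, N u -> dot w e u = 0) -> forall u, N u -> lip w e u = 0.
Proof.
move=> He NH lN h u Nu; apply: C_eq => /=; first exact: h.
rewrite -(h ('i *: u)); last exact: lin_closedZ.
apply: eq_ssum => n; have -> : ('i *: u) n = 'i * u n by [].
by congr (_ * _); rewrite !Re_mulJ !cReM !cImM /=; ring.
Qed.

(** T is bounded below, as w_n <= (1 + al) w_(n + 1). A limit y of points of T M therefore vanishes
    at index 0, and its backward shift is a limit of points of M. *)
Lemma sshift_closed (M : set V) : closedM M -> closedM (T @` M).
Proof.
move=> cM; have [MH M0 Ml Mc] := cM.
split; first by move=> _ [u Mu <-]; apply: l2_shift => //; exact: MH.
- by exists 0 => //; apply/funext => -[].
- move=> a _ _ [u Mu <-] [v Mv <-]; exists (a *: u + v); first exact: Ml.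
  by have := @iter_lin R 1 a u v.
move=> y [Hy hy]; pose y' : V := fun n => y n.+1.
have wS n : w n <= (1 + al) * w n.+1.
  rewrite bwS mulrA ler_pdivlMr; last by rewrite addr_gt0.
  rewrite mulrCA ler_pM2l //.
  have n1 : 1 <= n.+1%:R :> R by rewrite ler1n.
  by have := a0; move: (al) (n.+1%:R : R) n1 => b m; nra.
have nrm u : H u -> y 0%N = 0 -> H y' -> dot w (y' - u) (y' - u) <= (1 + al) * dot w (y - T u) (y - T u).
  move=> Hu y0 Hy'; rewrite !dotE -ssumZ; last exact: (l2wB hw Hy (l2_shift a0 Hu)).
  have A1 := l2wB hw Hy' Hu; have A2 := @asumZ _ (1 + al) _ (l2wB hw Hy (l2_shift a0 Hu)).
  rewrite [leRHS]ssum_recl // -[leLHS]add0r lerD //.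
    by rewrite !mulr_ge0 ?nsq_ge0 ?(ltW (hw _)) // addr_ge0 // ltW.
  apply: ssum_le => //; first exact: asumS A2.
  by move=> n; rewrite mulrA ler_wpM2r ?nsq_ge0.
have Hy' : H y'.
  apply: asum_le (@asumZ _ (1 + al) _ (asumS Hy)) => n.
  by rewrite ger0_norm ?mulr_ge0 ?nsq_ge0 ?(ltW (hw _)) // mulrA ler_wpM2r ?nsq_ge0.
have dist e : 0 < e -> exists2 u, M u & dot w (y - T u) (y - T u) <= e.
  move=> e0; have e1 : 0 < Num.sqrt e by rewrite sqrtr_gt0.
  have [_ [u Mu <-] h] := hy _ e1; exists u => //.
  have Hd := dot_ge0 hw (l2wB hw Hy (l2_shift a0 (MH _ Mu))).
  by move: h; rewrite ip_norm_lip ltr_sqrt // => /ltW.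
have y0 : y 0%N = 0.
  apply: nsq_eq0; apply/eqP; rewrite eq_le nsq_ge0 andbT; apply/ler_addgt0Pr => e e0; rewrite add0r.
  have [u Mu h] := dist e e0; apply: le_trans h.
  have := dot_coef hw 0 (l2wB hw Hy (l2_shift a0 (MH _ Mu))).
  by rewrite mul1r (_ : (y - T u) 0%N = y 0%N - 0) // subr0.
exists y'; last by apply/funext => -[].
apply: (closed_lim cM Hy') => e e0.
have a1 : 0 < 1 + al by rewrite addr_gt0.
have [u Mu h] := dist (e / (1 + al)) (divr_gt0 e0 a1); exists u => //.
apply: le_trans (nrm u (MH _ Mu) y0 Hy') _.
by rewrite mulrC -ler_pdivlMr.
Qed.

Hypothesis a2 : al <= 2.

Section Orthogonal.
Variables (M : set V) (v : V).
Hypotheses (cM : closedM M) (TM : T @` M `<=` M) (Mv : M v).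
Let E := ominus (lip w) M (T @` M).
Hypothesis vE : forall k e, E e -> dot w v (iter k T e) = 0.

Let MH : M `<=` H. Proof. by case: cM. Qed.
Let lM : lin_closed M. Proof. by case: cM. Qed.
Let iM k u : M u -> M (iter k T u).
Proof. by move=> Mu; elim: k => //= k IH; apply: TM; exists (iter k T u). Qed.

(** The membership hypothesis stands under the quantifier, with value 0 off M, so that [choice]
    yields a total function that can be iterated. *)
Let dec x : exists x', M x -> M x' /\ E (x - T x').
Proof.
have [Mx|nMx] := pselect (M x); last by exists 0.
have cT := sshift_closed cM; have [TH T0 Tl _] := cT.
have lT : lin_closed (T @` M) by split.
have [_ [x' Mx' <-] h] := projection hw cT (MH Mx); exists x' => _; split => //.
have Mz : M (x - T x') by apply: lin_closedB => //; apply: TM; exists x'.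
split => //; exact: (lip_eq0 (MH Mz)).
Qed.

Lemma wandering_orth : v = 0.
Proof.
have [nxt nP] := choice dec.
pose xs k := iter k nxt v.
have Mxs k : M (xs k) by elim: k => //= k /nP[].
pose es k := xs k - T (xs k.+1).
have Ees k : E (es k) by have [] := nP _ (Mxs k).
have Mes k : M (es k) by case: (Ees k).
have Hxs k := MH (Mxs k); have Hes k := MH (Mes k).
have Hv := MH Mv.
have dv N : v = \sum_(k < N) iter k T (es k) + iter N T (xs N).
  elim: N => [|N IH]; first by rewrite big_ord0 add0r.
  have E1 : iter N T (xs N) = iter N T (es N) + iter N.+1 T (xs N.+1).
    have := @iter_lin R N 1 (es N) (T (xs N.+1)); rewrite !scale1r -iterSr => <-.
    by rewrite subrK.
  by rewrite big_ord_recr -addrA -E1.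
pose D := dot w v v.
(* The finite list e_0, ..., e_(N - 1), x_N, followed by zeros. The last entry lies in M, which is
   enough for its shifts to be orthogonal to every earlier e_k. *)
pose ys N k : V := if (k < N)%N then es k else if k == N then xs N else 0.
have Mys N k : M (ys N k).
  by rewrite /ys; case: ifP => // _; case: ifP => // _; case: lM.
have Hys N k := MH (Mys N k).
have ys0 N k : (N.+1 <= k)%N -> ys N k = 0.
  by move=> h; rewrite /ys ltnNge (ltnW h) /= gtn_eqF.
have orth N k l : (k < l)%N -> dot w (ys N k) (iter (l - k) T (ys N l)) = 0.
  move=> kl; have [lN|Nl] := leqP l N; last first.
    rewrite (ys0 N l) // iter_sshift0 dotC -[RHS](@ssum0 R); apply: eq_ssum => n.
    by have -> : (0 : V) n = 0 by []; rewrite mul0r mulr0.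
  rewrite {1}/ys (leq_trans kl lN) /=.
  have [_ h] := Ees k; have := h (iter (l - k) T (ys N l)).
  move=> /(_ _)/(congr1 Re) /= -> //.
  by rewrite -(prednK (_ : 0 < l - k)%N) ?subn_gt0 //=; exists (iter (l - k).-1 T (ys N l)) => //; apply: iM.
pose r N : R := 1 - N.+1%:R^-1.
have r01 N : 0 <= r N <= 1.
  rewrite /r subr_ge0 invf_le1 ?ltr0Sn // ler1n /=.
  by rewrite lerBlDr lerDl invr_ge0.
pose u N : V := \sum_(k < N.+1) (r N ^+ (k ^ 2))%:C *: iter k T (ys N k).
have Hu N : H (u N).
  apply: (@H_sum R al a0 _ (fun k => (r N ^+ (k ^ 2))%:C *: iter k T (ys N k))) => k.
  by apply: (l2wZ hw); exact: l2_iter.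
have uN N : dot w (u N) (u N) <= D.
  have := @sshift_contract _ _ a0 a2 (ys N) N.+1 (r N) (@Hys N) (@ys0 N) (@orth N) (r01 N).
  suff <- : v = \sum_(k < N.+1) iter k T (ys N k) by [].
  rewrite {1}(dv N) big_ord_recr /= {2}/ys ltnn eqxx; congr (_ + _).
  by apply: eq_bigr => k _; rewrite /ys ltn_ord.
have orthv N k : (k < N)%N -> dot w (iter k T (ys N k)) v = 0.
  by move=> kN; rewrite dotC /ys kN vE.
have Hit N k : H (iter k T (ys N k)) by exact: l2_iter.
(* Every T^k e_k is orthogonal to v; only the remainder pairs with v, and it does so like v
   itself. *)
have uv N : dot w (u N) v = r N ^+ (N ^ 2) * D.
  rewrite (@dot_suml R al a0 _ (fun k => (r N ^+ (k ^ 2))%:C *: iter k T (ys N k))) //; last first.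
    by move=> k; exact: (l2wZ hw).
  rewrite big_ord_recr big1 /=; last by move=> k _; rewrite (dotZl hw) // orthv ?mulr0.
  rewrite add0r (dotZl hw) // /ys ltnn eqxx; congr (_ * _).
  rewrite /D {2}(dv N) (dotDl hw) //; last 2 first.
  - by apply: (@H_sum R al a0 _ (fun k => iter k T (es k))) => k; exact: l2_iter.
  - exact: l2_iter.
  rewrite (@dot_suml R al a0 _ (fun k => iter k T (es k))) //; last by move=> k; exact: l2_iter.
  by rewrite big1 ?add0r // => k _; rewrite dotC vE.
apply: (dot_eq0 hw Hv); rewrite -/D leNgt; apply/negP => D0.
(* The budget: cutting v off at m costs D / 16. For large N, <u, z> is then at least 15 D / 16 - D /
   4 and |<u, v - z>| is at most D / 4, whereas the two add up to at most D / 8. *)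
have D16 : 0 < D / 16 by rewrite divr_gt0.
have [m tm] : exists m, ssum (fun k => w (m + k)%N * nsq (v (m + k)%N)) <= D / 16.
  have /cvgrPdist_le /(_ _ D16)[m _ hm] := ssum_tail Hv.
  exists m; have := hm m (leqnn m); rewrite sub0r normrN; apply: le_trans; exact: ler_norm.
pose z : V := fun n => if (n < m)%N then v n else 0.
have Hz : H z by apply: (@asum_fin _ _ m) => k mk; rewrite /z ltnNge mk /= nsq0 mulr0.
have Hvz := l2wB hw Hv Hz.
have vz : dot w (v - z) (v - z) <= D / 16.
  rewrite dotE (ssum_split m Hvz) big1 ?add0r; last first.
    move=> k _; have -> : (v - z) k = v k - z k by [].
    by rewrite /z ltn_ord subrr nsq0 mulr0.
  rewrite (@eq_ssum _ _ (fun k => w (m + k)%N * nsq (v (m + k)%N))) // => k.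
  have -> : (v - z) (m + k)%N = v (m + k)%N - z (m + k)%N by [].
  by rewrite /z ltnNge leq_addr /= subr0.
have vz0 : D - D / 16 <= \sum_(n < m) w n * nsq (v n).
  by have := tm; rewrite /D dotE (ssum_split m Hv); move: (ssum _) => s; lra.
pose c k n : C := iter k T (es k) n.
pose q N : R := \sum_(n < m) w n * \sum_(k < n.+1) r N ^+ (k ^ 2) * Re (c k n * (v n)^*).
have rc : r N @[N --> \oo] --> (1 : R).
  rewrite -[X in _ --> X]subr0; apply: cvgB; first exact: cvg_cst.
  exact: (@cvg_harmonic R).
(* T^(n + 1) x_(n + 1) has no coefficient at index n, so the coefficient of v there involves only
   e_0, ..., e_n and not N. *)
have vn n : v n = \sum_(k < n.+1) c k n.
  have -> : v n = (\sum_(k < n.+1) iter k T (es k) + iter n.+1 T (xs n.+1)) n by rewrite -dv.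
  have -> : (\sum_(k < n.+1) iter k T (es k) + iter n.+1 T (xs n.+1)) n =
    (\sum_(k < n.+1) iter k T (es k)) n + iter n.+1 T (xs n.+1) n by [].
  by rewrite iter_sshift ltnn addr0 fct_sumE.
have qc : q N @[N --> \oo] --> \sum_(n < m) w n * nsq (v n).
  have -> : \sum_(n < m) w n * nsq (v n) = \sum_(n < m) w n * \sum_(k < n.+1) 1 * Re (c k n * (v n)^*).
    apply: eq_bigr => n _; congr (_ * _); rewrite -Re_mulJJ {1}vn mulr_suml cRe_sum.
    by apply: eq_bigr => k _; rewrite mul1r.
  apply: cvg_big => [|n _]; [exact: add_continuous|apply: cvgMr].
  apply: cvg_big => [|k _]; [exact: add_continuous|apply: cvgMl].
  rewrite -[X in _ --> X](expr1n _ (k ^ 2)).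
  exact: (@cvg_comp _ _ _ _ (fun x : R => x ^+ (k ^ 2)) _ _ _ rc (@exprn_continuous _ _ _)).
have uz N : (m <= N)%N -> dot w (u N) z = q N.
  move=> mN; rewrite /dot (@ssum_fin _ _ m); last first.
    by move=> k mk; rewrite /z ltnNge mk /= conjC0 mulr0 mulr0.
  apply: eq_bigr => n _; congr (_ * _); rewrite /z ltn_ord.
  have -> : u N n = \sum_(k < n.+1) (r N ^+ (k ^ 2))%:C * c k n.
    rewrite /u fct_sumE; have nN : (n.+1 <= N.+1)%N by rewrite ltnS (leq_trans (ltnW (ltn_ord n))).
    rewrite (big_ord_widen _ (fun k => (r N ^+ (k ^ 2))%:C * c k n) nN) [RHS]big_mkcond /=.
    apply: eq_bigr => k _.
    have -> : ((r N ^+ (k ^ 2))%:C *: iter k T (ys N k)) n = (r N ^+ (k ^ 2))%:C * iter k T (ys N k) n by [].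
    rewrite ltnS /c !iter_sshift; case: ifP => [kn|]; last by rewrite mulr0.
    by rewrite /ys (leq_ltn_trans kn) // (leq_trans (ltn_ord n)).
  rewrite mulr_suml cRe_sum; apply: eq_bigr => k _.
  by rewrite -mulrA cReM /= mul0r subr0.
have D4 : 0 < D / 4 by rewrite divr_gt0.
have /cvgrPdist_le /(_ _ D4)[N1 _ hN1] := qc.
(* 16 makes r^(N^2) at most 1/8, m ensures that the coefficients of u below m involve no remainder,
   and N1 brings q N close to its limit. *)
pose N := (maxn 16 (maxn m N1)).
have N16 : (16 <= N)%N by rewrite leq_maxl.
have Nm : (m <= N)%N by rewrite /N !leq_max leqnn !orbT.
have NN1 : (N1 <= N)%N by rewrite /N !leq_max leqnn !orbT.
have h1 := hN1 N NN1; rewrite /= -uz // in h1.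
have h2 : dot w (u N) (v - z) ^+ 2 <= (D / 4) ^+ 2.
  apply: le_trans (dot_cs hw (Hu N) Hvz) _.
  apply: (@le_trans _ _ (D * (D / 16))); first by apply: ler_pM => //; exact: dot_ge0.
  by rewrite le_eqVlt; apply/orP; left; apply/eqP; field.
have h3 : `|dot w (u N) (v - z)| <= D / 4.
  by move: h2; rewrite -[X in X <= _]real_normK ?num_real // ler_pXn2r ?nnegrE // ltW.
have h4 : r N ^+ (N ^ 2) <= 8^-1.
  have x1 : 0 <= (N.+1%:R^-1 : R) <= 1.
    by rewrite invr_ge0 ler0n /= invf_le1 ?ltr0Sn // ler1n.
  have := exp1m_le (N ^ 2) x1; rewrite -/(r N) => h.
  have h8 : 8 <= 1 + (N ^ 2)%:R * N.+1%:R^-1 :> R.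
    have x16 : 16 <= N%:R :> R by rewrite ler_nat.
    have x0 : 0 < N%:R + 1 :> R by rewrite ltr_wpDl.
    rewrite natrX -[N.+1%:R]natr1 -lerBlDl ler_pdivlMr //.
    by move: x16; move: (N%:R : R) => x x16; nra.
  rewrite -[leRHS]div1r ler_pdivlMr //; apply: le_trans h; rewrite ler_wpM2l //.
  by rewrite exprn_ge0 //; case/andP: (r01 N).
have := uv N; have -> : v = z + (v - z) by rewrite addrC subrK.
rewrite (dotDr hw) // => E1.
have h5 : r N ^+ (N ^ 2) * D <= 8^-1 * D by rewrite ler_wpM2r // ltW.
move: h1 h3 E1 h5 vz0 D0; rewrite ler_distl ler_norml => /andP[_ +] /andP[+ _].
have fin (x y t s d : R) : s <= x + d / 4 -> - (d / 4) <= y -> x + y = t -> t <= 8^-1 * d ->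
  d - d / 16 <= s -> 0 < d -> False by lra.
exact: fin.
Qed.

End Orthogonal.

(** The difference of x and its projection on the closed span of the T^n E lies in M and is
    orthogonal to every T^n E, so [wandering_orth] makes it 0. *)
Theorem Beurling_seq_le : Beurling_type H (lip w) T.
Proof.
move=> M cM TM; have [MH M0 Ml Mc] := cM.
pose E := ominus (lip w) M (T @` M).
have gM : generated H (lip w) T E `<=` M by apply: generated_sub => // x [].
apply/seteqP; split => // x Mx.
pose A := [set iter n T v | n in [set: nat] & v in E].
have iM k e : E e -> M (iter k T e).
  by case=> Me _; elim: k => //= k IH; apply: TM; exists (iter k T e).
have SM : lin_span A `<=` M.
  move=> _ [n [a [y [yA ->]]]]; apply: lin_closed_sum; first by split.
  move=> i; apply: lin_closedZ; first by split.
  by have [k _ [e Ee <-]] := yA i; exact: iM.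
have SH : lin_span A `<=` H by move=> y /SM; exact: MH.
have Hx := MH _ Mx.
have [m [Hm my mx]] := projection_closure hw (lin_closed_span A) SH Hx.
have Mm : M m.
  by apply: (closed_lim cM Hm) => e /my[y Sy ye]; exists y => //; exact: SM.
have xm : x - m = 0.
  apply: (wandering_orth cM TM).
    by apply: (lin_closedB _ Mx Mm); split.
  by move=> k e Ee; apply: mx; apply: lin_span_in; exists k => //; exists e.
have {xm}-> : x = m by apply/eqP; rewrite -subr_eq0 xm.
split => // e e0; have e1 : 0 < (e / 2) ^+ 2 by rewrite exprn_gt0 // divr_gt0.
have [y Sy ye] := my _ e1; exists y => //; rewrite ip_norm_lip.
have e20 : 0 <= e / 2 by rewrite divr_ge0 // ltW.
apply: (@le_lt_trans _ _ (e / 2)); last by rewrite ltr_pdivrMr //; lra.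
by rewrite -(ger0_norm e20) -sqrtr_sqr ler_wsqrtr.
Qed.

End BeurlingLe.

(** * The case alpha > 1 *)

Section WeightBounds.
Context {R : realType}.
Implicit Types al q x : R.

Lemma bw_decr al m n : 0 < al -> (m <= n)%N -> bw al n <= bw al m.
Proof.
move=> a0 /subnK <-; elim: (n - m)%N => [//|k IH]; rewrite addSn.
by apply: le_trans IH; exact: bw_le.
Qed.

Lemma bw_le1 al n : 0 < al -> bw al n <= 1.
Proof. by move=> a0; exact: (@bw_decr al 0 n). Qed.

(** The factors j / (j + al) increase with j, and w_(n + k) / w_n is the product of k later ones.
    This is what makes z^n c_n bounded below in [starn_ge]. *)
Lemma bwM_le al n k : 0 < al -> bw al n * bw al k <= bw al (n + k).
Proof.
move=> a0; elim: k => [|k IH]; first by rewrite addn0 mulr1.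
rewrite addnS !bwS.
have -> : bw al n * (bw al k * k.+1%:R / (k.+1%:R + al)) = bw al n * bw al k * (k.+1%:R / (k.+1%:R + al)) by ring.
rewrite -[leRHS]mulrA.
have d1 : 0 < k.+1%:R + al by rewrite addr_gt0.
have d2 : 0 < (n + k).+1%:R + al by rewrite addr_gt0.
have k0 : 0 < k.+1%:R :> R by [].
apply: ler_pM => //.
- by rewrite mulr_ge0 // ltW // bw_gt0.
- by apply: ltW; exact: divr_gt0.
rewrite ler_pdivrMr // mulrAC ler_pdivlMr //.
have : k.+1%:R <= (n + k).+1%:R :> R by rewrite ler_nat ltnS leq_addl.
have : 0 <= k.+1%:R :> R by [].
by move: ((n + k).+1%:R : R) (k.+1%:R : R) => x y; nra.
Qed.

Lemma bw_le_inv al n : 1 <= al -> bw al n <= n.+1%:R^-1.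
Proof.
move=> a1; have a0 : 0 < al by apply: lt_le_trans a1.
elim: n => [|n IH]; first by rewrite invr1.
have n0 : 0 < n.+1%:R :> R by [].
have d0 : 0 < n.+1%:R + al by rewrite addr_gt0.
rewrite bwS ler_pdivrMr //; apply: (@le_trans _ _ 1).
  by rewrite -ler_pdivlMr // div1r.
by rewrite mulrC ler_pdivlMr // mul1r -natr1 lerD2l.
Qed.

(** Between m and 2 m the weights shrink at most by (1 + al / (m + 1))^m, which is below e^al. *)
Lemma bw_double al m j : 0 < al -> (j <= m + m)%N -> bw al m <= expR al * bw al j.
Proof.
move=> a0 jm; have w0 i := bw_gt0 i a0.
suff h i : (i <= m)%N -> bw al m <= expR al * bw al (m + i).
  apply: (le_trans (h m (leqnn m))); rewrite ler_pM2l ?expR_gt0 //; exact: bw_decr.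
have m0 : 0 < m.+1%:R :> R by [].
pose E := 1 + al / m.+1%:R.
have E0 : 0 <= E by rewrite addr_ge0 // divr_ge0 // ltW.
have hE : bw al m <= E ^+ i * bw al (m + i).
  elim: i => [|i IH]; first by rewrite expr0 mul1r addn0.
  apply: (le_trans IH); rewrite exprSr -mulrA ler_wpM2l ?exprn_ge0 // addnS bwS.
  have d0 : 0 < (m + i).+1%:R :> R by [].
  have d2 : 0 < (m + i).+1%:R + al by rewrite addr_gt0.
  rewrite mulrA ler_pdivlMr // mulrCA ler_pM2l //.
  have : m.+1%:R <= (m + i).+1%:R :> R by rewrite ler_nat ltnS leq_addr.
  rewrite /E; move: ((m + i).+1%:R : R) d0 d2 => y y0 y2 my.
  rewrite mulrDl mul1r lerD2l mulrAC ler_pdivlMr // ler_wpM2l // ltW //.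
move=> im; apply: (le_trans hE); rewrite ler_pM2r //.
apply: (@le_trans _ _ (expR (al / m.+1%:R) ^+ i)).
  by rewrite lerXn2r ?nnegrE ?expR_ge0 // expR_ge1Dx.
rewrite -expRM_natl ler_expR mulrA ler_pdivrMr // mulrC ler_wpM2l ?(ltW a0) // ler_nat.
by rewrite (leq_trans im).
Qed.

(** Seen from a far index the weights are flat. In [limit_equation] this turns the contribution of
    c_n z^n into an unweighted sum. *)
Lemma bw_ratio al k : 0 < al -> bw al (n + k) / bw al n @[n --> \oo] --> (1 : R).
Proof.
move=> a0; have w0 i := bw_gt0 i a0.
elim: k => [|k IH].
  by apply: cvg_near_cst; near=> n; rewrite addn0 divff // gt_eqF.
have E n : bw al (n + k) / bw al n * (1 - al / ((n + k).+1%:R + al)) = bw al (n + k.+1) / bw al n.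
  rewrite addnS bwS; have d2 : 0 < (n + k).+1%:R + al by rewrite addr_gt0.
  by move: (_.+1%:R : R) d2 => y d2; field; rewrite (gt_eqF (w0 _)) gt_eqF.
have <- : (fun n => bw al (n + k) / bw al n * (1 - al / ((n + k).+1%:R + al))) =
  (fun n => bw al (n + k.+1) / bw al n) by apply/funext => n; exact: E.
suff h : 1 - al / ((n + k).+1%:R + al) @[n --> \oo] --> (1 : R).
  suff : bw al (n + k) / bw al n * (1 - al / ((n + k).+1%:R + al)) @[n --> \oo] --> (1 * 1 : R).
    by rewrite mulr1.
  by apply: cvgM; [exact: IH|exact: h].
rewrite -[X in _ --> X]subr0; apply: cvgB; first exact: cvg_cst.
apply: (@squeeze_cvgr _ _ _ _ (fun=> 0) (fun n => al * n.+1%:R^-1)).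
- near=> n; have d2 : 0 < (n + k).+1%:R + al by rewrite addr_gt0.
  rewrite divr_ge0 ?(ltW a0) ?(ltW d2) //= ler_pM2l // lef_pV2 ?posrE //.
  apply: (@le_trans _ _ (n + k).+1%:R); first by rewrite ler_nat ltnS leq_addr.
  by rewrite lerDl ltW.
- exact: cvg_cst.
- by rewrite -[X in _ --> X](mulr0 al); apply: cvgMr; exact: cvg_harmonic.
Unshelve. all: by end_near. Qed.

Lemma asum_xw al x : 0 < al -> 0 <= x < 1 -> asum (fun k => x ^+ k / bw al k).
Proof.
move=> a0 /andP[x0 x1]; pose th := (x + 1) / 2.
have th1 : 0 < th < 1 by rewrite /th; apply/andP; split; lra.
have [k k0 hk] := bw_geo a0 th1; case/andP: th1 => t0 t1.
have xt : `|x / th| < 1.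
  have xt0 : 0 <= x / th by rewrite divr_ge0 // ltW.
  by rewrite (ger0_norm xt0) ltr_pdivrMr // mul1r /th; lra.
apply: asum_le (@asumZ _ k^-1 _ (asum_geo xt)) => n.
have w0 := bw_gt0 n a0; have tn : 0 < th ^+ n by rewrite exprn_gt0.
rewrite ger0_norm ?divr_ge0 ?exprn_ge0 ?(ltW w0) // expr_div_n mulrCA ler_wpM2l ?exprn_ge0 //.
by rewrite -invfM lef_pV2 ?posrE ?mulr_gt0.
Qed.

End WeightBounds.

(** * Cauchy products *)

Section Convolution.
Context {R : realType}.
Implicit Types u v : nat -> R.

Definition cprod u v n : R := \sum_(k < n.+1) u k * v (n - k)%N.

Lemma sum_cprod u v N : \sum_(n < N) cprod u v n = \sum_(k < N) u k * \sum_(m < N - k) v m.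
Proof.
elim: N => [|N IH]; first by rewrite !big_ord0.
rewrite big_ord_recr /= IH /cprod big_ord_recr [RHS]big_ord_recr /= subSnn subnn big_ord1 addrA; congr (_ + _).
rewrite -big_split /=; apply: eq_bigr => k _.
by rewrite subSn ?(ltnW (ltn_ord k)) // big_ord_recr /= mulrDr.
Qed.

Lemma asum_cprod u v : asum u -> asum v -> asum (cprod u v).
Proof.
move=> hu hv; have [nu nv] := (asum_norm hu, asum_norm hv).
apply: (@asum_bnd _ _ (ssum (fun k => `|u k|) * ssum (fun k => `|v k|))) => N.
apply: (@le_trans _ _ (\sum_(n < N) cprod (fun k => `|u k|) (fun k => `|v k|) n)).
  apply: ler_sum => n _; apply: (le_trans (ler_norm_sum _ _ _)).
  by apply: ler_sum => k _; rewrite normrM.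
rewrite sum_cprod; apply: (@le_trans _ _ (\sum_(k < N) `|u k| * ssum (fun k => `|v k|))).
  by apply: ler_sum => k _; rewrite ler_wpM2l //; exact: ssum_part.
by rewrite -mulr_suml ler_wpM2r ?ssum_ge0 //; exact: ssum_part.
Qed.

Lemma ssum_cprod u v : asum u -> asum v -> ssum (cprod u v) = ssum u * ssum v.
Proof.
move=> hu hv; have hc := asum_cprod hu hv.
have cvv : series v @ \oo --> ssum v by exact: asum_cvg.
(* The N-th partial sum of the product, arranged by the index of u; [tannery] takes the limit in
   N. *)
pose g (N k : nat) : R := if (k < N)%N then u k * series v (N - k)%N else 0.
have c1 : ssum (g N) @[N --> \oo] --> ssum (fun k => u k * ssum v).
  apply: (@tannery _ _ _ _ g (fun k => u k * ssum v) (fun k => ssum (fun k => `|v k|) * `|u k|)).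
  - by apply: asumZ; exact: asum_norm.
  - near=> N => k; rewrite /g; case: ifP => _; last first.
      by rewrite normr0 mulr_ge0 // ssum_ge0 //; exact: asum_norm.
    rewrite normrM mulrC ler_wpM2r // seriesEord /=.
    by apply: (le_trans (ler_norm_sum _ _ _)); apply: ssum_part => //; exact: asum_norm.
  - move=> k; apply: (@cvg_trans _ (u k * series v (N - k)%N @[N --> \oo])).
      by apply: near_eq_cvg; near=> N; rewrite /g ifT //; near: N; exists k.+1.
    by apply: cvgMr; rewrite -(cvg_shiftn k); under eq_fun do rewrite addnK.
have -> : ssum u * ssum v = ssum (fun k => u k * ssum v).
  by rewrite mulrC -ssumZ //; apply: eq_ssum => k; rewrite mulrC.
rewrite -(cvg_lim _ c1) //; congr (limn _); apply/funext => N.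
rewrite seriesEord /= sum_cprod (@ssum_fin _ _ N); last by move=> k Nk; rewrite /g ltnNge Nk.
by apply: eq_bigr => k _; rewrite /g ltn_ord seriesEord.
Unshelve. all: by end_near. Qed.

Lemma cprod_pow u v x n : cprod u v n * x ^+ n = cprod (fun k => u k * x ^+ k) (fun k => v k * x ^+ k) n.
Proof.
rewrite /cprod mulr_suml; apply: eq_bigr => k _.
have kn : (k <= n)%N by rewrite -ltnS.
have -> : x ^+ n = x ^+ k * x ^+ (n - k) by rewrite -exprD subnKC.
by ring.
Qed.

End Convolution.

(** * The binomial series of (1 - x)^(- q) *)

Section Binomial.
Context {R : realType}.
Implicit Types al q x : R.

(** The Taylor coefficients (q)_n / n! of (1 - z)^(- q). *)
Fixpoint bF q (n : nat) : R := if n is k.+1 then bF q k * (q + k%:R) / k.+1%:R else 1.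

Lemma bFS q n : bF q n.+1 = bF q n * (q + n%:R) / n.+1%:R. Proof. by []. Qed.

Lemma bF_gt0 q n : 0 < q -> 0 < bF q n.
Proof.
move=> q0; elim: n => [//|n IH]; rewrite bFS divr_gt0 // mulr_gt0 // ltr_pwDl //.
Qed.

Lemma bF_mono q m n : 1 <= q -> (m <= n)%N -> bF q m <= bF q n.
Proof.
move=> q1 /subnK <-; have q0 : 0 < q by apply: lt_le_trans q1.
elim: (n - m)%N => [//|k IH]; rewrite addSn; apply: (le_trans IH).
rewrite bFS -mulrA ler_peMr ?(ltW (bF_gt0 _ _)) // ler_pdivlMr // mul1r -natr1 addrC lerD2r //.
Qed.

(* With B_m = m w_m F_m^2 the increments B_m - B_(m+1) dominate w_m F_m^2 as soon as
   1 + al - 2 q > 0 and m is large. *)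
Lemma asum_bwF al q : 0 < al -> 0 < q -> 2 * q < al + 1 ->
  asum (fun m => bw al m * bF q m ^+ 2).
Proof.
move=> a0 q0 hq; pose d := al + 1 - 2 * q.
have d0 : 0 < d by rewrite subr_gt0.
pose t m := bw al m * bF q m ^+ 2; pose B m := m%:R * t m.
have t0 m : 0 <= t m by rewrite mulr_ge0 ?sqr_ge0 // ltW // bw_gt0.
pose m0 := Num.truncn (2 * (q ^+ 2 + d * (1 + al)) / d).
have tB m : (m0 < m)%N -> t m <= (2 / d) * (B m - B m.+1).
  move=> mm; have m1 : 2 * (q ^+ 2 + d * (1 + al)) < d * m%:R.
    have := truncnS_gt (2 * (q ^+ 2 + d * (1 + al)) / d); rewrite ltr_pdivrMr // => h.
    by apply: (lt_le_trans h); rewrite mulrC ler_pM2l // ler_nat.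
  have dm : 0 < m.+1%:R + al by rewrite addr_gt0.
  have mm1 : 0 < m.+1%:R :> R by [].
  have -> : B m - B m.+1 = t m * ((d * m%:R - q ^+ 2) / (m.+1%:R + al)).
    rewrite /B /t bwS bFS; move: dm mm1; rewrite -natr1 /d; move: (m%:R : R) => x h1 h2.
    by field; rewrite !gt_eqF.
  rewrite mulrCA -[leLHS]mulr1 ler_wpM2l // mulrA ler_pdivlMr // mul1r.
  rewrite mulrAC ler_pdivlMr //; move: m1 d0; rewrite -[m.+1%:R]natr1.
  have := ler0n R m; move: (m%:R : R) => x x0; move: (d) => e; nra.
apply: (@asum_unshift _ _ m0.+1).
apply: (@asum_bnd _ _ (2 / d * B m0.+1)) => N.
have B0 m : 0 <= B m by rewrite mulr_ge0.
apply: (@le_trans _ _ (2 / d * (B m0.+1 - B (m0.+1 + N)%N))); last first.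
  by rewrite ler_pM2l ?divr_gt0 // gerBl.
elim: N => [|N IH]; first by rewrite big_ord0 addn0 subrr mulr0.
rewrite big_ord_recr [X in _ + X <= _](ger0_norm (t0 (m0.+1 + N)%N)).
have := tB (m0.+1 + N)%N (leq_addr _ _); rewrite -addnS.
move: IH; move: (\sum_(_ < _) _) (B _) (B _) (B _) (t _) (2 / d) => s b1 b2 b3 u e; lra.
Qed.

Lemma asum_bF q x : 0 < q -> 0 <= x < 1 -> asum (fun k => bF q k * x ^+ k).
Proof.
move=> q0 x01; pose al := 2 * q.
have a0 : 0 < al by rewrite mulr_gt0.
have hq : 2 * q < al + 1 by rewrite ltrDl.
have h := asum_bwF a0 q0 hq; pose S := ssum (fun m => bw al m * bF q m ^+ 2).
apply: asum_le (@asumZ _ (1 + S) _ (asum_xw a0 x01)) => k.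
have F0 := bF_gt0 k q0; have w0 := bw_gt0 k a0; have w1 := bw_le1 k a0.
case/andP: x01 => x0 _; rewrite ger0_norm ?mulr_ge0 ?exprn_ge0 ?(ltW F0) //.
rewrite mulrC [leRHS]mulrCA ler_wpM2l ?exprn_ge0 // ler_pdivlMr //.
have : bw al k * bF q k ^+ 2 <= S.
  apply: (@ssum_term _ (fun m => bw al m * bF q m ^+ 2)) => // n.
  by rewrite mulr_ge0 ?sqr_ge0 // ltW // bw_gt0.
by move: F0 w0 w1; move: (bF q k) (bw al k) S => f w s f0 w0 w1 ?; have := mulr_ge0 (ltW w0) (sqr_ge0 (f - 1)); nra.
Qed.

Lemma bF_shift q k : (q + k%:R) * bF q k = q * bF (q + 1) k.
Proof.
elim: k => [|k IH]; first by rewrite addr0.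
rewrite !bFS; have := ltr0Sn R k; have := ler0n R k; rewrite -[k.+1%:R]natr1 => k0 k1.
have -> : (q + (k%:R + 1)) * (bF q k * (q + k%:R) / (k%:R + 1)) =
  (q + k%:R + 1) / (k%:R + 1) * ((q + k%:R) * bF q k) by ring.
by rewrite IH; ring.
Qed.

(** Let F_q be the sum of the series. Then F_q' = q F_(q + 1) and (1 - y) F_(q + 1) = F_q, so (1 -
    y)^q F_q has derivative 0. *)
Lemma bF_sum q x : 0 < q -> 0 <= x < 1 -> ssum (fun k => bF q k * x ^+ k) = (1 - x) `^ (- q).
Proof.
move=> q0 /andP[x0 x1].
have dE (p : R) : 0 < p -> pseries_diffs (bF p) = (fun k => p * bF (p + 1) k).
  move=> p0; apply/funext => k; rewrite /pseries_diffs bFS mulrC divfK // -bF_shift.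
  by rewrite mulrC.
have as1 (p y : R) : 0 < p -> `|y| < 1 -> asum (fun k => bF p k * y ^+ k).
  move=> p0 y1; apply: asum_le (asum_bF p0 (_ : 0 <= `|y| < 1)) => [k|]; last by rewrite normr_ge0.
  by rewrite normrM normrX ger0_norm // ltW // bF_gt0.
pose F p y := ssum (fun k => bF p k * y ^+ k).
have cF (p y : R) : 0 < p -> `|y| < 1 -> cvgn (pseries (bF p) y).
  by move=> p0 y1; apply: cvgP (asum_cvg (as1 p y p0 y1)).
have pseriesZ (b : R) (c : nat -> R) y : pseries (fun k => b * c k) y = (fun n => b * pseries c y n).
  apply/funext => n; rewrite /pseries !seriesEord /= mulr_sumr.
  by apply: eq_bigr => k _; rewrite mulrA.
have cFZ (b p y : R) : 0 < p -> `|y| < 1 -> cvgn (pseries (fun k => b * bF p k) y).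
  by move=> p0 y1; rewrite pseriesZ; apply: is_cvgMr; exact: cF.
have dF (y : R) : `|y| < 1 -> is_derive y 1 (F q) (q * F (q + 1) y).
  move=> y1; pose K := (`|y| + 1) / 2.
  have n0 := normr_ge0 y; have K0 : 0 <= K by rewrite /K; lra.
  have K1 : `|K| < 1 by rewrite (ger0_norm K0) /K; lra.
  have yK : `|y| < `|K| by rewrite (ger0_norm K0) /K; lra.
  have q1 : 0 < q + 1 by rewrite addr_gt0.
  have := @pseries_snd_diffs R (bF q) K y (cF q K q0 K1).
  have dZ (b : R) (c : nat -> R) : pseries_diffs (fun k => b * c k) = (fun k => b * pseries_diffs c k).
    by apply/funext => k; rewrite /pseries_diffs mulrCA.
  rewrite (dE q) // dZ (dE (q + 1)) // => h.
  have := h (cFZ _ _ _ q1 K1).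
  have -> : (fun k => q * ((q + 1) * bF (q + 1 + 1) k)) = (fun k => (q * (q + 1)) * bF (q + 1 + 1) k).
    by apply/funext => k; rewrite mulrA.
  move=> /(_ (cFZ _ _ _ (addr_gt0 q1 ltr01) K1) yK).
  by move/is_derive_eq; apply; rewrite pseriesZ; apply/cvg_lim => //; apply: cvgMr; exact: cF.
have Fq1 (y : R) : `|y| < 1 -> (1 - y) * F (q + 1) y = F q y.
  move=> y1; have q1 : 0 < q + 1 by rewrite addr_gt0.
  have h1 := as1 (q + 1) y q1 y1; rewrite mulrBl mul1r {1}/F ssum_recl //.
  rewrite [in RHS]/F (ssum_recl (as1 q y q0 y1)) -addrA; congr (_ + _).
  rewrite /F -ssumZ // -ssumB; [|exact: (asumS h1)|exact: (asumZ h1)].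
  apply: eq_ssum => k; rewrite !bFS exprS.
  have := bF_shift q k; have := ltr0Sn R k; have := ler0n R k; rewrite -natr1.
  move: (k%:R : R) (bF q k) (bF (q + 1) k) (y ^+ k) => x' f g z x0' x1' e.
  have qn : q != 0 by rewrite gt_eqF.
  have -> : g = (q + x') * f / q by rewrite e mulrC mulKf.
  by field; rewrite qn gt_eqF.
pose G (y : R) := (1 - y) `^ q * F q y.
have dG (y : R) : 0 <= y <= x -> is_derive y 1 G 0.
  move=> /andP[y0 yx]; have y1 : y < 1 by apply: le_lt_trans x1.
  have ny : `|y| < 1 by rewrite ger0_norm.
  have := is_deriveM (is_derive_pow1m q y1) (dF y ny).
  move/is_derive_eq; apply; rewrite /GRing.scale /= -(Fq1 y ny).
  have -> : (1 - y) `^ q = (1 - y) * (1 - y) `^ (q - 1).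
    by rewrite -{2}(powRr1 (_ : 0 <= 1 - y)) ?subr_ge0 ?(ltW y1) // -powRD ?subrKC // subr_eq0 gt_eqF ?implybT.
  ring.
have := RI_FTC x0 dG (fun y _ => @cst_continuous _ _ _ _).
rewrite RI_cst // mul0r => /esym/eqP; rewrite subr_eq0 => /eqP.
have F0 : F q 0 = 1.
  rewrite /F ssum_recl; last by apply: as1; rewrite ?normr0.
  rewrite expr0 mulr1 -[RHS]addr0; congr (_ + _).
  by rewrite -[RHS](@ssum0 R); apply: eq_ssum => k; rewrite expr0n mulr0.
rewrite /G F0 subr0 powR1 mulr1 => e.
have p0 : (1 - x) `^ q != 0 by rewrite gt_eqF // powR_gt0 // subr_gt0.
by apply: (mulfI p0); rewrite powRN mulfV.
Qed.

End Binomial.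

(** * Operators bounded below have closed range *)

Section ClosedRange.
Context {R : realType}.
Notation C := (R[i]).
Notation V := (nat -> C^o).
Variable w : nat -> R.
Hypothesis hw : forall n, 0 < w n.
Notation H := (l2w w : set V).

Lemma dotD_le (u v : V) : H u -> H v ->
  dot w (u + v) (u + v) <= 2 * dot w u u + 2 * dot w v v.
Proof.
move=> hu hv; have := dot_ge0 hw (l2wB hw hu hv).
by rewrite (dotBB hw) // (dotDD hw) //; lra.
Qed.

Lemma closed_range (P : V -> V) (c1 c2 : R) : 0 < c1 -> 0 <= c2 ->
  (forall u, H u -> H (P u)) ->
  (forall (a : C) u v, P (a *: u + v) = a *: P u + P v) ->
  (forall u, H u -> c1 * dot w u u <= dot w (P u) (P u) <= c2 * dot w u u) ->
  closed_subspace H (lip w) (P @` H).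
Proof.
move=> c10 c20 PH Pl Pb.
have PB u v : P (u - v) = P u - P v.
  by rewrite addrC -scaleN1r Pl scaleN1r addrC.
split; first by move=> _ [u hu <-]; exact: PH.
- exists 0; first by case: (lin_closedH hw).
  by have := PB 0 0; rewrite !subrr.
- move=> a _ _ [u hu <-] [v hv <-]; exists (a *: u + v); last exact: Pl.
  exact: (l2wD hw (@l2wZ _ _ hw a _ hu) hv).
move=> v [hv h].
have ap k : exists u, H u /\ dot w (v - P u) (v - P u) <= k.+1%:R^-1.
  have k0 : 0 < k.+1%:R^-1 :> R by rewrite invr_gt0.
  have e0 : 0 < Num.sqrt (k.+1%:R^-1 : R) by rewrite sqrtr_gt0.
  have [_ [u hu <-] uv] := h _ e0; exists u; split => //.
  by move: uv; rewrite ip_norm_lip ltr_sqrt // => /ltW.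
have [g gP] := choice ap; have Hg k : H (g k) by case: (gP k).
have gv k : dot w (v - P (g k)) (v - P (g k)) <= k.+1%:R^-1 by case: (gP k).
have inv (e : R) : 0 < e -> exists K, forall k, (K <= k)%N -> k.+1%:R^-1 <= e.
  move=> e0; exists (Num.truncn e^-1) => k Kk.
  rewrite -[e]invrK lef_pV2 ?posrE ?invr_gt0 //.
  by apply: (le_trans (ltW (truncnS_gt _))); rewrite ler_nat ltnS.
have Hvg k : H (v - P (g k)) by apply: (l2wB hw) => //; exact: PH.
have cau e : 0 < e -> exists K, forall j k, (K <= j)%N -> (K <= k)%N ->
    dot w (g j - g k) (g j - g k) <= e.
  move=> e0; have [K hK] := inv (c1 * e / 4) (divr_gt0 (mulr_gt0 c10 e0) (ltr0Sn R 3)).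
  exists K => j k Kj Kk.
  rewrite -(ler_pM2l c10); have Hjk := l2wB hw (Hg j) (Hg k).
  have /andP[h1 _] := Pb _ Hjk; apply: (le_trans h1); rewrite PB.
  have -> : P (g j) - P (g k) = (v - P (g k)) + - (v - P (g j)).
    by rewrite opprB [RHS]addrC addrA subrK.
  apply: (le_trans (dotD_le (Hvg k) (l2wN hw (Hvg j)))).
  have -> : dot w (- (v - P (g j))) (- (v - P (g j))) = dot w (v - P (g j)) (v - P (g j)).
    by rewrite (dotNl hw) ?(dotC w _ (- _)) ?(dotNl hw) ?opprK //; exact: l2wN.
  have := le_trans (gv j) (hK j Kj); have := le_trans (gv k) (hK k Kk); lra.
have [x hx gx] := seq_complete hw Hg cau.
exists x => //; apply/eqP; rewrite eq_sym -subr_eq0; apply/eqP.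
have Hvx : H (v - P x) by apply: (l2wB hw) => //; exact: PH.
apply: (dot_eq0 hw Hvx); apply/ler_addgt0Pr => e e0; rewrite add0r.
have [K1 hK1] := inv (e / 4) (divr_gt0 e0 (ltr0Sn R 3)).
have [K2 hK2] := gx (e / (4 * (c2 + 1))) (divr_gt0 e0 (mulr_gt0 (ltr0Sn R 3) (ltr_wpDl c20 ltr01))).
pose k := maxn K1 K2.
have h1 := le_trans (gv k) (hK1 k (leq_maxl _ _)); have h2 := hK2 k (leq_maxr _ _).
have Hgx := l2wB hw (Hg k) hx.
have -> : v - P x = (v - P (g k)) + P (g k - x) by rewrite PB addrA subrK.
apply: (le_trans (dotD_le (Hvg k) (PH _ Hgx))).
have /andP[_ h3] := Pb _ Hgx.
have : c2 * dot w (g k - x) (g k - x) <= e / 4.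
  apply: (@le_trans _ _ ((c2 + 1) * (e / (4 * (c2 + 1))))).
    by apply: ler_pM => //; [exact: dot_ge0|rewrite lerDl].
  by rewrite le_eqVlt; apply/orP; left; apply/eqP; field; rewrite gt_eqF // ltr_wpDl.
move: h1 h3; lra.
Qed.

End ClosedRange.

(** * Multiplication by a polynomial with a dominant last coefficient *)

Section Multiplier.
Context {R : realType}.
Notation C := (R[i]).
Notation Re := (@complex.Re R).
Notation Im := (@complex.Im R).
Notation V := (nat -> C^o).
Variable al : R.
Hypothesis a0 : 0 < al.
Notation w := (bw al).
Notation H := (l2w w : set V).
Notation T := (@sshift R).
Implicit Types u v g : V.

Let hw n : 0 < w n. Proof. exact: bw_gt0. Qed.
Let hI k u : H u -> H (iter k T u). Proof. exact: l2_iter. Qed.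

Lemma dot_iterE n u : H u ->
  asum (fun j => w (n + j)%N * nsq (u j)) /\
  dot w (iter n T u) (iter n T u) = ssum (fun j => w (n + j)%N * nsq (u j)).
Proof.
move=> hu; have h := @asum_shift _ _ n (@hI n _ hu).
have E j : w (n + j)%N * nsq (iter n T u (n + j)%N) = w (n + j)%N * nsq (u j).
  by rewrite iter_sshift leq_addr addKn.
split; first by apply: (eq_asum h).
rewrite dotE (ssum_split n (@hI n _ hu)) big1 ?add0r; first exact: eq_ssum.
by move=> i _; rewrite iter_sshift leqNgt ltn_ord /= nsq0 mulr0.
Qed.

(* The doubling property of the weights makes the bound uniform in [k < n]. *)
Lemma dot_cross n k u v : (k <= n)%N -> H u -> H v ->
  `|2 * dot w (iter k T u) (iter n T v)| <=
  Num.sqrt (expR al) * (dot w (iter n T u) (iter n T u) + dot w (iter n T v) (iter n T v)).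
Proof.
move=> kn hu hv; pose K := expR al; pose s := Num.sqrt K.
have K0 : 0 < K by exact: expR_gt0.
have s0 : 0 < s by rewrite sqrtr_gt0.
have sK : s * s = K by rewrite -expr2 sqr_sqrtr // ltW.
have [Au Eu] := dot_iterE n hu; have [Av Ev] := dot_iterE n hv.
have B := asum_dot hw (@hI k _ hu) (@hI n _ hv).
have Bn := @asum_shift _ _ n B.
rewrite Eu Ev /dot (ssum_split n B) big1 ?add0r; last first.
  by move=> i _; rewrite [iter n T v i]iter_sshift leqNgt ltn_ord /= conjC0 mulr0 mulr0.
rewrite -ssumZ //; apply: (le_trans (ssum_norm (asumZ Bn))).
pose fu j := w (n + j)%N * nsq (u j); pose fv j := w (n + j)%N * nsq (v j).
have Su := @asum_shift _ _ (n - k)%N Au.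
apply: (@le_trans _ _ (ssum (fun i => s * fu (n - k + i)%N + s * fv i))).
  apply: ssum_le.
  - by apply: asum_norm; exact: asumZ.
  - by apply: asumD; apply: asumZ.
  move=> i; rewrite iter_sshift (leq_trans kn (leq_addr _ _)) iter_sshift leq_addr addKn.
  have -> : (n + i - k = n - k + i)%N by rewrite addnBAC.
  set x := u _; set y := v _.
  have h1 : w (n + i)%N <= K * w (n + (n - k + i))%N.
    by apply: bw_double => //; rewrite leq_add ?leq_addr // leq_add2r leq_subr.
  have h2 := nsq_ge0 (x + s%:C * y); have h3 := nsq_ge0 (x - s%:C * y).
  have ns : nsq (s%:C : C) = K by rewrite /nsq /= expr0n addr0 /= expr2.
  have e1 : Re (x * (s%:C * y)^*) = s * Re (x * y^*) by rewrite !Re_mulJ cReM cImM /=; ring.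
  move: h2 h3; rewrite !nsqD nsqN nsqM ns rmorphN mulrN cReN e1 => h2 h3.
  rewrite normrM (ger0_norm (_ : 0 <= 2 :> R)) // normrM (ger0_norm (ltW (hw _))).
  have h4 : s * (2 * `|Re (x * y^*)|) <= nsq x + K * nsq y.
    by rewrite -[X in X * _](gtr0_norm s0) -[X in _ * (X * _)](ger0_norm (_ : 0 <= 2 :> R)) // -!normrM ler_norml; apply/andP; split; lra.
  rewrite -(ler_pM2l s0) /fu /fv -/x -/y.
  have w0 := hw (n + i); have nx := nsq_ge0 x; have ny := nsq_ge0 y.
  have := ler_wpM2l (ltW w0) h4; have := ler_wpM2r nx h1.
  move: (w (n + i)%N) (w (n + (n - k + i))%N) (nsq x) (nsq y) `|Re (x * y^*)| => a b c d e.
  have -> : s * (s * (b * c) + s * (a * d)) = K * (b * c + a * d) by rewrite -sK; ring.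
  lra.
rewrite ssumD; [|exact: asumZ..]; rewrite !ssumZ // -mulrDr ler_pM2l // lerD2r.
rewrite [leRHS](ssum_split (n - k) Au) lerDr sumr_ge0 // => i _.
by rewrite mulr_ge0 ?nsq_ge0 // ltW.
Qed.

Variables (F : nat -> R) (N n : nat) (c : R).
Hypotheses (F0 : F 0 = 1) (Fge : forall k, 0 <= F k) (N0 : (0 < N)%N) (Nn : (N <= n)%N) (c0 : 0 < c).

Definition cn : R := Num.sqrt (c / w n).
Definition mulF u : V := \sum_(k < N) (F k)%:C *: iter k T u.
(* Multiplication by the polynomial sum_(k < N) F_k z^k + c_n z^n, where c_n^2 w_n = c. *)
Definition mulP u : V := mulF u + cn%:C *: iter n T u.
(** The size of the cross terms between the two parts of [mulP], relative to [starn], the squared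
    norm of c_n z^n u. It is small because c_n is large. *)
Definition delta : R := (\sum_(k < N) F k) * Num.sqrt (expR al) / cn.
Definition starn u : R := cn ^+ 2 * dot w (iter n T u) (iter n T u).

Lemma cn_gt0 : 0 < cn.
Proof. by rewrite sqrtr_gt0 divr_gt0. Qed.
Lemma cn2 : cn ^+ 2 = c / w n.
Proof. by rewrite sqr_sqrtr // divr_ge0 // ltW. Qed.

Lemma mulF_H u : H u -> H (mulF u).
Proof.
move=> hu; apply: (@H_sum R al a0 _ (fun k => (F k)%:C *: iter k T u)) => k.
by apply: (l2wZ hw); exact: hI.
Qed.

Lemma mulP_H u : H u -> H (mulP u).
Proof.
by move=> hu; apply: (l2wD hw); [exact: mulF_H|apply: (l2wZ hw); exact: hI].
Qed.

Lemma mulP_lin (a : C) u v : mulP (a *: u + v) = a *: mulP u + mulP v.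
Proof.
rewrite /mulP /mulF.
have -> : \sum_(k < N) (F k)%:C *: iter k T (a *: u + v) =
    a *: (\sum_(k < N) (F k)%:C *: iter k T u) + \sum_(k < N) (F k)%:C *: iter k T v.
  rewrite scaler_sumr -big_split /=; apply: eq_bigr => k _.
  by rewrite iter_lin scalerDr !scalerA mulrC.
rewrite iter_lin !scalerDr !scalerA [cn%:C * a]mulrC.
by rewrite addrACA.
Qed.

Lemma mulP_shift u : mulP (T u) = T (mulP u).
Proof.
have Tl (a : C) x y : T (a *: x + y) = a *: T x + T y by have := @iter_lin R 1 a x y.
have T0 : T 0 = 0 by apply/funext => -[].
have iT k : iter k T (T u) = T (iter k T u) by rewrite -iterSr.
rewrite /mulP /mulF addrC [in RHS]addrC Tl iT; congr (_ + _).
elim: N => [|M IH]; first by rewrite !big_ord0 T0.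
by rewrite !big_ord_recr /= addrC IH iT -Tl addrC.
Qed.

Lemma mulP_coef u m : mulP u m = \sum_(k < N) (F k)%:C * iter k T u m + cn%:C * iter n T u m.
Proof.
have -> : mulP u m = mulF u m + cn%:C * iter n T u m by [].
by rewrite /mulF fct_sumE.
Qed.

Lemma mulP0 u : mulP u 0 = u 0%N.
Proof.
rewrite mulP_coef [iter n T u 0]iter_sshift leqNgt (leq_trans N0 Nn) /= mulr0 addr0.
case: (N) N0 => // M _; rewrite big_ord_recl /= F0 mul1r big1 ?addr0 // => k _.
by rewrite mulr0.
Qed.

(** All coefficients of the multiplier are real, so passing to real parts of the coefficients
    commutes with [mulP]; this is how psi is made real. *)
Definition rpart u : V := fun k => (Re (u k))%:C.

Lemma rpart_H u : H u -> H (rpart u).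
Proof.
apply: asum_le => k; rewrite ger0_norm; last by rewrite mulr_ge0 ?nsq_ge0 // ltW.
by rewrite ler_wpM2l ?(ltW (hw _)) // /nsq /= expr0n addr0 lerDl sqr_ge0.
Qed.

Lemma mulP_rpart u : mulP (rpart u) = rpart (mulP u).
Proof.
apply/funext => m; rewrite /rpart !mulP_coef cReD cRe_sum rmorphD raddf_sum.
have E k : iter k T (fun k => (Re (u k))%:C) m = (Re (iter k T u m))%:C.
  by rewrite !iter_sshift; case: ifP.
congr (_ + _); last by rewrite E cReM /= mul0r subr0 rmorphM.
by apply: eq_bigr => k _; rewrite E cReM /= mul0r subr0 rmorphM.
Qed.

Lemma dot_rpart u v : dot w (rpart u) v = dot w u (rpart v).
Proof. by apply: eq_ssum => m; rewrite !Re_mulJ /=; ring. Qed.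

Lemma dot_mulF_cross u v : H u -> H v ->
  `|2 * dot w (mulF u) (cn%:C *: iter n T v)| <= delta * (starn u + starn v).
Proof.
move=> hu hv; have cg := cn_gt0.
have HF k : H ((F k)%:C *: iter k T u) by apply: (l2wZ hw); exact: hI.
rewrite (dotZr hw); [|exact: hI|exact: mulF_H].
rewrite /mulF (@dot_suml R al a0 _ (fun k => (F k)%:C *: iter k T u)) //; last exact: hI.
rewrite mulrCA normrM (gtr0_norm cg) mulr_sumr.
have -> : delta * (starn u + starn v) = cn * \sum_(k < N) F k * (Num.sqrt (expR al) *
   (dot w (iter n T u) (iter n T u) + dot w (iter n T v) (iter n T v))).
  by rewrite -mulr_suml /delta /starn; field; rewrite gt_eqF.
rewrite ler_pM2l //; apply: (le_trans (ler_norm_sum _ _ _)); apply: ler_sum => k _.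
rewrite (dotZl hw); [|exact: hI..]; rewrite mulrCA normrM ger0_norm // ler_wpM2l //.
by apply: dot_cross => //; rewrite (leq_trans _ Nn) // ltnW.
Qed.

Hypothesis hd : delta <= 4^-1.

(** Here c_n^2 w_(n + j) = c w_(n + j) / w_n, which is at least c w_j by [bwM_le]. *)
Lemma starn_ge u : H u -> c * dot w u u <= starn u.
Proof.
move=> hu; have [Au Eu] := dot_iterE n hu; rewrite /starn Eu cn2 dotE -!ssumZ //.
apply: ssum_le; [exact: asumZ..|] => j.
rewrite mulrA [leRHS]mulrA ler_wpM2r ?nsq_ge0 // -mulrA ler_pM2l //.
by rewrite -ler_pdivrMl ?invr_gt0 // invrK; exact: bwM_le.
Qed.

Lemma starn_ge0 u : H u -> 0 <= starn u.
Proof. by move=> hu; rewrite mulr_ge0 ?sqr_ge0 //; apply: (dot_ge0 hw); exact: hI. Qed.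

(** With delta <= 1/4 the cross terms use up at most half of [starn]. *)
Lemma mulP_lower u : H u -> dot w (mulF u) (mulF u) + starn u / 2 <= dot w (mulP u) (mulP u).
Proof.
move=> hu; have hF := mulF_H hu; have hT := @hI n _ hu; have hc := @l2wZ _ _ hw cn%:C _ hT.
rewrite (dotDD hw) //; have := dot_mulF_cross hu hu; have := starn_ge0 hu.
have -> : dot w (cn%:C *: iter n T u) (cn%:C *: iter n T u) = starn u.
  by rewrite (dotZl hw) // (dotZr hw) // mulrA -expr2.
move: hd; move: (dot w (mulF u) (cn%:C *: _)) (dot w (mulF u) (mulF u)) (starn u) delta.
by move=> x y s d hd4 s0; rewrite ler_norml => /andP[h _]; nra.
Qed.

Lemma mulP_upper : exists2 c2, 0 <= c2 & forall u, H u -> dot w (mulP u) (mulP u) <= c2 * dot w u u.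
Proof.
have up k u : H u -> dot w (iter k T u) (iter k T u) <= dot w u u.
  move=> hu; have [Au Eu] := dot_iterE k hu; rewrite Eu dotE; apply: ssum_le => // j.
  by rewrite ler_wpM2r ?nsq_ge0 //; apply: bw_decr => //; exact: leq_addl.
have upZ k (r : R) u : H u -> dot w (r%:C *: iter k T u) (r%:C *: iter k T u) <= r ^+ 2 * dot w u u.
  move=> hu; have hk := @hI k _ hu; rewrite (dotZl hw) // ?(dotZr hw) //; last exact: (l2wZ hw).
  by rewrite mulrA -expr2 ler_wpM2l ?sqr_ge0 //; exact: up.
have [C1 C10 hC1] : exists2 C1, 0 <= C1 & forall u, H u -> dot w (mulF u) (mulF u) <= C1 * dot w u u.
  rewrite /mulF; elim: N => [|M [C1 C10 IH]].
    exists 0 => // u hu; rewrite big_ord0 mul0r -[leRHS](@ssum0 R) le_eqVlt; apply/orP; left; apply/eqP.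
    by apply: eq_ssum => j; have -> : (0 : V) j = 0 by []; rewrite mul0r mulr0.
  exists (2 * C1 + 2 * F M ^+ 2); first by rewrite addr_ge0 // mulr_ge0 ?sqr_ge0.
  move=> u hu; rewrite big_ord_recr /=; apply: (le_trans (dotD_le hw _ _)).
  - apply: (@H_sum R al a0 _ (fun k => (F k)%:C *: iter k T u)) => k.
    by apply: (l2wZ hw); exact: hI.
  - by apply: (l2wZ hw); exact: hI.
  by have := IH u hu; have := upZ M (F M) u hu; lra.
exists (2 * C1 + 2 * cn ^+ 2); first by rewrite addr_ge0 // mulr_ge0 ?sqr_ge0.
move=> u hu; apply: (le_trans (dotD_le hw (mulF_H hu) (@l2wZ _ _ hw cn%:C _ (@hI n _ hu)))).
by have := hC1 u hu; have := upZ n cn u hu; lra.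
Qed.

Lemma mulP_closed : closed_subspace H (lip w) (mulP @` H).
Proof.
have [c2 c20 hc2] := mulP_upper.
apply: (@closed_range _ _ hw mulP (c / 2) c2) => //; first exact: divr_gt0.
- exact: mulP_H.
- exact: mulP_lin.
- move=> u hu; rewrite hc2 // andbT; have := mulP_lower hu; have := starn_ge hu.
  by have := dot_ge0 hw (mulF_H hu); lra.
Qed.

End Multiplier.

(** * The function representing f |-> f(0) in the range of the multiplier *)

Section Wandering.
Context {R : realType}.
Notation C := (R[i]).
Notation Re := (@complex.Re R).
Notation Im := (@complex.Im R).
Notation V := (nat -> C^o).
Variable al : R.
Hypothesis a0 : 0 < al.
Notation w := (bw al).
Notation H := (l2w w : set V).
Notation T := (@sshift R).
Implicit Types u v g : V.

Let hw n : 0 < w n. Proof. exact: bw_gt0. Qed.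
Let hI k u : H u -> H (iter k T u). Proof. exact: l2_iter. Qed.

Lemma l2_unshift u : H (T u) -> H u.
Proof.
move=> hu; apply: asum_le (@asumZ _ (1 + al) _ (asumS hu)) => n.
rewrite ger0_norm ?mulr_ge0 ?nsq_ge0 ?(ltW (hw _)) //= mulrA ler_wpM2r ?nsq_ge0 //.
have d0 : 0 < n.+1%:R + al by rewrite addr_gt0.
rewrite mulrA ler_pdivlMr // mulrCA ler_pM2l //.
have n1 : 1 <= n.+1%:R :> R by rewrite ler1n.
by have := a0; move: (al) (n.+1%:R : R) n1 => b m; nra.
Qed.

Lemma dotZJ (b : C) u v : dot w (b *: u) v = dot w u (b^* *: v).
Proof.
apply: eq_ssum => k; congr (_ * _); have -> : (b *: u) k = b * u k by [].
by have -> : (b^* *: v) k = b^* * v k by []; rewrite !Re_mulJ !cReM !cImM cReJ cImJ; ring.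
Qed.

Lemma dotZZ (b : C) u : H u -> dot w (b *: u) (b *: u) = nsq b * dot w u u.
Proof.
move=> hu; rewrite !dotE -ssumZ //; apply: eq_ssum => k.
by have -> : (b *: u) k = b * u k by []; rewrite nsqM mulrCA.
Qed.

Section Evaluation.
Variable x : R.
Hypothesis x01 : 0 <= x < 1.

(** The reproducing kernel at x: pairing with it gives the real part of the value of the power
    series at x. *)
Definition evs : V := fun k => (x ^+ k / w k)%:C.

Lemma evs_H : H evs.
Proof.
have x2 : 0 <= x * x < 1.
  by case/andP: x01 => x0 x1; rewrite mulr_ge0 //= -[ltRHS]mulr1; apply: ltr_pM.
apply: (eq_asum (asum_xw a0 x2)) => k.
rewrite /nsq /= expr0n addr0 exprMn expr2; field; by rewrite gt_eqF.
Qed.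

Lemma dot_evs u : dot w u evs = ssum (fun k => Re (u k) * x ^+ k).
Proof.
by apply: eq_ssum => k; rewrite Re_mulJ /= mulr0 addr0; field; rewrite gt_eqF.
Qed.

Lemma asum_evs u : H u -> asum (fun k => Re (u k) * x ^+ k).
Proof.
move=> hu; apply: (eq_asum (asum_dot hw hu evs_H)) => k.
by rewrite Re_mulJ /= mulr0 addr0; field; rewrite gt_eqF.
Qed.

Lemma dot_iter_evs k u : H u -> dot w (iter k T u) evs = x ^+ k * dot w u evs.
Proof.
move=> hu; rewrite !dot_evs -ssumZ; last exact: asum_evs.
rewrite (ssum_split k (asum_evs (@hI k _ hu))) big1 ?add0r; last first.
  by move=> i _; rewrite iter_sshift leqNgt ltn_ord mul0r.
apply: eq_ssum => j; rewrite iter_sshift leq_addr addKn exprD; ring.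
Qed.

(** [dot] sees only real parts; the quantifier over b makes the whole complex value at x vanish and
    the set a complex subspace. *)
Definition evanish u := H u /\ forall b : C, dot w (b *: u) evs = 0.

Lemma evanish_closed : closed_subspace H (lip w) evanish.
Proof.
split; first by move=> u [].
- split; first by case: (lin_closedH hw).
  move=> b; rewrite scaler0 -[RHS](@ssum0 R); apply: eq_ssum => k.
  by have -> : (0 : V) k = 0 by []; rewrite mul0r mulr0.
- move=> a u v [hu zu] [hv zv]; have hau := @l2wZ _ _ hw a _ hu; split; first exact: (l2wD hw).
  move=> b; rewrite scalerDr scalerA (dotDl hw) ?zu ?zv ?addr0 //; last exact: evs_H.
    by apply: (l2wZ hw).
  by apply: (l2wZ hw).
move=> v [hv h]; split => // b; have he := evs_H.
have D0 := dot_ge0 hw he; have b0 := nsq_ge0 b.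
apply/eqP; rewrite -sqrf_eq0; apply/eqP/le_anti/andP; split; last exact: sqr_ge0.
apply/ler_addgt0Pr => e e0; rewrite add0r.
pose K := nsq b * dot w evs evs + 1; have K0 : 0 < K by rewrite ltr_wpDl // mulr_ge0.
have e1 : 0 < Num.sqrt (e / K) by rewrite sqrtr_gt0 divr_gt0.
have [u [hu zu] uv] := h _ e1; have hvu := l2wB hw hv hu.
move: uv; rewrite ip_norm_lip ltr_sqrt ?divr_gt0 // => /ltW uv.
have -> : dot w (b *: v) evs = dot w (b *: (v - u)) evs.
  by rewrite scalerBr (dotBl hw) ?zu ?subr0 //; exact: (l2wZ hw).
apply: (le_trans (dot_cs hw (@l2wZ _ _ hw b _ hvu) he)); rewrite dotZZ //.
have d0 := dot_ge0 hw hvu.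
apply: (@le_trans _ _ (K * (e / K))); last by rewrite mulrC divfK // gt_eqF.
rewrite mulrAC; apply: ler_pM => //; first exact: mulr_ge0.
by rewrite lerDl.
Qed.

Lemma evanish_shift : T @` evanish `<=` evanish.
Proof.
move=> _ [u [hu zu] <-]; split; first exact: l2_shift.
move=> b; have := @iterZ R 1 b u => /= <-.
have := @dot_iter_evs 1 (b *: u) (@l2wZ _ _ hw b _ hu) => /= ->.
by rewrite zu mulr0.
Qed.

End Evaluation.

Variables (F : nat -> R) (N n : nat) (c : R).
Hypotheses (F0 : F 0 = 1) (Fge : forall k, 0 <= F k) (N0 : (0 < N)%N) (Nn : (N <= n)%N) (c0 : 0 < c).
Hypothesis hd : delta al F N n c <= 4^-1.
Notation P := (mulP al F N n c).

(** Let phi be the projection of the constant 1 on M. It spans the complement of T M in M, so the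
    Beurling-type theorem makes it generate M. A zero of phi in [0, 1) would then be a zero of all
    of M, but the multiplier itself is positive there. As phi is positive at 0 it keeps its sign,
    and so does its quotient psi by the multiplier. *)
Theorem exists_psi : Beurling_type H (lip w) T -> exists psi : nat -> R,
  let rpsi : V := fun k => (psi k)%:C in
  [/\ H rpsi, forall g, H g -> dot w (P rpsi) (P g) = Re (g 0%N) &
    forall x, 0 <= x < 1 -> 0 <= ssum (fun k => psi k * x ^+ k)].
Proof.
move=> B; pose M := P @` H.
have cM : closed_subspace H (lip w) M by exact: mulP_closed.
have [MH _ _ _] := cM.
have lM : lin_closed M by case: cM.
have PH u : H u -> H (P u) by exact: mulP_H.
have TM : T @` M `<=` M.
  by move=> _ [_ [u hu <-] <-]; exists (T u); [exact: l2_shift|rewrite mulP_shift].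
pose e0 : V := fun k => (k == 0%N)%:R.
have He0 : H e0 by apply: (@asum_fin _ _ 1) => -[|k] //= _; rewrite nsq0 mulr0.
have dot_e0 g : dot w e0 g = Re (g 0%N).
  rewrite /dot (@ssum_fin _ _ 1); last by move=> -[|k] //= _; rewrite /e0 mul0r mulr0.
  by rewrite big_ord1 /e0 /= !mul1r cReJ.
have [_ [psic Hpsic <-] proj] := projection hw cM He0.
have E0 g : H g -> dot w (P psic) (P g) = Re (g 0%N).
  move=> hg; have Mg : M (P g) by exists g.
  have := proj _ Mg; rewrite (dotBl hw) ?dot_e0 ?mulP0 //; last 2 first.
  - exact: PH.
  - exact: PH.
  by move/eqP; rewrite subr_eq0 => /eqP.
pose psi k := Re (psic k); exists psi => rpsi.
have Hr : H rpsi by exact: rpart_H.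
pose phi := P rpsi.
have Hphi : H phi by exact: PH.
have phiE : phi = rpart (P psic) by rewrite /phi -mulP_rpart.
have E1 g : H g -> dot w phi (P g) = Re (g 0%N).
  move=> hg; rewrite phiE dot_rpart -mulP_rpart E0 //; exact: rpart_H.
have psi0E : dot w phi phi = psi 0%N by rewrite {2}/phi E1.
have psi0 : 0 < psi 0%N.
  rewrite lt_neqAle -psi0E (dot_ge0 hw) // andbT eq_sym; apply/eqP => h.
  have phi0 : phi = 0 by apply: (dot_eq0 hw); rewrite ?h.
  have := E1 _ He0; rewrite phi0 /e0 /= => /eqP; rewrite eq_sym.
  have -> : dot w 0 (P e0) = 0.
    rewrite -[RHS](@ssum0 R); apply: eq_ssum => k.
    by have -> : (0 : V) k = 0 by []; rewrite mul0r mulr0.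
  by rewrite oner_eq0.
have phi0 : phi 0%N = (psi 0%N)%:C by rewrite /phi mulP0.
pose E := ominus (lip w) M (T @` M).
have orth (b : C) g : H g -> dot w (b *: phi) (P (T g)) = 0.
  move=> hg; rewrite dotZJ.
  have -> : b^* *: P (T g) = P (T (b^* *: g)).
    have h := @iterZ R 1 b^* g; rewrite /= in h; rewrite h.
    have p0 : P 0 = 0 by have := @mulP_lin R al F N n c (-1) 0 0; rewrite scaler0 addr0 scaleN1r addNr.
    by have := @mulP_lin R al F N n c b^* (T g) 0; rewrite p0 !addr0.
  by rewrite E1 //; apply: l2_shift => //; exact: (l2wZ hw).
(* Removing the right multiple of phi cancels the constant coefficient; the rest lies in T M and is
   orthogonal to it. *)
have EE v : E v -> exists b : C, v = b *: phi.
  move=> [[g hg gv] vo]; pose b : C := g 0%N / (psi 0%N)%:C; exists b.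
  have p0 : (psi 0%N)%:C != 0 :> C by rewrite (fmorph_eq0 (real_complex R)) gt_eqF.
  pose g' : V := g - b *: rpsi.
  have g'0 : g' 0%N = 0.
    have -> : g' 0%N = g 0%N - b * (psi 0%N)%:C by [].
    by rewrite /b divfK // subrr.
  have hg' : H g' by apply: (l2wB hw) => //; exact: (l2wZ hw).
  pose g'' : V := fun k => g' k.+1.
  have Tg : T g'' = g' by apply/funext => -[|k].
  have hg'' : H g'' by apply: l2_unshift; rewrite Tg.
  have yE : v - b *: phi = P (T g'').
    rewrite Tg /g' addrC -scaleNr -gv /phi -mulP_lin scaleNr; congr (P _).
    by rewrite addrC.
  have hv : H v by rewrite -gv; exact: PH.
  have hy : H (P (T g'')) by apply: PH; rewrite Tg.
  apply/eqP; rewrite -subr_eq0 yE; apply/eqP; apply: (dot_eq0 hw hy).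
  have hb := @l2wZ _ _ hw b _ Hphi.
  rewrite -{1}yE (dotBl hw) // orth // subr0.
  have h : (T @` M) (P (T g'')) by exists (P g''); [exists g''|rewrite mulP_shift].
  by have := vo _ h => /(congr1 Re) /= ->.
have MG := B M cM TM; rewrite -/E in MG.
have nz x : 0 <= x < 1 -> dot w phi (evs x) != 0.
  move=> x01; apply/eqP => h.
  have MZ : M `<=` evanish x.
    rewrite MG; apply: generated_sub; [exact: evanish_closed|exact: evanish_shift|].
    move=> _ /EE[b ->]; have hb := @l2wZ _ _ hw b _ Hphi; split => // b'.
    rewrite scalerA; set d := b' * b.
    have -> : dot w (d *: phi) (evs x) = Re d * dot w phi (evs x).
      rewrite !dot_evs -ssumZ; last exact: asum_evs.
      apply: eq_ssum => k; have -> : (d *: phi) k = d * phi k by [].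
      by rewrite phiE /rpart cReM /= mulr0 subr0 mulrA.
    by rewrite h mulr0.
  (* P e0 is the multiplier itself: its coefficients are nonnegative and the first is 1. *)
  have [_ /(_ 1)] : evanish x (P e0) by apply: MZ; exists e0.
  have hP : H (P e0) by exact: PH.
  rewrite scale1r dot_evs; apply/eqP; rewrite gt_eqF //.
  have t1 : Re (P e0 0%N) * x ^+ 0 = 1 by rewrite mulP0 // expr0 mulr1.
  apply: (@lt_le_trans _ _ (Re (P e0 0%N) * x ^+ 0)); first by rewrite t1.
  apply: (@ssum_term _ (fun k => Re (P e0 k) * x ^+ k)); first exact: asum_evs.
  have i0 j m : 0 <= Re (iter j T e0 m).
    rewrite iter_sshift; case: ifP => // _; rewrite /e0; case: eqP => //=.
  move=> k; case/andP: x01 => x0 _; rewrite mulr_ge0 ?exprn_ge0 // mulP_coef cReD cRe_sum.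
  rewrite addr_ge0 ?sumr_ge0 // => [j _|]; rewrite cReM /= mul0r subr0 mulr_ge0 ?i0 //.
  exact: sqrtr_ge0.
split => // x x01.
have phix : 0 <= dot w phi (evs x).
  rewrite leNgt; apply/negP => neg; have /andP[x0 x1] := x01.
  (* Clamping to [0, x] makes f continuous on the whole line, with the series at x as a uniform
     majorant. *)
  pose cl (y : R) := Num.max 0 (Num.min y x).
  have cl01 y : 0 <= cl y <= x by rewrite /cl le_max lexx /= ge_max x0 ge_min lexx orbT.
  pose f y := ssum (fun k => Re (phi k) * cl y ^+ k).
  have clc : continuous cl.
    move=> y; apply: (@continuous_max _ _ (fun=> 0) (fun y => Num.min y x)); first exact: cvg_cst.
    by apply: continuous_min; [exact: cvg_id|exact: cvg_cst].
  have fc : continuous f.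
    move=> y; apply: (@tannery _ _ (nbhs y) _ (fun y k => Re (phi k) * cl y ^+ k) _ (fun k => `|Re (phi k) * x ^+ k|)).
    - by apply: asum_norm; exact: asum_evs.
    - near=> z => k; rewrite !normrM ler_wpM2l // !normrX.
      have /andP[h1 h2] := cl01 z.
      by rewrite lerXn2r ?nnegrE // (ger0_norm h1) ger0_norm.
    - move=> k; apply: cvgMr.
      exact: (@cvg_comp _ _ _ _ (fun z : R => z ^+ k) _ _ _ (clc y) (@exprn_continuous _ _ _)).
  have clE y : 0 <= y <= x -> cl y = y.
    by move=> /andP[y0 yx]; rewrite /cl (min_idPl yx) (max_idPr y0).
  have fE y : 0 <= y <= x -> f y = dot w phi (evs y).
    by move=> yx; rewrite /f dot_evs clE.
  have f0 : f 0 = psi 0%N.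
    rewrite /f clE ?lexx // (@ssum_fin _ _ 1); last by move=> -[|k] // _; rewrite expr0n mulr0.
    by rewrite big_ord1 expr0 mulr1 phi0.
  have fx : f x = dot w phi (evs x) by rewrite fE ?lexx ?x0.
  have : exists2 y, y \in `[0, x] & f y = 0.
    apply: IVT => //; first exact: continuous_subspaceT.
    by rewrite f0 fx ge_min (ltW neg) orbT /= le_max (ltW psi0).
  move=> [y]; rewrite in_itv /= => /andP[y0 yx]; rewrite fE ?y0 //; apply/eqP; apply: nz.
  by rewrite y0 (le_lt_trans yx).
have Hev := evs_H x01.
have hE : dot w phi (evs x) = (\sum_(k < N) F k * x ^+ k + cn al n c * x ^+ n) * dot w rpsi (evs x).
  have hF := @mulF_H R al a0 F N _ Hr; have hT := @hI n _ Hr.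
  rewrite /phi /mulP (dotDl hw) //; last exact: (l2wZ hw).
  rewrite (dotZl hw) // dot_iter_evs // mulrDl mulrA; congr (_ + _).
  rewrite /mulF (@dot_suml R al a0 _ (fun k => (F k)%:C *: iter k T rpsi)) //; last first.
    by move=> k; apply: (l2wZ hw); exact: hI.
  rewrite mulr_suml; apply: eq_bigr => k _; rewrite (dotZl hw) //; last exact: hI.
  by rewrite dot_iter_evs // mulrA.
have d0 : 0 < \sum_(k < N) F k * x ^+ k + cn al n c * x ^+ n.
  case/andP: x01 => x0 _; case: (N) N0 => // K _; rewrite big_ord_recl expr0 mulr1 F0.
  rewrite -addrA ltr_wpDr // addr_ge0 //.
    by apply: sumr_ge0 => k _; rewrite mulr_ge0 ?exprn_ge0.
  by rewrite mulr_ge0 ?exprn_ge0 // sqrtr_ge0.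
move: phix; rewrite hE pmulr_rge0 // dot_evs.
by [].
Unshelve. all: by end_near. Qed.

End Wandering.

(** * Limits along ultrafilters, and weak against strong convergence *)

Section Limits.
Context {R : realType}.

(** By compactness all coordinates of bounded sequences converge along one ultrafilter, which does
    the work of a diagonal subsequence. *)
Lemma ultra_bounded_cvg (U : set_system nat) (f : nat -> R) B : UltraFilter U ->
  (forall N, `|f N| <= B) -> exists l : R, f N @[N --> U] --> l.
Proof.
move=> UU fB; have [|p [_ hp]] := @segment_compact R (- B) B (f @ U) _ _.
  apply: (@filterS _ U _ setT); last exact: filterT.
  by move=> N _; rewrite /= in_itv /= -ler_norml.
exists p => A pA.
have [//|nA] := in_ultra_setVsetC (f @^-1` A) UU.
by have [y []] := hp (~` A) A nA pA.
Qed.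

Lemma cvg_ultra (U : set_system nat) (f : nat -> R) (l : R) : \oo `<=` U ->
  f N @[N --> \oo] --> l -> f N @[N --> U] --> l.
Proof. by move=> sU fl A /fl; exact: sU. Qed.

(** h is bounded in norm and converges coordinatewise, that is, weakly; u is dominated by a fixed
    square summable v, that is, converges strongly. Their products then converge. *)
Lemma weak_strong (T : Type) (G : set_system T) {FG : ProperFilter G}
    (w : nat -> R) (h u : T -> nat -> R) (lh lu v : nat -> R) B :
  (forall k, 0 <= w k) ->
  (forall t, asum (fun k => w k * h t k ^+ 2)) ->
  (forall t, ssum (fun k => w k * h t k ^+ 2) <= B) ->
  asum (fun k => w k * v k ^+ 2) -> (forall t k, `|u t k| <= v k) ->
  (forall k, h t k @[t --> G] --> lh k) -> (forall k, u t k @[t --> G] --> lu k) ->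
  asum (fun k => w k * lh k ^+ 2) /\
  ssum (fun k => w k * (u t k * h t k)) @[t --> G] --> ssum (fun k => w k * (lu k * lh k)).
Proof.
move=> w0 ah hB av uv ch cu.
have sq k (x : R) : 0 <= w k * x ^+ 2 by rewrite mulr_ge0 ?sqr_ge0.
have part t N : \sum_(k < N) w k * h t k ^+ 2 <= B by apply: le_trans (hB t); exact: ssum_part.
have cfin N (f : T -> nat -> R) (l : nat -> R) : (forall k, f t k @[t --> G] --> l k) ->
    \sum_(k < N) f t k @[t --> G] --> \sum_(k < N) l k.
  by move=> hf; apply: cvg_big => [|k _]; [exact: add_continuous|exact: hf].
have partl N : \sum_(k < N) w k * lh k ^+ 2 <= B.
  have c : \sum_(k < N) w k * h t k ^+ 2 @[t --> G] --> \sum_(k < N) w k * lh k ^+ 2.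
    apply: (cfin N (fun t k => w k * h t k ^+ 2) (fun k => w k * lh k ^+ 2)) => k.
    by apply: cvgMr; exact: (@cvg_comp _ _ _ _ (fun x : R => x ^+ 2) _ _ _ (ch k) (@exprn_continuous _ _ _)).
  rewrite -(cvg_lim _ c) //; apply: limr_le; first exact: (cvgP _ c).
  by near=> t; exact: part.
have al : asum (fun k => w k * lh k ^+ 2).
  by apply: (@asum_bnd _ _ B) => N; under eq_bigr do rewrite ger0_norm //.
have lB : ssum (fun k => w k * lh k ^+ 2) <= B by exact: ssum_leB.
have luv k : `|lu k| <= v k.
  have c : `|u t k| @[t --> G] --> `|lu k| by apply: cvg_norm; exact: cu.
  by rewrite -(cvg_lim _ c) //; apply: limr_le; [exact: (cvgP _ c)|near=> t].
have v0 k : 0 <= v k by apply: le_trans (luv k).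
split => //.
(* AM-GM with a free parameter r bounds both tails. *)
have amgm (r : R) (f g : nat -> R) k : 0 < r -> `|g k| <= v k ->
    `|w k * (g k * f k)| <= r * (w k * f k ^+ 2) + r^-1 * (w k * v k ^+ 2).
  move=> r0 gv; rewrite normrM (ger0_norm (w0 k)) normrM !(mulrCA _ (w k)) -mulrDr ler_wpM2l //.
  apply: (@le_trans _ _ (v k * `|f k|)); first by rewrite ler_wpM2r.
  rewrite -(real_normK (num_real (f k))); move: (v k) `|f k| (v0 k) (normr_ge0 (f k)) => a b a0 b0.
  rewrite -(ler_pM2l r0).
  have -> : r * (r * b ^+ 2 + r^-1 * a ^+ 2) = (r * b) ^+ 2 + a ^+ 2 by field; rewrite gt_eqF.
  have := sqr_ge0 (r * b - a); have := mulr_ge0 (mulr_ge0 (ltW r0) a0) b0; nra.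
have af f g : asum (fun k => w k * f k ^+ 2) -> (forall k, `|g k| <= v k) -> asum (fun k => w k * (g k * f k)).
  move=> hf gv; apply: asum_le (asumD (@asumZ _ 1 _ hf) (@asumZ _ 1^-1 _ av)) => k.
  exact: amgm.
have tail (r : R) m f g : 0 < r -> asum (fun k => w k * f k ^+ 2) -> ssum (fun k => w k * f k ^+ 2) <= B ->
    (forall k, `|g k| <= v k) -> `|ssum (fun k => w (m + k)%N * (g (m + k)%N * f (m + k)%N))| <=
     r * B + r^-1 * ssum (fun k => w (m + k)%N * v (m + k)%N ^+ 2).
  move=> r0 hf fB gv; have h1 := @asum_shift _ _ m (af f g hf gv).
  have h2 := @asum_shift _ _ m hf; have h3 := @asum_shift _ _ m av.
  apply: (le_trans (ssum_norm h1)).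
  apply: (@le_trans _ _ (r * ssum (fun k => w (m + k)%N * f (m + k)%N ^+ 2) + r^-1 * ssum (fun k => w (m + k)%N * v (m + k)%N ^+ 2))).
    rewrite -!ssumZ // -ssumD; [|exact: asumZ..].
    apply: ssum_le; [exact: asum_norm|by apply: asumD; apply: asumZ|].
    by move=> k; apply: (amgm r f g).
  rewrite lerD2r ler_pM2l //; apply: le_trans fB; rewrite (ssum_split m hf) lerDr.
  by apply: sumr_ge0 => k _.
have B0 : 0 <= B by apply: le_trans (partl 0%N); rewrite big_ord0.
apply/cvgrPdist_le => /= e e0.
pose r := e / (6 * (B + 1)).
have r0 : 0 < r by rewrite divr_gt0 // mulr_gt0 // ltr_wpDl.
have rB : r * B <= e / 6.
  have -> : e / 6 = r * (B + 1) by rewrite /r; field; rewrite gt_eqF // ltr_wpDl.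
  by rewrite ler_pM2l // lerDl.
have re0 : 0 < r * (e / 6) by rewrite mulr_gt0 // divr_gt0.
have /cvgrPdist_le /(_ _ re0)[m _ hm] := ssum_tail av.
have := hm m (leqnn m); rewrite sub0r normrN => /(le_trans (ler_norm _)) {}hm.
have hm' : r^-1 * ssum (fun k => w (m + k)%N * v (m + k)%N ^+ 2) <= e / 6.
  by rewrite ler_pdivrMl.
have e3 : 0 < e / 3 by rewrite divr_gt0.
have cf : \sum_(k < m) w k * (u t k * h t k) @[t --> G] --> \sum_(k < m) w k * (lu k * lh k).
  apply: (cfin m (fun t k => w k * (u t k * h t k)) (fun k => w k * (lu k * lh k))) => k.
  by apply: cvgMr; apply: cvgM; [exact: cu|exact: ch].
move/cvgrPdist_le : cf => /(_ _ e3) cf.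
near=> t.
have h1 : `|\sum_(k < m) w k * (lu k * lh k) - \sum_(k < m) w k * (u t k * h t k)| <= e / 3 by near: t; exact: cf.
have h2 := tail r m lh lu r0 al lB luv; have h3 := tail r m (h t) (u t) r0 (ah t) (hB t) (uv t).
rewrite (ssum_split m (af _ _ al luv)) (ssum_split m (af _ _ (ah t) (uv t))).
move: h1 h2 h3 rB hm'; move: (\sum_(k < m) w k * (lu k * lh k)) (\sum_(k < m) w k * (u t k * h t k)).
move: (ssum _) (ssum (fun k => w (m + k)%N * (u t _ * _))) (r^-1 * _) (r * B) => x y t1 t2 p q.
rewrite !ler_norml => /andP[? ?] /andP[? ?] /andP[? ?] ? ?; apply/andP; split; lra.
Unshelve. all: by end_near. Qed.

End Limits.

(** * The equation satisfied by the limit of the functions psi *)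

Section LimitEquation.
Context {R : realType}.
Notation C := (R[i]).
Notation Re := (@complex.Re R).
Notation Im := (@complex.Im R).
Notation V := (nat -> C^o).
Variable al : R.
Hypothesis a1 : 1 <= al.
Notation w := (bw al).
Notation H := (l2w w : set V).
Notation T := (@sshift R).
Implicit Types u v : nat -> R.

Let a0 : 0 < al. Proof. exact: lt_le_trans a1. Qed.
Let hw n : 0 < w n. Proof. exact: bw_gt0. Qed.
Let hI k (u : V) : H u -> H (iter k T u). Proof. exact: l2_iter. Qed.

Definition rc u : V := fun k => (u k)%:C.
Definition tconv (F : nat -> R) N u m : R := \sum_(k < N) F k * (if (k <= m)%N then u (m - k)%N else 0).

Lemma mulF_rc F N u : mulF F N (rc u) = rc (tconv F N u).
Proof.
apply/funext => m; rewrite /mulF fct_sumE /rc /tconv rmorph_sum; apply: eq_bigr => k _.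
have -> : ((F k)%:C *: iter k T (fun k0 => (u k0)%:C)) m = (F k)%:C * iter k T (fun k0 => (u k0)%:C) m by [].
by rewrite iter_sshift rmorphM; congr (_ * _); case: ifP.
Qed.

Lemma dot_rc u v : dot w (rc u) (rc v) = ssum (fun k => w k * (u k * v k)).
Proof. by apply: eq_ssum => k; rewrite Re_mulJ /= mulr0 addr0. Qed.

Lemma l2w_rc u : H (rc u) <-> asum (fun k => w k * u k ^+ 2).
Proof.
by split=> h; apply: (eq_asum h) => k; rewrite /nsq /= expr0n addr0.
Qed.

Lemma tconv_cprod F N u m : (m < N)%N -> tconv F N u m = cprod F u m.
Proof.
move=> mN; pose f k := F k * (if (k <= m)%N then u (m - k)%N else 0).
have f0 k : (m < k)%N -> f k = 0 by rewrite /f ltnNge => /negbTE ->; rewrite mulr0.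
transitivity (ssum f).
  by rewrite (@ssum_fin _ f N) // => k Nk; apply: f0; exact: leq_trans Nk.
rewrite (@ssum_fin _ f m.+1) //; apply: eq_bigr => k _.
by rewrite /f -ltnS ltn_ord.
Qed.

Lemma tconv_bound F N u m : (forall k, 0 <= F k) -> (forall k, 0 <= u k) ->
  `|tconv F N u m| <= cprod F u m.
Proof.
move=> F0 u0; pose f k := F k * (if (k <= m)%N then u (m - k)%N else 0).
have f0 k : (m.+1 <= k)%N -> f k = 0 by rewrite /f ltnNge => /negbTE ->; rewrite mulr0.
have fge k : 0 <= f k by rewrite /f mulr_ge0 //; case: ifP.
rewrite ger0_norm; last by apply: sumr_ge0 => k _; exact: fge.
have -> : cprod F u m = ssum f.
  rewrite (@ssum_fin _ f m.+1) //; apply: eq_bigr => k _.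
  by rewrite /f -[in RHS]ltnS ltn_ord.
by apply: ssum_part => //; exact: asum_fin f0.
Qed.

Lemma dot_iter_rc n u v : H (rc u) -> H (rc v) ->
  dot w (iter n T (rc u)) (iter n T (rc v)) = ssum (fun j => w (n + j)%N * (u j * v j)).
Proof.
move=> hu hv; have h := asum_dot hw (@hI n _ hu) (@hI n _ hv).
rewrite /dot (ssum_split n h) big1 ?add0r; last first.
  by move=> i _; rewrite iter_sshift leqNgt ltn_ord /= mul0r mulr0.
by apply: eq_ssum => j; rewrite !iter_sshift leq_addr addKn Re_mulJ /= mulr0 addr0.
Qed.

Variable c : R.
Hypothesis c0 : 0 < c.

Lemma small_delta F N (e : R) : (forall k, 0 <= F k) -> 0 < e ->
  exists2 n, (N <= n)%N & delta al F N n c <= e.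
Proof.
move=> F0 e0; pose Q := (\sum_(k < N) F k) * Num.sqrt (expR al).
have Q0 : 0 <= Q by rewrite mulr_ge0 ?sqrtr_ge0 // sumr_ge0.
(* c_n^2 = c / w_n is at least c (n + 1) by [bw_le_inv]; this n makes it exceed (Q / e)^2. *)
pose n := maxn N (Num.truncn ((Q / e) ^+ 2 / c)); exists n; first exact: leq_maxl.
have cg := @cn_gt0 R al a0 n c c0; rewrite /delta -/Q ler_pdivrMr // mulrC -ler_pdivrMr //.
rewrite -(ler_pXn2r (ltn0Sn 1)) ?nnegrE ?(ltW cg) ?divr_ge0 ?(ltW e0) // cn2 //.
apply: (@le_trans _ _ (c * n.+1%:R)).
  have := truncnS_gt ((Q / e) ^+ 2 / c); rewrite ltr_pdivrMr // => h.
  by apply: (le_trans (ltW h)); rewrite mulrC ler_pM2l // ler_nat ltnS leq_maxr.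
rewrite ler_pM2l // -[leLHS]invrK lef_pV2 ?posrE ?invr_gt0 //; exact: bw_le_inv.
Qed.

Variable q : R.
Hypotheses (q1 : 1 <= q) (hq : 2 * q < al + 1).
Let q0 : 0 < q. Proof. exact: lt_le_trans q1. Qed.

(** These are the coefficients of F / (1 - x z). For q >= 1 the F_k increase, so F_m can be taken
    out of the sum. *)
Lemma cprod_bF_geo (x : R) m : 0 <= x < 1 -> 0 <= cprod (bF q) (fun k => x ^+ k) m <= bF q m / (1 - x).
Proof.
move=> /andP[x0 x1]; have s0 : 0 < 1 - x by rewrite subr_gt0.
apply/andP; split.
  by apply: sumr_ge0 => k _; rewrite mulr_ge0 ?exprn_ge0 // ltW // bF_gt0.
apply: (@le_trans _ _ (\sum_(k < m.+1) bF q m * x ^+ (m - k))).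
  by apply: ler_sum => k _; rewrite ler_wpM2r ?exprn_ge0 // bF_mono // -ltnS.
rewrite -mulr_sumr ler_pM2l ?bF_gt0 // (reindex_inj rev_ord_inj) /=.
under eq_bigr => k _ do rewrite subSS subKn -1?ltnS //.
have nx : `|x| < 1 by rewrite ger0_norm.
rewrite -(ssum_geo nx); apply: (@ssum_part _ (fun k => x ^+ k)); first exact: asum_geo.
by move=> k; rewrite exprn_ge0.
Qed.

Lemma asum_bw_cprod_geo (x : R) : 0 <= x < 1 ->
  asum (fun m => w m * cprod (bF q) (fun k => x ^+ k) m ^+ 2).
Proof.
move=> x01; apply: asum_le (@asumZ _ ((1 - x)^-1 ^+ 2) _ (asum_bwF a0 q0 hq)) => m.
have wm := ltW (hw m); rewrite ger0_norm; last by rewrite mulr_ge0 // sqr_ge0.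
rewrite [leRHS]mulrCA ler_wpM2l //.
have /andP[h1 h2] := cprod_bF_geo m x01; rewrite -exprMn mulrC.
by rewrite lerXn2r ?nnegrE // (le_trans h1).
Qed.

Theorem limit_equation : Beurling_type H (lip w) T -> exists psi : nat -> R,
  [/\ exists B, forall k, `|psi k| <= B / w k,
    asum (fun k => w k * cprod (bF q) psi k ^+ 2),
    forall x, 0 <= x < 1 -> 0 <= ssum (fun k => psi k * x ^+ k) &
    forall x, 0 <= x < 1 ->
      ssum (fun m => w m * (cprod (bF q) (fun k => x ^+ k) m * cprod (bF q) psi m)) +
      c * ssum (fun k => psi k * x ^+ k) = 1].
Proof.
move=> B; pose F := bF q.
have F0 : F 0 = 1 by [].
have Fge k : 0 <= F k by rewrite ltW // bF_gt0.
(* The bound 1 / (N + 4) is at most 1/4 for every N, as [exists_psi] requires, and tends to 0, which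
   removes the cross terms. *)
have data N : exists np : nat * (nat -> R), [/\ (N.+1 <= np.1)%N,
    delta al F N.+1 np.1 c <= N.+4%:R^-1, H (rc np.2),
    (forall g, H g -> dot w (mulP al F N.+1 np.1 c (rc np.2)) (mulP al F N.+1 np.1 c g) = Re (g 0%N)) &
    forall x, 0 <= x < 1 -> 0 <= ssum (fun k => np.2 k * x ^+ k)].
  have N4 : 0 < N.+4%:R^-1 :> R by rewrite invr_gt0.
  have [n Nn dn] := @small_delta F N.+1 _ Fge N4.
  have d4 : delta al F N.+1 n c <= 4^-1.
    by apply: (le_trans dn); rewrite lef_pV2 ?posrE // ler_nat.
  have [p [h1 h2 h3]] := exists_psi a0 F0 Fge (ltn0Sn N) Nn c0 d4 B.
  by exists (n, p).
have [np npP] := choice data.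
pose n N := (np N).1; pose p N := (np N).2.
have Nn N : (N.+1 <= n N)%N by case: (npP N).
have dN N : delta al F N.+1 (n N) c <= N.+4%:R^-1 by case: (npP N).
have Hp N : H (rc (p N)) by case: (npP N).
have eqp N g : H g -> dot w (mulP al F N.+1 (n N) c (rc (p N))) (mulP al F N.+1 (n N) c g) = Re (g 0%N).
  by case: (npP N) => _ _ _ + _; apply.
have ppos N x : 0 <= x < 1 -> 0 <= ssum (fun k => p N k * x ^+ k).
  by case: (npP N) => _ _ _ _; apply.
have d4 N : delta al F N.+1 (n N) c <= 4^-1.
  by apply: (le_trans (dN N)); rewrite lef_pV2 ?posrE // ler_nat.
pose t N := tconv F N.+1 (p N).
pose st N := starn al (n N) c.
have low N : dot w (rc (t N)) (rc (t N)) + st N (rc (p N)) / 2 <= p N 0%N.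
  have := @mulP_lower R al a0 F N.+1 (n N) c Fge (Nn N) c0 (d4 N) _ (Hp N).
  by rewrite eqp // mulF_rc.
have stc N : c * (w 0 * nsq (rc (p N) 0%N)) <= st N (rc (p N)).
  apply: le_trans (@starn_ge R al a0 (n N) c c0 _ (Hp N)); rewrite ler_pM2l //; exact: dot_coef.
have Ht N : H (rc (t N)) by rewrite -mulF_rc; exact: mulF_H.
have dt0 N := dot_ge0 hw (Ht N).
have st0 N := @starn_ge0 R al a0 (n N) c _ (Hp N).
(* Testing the equation on psi itself bounds half of [starn] by psi(0), while [starn] is at least c
   psi(0)^2. *)
have p0 N : p N 0%N <= 2 / c.
  rewrite ler_pdivlMr //; have := low N; have := stc N; have := dt0 N; have := st0 N.
  rewrite /nsq /= expr0n addr0 mul1r -/(st N _).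
  move: (dot w _ _) (st N _) (p N 0%N) => x y z y0 x0 h1 h2.
  have z0 : 0 <= z by lra.
  have [->|zn] := eqVneq z 0; first by rewrite mul0r.
  have z1 : 0 < z by rewrite lt_neqAle eq_sym zn.
  rewrite -(ler_pM2r z1); move: h1; rewrite expr2; lra.
have stB N : st N (rc (p N)) <= 4 / c.
  have -> : 4 / c = 2 * (2 / c) by field; rewrite gt_eqF.
  by have := low N; have := p0 N; have := dt0 N; lra.
have dtB N : ssum (fun k => w k * t N k ^+ 2) <= 2 / c.
  have -> : ssum (fun k => w k * t N k ^+ 2) = dot w (rc (t N)) (rc (t N)).
    by rewrite dot_rc; apply: eq_ssum => k; rewrite expr2.
  by have := low N; have := p0 N; have := st0 N; rewrite -/(st N _); lra.
(* The estimate is one for w_k psi_k^2; since w_k <= 1, dividing by w_k once more removes the square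
   root. *)
have pB N k : `|p N k| <= (2 / c) / w k.
  have h : c * (w k * nsq (rc (p N) k)) <= 4 / c.
    apply: le_trans (stB N); apply: le_trans (@starn_ge R al a0 (n N) c c0 _ (Hp N)).
    by rewrite ler_pM2l //; exact: dot_coef.
  have wk := hw k; have w1 := @bw_le1 _ al k a0.
  have e0 : 0 <= 2 / c / w k by rewrite !divr_ge0 // ltW.
  rewrite -(ler_pXn2r (ltn0Sn 1)) ?nnegrE // real_normK ?num_real //.
  have h2 : c ^+ 2 * (w k * p N k ^+ 2) <= 4.
    by move: h; rewrite ler_pdivlMr // /nsq /= expr0n addr0; lra.
  have -> : (2 / c / w k) ^+ 2 = 4 / (c ^+ 2 * w k ^+ 2) by field; rewrite !gt_eqF.
  rewrite ler_pdivlMr ?mulr_gt0 ?exprn_gt0 //; apply: le_trans h2.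
  rewrite mulrC -mulrA ler_pM2l ?exprn_gt0 // expr2 -mulrA ler_pM2l //.
  by rewrite ler_piMl ?sqr_ge0.
have [U [UU sU]] := @ultraFilterLemma nat \oo _.
have lim k : exists l : R, p N k @[N --> U] --> l.
  exact: (ultra_bounded_cvg UU (fun N => pB N k)).
have [psi cpsi] := choice lim; exists psi.
have psiB k : `|psi k| <= (2 / c) / w k.
  have h : `|p N k| @[N --> U] --> `|psi k| by apply: cvg_norm; exact: cpsi.
  by rewrite -(cvg_lim _ h) //; apply: limr_le; [exact: (cvgP _ h)|near=> N].
have dom x k (y : R) : 0 <= x < 1 -> `|y| <= (2 / c) / w k -> `|y * x ^+ k| <= (2 / c) * (x ^+ k / w k).
  move=> /andP[x0 _] h; rewrite normrM (ger0_norm (exprn_ge0 _ x0)).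
  by rewrite [leRHS]mulrCA [leRHS]mulrC ler_wpM2r ?exprn_ge0.
have cval x : 0 <= x < 1 -> ssum (fun k => p N k * x ^+ k) @[N --> U] --> ssum (fun k => psi k * x ^+ k).
  move=> x01; apply: (@tannery _ _ U _ (fun N k => p N k * x ^+ k) _ (fun k => (2 / c) * (x ^+ k / w k))).
  - by apply: asumZ; exact: asum_xw.
  - by near=> N => k; exact: dom.
  - by move=> k; apply: cvgMl; exact: cpsi.
have ct k : t N k @[N --> U] --> cprod F psi k.
  apply: (@cvg_trans _ (cprod F (p N) k @[N --> U])).
    apply: near_eq_cvg; apply: sU; exists k => // N /= kN; by rewrite /t tconv_cprod.
  apply: cvg_big => [|j _]; [exact: add_continuous|apply: cvgMr; exact: cpsi].
have ws x : 0 <= x < 1 -> asum (fun k => w k * cprod F psi k ^+ 2) /\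
    ssum (fun k => w k * (tconv F N.+1 (fun k => x ^+ k) k * t N k)) @[N --> U] -->
    ssum (fun k => w k * (cprod F (fun k => x ^+ k) k * cprod F psi k)).
  move=> x01; have /andP[x0 x1] := x01.
  apply: (@weak_strong _ _ U _ w t (fun N => tconv F N.+1 (fun k => x ^+ k)) _ _
    (cprod F (fun k => x ^+ k)) (2 / c)) => //.
  - by move=> k; exact: ltW.
  - by move=> N; exact: ((l2w_rc (t N)).1 (Ht N)).
  - exact: asum_bw_cprod_geo.
  - by move=> N k; apply: tconv_bound => // j; exact: exprn_ge0.
  - move=> k; apply: (@cvg_trans _ (cprod F (fun k => x ^+ k) k @[N --> U])); last exact: cvg_cst.
    by apply: near_eq_cvg; apply: sU; exists k => // N /= kN; rewrite tconv_cprod.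
split.
- by exists (2 / c).
- by have [] := ws 0 (_ : 0 <= 0 < 1); rewrite ?lexx ?ltr01.
- move=> x x01; rewrite -(cvg_lim _ (cval x x01)) //; apply: limr_ge; first exact: (cvgP _ (cval x x01)).
  by near=> N; exact: ppos.
move=> x x01; have /andP[x0 x1] := x01.
(* A N comes from the truncation of F and Y N from c_n z^n, both tested against g = 1 / (1 - x
   z). *)
pose A N := ssum (fun k => w k * (tconv F N.+1 (fun k => x ^+ k) k * t N k)).
pose Y N := ssum (fun j => c * (w (n N + j)%N / w (n N) * (p N j * x ^+ j))).
have x2 : `|x * x| < 1.
  by rewrite ger0_norm ?mulr_ge0 // -[ltRHS]mulr1; apply: ltr_pM.
pose g := rc (fun k => x ^+ k).
have Hg : H g.
  apply/l2w_rc; apply: asum_le (asum_geo x2) => k.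
  have wk := ltW (hw k); rewrite ger0_norm; last by rewrite mulr_ge0 // sqr_ge0.
  by rewrite exprMn -expr2 ler_piMl ?sqr_ge0 // bw_le1.
pose G := c * (1 - x * x)^-1.
have stg N : st N g <= G.
  rewrite /st /starn dot_iter_rc // cn2 // /G -(ssum_geo x2) -mulrA ler_pM2l //.
  rewrite mulrC ler_pdivrMr // mulrC -ssumZ; last exact: asum_geo.
  apply: ssum_le.
  - have [h _] := @dot_iterE R al a0 (n N) _ Hg; apply: (eq_asum h) => j.
    by rewrite /nsq /= expr0n addr0 expr2.
  - by apply: asumZ; exact: asum_geo.
  - by move=> j; rewrite -exprMn ler_pM ?exprn_ge0 ?mulr_ge0 ?(ltW (hw _)) // bw_decr // leq_addr.
(* The exact equation tested on g, where the two cross terms are bounded by delta times the sum of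
   the two [starn]. *)
have near1 N : `|1 - (A N + Y N)| <= N.+4%:R^-1 * (4 / c + G).
  have hF1 := @mulF_H R al a0 F N.+1 _ (Hp N); have hF2 := @mulF_H R al a0 F N.+1 _ Hg.
  have hT1 := @l2wZ _ _ hw (cn al (n N) c)%:C _ (@hI (n N) _ (Hp N)).
  have hT2 := @l2wZ _ _ hw (cn al (n N) c)%:C _ (@hI (n N) _ Hg).
  have h1 := @dot_mulF_cross R al a0 F N.+1 (n N) c Fge (Nn N) c0 _ _ (Hp N) Hg.
  have h2 := @dot_mulF_cross R al a0 F N.+1 (n N) c Fge (Nn N) c0 _ _ Hg (Hp N).
  have := eqp N g Hg; rewrite /mulP (dotDl hw) ?(dotDr hw) //; last exact: (l2wD hw).
  rewrite [Re _]/= expr0.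
  have -> : dot w (mulF F N.+1 (rc (p N))) (mulF F N.+1 g) = A N.
    by rewrite !mulF_rc dot_rc; apply: eq_ssum => k; rewrite [_ * t N k]mulrC.
  have -> : dot w ((cn al (n N) c)%:C *: iter (n N) T (rc (p N))) ((cn al (n N) c)%:C *: iter (n N) T g) = Y N.
    rewrite (dotZl hw) ?(dotZr hw) //; [|exact: hI..]; rewrite mulrA -expr2 cn2 // dot_iter_rc //.
    rewrite /Y -ssumZ; last first.
      have h := asum_dot hw (@hI (n N) _ (Hp N)) (@hI (n N) _ Hg).
      apply: (eq_asum (@asum_shift _ _ (n N) h)) => j.
      by rewrite !iter_sshift leq_addr addKn Re_mulJ /= mulr0 addr0.
    by apply: eq_ssum => j; rewrite -!mulrA; congr (c * _); rewrite mulrCA.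
  rewrite [dot w (_ *: _) (mulF _ _ _)]dotC => e.
  have hS : delta al F N.+1 (n N) c * (st N (rc (p N)) + st N g) <= N.+4%:R^-1 * (4 / c + G).
    have sg := @starn_ge0 R al a0 (n N) c _ Hg.
    apply: ler_pM => //; last exact: lerD.
      by rewrite divr_ge0 ?mulr_ge0 ?sqrtr_ge0 // sumr_ge0.
    by apply: addr_ge0; [exact: st0|exact: sg].
  apply: le_trans hS; rewrite /st.
  move: h1 h2 e; rewrite [starn _ _ _ g + _]addrC.
  move: (dot w (mulF F N.+1 (rc (p N))) _) (dot w (mulF F N.+1 g) _) (delta _ _ _ _ _ * _) (A N) (Y N).
  move=> X1 X2 D AN YN; rewrite !ler_norml => /andP[? ?] /andP[? ?] e; apply/andP; split; lra.
have cA : A N @[N --> U] --> ssum (fun m => w m * (cprod F (fun k => x ^+ k) m * cprod F psi m)).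
  by have [] := ws x x01.
have ninf k : w (n N + k)%N / w (n N) @[N --> \oo] --> (1 : R).
  apply: (@cvg_comp _ _ _ n (fun m => w (m + k)%N / w m) _ \oo); last exact: bw_ratio.
  move=> D [m _ hm]; exists m => // N /= mN; apply: hm => /=.
  by rewrite (leq_trans mN) // (leq_trans _ (Nn N)).
have cY : Y N @[N --> U] --> c * ssum (fun k => psi k * x ^+ k).
  have ap : asum (fun k => psi k * x ^+ k).
    by apply: asum_le (@asumZ _ (2 / c) _ (asum_xw a0 x01)) => k; exact: dom.
  rewrite -ssumZ //.
  apply: (@tannery _ _ U _ (fun N j => c * (w (n N + j)%N / w (n N) * (p N j * x ^+ j))) _
     (fun k => c * ((2 / c) * (x ^+ k / w k)))).
  - by apply: asumZ; apply: asumZ; exact: asum_xw.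
  - near=> N => k; rewrite normrM (gtr0_norm c0) ler_pM2l //.
    have r1 : `|w (n N + k)%N / w (n N)| <= 1.
      rewrite ger0_norm ?divr_ge0 ?(ltW (hw _)) // ler_pdivrMr // mul1r.
      by apply: bw_decr => //; exact: leq_addr.
    rewrite normrM -[leRHS]mul1r; apply: ler_pM => //; exact: dom.
  - move=> k; apply: cvgMr; rewrite -[X in _ --> X]mul1r.
    by apply: cvgM; [apply: (cvg_ultra sU); exact: ninf|apply: cvgMl; exact: cpsi].
have c1 : A N + Y N @[N --> U] --> (1 : R).
  apply: (cvg_ultra sU); apply/cvgrPdist_le => e e0.
  pose K := 4 / c + G; have K0 : 0 <= K.
    apply: addr_ge0; first by rewrite divr_ge0 // ltW.
    apply: le_trans (stg 0%N).
    exact: (@starn_ge0 R al a0 (n 0%N) c _ Hg).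
  exists (Num.truncn (K / e)) => // N /= hN; apply: (le_trans (near1 N)).
  have := truncnS_gt (K / e); rewrite ltr_pdivrMr // => h.
  rewrite -/K [leLHS]mulrC ler_pdivrMr //; apply: (le_trans (ltW h)).
  rewrite mulrC ler_pM2l // ler_nat ltnS (leq_trans hN) //.
  by do 3 apply: leqW.
exact: (cvg_unique _ (cvgD cA cY) c1).
Unshelve. all: by end_near. Qed.

End LimitEquation.

(** * The integral kernel *)

Section UnitInterval.
Context {R : realType}.
Notation mu := (@lebesgue_measure R).
Notation mR := (measurableTypeR R).
Notation pl := (@pl R).
Notation I01 := (`]0%R, 1%R[%classic : set mR).

Lemma FTC01 (f G : R -> R) (A B : R) :
  measurable_fun I01 (fun x : mR => (f x)%:E) ->
  (forall x : R, 0 < x < 1 -> 0 <= f x) ->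
  (forall x : R, 0 < x < 1 -> is_derive x 1 G (f x)) ->
  (forall x : R, 0 < x < 1 -> {for x, continuous f}) ->
  G (@ep R n) @[n --> \oo] --> A -> G (1 - @ep R n) @[n --> \oo] --> B ->
  (\int[mu]_(x in I01) (f x)%:E = (B - A)%:E)%E.
Proof.
move=> mf f0 dG cf GA GB; have := cvg_int_exh mf f0.
have E n : (\int[mu]_(x in exh n) (f x)%:E = (G (1 - ep n) - G (ep n))%:E)%E.
  have h (x : R) : ep n <= x <= 1 - ep n -> 0 < x < 1.
    by move=> hx; apply: (@exhP _ n); rewrite /exh /= in_itv.
  by apply: FTC_smooth => [|x /h|x /h]; [exact: exh_lt|exact: dG|exact: cf].
under eq_fun do rewrite E; move=> h.
have h2 : (G (1 - ep n) - G (ep n))%:E @[n --> \oo] --> (B - A)%:E.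
  by apply: cvg_EFin; [near=> n|apply: (@cvgB _ R^o)].
exact: (cvg_unique _ h h2).
Unshelve. all: by end_near. Qed.

Lemma cvg_ep : @ep R n @[n --> \oo] --> (0 : R).
Proof.
have := cvg_comp _ _ (cvg_addnr 2) (@cvg_harmonic R).
by rewrite /comp /harmonic; under eq_fun do rewrite addn2.
Qed.

Lemma I01P (x : mR) : I01 x -> 0 < (x : R) < 1.
Proof. by rewrite /= in_itv. Qed.

(** The indicator of the open unit interval, which reduces integrals over it to the whole-line
    statements on affine changes of variable and Tonelli. *)
Definition i01 (x : R) : R := if (0 < x) && (x < 1) then 1 else 0.

Lemma i01_ge0 x : 0 <= i01 x. Proof. by rewrite /i01; case: ifP. Qed.

Lemma measurable_i01 : measurable_fun [set: mR] (i01 : mR -> R).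
Proof.
apply: measurable_fun_ifT => //; apply: measurable_and; exact: measurable_fun_ltr.
Qed.

Lemma int01 (f : mR -> \bar R) :
  (\int[mu]_(x in I01) f x = \int[mu]_x ((i01 x)%:E * f x))%E.
Proof.
rewrite integral_mkcond; apply: eq_integral => x _; rewrite /patch /i01.
have -> : (x \in I01) = (0 < x) && (x < 1).
  by apply/idP/idP => [/set_mem|h]; [|apply/mem_set]; rewrite /= in_itv.
by case: ifP => _; rewrite ?mul1e ?mul0e.
Qed.

Lemma measurable_EFin_slices (g : R -> R -> R) :
  measurable_fun [set: pl] (fun p : pl => g p.1 p.2) ->
  (forall x, measurable_fun [set: mR] (fun t : mR => (g x t)%:E)) *
  (forall t, measurable_fun [set: mR] (fun x : mR => (g x t)%:E)).
Proof.
move=> mg; have mf : measurable_fun [set: pl] (fun p : pl => (g p.1 p.2)%:E).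
  exact/measurable_EFinP.
by split => [x|t]; [have := measurable_slice2 x mf|have := measurable_slice1 t mf].
Qed.

Lemma tonelli01 (g : R -> R -> R) : (forall x t, 0 <= g x t) ->
  measurable_fun [set: pl] (fun p : pl => g p.1 p.2) ->
  (\int[mu]_(x in I01) \int[mu]_(t in I01) (g x t)%:E =
   \int[mu]_(t in I01) \int[mu]_(x in I01) (g x t)%:E)%E.
Proof.
move=> g0 mg; pose f (p : pl) : \bar R := (i01 p.1 * (i01 p.2 * g p.1 p.2))%:E.
have f0 p : (0 <= f p)%E by rewrite lee_fin !mulr_ge0 ?i01_ge0.
have mf : measurable_fun [set: pl] f.
  apply/measurable_EFinP; apply: measurable_funM; first exact: (measurableT_comp measurable_i01).
  by apply: measurable_funM => //; exact: (measurableT_comp measurable_i01).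
have [ms1 ms2] := measurable_EFin_slices mg.
have mi : measurable_fun [set: mR] (fun x : mR => (i01 x)%:E).
  by apply/measurable_EFinP; exact: measurable_i01.
have pos (x y : R) : (0 <= (i01 x)%:E * (g x y)%:E)%E by rewrite mule_ge0 ?lee_fin ?i01_ge0.
transitivity (\int[mu]_x \int[mu]_y f (x, y))%E.
  rewrite int01; apply: eq_integral => x _; rewrite int01 -ge0_integralZl //=.
  - by apply: emeasurable_funM.
  - by move=> t _; rewrite mule_ge0 ?lee_fin ?i01_ge0.
  - by rewrite lee_fin i01_ge0.
rewrite -tonelli1 // tonelli2 // [RHS]int01; apply: eq_integral => t _.
rewrite int01 -ge0_integralZl //=; [|by apply: emeasurable_funM|by rewrite lee_fin i01_ge0].
by apply: eq_integral => x _; rewrite /f /= !EFinM muleCA.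
Qed.

Lemma measurable_int01 (g : R -> R -> R) : (forall x t, 0 <= g x t) ->
  measurable_fun [set: pl] (fun p : pl => g p.1 p.2) ->
  measurable_fun [set: mR] (fun x : mR => \int[mu]_(t in I01) (g x t)%:E)%E.
Proof.
move=> g0 mg; pose f (p : pl) : \bar R := (i01 p.2 * g p.1 p.2)%:E.
have f0 p : (0 <= f p)%E by rewrite lee_fin !mulr_ge0 ?i01_ge0.
have mf : measurable_fun [set: pl] f.
  apply/measurable_EFinP; apply: measurable_funM => //; exact: (measurableT_comp measurable_i01).
under eq_fun => x do (rewrite int01; under eq_integral do rewrite -EFinM).
exact: (@measurable_fun_fubini_tonelli_F _ _ mR mR R mu f).
Qed.

Lemma ge0Zl01 (f : mR -> \bar R) (k : R) : measurable_fun I01 f ->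
  (forall x, I01 x -> 0 <= f x)%E -> 0 <= k ->
  (\int[mu]_(x in I01) (k%:E * f x) = k%:E * \int[mu]_(x in I01) f x)%E.
Proof. by move=> mf f0 k0; apply: ge0_integralZl_EFin. Qed.

Lemma int_comb (f g : R -> R) (a b A B : R) :
  measurable_fun I01 (fun x : mR => (f x)%:E) -> measurable_fun I01 (fun x : mR => (g x)%:E) ->
  (forall x, 0 <= f x) -> (forall x, 0 <= g x) -> 0 <= a -> 0 <= b ->
  (\int[mu]_(x in I01) (f x)%:E = A%:E)%E -> (\int[mu]_(x in I01) (g x)%:E = B%:E)%E ->
  (\int[mu]_(x in I01) (a * f x + b * g x)%:E = (a * A + b * B)%:E)%E.
Proof.
move=> mf mg f0 g0 a0 b0 hA hB; rewrite EFinD !EFinM -hA -hB.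
have f0' (x : mR) : I01 x -> (0 <= (f x)%:E)%E by rewrite lee_fin.
have g0' (x : mR) : I01 x -> (0 <= (g x)%:E)%E by rewrite lee_fin.
rewrite -(ge0Zl01 mf f0' a0) -(ge0Zl01 mg g0' b0).
have h (c : R) (u : R -> R) : 0 <= c -> (forall x, 0 <= u x) ->
    forall x : mR, I01 x -> (0 <= c%:E * (u x)%:E)%E.
  by move=> c0 u0 x _; rewrite mule_ge0 ?lee_fin.
have mh (c : R) (u : R -> R) : measurable_fun I01 (fun x : mR => (u x)%:E) ->
    measurable_fun I01 (fun x : mR => c%:E * (u x)%:E)%E.
  by move=> mu0; apply: emeasurable_funM.
by rewrite -(ge0_integralD _ _ (h a f a0 f0) (mh a f mf) (h b g b0 g0) (mh b g mg)).
Qed.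

End UnitInterval.

(** * An integral formula for the coefficients of F / (1 - e z) *)

Section JIntegral.
Context {R : realType}.
Notation mu := (@lebesgue_measure R).
Notation mR := (measurableTypeR R).
Notation I01 := (`]0%R, 1%R[%classic : set mR).
Variables (q Y : R).
Hypotheses (q1 : 1 <= q) (Y0 : 0 <= Y).

(** [Ji b] is the mean of (1 + Y t)^(- b) for the probability density q (1 - t)^(q - 1) on the unit
    interval. *)
Definition jker b (t : R) : R := q * (1 - t) `^ (q - 1) * (1 + Y * t) `^ (- b).
Definition Ji b : R := fine (\int[mu]_(t in I01) (jker b t)%:E)%E.

Let q0 : 0 < q. Proof. by apply: lt_le_trans q1. Qed.

Lemma jker_ge0 b t : 0 <= jker b t.
Proof. by rewrite /jker !mulr_ge0 ?powR_ge0 // ltW. Qed.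

Lemma measurable_powR_aff (c d e : R) : measurable_fun [set: R] (fun t : R => (c + d * t) `^ e).
Proof.
have h : measurable_fun [set: R] (fun x : R => c + d * x).
  by apply: measurable_funD => //; apply: measurable_funM.
exact: (measurableT_comp (@measurable_powR R e) h).
Qed.

Lemma measurable_jker b : measurable_fun [set: R] (jker b).
Proof.
apply: measurable_funM; last exact: measurable_powR_aff.
apply: measurable_funM => //.
have := @measurable_powR_aff 1 (-1) (q - 1).
by under eq_fun do rewrite mulN1r.
Qed.

Lemma measurable_jkerE (D : set mR) b : measurable_fun D (fun x : mR => (jker b x)%:E).
Proof.
apply/measurable_EFinP; have h : @measurable_fun _ _ mR R [set: mR] (jker b).
  exact: measurable_jker.
exact: measurable_funTS.
Qed.

Lemma is_derive_powR_aff b (t : R) : 0 <= t ->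
  is_derive t 1 (fun t => (1 + Y * t) `^ b) (Y * (b * (1 + Y * t) `^ (b - 1))).
Proof.
move=> t0; have h : 0 < 1 + Y * t by rewrite ltr_wpDr // mulr_ge0.
have h1 := is_derive1_powR b h.
have h2 : is_derive t 1 (fun t => 1 + Y * t) Y.
  have := is_deriveD (is_derive_cst (1 : R) t 1) (is_deriveZ Y (is_derive_id t 1)).
  by rewrite add0r /GRing.scale /= mulr1.
have := @is_derive1_comp R (fun x => x `^ b) (fun t => 1 + Y * t) t _ _ h1 h2.
by rewrite /comp mulrC.
Qed.

(** The derivative of - (1 - t)^q (1 + Y t)^(- b), whose increment over [0, 1] is 1. *)
Definition jsum b t := jker b t + b * Y * ((1 - t) `^ q * (1 + Y * t) `^ (- b - 1)).

Lemma measurable_jsum b : measurable_fun [set: R] (jsum b).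
Proof.
apply: measurable_funD; first exact: measurable_jker.
apply: measurable_funM => //; apply: measurable_funM; last exact: measurable_powR_aff.
have := @measurable_powR_aff 1 (-1) q.
by under eq_fun do rewrite mulN1r.
Qed.

Lemma int_jsum b : 0 <= b -> (\int[mu]_(t in I01) (jsum b t)%:E = 1%:E)%E.
Proof.
move=> b0; pose G t := - ((1 - t) `^ q * (1 + Y * t) `^ (- b)).
have dG (t : R) : 0 <= t < 1 -> is_derive t 1 G (jsum b t).
  move=> /andP[t0 t1].
  have := is_deriveN (is_deriveM (is_derive_pow1m q t1) (is_derive_powR_aff (- b) t0)).
  by move/is_derive_eq; apply; rewrite /jsum /jker /GRing.scale /=; ring.
have -> : 1%:E = (0 - (-1 : R))%:E by rewrite sub0r opprK.
apply: (@FTC01 _ _ G).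
- apply/measurable_EFinP; have h : @measurable_fun _ _ mR R [set: mR] (jsum b).
    exact: measurable_jsum.
  exact: measurable_funTS.
- move=> x /andP[x0 x1]; rewrite addr_ge0 ?jker_ge0 //.
  by rewrite !mulr_ge0 ?powR_ge0.
- by move=> x /andP[x0 x1]; apply: dG; rewrite x1 ltW.
- move=> x /andP[x0 x1]; have xx : 0 <= x by exact: ltW.
  have c1 c := is_derive_continuous (is_derive_pow1m c x1).
  have c2 c := is_derive_continuous (is_derive_powR_aff c xx).
  apply: (@cvgD _ R^o); apply: cvgM.
  + by apply: cvgM; [exact: cvg_cst|exact: c1].
  + exact: c2.
  + exact: cvg_cst.
  + by apply: cvgM; [exact: c1|exact: c2].
- have := is_derive_continuous (dG 0 _); rewrite lexx ltr01 => /(_ isT) h.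
  have -> : -1 = G 0 by rewrite /G subr0 mulr0 addr0 !powR1 mulr1.
  exact: (@cvg_comp _ _ _ (@ep R) G _ _ _ cvg_ep h).
- rewrite -[0]oppr0; apply: (@cvgN _ R^o).
  apply: (squeeze_cvgr (f := fun=> 0) (h := fun n => ep n `^ q)); [|exact: cvg_cst|].
    near=> n; have e0 := ep_gt0 (R := R) n; have e1 := ep_lt (R := R) n.
    rewrite mulr_ge0 ?powR_ge0 //= subKr ler_piMr ?powR_ge0 //.
    rewrite powRN invf_le1 ?powR_gt0 //; last first.
      by rewrite ltr_wpDr // mulr_ge0 // subr_ge0; move: (ep n) e1 => x; lra.
    have h : 1 <= 1 + Y * (1 - ep n).
      by rewrite lerDl mulr_ge0 // subr_ge0; move: (ep n) e1 => x; lra.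
    by have := ler_powR h b0; rewrite powRr0.
  apply: (cvg_at_rightP _ _ _).1 (powR_cvg0 q0) _ _.
  by split => [n|]; [exact: ep_gt0|exact: cvg_ep].
Unshelve. all: by end_near. Qed.

Lemma Ji_le1 b : 0 <= b -> (\int[mu]_(t in I01) (jker b t)%:E <= 1%:E)%E.
Proof.
move=> b0; rewrite -(int_jsum b0); apply: ge0_le_integral => //.
- by move=> x _; rewrite lee_fin jker_ge0.
- exact: measurable_jkerE.
- apply/measurable_EFinP; have h : @measurable_fun _ _ mR R [set: mR] (jsum b).
    exact: measurable_jsum.
  exact: measurable_funTS.
- by move=> x _; rewrite lee_fin lerDl !mulr_ge0 ?powR_ge0.
Qed.

Lemma JiE b : 0 <= b -> (\int[mu]_(t in I01) (jker b t)%:E = (Ji b)%:E)%E.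
Proof.
move=> b0; rewrite fineK // ge0_fin_numE; first exact: le_lt_trans (Ji_le1 b0) (ltry _).
by apply: integral_ge0 => x _; rewrite lee_fin jker_ge0.
Qed.

(** Pointwise q [jsum] + b [jker b] = q [jker b] + b (1 + Y) [jker (b + 1)], as Y (1 - t) + (1 + Y
    t) = 1 + Y. *)
Lemma Ji_rec b : 0 <= b -> q + b * Ji b = q * Ji b + b * (1 + Y) * Ji (b + 1).
Proof.
move=> b0; have b1 : 0 <= b + 1 by rewrite addr_ge0.
have bY : 0 <= b * (1 + Y) by rewrite mulr_ge0 // addr_ge0.
have mj c : measurable_fun I01 (fun x : mR => (jker c x)%:E) by exact: measurable_jkerE.
have ms : measurable_fun I01 (fun x : mR => (jsum b x)%:E).
  apply/measurable_EFinP; have h : @measurable_fun _ _ mR R [set: mR] (jsum b).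
    exact: measurable_jsum.
  exact: measurable_funTS.
have s0 (x : R) : 0 <= jsum b x.
  by rewrite addr_ge0 ?jker_ge0 // !mulr_ge0 ?powR_ge0.
have := int_comb ms (mj b) s0 (jker_ge0 b) (ltW q0) b0 (int_jsum b0) (JiE b0).
have := int_comb (mj b) (mj (b + 1)) (jker_ge0 b) (jker_ge0 (b + 1)) (ltW q0) bY (JiE b0) (JiE b1).
rewrite mulr1 => h2 h1; apply: EFin_inj; rewrite -h1 -h2.
apply: eq_integral => t /set_mem /I01P /andP[t0 t1]; congr EFin.
have {}h1 : 0 < 1 - t by rewrite subr_gt0.
have {}h2 : 0 < 1 + Y * t by rewrite ltr_wpDr // mulr_ge0 // ltW.
rewrite /jsum /jker opprD.
have -> : (1 - t) `^ q = (1 - t) `^ (q - 1) * (1 - t).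
  by rewrite -{3}[1 - t](@powRr1) ?(ltW h1) // -powRD ?subrK // (gt_eqF h1) implybT.
have -> : (1 + Y * t) `^ (- b) = (1 + Y * t) `^ (- b - 1) * (1 + Y * t).
  by rewrite -{3}[1 + Y * t](@powRr1) ?(ltW h2) // -powRD ?subrK // (gt_eqF h2) implybT.
by move: (_ `^ (q - 1)) (_ `^ (- b - 1)) => u v; ring.
Qed.

Lemma Ji0 : Ji 0 = 1.
Proof.
have := Ji_rec (lexx 0); rewrite !mul0r !addr0 -{1}[q]mulr1 => h.
by apply/esym/(mulfI _ h); rewrite gt_eqF.
Qed.

Lemma cprodS (u : nat -> R) (e : R) n :
  cprod u (fun k => e ^+ k) n.+1 = e * cprod u (fun k => e ^+ k) n + u n.+1.
Proof.
rewrite /cprod big_ord_recr /= subnn expr0 mulr1; congr (_ + _).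
rewrite mulr_sumr; apply: eq_bigr => i _.
by rewrite (subSn (leq_ord i)) exprS mulrCA.
Qed.

(** With e = 1 / (1 + Y), both sides satisfy the same first-order recursion in k: [Ji_rec] on the
    left, [cprodS] on the right. *)
Lemma Ji_cprod k :
  Ji (q + 1 + k%:R) * bF (q + 1) k = (1 + Y)^-1 * cprod (bF q) (fun i => (1 + Y)^-1 ^+ i) k.
Proof.
have Y1 : 1 + Y != 0 by rewrite gt_eqF // ltr_pwDl.
elim: k => [|k IH].
  rewrite /cprod big_ord1 subnn expr0 !mulr1 addr0.
  have := Ji_rec (ltW q0) => h.
  have {}h : q * ((1 + Y) * Ji (q + 1)) = q * 1 by move: h; rewrite -mulrA => h; lra.
  by apply: (mulfI Y1); rewrite mulfV //; apply: (mulfI _ h); rewrite gt_eqF.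
rewrite cprodS mulrDr [X in _ = _ * X + _]mulrC [X in _ = X + _]mulrA -IH.
have b0 : 0 <= q + 1 + k%:R by rewrite !addr_ge0 ?(ltW q0).
have := Ji_rec b0; rewrite -[(k.+1)%:R]natr1 addrA.
have k1 : k%:R + 1 != 0 :> R by rewrite gt_eqF // ltr_wpDl.
have F0 := bF_shift q k; rewrite (bFS (q + 1) k) (bFS q k) -[(k.+1)%:R]natr1.
have b1 : q + 1 + k%:R != 0 by rewrite gt_eqF // -addrA ltr_pwDl // addr_ge0.
move: (Ji _) (Ji _) => J1 J0 rec.
have {}rec : J1 = (q + (k%:R + 1) * J0) / ((q + 1 + k%:R) * (1 + Y)).
  by apply: (mulIf (mulf_neq0 b1 Y1)); rewrite divfK ?mulf_neq0 //; lra.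
have -> : bF q k * (q + k%:R) = q * bF (q + 1) k by rewrite -F0 mulrC.
by rewrite rec; field; rewrite Y1 k1.
Qed.

End JIntegral.

(** * Rescaled Beta integrals *)

Section ScaledBeta.
Context {R : realType}.
Notation mu := (@lebesgue_measure R).
Notation mR := (measurableTypeR R).
Notation I01 := (`]0%R, 1%R[%classic : set mR).

(** The Beta integrand in which 1 - x becomes 1 - s x, cut off at x = 1 / s. For s >= 1 its support
    remains in [0, 1], so rescaling gives the factor s^(- (b + 1)). *)
Definition tker (b p s x : R) : R := x `^ b * Num.max 0 (1 - s * x) `^ p.

Lemma tker_ge0 b p s x : 0 <= tker b p s x.
Proof. by rewrite mulr_ge0 ?powR_ge0. Qed.

Lemma measurable_tker (b p s : R) : measurable_fun [set: mR] (tker b p s : mR -> R).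
Proof.
apply: measurable_funM; first exact: measurable_powR.
have h : measurable_fun [set: mR] (fun x : mR => Num.max 0 (1 - s * x) : R).
  by apply: measurable_maxr => //; apply: measurable_funB => //; apply: measurable_funM.
exact: (measurableT_comp (@measurable_powR R p) h).
Qed.

Lemma int_tker (b p s : R) : 0 <= b -> 0 < p -> 1 <= s ->
  (\int[mu]_(x in I01) (tker b p s x)%:E = (s `^ (- (b + 1)) * ib b p)%:E)%E.
Proof.
move=> b0 p0 s1; have s0 : 0 < s by apply: lt_le_trans s1.
have p1 : -1 < p by apply: lt_trans p0.
have mb : measurable_fun [set: mR] (fun x : mR => (i01 x * bker b p x)%:E).
  apply/measurable_EFinP; apply: measurable_funM; first exact: measurable_i01.
  exact: measurable_bker.
have := ibE b0 p1; rewrite int01; under eq_integral do rewrite -EFinM.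
rewrite (integral_affine 0 s0 mb) => [|x]; last by rewrite lee_fin mulr_ge0 ?i01_ge0 ?bker_ge0.
have E (x : R) : i01 (s * x + 0) * bker b p (s * x + 0) = s `^ b * (i01 x * tker b p s x).
  rewrite addr0 /i01 pmulr_rgt0 //; case: (ltP 0 x) => x0 /=; last by rewrite !(mul0r, mulr0).
  case: (ltP (s * x) 1) => sx.
    have -> : x < 1 by apply: le_lt_trans sx; rewrite ler_peMl // ltW.
    rewrite !mul1r /tker /bker powRM ?ltW // max_r ?subr_ge0 ?mulrA //; exact: ltW.
  rewrite mul0r /tker max_l ?subr_le0 // powR0 ?gt_eqF // !mulr0.
  by rewrite ?mulr0.
under eq_integral do rewrite E EFinM.
have mt : measurable_fun [set: mR] (fun x : mR => (i01 x * tker b p s x)%:E).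
  apply/measurable_EFinP; apply: measurable_funM; first exact: measurable_i01.
  exact: measurable_tker.
rewrite ge0_integralZl_EFin ?powR_ge0 //; last first.
  by move=> x _; rewrite lee_fin mulr_ge0 ?i01_ge0 ?tker_ge0.
rewrite int01; under [in X in _ -> X]eq_integral do rewrite -EFinM.
set J := (\int[mu]_x _)%E => h.
have sb : 0 < s `^ (b + 1) by rewrite powR_gt0.
rewrite EFinM -h muleC.
have -> : (s%:E * (((s `^ b)%:E) * J) = (s `^ (b + 1))%:E * J)%E.
  rewrite muleA -EFinM; congr (_%:E * _)%E.
  by rewrite powRD ?(gt_eqF s0) ?implybT // powRr1 ?ltW // mulrC.
by rewrite muleAC -EFinM powRN mulfV ?mul1e // gt_eqF.
Qed.

End ScaledBeta.

(** * The positive kernel and its comparison with the limit kernel *)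

Section Kernel.
Context {R : realType}.
Notation mu := (@lebesgue_measure R).
Notation mR := (measurableTypeR R).
Notation I01 := (`]0%R, 1%R[%classic : set mR).
Notation pl := (@pl R).
Variables (q Y p : R).
Hypotheses (q1 : 1 <= q) (Y0 : 0 <= Y) (p0 : 0 < p).

Let q0 : 0 < q. Proof. by apply: lt_le_trans q1. Qed.

(* The moments of [KY] are, up to a constant factor, the numbers w_k (F / (1 - e z))_k
   with e = 1 / (1 + Y); see [KY_momentE]. *)
Definition tY (x t : R) : R := q * (1 - t) `^ (q - 1) * tker q p (1 + Y * t) x.
Definition KY (x : R) : \bar R := (\int[mu]_(t in I01) (tY x t)%:E)%E.

Lemma tY_ge0 x t : 0 <= tY x t.
Proof. by rewrite !mulr_ge0 ?powR_ge0 // ltW. Qed.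

Lemma measurable_tY : measurable_fun [set: pl] (fun p : pl => tY p.1 p.2).
Proof.
have h1 : measurable_fun [set: pl] (fun p : pl => 1 - p.2 : R) by apply: measurable_funB.
have h2 : measurable_fun [set: pl] (fun p : pl => Num.max 0 (1 - (1 + Y * p.2) * p.1) : R).
  apply: measurable_maxr => //; apply: measurable_funB => //; apply: measurable_funM => //.
  by apply: measurable_funD => //; apply: measurable_funM.
have h3 : measurable_fun [set: pl] (fun p : pl => p.1 : R) := @measurable_fst _ _ mR mR.
apply: measurable_funM; first apply: measurable_funM => //.
- exact: (measurableT_comp (@measurable_powR R (q - 1)) h1).
apply: measurable_funM.
  exact: (measurableT_comp (@measurable_powR R q) h3).
exact: (measurableT_comp (@measurable_powR R p) h2).
Qed.

Lemma measurable_KY : measurable_fun [set: mR] (KY : mR -> \bar R).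
Proof. exact: (measurable_int01 tY_ge0 measurable_tY). Qed.

Lemma KY_ge0 x : (0 <= KY x)%E.
Proof. by apply: integral_ge0 => t _; rewrite lee_fin tY_ge0. Qed.

Lemma measurable_tYx x : measurable_fun I01 (fun t : mR => (tY x t)%:E).
Proof. by apply: measurable_funTS; case: (measurable_EFin_slices measurable_tY) => h _; exact: h. Qed.

Lemma KY_moment k :
  (\int[mu]_(x in I01) ((x ^+ k)%:E * KY x) = (ib (q + k%:R) p * Ji q Y (q + 1 + k%:R))%:E)%E.
Proof.
(* The absolute value makes the integrand nonnegative on the whole plane, as [tonelli01] asks; on
   the unit interval it changes nothing. *)
pose g (x t : R) := `|x ^+ k| * tY x t.
have g0 x t : 0 <= g x t by rewrite mulr_ge0 ?tY_ge0.
have mg : measurable_fun [set: pl] (fun p : pl => g p.1 p.2).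
  apply: measurable_funM; last exact: measurable_tY.
  have h : measurable_fun [set: pl] (fun p : pl => p.1 ^+ k : R) by apply: measurable_funX.
  exact: (measurableT_comp (@normr_measurable R _) h).
transitivity (\int[mu]_(x in I01) \int[mu]_(t in I01) (g x t)%:E)%E.
  apply: eq_integral => x /set_mem/I01P /andP[x0 x1].
  rewrite /KY -ge0Zl01; [|exact: measurable_tYx|by move=> t _; rewrite lee_fin tY_ge0|].
    apply: eq_integral => t _; rewrite -EFinM /g ger0_norm //.
    by rewrite exprn_ge0 // ltW.
  by rewrite exprn_ge0 // ltW.
rewrite tonelli01 //.
have b0 : 0 <= q + k%:R by rewrite addr_ge0 // ltW.
have b1 : 0 <= q + 1 + k%:R by rewrite !addr_ge0 // ltW.
transitivity (\int[mu]_(t in I01) ((ib (q + k%:R) p)%:E * (jker q Y (q + 1 + k%:R) t)%:E))%E.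
  apply: eq_integral => t /set_mem/I01P /andP[t0 t1].
  have s1 : 1 <= 1 + Y * t by rewrite lerDl mulr_ge0 // ltW.
  have mt : measurable_fun I01 (fun x : mR => (tker (q + k%:R) p (1 + Y * t) x)%:E).
    apply: measurable_funTS; apply/measurable_EFinP; exact: measurable_tker.
  transitivity (\int[mu]_(x in I01) ((q * (1 - t) `^ (q - 1))%:E * (tker (q + k%:R) p (1 + Y * t) x)%:E))%E.
    apply: eq_integral => x /set_mem/I01P /andP[x0 x1]; rewrite -EFinM; congr EFin.
    rewrite /g /tY /tker ger0_norm ?exprn_ge0 ?ltW // (@powRD _ x q k%:R) ?(gt_eqF x0) ?implybT //.
    by rewrite powR_mulrn ?ltW //; ring.
  rewrite ge0Zl01 //; last 2 first.
  - by move=> x _; rewrite lee_fin tker_ge0.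
  - by rewrite mulr_ge0 ?powR_ge0 // ltW.
  rewrite int_tker // -!EFinM; congr EFin; rewrite /jker.
  by rewrite [q + 1 + _]addrAC; ring.
rewrite ge0Zl01; first by rewrite JiE // EFinM.
- exact: measurable_jkerE.
- by move=> t _; rewrite lee_fin jker_ge0.
- by rewrite ltW // ib_gt0 //; apply: lt_trans p0.
Qed.

(** Beta moments are weights times binomial coefficients, for the parameter al = q + p + 1. This
    identity dictates the choice p = al - q - 1. *)
Lemma ib_bw_bF k : ib (q + k%:R) p = ib q p * (bw (q + p + 1) k * bF (q + 1) k).
Proof.
elim: k => [|k IH]; first by rewrite addr0 !mulr1.
have b0 : 0 <= q + k%:R by rewrite addr_ge0 // ltW.
have p1 : -1 < p by apply: lt_trans p0.
have -> : q + k.+1%:R = q + k%:R + 1 by rewrite -addrA natr1.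
have := ib_rec b0 p1; rewrite IH bwS (bFS (q + 1)) -[k.+1%:R]natr1.
have k0 := ler0n R k.
have h1 : k%:R + 1 != 0 :> R by rewrite gt_eqF // ltr_wpDl.
have h2 : q + k%:R + p + 2 != 0 by rewrite gt_eqF // ltr_wpDl // addr_ge0 // ltW.
have h3 : k%:R + 1 + (q + p + 1) = q + k%:R + p + 2 by ring.
rewrite h3; move: (ib (_ + 1) p) (bw _ _) (bF _ _) (ib q p) => i w f i0 h.
apply: (mulfI h2); rewrite h; field; rewrite h1.
by have -> : q + k%:R + p + 2%:R = q + k%:R + p + 2 by [].
Qed.

Lemma KY_momentE k :
  (\int[mu]_(x in I01) ((x ^+ k)%:E * KY x) =
   (ib q p * (1 + Y)^-1 * (bw (q + p + 1) k * cprod (bF q) (fun i => (1 + Y)^-1 ^+ i) k))%:E)%E.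
Proof.
rewrite KY_moment ib_bw_bF; congr EFin.
have := Ji_cprod q1 Y0 k; move: (Ji _ _ _) (bF _ k) (bw _ k) => j f w.
move: (cprod _ _ _) (ib q p) => c i e.
have -> : i * (w * f) * j = i * w * (j * f) by ring.
by rewrite e; ring.
Qed.

Definition lam : R := p / (1 + p).

(** For w < 1, (1 - w)^p <= e^(- p w) <= 1 / (1 + p w), and 1 - 1 / (1 + p w) is at least p w / (1 +
    p). *)
Lemma powR_lam (w : R) : 0 <= w -> Num.max 0 (1 - w) `^ p <= 1 - lam * Num.min 1 w.
Proof.
move=> w0; have p1 : 0 < 1 + p by rewrite addr_gt0.
have [w1|w1] := leP 1 w.
  rewrite max_l ?subr_le0 // powR0 ?gt_eqF // mulr1 subr_ge0 ler_pdivrMr // mul1r lerDr.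
  exact: ler01.
have h1 : 0 < 1 - w by rewrite subr_gt0.
rewrite max_r; last exact: ltW.
apply: (@le_trans _ _ ((1 + p * w)^-1)).
  have h : 1 - w <= expR (- w) by rewrite -[- w in leLHS]/(- w) expR_ge1Dx.
  apply: (@le_trans _ _ (expR (- w) `^ p)).
    by apply: ge0_ler_powR; rewrite ?nnegrE ?expR_ge0 // ltW.
  rewrite -expRM mulNr expRN lef_pV2 ?posrE ?expR_gt0 //; last first.
    by rewrite ltr_wpDr // mulr_ge0 // ltW.
  by rewrite [w * p]mulrC expR_ge1Dx.
have h2 : 0 < 1 + p * w by rewrite ltr_wpDr // mulr_ge0 // ltW.
rewrite -subr_ge0.
have -> : 1 - lam * w - (1 + p * w)^-1 = p ^+ 2 * w * (1 - w) / ((1 + p) * (1 + p * w)).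
  by rewrite /lam; field; rewrite !gt_eqF.
by rewrite divr_ge0 ?mulr_ge0 // ?ltW // mulr_ge0 // ltW.
Qed.

(** [lam] times the mean of t for the density q (1 - t)^(q - 1). *)
Definition kk : R := lam * (q * ib 1 (q - 1)).

Lemma lam_gt0 : 0 < lam.
Proof. by rewrite divr_gt0 // addr_gt0. Qed.

Lemma kk_gt0 : 0 < kk.
Proof. have h : -1 < q - 1 by have := q1; lra.
exact: (mulr_gt0 lam_gt0 (mulr_gt0 q0 (ib_gt0 ler01 h))). Qed.

(** Since 1 - (1 + Y t) x = (1 - x) (1 - w) with w = t Y x / (1 - x), this is [powR_lam] multiplied
    by the Beta kernel. *)
Lemma tker_le (x t : R) : 0 < x < 1 -> 0 < t < 1 ->
  tker q p (1 + Y * t) x + lam * (t * Num.min 1 (Y * x / (1 - x))) * bker q p x <= bker q p x.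
Proof.
move=> /andP[x0 x1] /andP[t0 t1]; have h1 : 0 < 1 - x by rewrite subr_gt0.
pose w := t * (Y * x / (1 - x)).
have v0 : 0 <= Y * x / (1 - x) by rewrite divr_ge0 ?mulr_ge0 // ltW.
have w0 : 0 <= w by rewrite mulr_ge0 // ltW.
have hm : t * Num.min 1 (Y * x / (1 - x)) <= Num.min 1 w.
  rewrite /w le_min; apply/andP; split.
    apply: (@le_trans _ _ (t * 1)); last by rewrite mulr1 ltW.
    by rewrite ler_pM2l // ge_min lexx.
  by rewrite ler_pM2l // ge_min lexx orbT.
have -> : tker q p (1 + Y * t) x = bker q p x * Num.max 0 (1 - w) `^ p.
  rewrite /tker /bker -mulrA -powRM ?(ltW h1) // ?le_max ?lexx //; congr (_ * _ `^ _).
  rewrite maxr_pMr ?(ltW h1) // mulr0; congr Num.max.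
  by rewrite /w; field; rewrite gt_eqF.
have b0 := bker_ge0 q p x; have hl := powR_lam w0; have l0 := lam_gt0.
move: (bker q p x) (_ `^ p) (Num.min 1 w) (Num.min 1 (Y * x / (1 - x))) b0 hl hm => b u m m' b0 hl hm.
rewrite [X in _ + X]mulrC -mulrDr ler_piMr //.
have : lam * (t * m') <= lam * m by rewrite ler_pM2l.
by move: (lam * m) (lam * (t * m')) hl => a c; lra.
Qed.

Lemma int_jk1 : (\int[mu]_(t in I01) (q * bker 1 (q - 1) t)%:E = (q * ib 1 (q - 1))%:E)%E.
Proof.
under eq_integral do rewrite EFinM.
rewrite ge0Zl01 ?(ltW q0) //; last 2 first.
- exact: measurable_bkerE.
- by move=> t _; rewrite lee_fin bker_ge0.
by rewrite ibE ?EFinM //; have := q1; lra.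
Qed.

(** The limit kernel [bker q p], at Y = 0, exceeds [KY] by a definite amount: the average over t of
    the gap in [tker_le]. *)
Lemma KY_le (x : R) : 0 < x < 1 ->
  (KY x + (kk * Num.min 1 (Y * x / (1 - x)) * bker q p x)%:E <= (bker q p x)%:E)%E.
Proof.
move=> x01; have /andP[x0 x1] := x01; have h1 : 0 < 1 - x by rewrite subr_gt0.
set m := Num.min _ _; have m0 : 0 <= m.
  by rewrite le_min ler01 divr_ge0 ?mulr_ge0 // ltW.
have b0 := bker_ge0 q p x; have l0 := ltW lam_gt0.
have c0 : 0 <= lam * m * bker q p x by apply: mulr_ge0 => //; exact: mulr_ge0.
have -> : (kk * m * bker q p x)%:E =
    (\int[mu]_(t in I01) ((lam * m * bker q p x)%:E * (q * bker 1 (q - 1) t)%:E))%E.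
  rewrite ge0Zl01 //; last 2 first.
  - apply/measurable_EFinP; apply: measurable_funTS; apply: measurable_funM => //.
    exact: measurable_bker.
  - by move=> t _; rewrite lee_fin mulr_ge0 ?bker_ge0 // ltW.
  by rewrite int_jk1 -EFinM /kk; congr EFin; ring.
have -> : (bker q p x)%:E = (\int[mu]_(t in I01) ((bker q p x)%:E * (jker q Y 0 t)%:E))%E.
  rewrite ge0Zl01 //; last 2 first.
  - exact: measurable_jkerE.
  - by move=> t _; rewrite lee_fin jker_ge0.
  by rewrite JiE // Ji0 // mule1.
rewrite /KY -ge0_integralD //; last 4 first.
- by move=> t _; rewrite lee_fin tY_ge0.
- exact: measurable_tYx.
- by move=> t _; rewrite mule_ge0 ?lee_fin // mulr_ge0 ?bker_ge0 // ltW.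
- apply: emeasurable_funM => //; apply/measurable_EFinP; apply: measurable_funTS.
  by apply: measurable_funM => //; exact: measurable_bker.
apply: ge0_le_integral => //.
- move=> t _; apply: adde_ge0; first by rewrite lee_fin tY_ge0.
  by apply: mule_ge0; rewrite lee_fin // mulr_ge0 ?bker_ge0 // ltW.
- apply: emeasurable_funD; first exact: measurable_tYx.
  apply: emeasurable_funM => //; apply/measurable_EFinP; apply: measurable_funTS.
  by apply: measurable_funM => //; exact: measurable_bker.
- by apply: emeasurable_funM => //; exact: measurable_jkerE.
move=> t /I01P t01; have /andP[t0 t1] := t01.
rewrite -!EFinM -EFinD lee_fin /tY /jker oppr0 powRr0 mulr1 [bker 1 _ t]/bker powRr1 ?(ltW t0) //.
have := tker_le x01 t01; rewrite -/m.
have : 0 <= q * (1 - t) `^ (q - 1) by rewrite mulr_ge0 ?powR_ge0 // ltW.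
move: (tker _ _ _ _) (bker q p x) (_ `^ (q - 1)) => u b v v0 h.
by have := ler_wpM2l v0 h; congr (_ <= _); ring.
Qed.

(** The integrand decreases in t apart from the density of mass 1, so its value at t = 1 is a lower
    bound. It recovers the limit kernel as Y tends to 0. *)
Lemma KY_ge (x : R) : 0 < x < 1 ->
  ((x `^ q * Num.max 0 (1 - (1 + Y) * x) `^ p)%:E <= KY x)%E.
Proof.
move=> /andP[x0 x1]; set c := _ * _; have c0 : 0 <= c by rewrite mulr_ge0 ?powR_ge0.
have -> : c%:E = (\int[mu]_(t in I01) (c%:E * (jker q Y 0 t)%:E))%E.
  rewrite ge0Zl01 //; last 2 first.
  - exact: measurable_jkerE.
  - by move=> t _; rewrite lee_fin jker_ge0.
  by rewrite JiE // Ji0 // mule1.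
apply: ge0_le_integral => //.
- by move=> t _; rewrite mule_ge0 ?lee_fin ?jker_ge0.
- by apply: emeasurable_funM => //; exact: measurable_jkerE.
- exact: measurable_tYx.
move=> t /I01P /andP[t0 t1]; rewrite -EFinM lee_fin /tY /jker oppr0 powRr0 mulr1 mulrC.
apply: ler_wpM2l; first by rewrite mulr_ge0 ?powR_ge0 // ltW.
apply: ler_wpM2l; rewrite ?powR_ge0 //.
apply: ge0_ler_powR; [exact: ltW|by rewrite nnegrE le_max lexx|by rewrite nnegrE le_max lexx|].
rewrite ge_max; apply/andP; split; first by rewrite le_max lexx.
rewrite le_max; apply/orP; right.
by rewrite lerD2l lerN2 ler_pM2r // lerD2l ler_piMr // ltW.
Qed.

End Kernel.

(** * Termwise integration of a nonnegative power series *)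

Section SeriesIntegral.
Context {R : realType}.
Notation mu := (@lebesgue_measure R).
Notation mR := (measurableTypeR R).
Notation I01 := (`]0%R, 1%R[%classic : set mR).
Implicit Types u v h : nat -> R.

Lemma nneseries_ssum v : asum v -> (\sum_(0 <= k <oo) (v k)%:E = (ssum v)%:E)%E.
Proof.
move=> hv; apply: cvg_lim => //.
have -> : (fun n => \sum_(0 <= k < n) (v k)%:E)%E = (fun n => (series v n)%:E).
  by apply/funext => n; rewrite sumEFin.
by apply: cvg_EFin; [near=> n|exact: asum_cvg].
Unshelve. all: by end_near. Qed.

Lemma measurable_ps u : (forall x : R, 0 < x < 1 -> asum (fun k => u k * x ^+ k)) ->
  measurable_fun I01 (fun x : mR => ssum (fun k => u k * x ^+ k) : R).
Proof.
move=> hu; apply: (@measurable_fun_cvg _ _ _ _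
  (fun n (x : mR) => \sum_(k < n) u k * x ^+ k : R)) => [n|x /I01P /hu h].
  apply: measurable_funTS; apply: measurable_sum => k.
  by apply: measurable_funM => //; exact: measurable_funX.
have -> : (fun n => \sum_(k < n) u k * x ^+ k) = series (fun k => u k * x ^+ k).
  by apply/funext => n; rewrite seriesEord.
exact: asum_cvg.
Qed.

Variables (K : R -> R) (m : nat -> R).
Hypotheses (K0 : forall x : R, 0 < x < 1 -> 0 <= K x)
  (mK : measurable_fun I01 (fun x : mR => K x : R))
  (Km : forall k, (\int[mu]_(x in I01) (x ^+ k * K x)%:E = (m k)%:E)%E).

Lemma int_ps_ge0 u : (forall k, 0 <= u k) ->
  (forall x : R, 0 < x < 1 -> asum (fun k => u k * x ^+ k)) -> asum (fun k => u k * m k) ->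
  (\int[mu]_(x in I01) (ssum (fun k => u k * x ^+ k)%R * K x)%:E = (ssum (fun k => u k * m k)%R)%:E)%E.
Proof.
move=> u0 hu hm.
have mxk k : measurable_fun I01 (fun x : mR => x ^+ k * K x : R).
  by apply: measurable_funM => //; apply: measurable_funTS; exact: measurable_funX.
have mf k : measurable_fun I01 (fun x : mR => (u k * (x ^+ k * K x))%:E).
  by apply/measurable_EFinP; apply: measurable_funM.
have xK k (x : mR) : I01 x -> 0 <= x ^+ k * K x.
  by move=> /I01P h; rewrite mulr_ge0 ?K0 // exprn_ge0 // ltW //; case/andP: h.
transitivity (\int[mu]_(x in I01) \sum_(0 <= k <oo) (u k * (x ^+ k * K x))%:E)%E.
  apply: eq_integral => x /set_mem/I01P h.
  have E : (fun k => u k * (x ^+ k * K x)) =1 (fun k => K x * (u k * x ^+ k)).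
    by move=> k; rewrite [RHS]mulrC mulrA.
  have hE : asum (fun k => u k * (x ^+ k * K x)).
    by apply: (eq_asum (@asumZ _ (K x) _ (hu x h))) => k; rewrite E.
  rewrite nneseries_ssum // (eq_ssum E) ssumZ; last exact: hu.
  by congr EFin; exact: mulrC.
rewrite integral_nneseries //; last by move=> k x hx; rewrite lee_fin mulr_ge0 // xK.
rewrite -nneseries_ssum //; apply: eq_eseriesr => k _.
under eq_integral do rewrite EFinM.
rewrite ge0Zl01 //; first by rewrite Km -EFinM.
  by apply/measurable_EFinP.
by move=> x hx; rewrite lee_fin xK.
Qed.

(** Only the sum of the series is nonnegative, not its coefficients. Splitting them into positive
    and negative parts reduces the claim to monotone convergence; the negative part has a finite
    integral, which can be cancelled. *)
Lemma int_ps h : (forall x : R, 0 < x < 1 -> asum (fun k => h k * x ^+ k)) ->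
  asum (fun k => h k * m k) ->
  (forall x : R, 0 < x < 1 -> 0 <= ssum (fun k => h k * x ^+ k)) ->
  (\int[mu]_(x in I01) (ssum (fun k => h k * x ^+ k)%R * K x)%:E = (ssum (fun k => h k * m k)%R)%:E)%E.
Proof.
move=> hh hm h0; pose hp k := Num.max (h k) 0; pose hn k := Num.max (- h k) 0.
have hp0 k : 0 <= hp k by rewrite le_max lexx orbT.
have hn0 k : 0 <= hn k by rewrite le_max lexx orbT.
have hpn k : hp k <= `|h k| by rewrite ge_max ler_norm normr_ge0.
have hnn k : hn k <= `|h k| by rewrite ge_max -normrN ler_norm normr_ge0.
have E k : hp k = h k + hn k.
  by rewrite /hp /hn; case: (leP (h k) 0) => hk;
    [rewrite max_l ?oppr_ge0 // subrr|rewrite max_r ?addr0 // oppr_le0 ltW].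
have A g : (forall k, 0 <= g k) -> (forall k, g k <= `|h k|) ->
    forall y, asum (fun k => h k * y k) -> asum (fun k => g k * y k).
  move=> g0 gh y hy; apply: asum_le (asum_norm hy) => k.
  by rewrite !normrM ler_wpM2r // ger0_norm.
have Ap x hx := A hp hp0 hpn _ (hh x hx); have An x hx := A hn hn0 hnn _ (hh x hx).
have Bp := A hp hp0 hpn _ hm; have Bn := A hn hn0 hnn _ hm.
have Ip := int_ps_ge0 hp0 Ap Bp; have In := int_ps_ge0 hn0 An Bn.
have n0 (x : R) : 0 < x < 1 -> 0 <= ssum (fun k => hn k * x ^+ k).
  move=> hx; apply: ssum_ge0 => [|k]; first exact: An.
  by rewrite mulr_ge0 // exprn_ge0 // ltW //; case/andP: hx.
have : (\int[mu]_(x in I01) (ssum (fun k => h k * x ^+ k)%R * K x)%:E +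
        \int[mu]_(x in I01) (ssum (fun k => hn k * x ^+ k)%R * K x)%:E =
        \int[mu]_(x in I01) (ssum (fun k => hp k * x ^+ k)%R * K x)%:E)%E.
  rewrite -ge0_integralD //.
  - apply: eq_integral => x /set_mem/I01P hx; rewrite -EFinD; congr EFin.
    rewrite -mulrDl -ssumD; [|exact: hh|exact: An]; congr (_ * _); apply: eq_ssum => k.
    by rewrite E mulrDl.
  - by move=> x /I01P hx; rewrite lee_fin mulr_ge0 ?h0 ?K0.
  - by apply/measurable_EFinP; apply: measurable_funM => //; exact: measurable_ps.
  - by move=> x /I01P hx; rewrite lee_fin mulr_ge0 ?n0 ?K0.
  - by apply/measurable_EFinP; apply: measurable_funM => //; exact: measurable_ps.
rewrite In Ip; have -> : ssum (fun k => hp k * m k) =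
    ssum (fun k => h k * m k) + ssum (fun k => hn k * m k).
  by rewrite -ssumD //; apply: eq_ssum => k; rewrite E mulrDl.
case: (\int[mu]_(x in I01) _)%E => [r|//|//] /= [] /addIr ->.
by [].
Qed.

End SeriesIntegral.

(** * The growth argument in abstract form *)

Section Blowup.
Context {R : realType}.
Variables (c k A D e m : R) (S Psi : R -> R).
Hypotheses (c0 : 0 < c) (k0 : 0 < k) (A0 : 0 < A) (D4 : D <= 4^-1) (e0 : 0 < e) (m1 : m <= 1).
Hypotheses (S0 : forall Y : R, 0 < Y -> 0 <= S Y)
  (Smono : forall y Y : R, 0 < y -> y <= Y -> y / Y * S Y <= S y)
  (Spsi : forall x : R, 0 < x < 1 -> x * (1 - c * Psi x) + k * S ((1 - x) / x) <= m)
  (Sge : forall s b : R, 0 < s -> s <= 2^-1 -> 0 <= b ->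
     (forall x : R, 1 - s <= x <= 1 - s / 2 -> b <= Psi x) -> A * b * s `^ (- e) <= S (s / (1 - s)))
  (mle : forall s : R, 0 < s -> s < 1 -> s * (64 / k) <= 1 ->
     m <= S (s / (1 - s)) / (s * (64 / k)) + D).

Lemma powRN_large (M : R) : 0 < M -> exists2 d : R, 0 < d & forall s : R, 0 < s -> s <= d -> M <= s `^ (- e).
Proof.
move=> M0; exists (M `^ (- e^-1)); first exact: powR_gt0.
move=> s s0 sd.
have h : s `^ e <= M^-1.
  have := ge0_ler_powR (ltW e0) _ _ sd; rewrite !nnegrE (ltW s0) powR_ge0 => /(_ isT isT).
  by rewrite -powRrM mulNr mulVf ?gt_eqF // powRN powRr1 // ltW.
by rewrite powRN -[M]invrK lef_pV2 ?posrE ?powR_gt0 ?invr_gt0.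
Qed.

(* First S (s / (1 - s)) <= 16 s / k for small s: otherwise [Spsi] bounds Psi from below by
   a multiple of S on [1 - s, 1 - s / 2], and [Sge] fails since s^(-e) blows up.
   By [mle] this gives m <= 1 / 2, so c Psi >= 1 / 4 near 1, and [Sge] fails again. *)
Lemma blowup_false : False.
Proof.
pose B := A * (3 / 16 * (k / c)).
have B0 : 0 < B by rewrite !mulr_gt0 // ?invr_gt0.
have M1 : 0 < 2 / B by rewrite divr_gt0.
have [d1 d10 hd1] := powRN_large M1.
have M2 : 0 < 8 * c / A by rewrite divr_gt0 // mulr_gt0.
have [d2 d20 hd2] := powRN_large M2.
have k64 : 0 < k / 64 by rewrite divr_gt0.
pose s := Num.min (Num.min d1 d2) (Num.min 4^-1 (k / 64)).
have s0 : 0 < s by rewrite !lt_min d10 d20 k64 invr_gt0 ltr0n.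
have sd1 : s <= d1 by rewrite !ge_min lexx.
have sd2 : s <= d2 by rewrite !ge_min lexx orbT.
have s4 : s <= 4^-1 by rewrite !ge_min lexx !orbT.
have sk : s <= k / 64 by rewrite !ge_min lexx !orbT.
have {}hd1 := hd1 s s0 sd1; have {}hd2 := hd2 s s0 sd2.
have sp0 : 0 < s `^ (- e) by exact: powR_gt0.
have hge b := @Sge s b s0.
have [P PE] : exists P, P = s `^ (- e) by exists (s `^ (- e)).
rewrite -PE in sp0 hd1 hd2 hge.
clearbody s; clear d1 d10 sd1 d2 d20 sd2.
pose Y := s / (1 - s); have s1 : 0 < 1 - s by move: s4; lra.
have Y0 : 0 < Y by rewrite divr_gt0.
have s2 : s <= 2^-1 by move: s4; lra.
have xI (x : R) : 1 - s <= x <= 1 - s / 2 -> 0 < x < 1.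
  by move=> /andP[h1 h2]; move: s0 s1 h1 h2 => ? ? ? ?; apply/andP; split; lra.
have S16 : S Y <= 16 * s / k.
  have [//|hS] := leP (S Y) (16 * s / k); exfalso.
  have {}hS : 16 * s < k * S Y by move: hS; rewrite ltr_pdivrMr // [S Y * k]mulrC.
  have SY : 0 < S Y.
    by rewrite -(pmulr_rgt0 _ k0); apply: lt_trans hS; rewrite mulr_gt0.
  (* Since y / Y >= 1/4, k S(y) is at least k S(Y) / 4, while 1 - x <= s costs less than k S(Y) /
     16; the difference of the fractions is 3/16. *)
  have lb (x : R) : 1 - s <= x <= 1 - s / 2 -> 3 / 16 * (k / c) * S Y <= Psi x.
    move=> hx; have x01 := xI x hx; have /andP[x0 x1] := x01; have /andP[hx1 hx2] := hx.
    have y0 : 0 < (1 - x) / x by rewrite divr_gt0 // subr_gt0.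
    have yY : (1 - x) / x <= Y.
      rewrite /Y ler_pdivrMr // mulrAC ler_pdivlMr //.
      have := hx1; have := x0; have := s0; move=> *; nra.
    have y4 : 4^-1 <= (1 - x) / x / Y.
      rewrite /Y invf_div mulf_div ler_pdivlMr; last by rewrite mulr_gt0.
      have := s4; have := s0; have := hx1; have := hx2; have := x1; move=> *; nra.
    have h1 := Smono y0 yY; have h2 := Spsi x01.
    have h3 : S Y / 4 <= S ((1 - x) / x).
      by apply: le_trans h1; rewrite mulrC ler_pM2r.
    have h4 : k * (S Y / 4) <= k * S ((1 - x) / x) by rewrite ler_pM2l.
    have h5 : 3 / 16 * (k * S Y) <= x * (c * Psi x).
      have := m1; move: h2 h4 hS hx1; move: (k * S ((1 - x) / x)) => Z.
      have -> : k * (S Y / 4) = k * S Y / 4 by rewrite mulrA.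
      move: (k * S Y) (c * Psi x) => Q T *; lra.
    have h6 : 3 / 16 * (k * S Y) <= c * Psi x.
      have kS : 0 < k * S Y by rewrite mulr_gt0.
      apply: (le_trans h5); rewrite ger_pMl ?(ltW x1) //.
      have : 0 < x * (c * Psi x) by apply: lt_le_trans h5; rewrite mulr_gt0.
      by rewrite pmulr_rgt0.
    have -> : 3 / 16 * (k / c) * S Y = 3 / 16 * (k * S Y) / c by field; rewrite gt_eqF.
    by rewrite ler_pdivrMr // [Psi x * c]mulrC.
  have b0 : 0 <= 3 / 16 * (k / c) * S Y by rewrite !mulr_ge0 ?invr_ge0 // ltW.
  have := hge _ s2 b0 lb; rewrite -/Y.
  have -> : A * (3 / 16 * (k / c) * S Y) * P = B * P * S Y by rewrite /B; ring.
  have : 2 <= B * P by move: hd1; rewrite ler_pdivrMr // mulrC.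
  by move: (B * P) => Q *; nra.
have sk1 : s * (64 / k) <= 1.
  by rewrite mulrA ler_pdivrMr // mul1r; move: sk; rewrite ler_pdivlMr.
have s11 : s < 1 by move: s2; lra.
(* 64 = 4 * 16: by [S16] the quotient in [mle] is at most 1/4, and D is at most 1/4 as well. *)
have m2 : m <= 2^-1.
  have hm := mle s0 s11 sk1; rewrite -/Y in hm.
  have h1 : S Y / (s * (64 / k)) <= 4^-1.
    rewrite ler_pdivrMr ?mulr_gt0 ?invr_gt0 //.
    by apply: (le_trans S16); rewrite le_eqVlt; apply/orP; left; apply/eqP; field; rewrite gt_eqF.
  by move: h1 hm D4; move: (S Y / _) => Z; lra.
have lb (x : R) : 1 - s <= x <= 1 - s / 2 -> (4 * c)^-1 <= Psi x.
  move=> hx; have x01 := xI x hx; have /andP[x0 x1] := x01; have /andP[hx1 hx2] := hx.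
  have y0 : 0 < (1 - x) / x by rewrite divr_gt0 // subr_gt0.
  have h2 := Spsi x01; have h3 : 0 <= k * S ((1 - x) / x) by rewrite mulr_ge0 ?S0 // ltW.
  have h4 : 4^-1 <= x * (c * Psi x).
    by move: h2 h3 m2 s4 hx1; move: (k * _) (c * Psi x) => Z T *; lra.
  have h5 : 4^-1 <= c * Psi x.
    apply: (le_trans h4); rewrite ger_pMl ?(ltW x1) //.
    have : 0 < x * (c * Psi x) by apply: lt_le_trans h4; rewrite invr_gt0.
    by rewrite pmulr_rgt0.
  by rewrite invfM ler_pdivrMr // mulrC.
have b0 : 0 <= (4 * c)^-1 by rewrite invr_ge0 mulr_ge0 // ltW.
have := hge _ s2 b0 lb; rewrite -/Y => h.
have h1 : 2 <= A * (4 * c)^-1 * P.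
  move: hd2; rewrite ler_pdivrMr // => hd2.
  rewrite mulrAC ler_pdivlMr ?mulr_gt0 //; move: hd2; rewrite [P * A]mulrC.
  by move: (A * P) => Q; lra.
have h2 : 16 * s / k <= 4^-1.
  by rewrite ler_pdivrMr //; move: sk; lra.
by move: h h1 h2 S16; move: (A * _ * P) (16 * s / k) => U W; lra.
Qed.

End Blowup.

(** * The limit equation contradicts the kernel estimates *)

Section Contradiction.
Context {R : realType}.
Notation mu := (@lebesgue_measure R).
Notation mR := (measurableTypeR R).
Notation I01 := (`]0%R, 1%R[%classic : set mR).
Variables (q p c : R) (psi : nat -> R).
Notation al := (q + p + 1).
Notation w := (bw al).
Notation h := (cprod (bF q) psi).
Hypotheses (q1 : 1 <= q) (p0 : 0 < p) (hq : 2 * q < al + 1) (c0 : 0 < c).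
Hypotheses (psi_bnd : exists B, forall k, `|psi k| <= B / w k)
  (h_l2 : asum (fun k => w k * h k ^+ 2)).

Definition Psi (x : R) : R := ssum (fun k => psi k * x ^+ k).

Hypotheses (Psi0 : forall x : R, 0 <= x < 1 -> 0 <= Psi x)
  (limE : forall x : R, 0 <= x < 1 ->
    ssum (fun m => w m * (cprod (bF q) (fun k => x ^+ k) m * h m)) + c * Psi x = 1).

Let q0 : 0 < q. Proof. exact: lt_le_trans q1. Qed.
Let al0 : 0 < al. Proof. by rewrite !addr_gt0. Qed.
Let al1 : 1 <= al. Proof. by rewrite lerDr addr_ge0 // ltW. Qed.
Let pm1 : -1 < p. Proof. by apply: lt_trans p0. Qed.
Let b0 : 0 < ib q p. Proof. by rewrite ib_gt0 // ltW. Qed.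
Let kk0 : 0 < kk q p. Proof. exact: kk_gt0. Qed.

Let asum_psi (x : R) : 0 <= x < 1 -> asum (fun k => psi k * x ^+ k).
Proof.
move=> x01; have [B hB] := psi_bnd; have /andP[x0 _] := x01.
apply: asum_le (@asumZ _ B _ (asum_xw al0 x01)) => k.
rewrite normrM (ger0_norm (exprn_ge0 k x0)) [X in _ <= B * X]mulrC mulrA.
by rewrite ler_wpM2r ?exprn_ge0.
Qed.

Definition hh (x : R) : R := ssum (fun k => h k * x ^+ k).

Let asum_hh (x : R) : 0 <= x < 1 -> asum (fun k => h k * x ^+ k).
Proof.
by move=> x01; apply: (eq_asum (asum_cprod (asum_bF q0 x01) (asum_psi x01))) => k; rewrite cprod_pow.
Qed.

Let hhE (x : R) : 0 <= x < 1 -> hh x = (1 - x) `^ (- q) * Psi x.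
Proof.
move=> x01; rewrite /hh (eq_ssum (cprod_pow _ _ x)) ssum_cprod ?bF_sum //.
- exact: asum_bF.
- exact: asum_psi.
Qed.

Let wI (x : R) : 0 < x < 1 -> 0 <= x < 1.
Proof. by case/andP => /ltW -> ->. Qed.

Let hh0 (x : R) : 0 < x < 1 -> 0 <= hh x.
Proof. by move=> /wI hx; rewrite hhE // mulr_ge0 ?powR_ge0 ?Psi0. Qed.

Let measurable_hh : measurable_fun I01 (fun x : mR => hh x : R).
Proof. by apply: measurable_ps => x /wI hx; exact: asum_hh. Qed.

(** The integrand h times the limit kernel, that is x^q (1 - x)^(p - q) Psi(x). A lower bound on Psi
    near 1 would make it non-integrable when q > p + 1. *)
Definition Om0 (x : R) : R := bker q p x * hh x.

Let Om0_ge0 (x : R) : 0 < x < 1 -> 0 <= Om0 x.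
Proof. by move=> hx; rewrite mulr_ge0 ?bker_ge0 ?hh0. Qed.

Let measurable_Om0 : measurable_fun I01 (fun x : mR => Om0 x : R).
Proof.
apply: measurable_funM; last exact: measurable_hh.
by apply: measurable_funTS; exact: measurable_bker.
Qed.

Let Om0E (x : R) : 0 < x < 1 -> Om0 x = x `^ q * (1 - x) `^ (p - q) * Psi x.
Proof.
move=> hx; have /andP[x0 x1] := hx; have h1 : 0 < 1 - x by rewrite subr_gt0.
rewrite /Om0 /bker hhE ?wI // (@powRD _ (1 - x) p (- q)) ?(gt_eqF h1) ?implybT //.
by ring.
Qed.

Let KY_fin Y (x : R) : 0 <= Y -> 0 < x < 1 -> KY q Y p x = (fine (KY q Y p x))%:E.
Proof.
move=> Y0 hx; rewrite fineK // ge0_fin_numE ?KY_ge0 //.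
apply: (@le_lt_trans _ _ (bker q p x)%:E); last exact: ltry.
apply: le_trans (KY_le q1 Y0 p0 hx); rewrite leeDl // lee_fin.
have /andP[x0 x1] := hx.
rewrite mulr_ge0 ?bker_ge0 // mulr_ge0 ?(ltW kk0) // le_min ler01.
by rewrite divr_ge0 ?mulr_ge0 ?subr_ge0 // ltW.
Qed.

Let kY Y (x : R) : R := fine (KY q Y p x).

Let kY_ge0 Y (x : R) : 0 <= kY Y x.
Proof. by rewrite fine_ge0 // KY_ge0. Qed.

Let measurable_kY Y : measurable_fun I01 (fun x : mR => kY Y x : R).
Proof.
apply: measurable_funTS.
have hf : measurable_fun [set: \bar R] (@fine R) by exact: fine_measurable.
exact: (measurableT_comp hf (@measurable_KY R q Y p q1)).
Qed.

(** The limit equation at eta as an integral of h: Y = (1 - eta) / eta is chosen so that 1 / (1 + Y)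
    = eta, and [KY_momentE] identifies the moments. *)
Lemma int_hkY (eta : R) : 0 < eta < 1 ->
  (\int[mu]_(x in I01) (hh x * kY ((1 - eta) / eta) x)%:E =
    (ib q p * eta * (1 - c * Psi eta))%:E)%E.
Proof.
move=> heta; have /andP[e0 e1] := heta; set Y := (1 - eta) / eta.
have Y0 : 0 <= Y by rewrite divr_ge0 ?subr_ge0 // ltW.
have Ye : (1 + Y)^-1 = eta by have -> : 1 + Y = eta^-1; [rewrite /Y; field; rewrite gt_eqF|rewrite invrK].
pose cg m := cprod (bF q) (fun k => eta ^+ k) m.
pose m k := ib q p * eta * (w k * cg k).
have Km k : (\int[mu]_(x in I01) (x ^+ k * kY Y x)%:E = (m k)%:E)%E.
  rewrite /m /cg -Ye -KY_momentE //; apply: eq_integral => x /set_mem/I01P hx.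
  by rewrite EFinM -KY_fin.
have hm : asum (fun k => w k * (cg k * h k)).
  have hg := @asum_bw_cprod_geo R al al1 q q1 hq eta (wI heta).
  have w0 k : 0 <= w k by rewrite ltW // bw_gt0.
  apply: (eq_asum (@asum_sqM _ (fun k => Num.sqrt (w k) * cg k) (fun k => Num.sqrt (w k) * h k) _ _)).
  - by apply: (eq_asum hg) => k; rewrite exprMn sqr_sqrtr.
  - by apply: (eq_asum h_l2) => k; rewrite exprMn sqr_sqrtr.
  - by move=> k; rewrite mulrACA -expr2 sqr_sqrtr.
have E : (fun k => h k * m k) =1 (fun k => ib q p * eta * (w k * (cg k * h k))).
  by move=> k; rewrite /m; ring.
rewrite (@int_ps _ (kY Y) m _ (measurable_kY Y) Km h) //.
- rewrite (eq_ssum E) ssumZ //; congr (_ * _)%:E.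
  by apply/eqP; rewrite eq_sym subr_eq; apply/eqP; rewrite -[LHS](limE (wI heta)).
- by move=> x /wI; exact: asum_hh.
- by apply: (eq_asum (@asumZ _ (ib q p * eta) _ hm)) => k; rewrite E.
Qed.

(** Fatou as eta = 1 / (1 + [ep n]) tends to 1: [KY_ge] provides the minorants, and [int_hkY] bounds
    their integrals since Psi >= 0. *)
Let Om0_le1 : (\int[mu]_(x in I01) (Om0 x)%:E <= (ib q p)%:E)%E.
Proof.
pose f n (x : R) := x `^ q * Num.max 0 (1 - (1 + ep n) * x) `^ p * hh x.
apply: (@fatou_le _ _ _ mu I01 (fun n (x : mR) => (f n x)%:E)) => //.
- move=> n; apply/measurable_EFinP; apply: measurable_funM; last exact: measurable_hh.
  by apply: measurable_funTS; exact: measurable_tker.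
- by move=> n x /I01P hx; rewrite lee_fin mulr_ge0 ?hh0 // mulr_ge0 ?powR_ge0.
- move=> x /I01P hx; have /andP[x0 x1] := hx; have h1 : 0 < 1 - x by rewrite subr_gt0.
  apply: cvg_EFin; first by near=> n.
  apply: cvgM; last exact: cvg_cst.
  apply: cvgM; first exact: cvg_cst.
  have hc : 1 - (1 + ep n) * x @[n --> \oo] --> 1 - x.
    have -> : 1 - x = 1 - (1 + 0) * x by rewrite addr0 mul1r.
    apply: (@cvgB _ R^o); first exact: cvg_cst.
    apply: cvgM; last exact: cvg_cst.
    by apply: (@cvgD _ R^o); [exact: cvg_cst|exact: cvg_ep].
  have hm : Num.max 0 (1 - (1 + ep n) * x) @[n --> \oo] --> 1 - x.
    apply: (cvg_trans _ hc); apply: near_eq_cvg; near=> n.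
    rewrite max_r // ltW //; near: n; exact: (cvgr_gt _ hc _ h1).
  have := is_derive_continuous (is_derive1_powR p h1) => hcont.
  exact: (@cvg_comp _ _ _ _ (fun y : R => y `^ p) _ _ _ hm hcont).
- move=> n; have e0 := @ep_gt0 R n.
  pose eta : R := (1 + ep n)^-1.
  have n1 : 0 < 1 + ep n :> R by rewrite addr_gt0.
  have heta : 0 < eta < 1 by rewrite invr_gt0 n1 invf_lt1 // ltrDl e0.
  have Ye : (1 - eta) / eta = ep n by rewrite /eta; field; rewrite gt_eqF.
  have := int_hkY heta; rewrite Ye => hI.
  apply: (@le_trans _ _ (\int[mu]_(x in I01) (hh x * kY (ep n) x)%:E)%E).
    apply: ge0_le_integral => //.
    + by move=> x /I01P hx; rewrite lee_fin mulr_ge0 ?hh0 // mulr_ge0 ?powR_ge0.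
    + apply/measurable_EFinP; apply: measurable_funM; last exact: measurable_hh.
      by apply: measurable_funTS; exact: measurable_tker.
    + apply/measurable_EFinP; apply: measurable_funM; first exact: measurable_hh.
      exact: measurable_kY.
    + move=> x /I01P hx; rewrite lee_fin /f mulrC ler_wpM2l ?hh0 //.
      by have := KY_ge q1 (ltW e0) p0 hx; rewrite KY_fin ?(ltW e0) // lee_fin.
  rewrite hI lee_fin -mulrA ler_piMr ?(ltW b0) //.
  have := Psi0 (wI heta) => P0; have /andP[h0 h1] := heta.
  have : 0 <= c * Psi eta by rewrite mulr_ge0 // ltW.
  have fin (y z : R) : 0 < y -> y < 1 -> 0 <= z -> y * (1 - z) <= 1 by move=> *; nra.
  exact: fin.
Unshelve. all: by end_near. Qed.

Let M0 : R := fine (\int[mu]_(x in I01) (Om0 x)%:E)%E.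

Let M0E : (\int[mu]_(x in I01) (Om0 x)%:E = M0%:E)%E.
Proof.
rewrite fineK // ge0_fin_numE; first exact: le_lt_trans Om0_le1 (ltry _).
by apply: integral_ge0 => x /I01P hx; rewrite lee_fin Om0_ge0.
Qed.

Let M0_le : M0 <= ib q p.
Proof. by rewrite -lee_fin -M0E Om0_le1. Qed.

Let mn Y (x : R) : R := Num.min 1 (Y * x / (1 - x)).

Let mn01 Y (x : R) : 0 <= Y -> 0 < x < 1 -> 0 <= mn Y x <= 1.
Proof.
move=> Y0 /andP[x0 x1]; rewrite /mn ge_min lexx le_min ler01 /= andbT.
by rewrite divr_ge0 ?mulr_ge0 ?subr_ge0 // ltW.
Qed.

Let measurable_mn Y : measurable_fun I01 (fun x : mR => mn Y x : R).
Proof.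
apply: measurable_minr => //.
apply: measurable_funM; first by apply: measurable_funTS; apply: measurable_funM.
have hV : measurable_fun [set: mR] (fun x : mR => (1 - x) `^ (-1) : R).
  have := @measurable_powR_aff R 1 (-1) (-1).
  by under eq_fun do rewrite mulN1r.
apply: (eq_measurable_fun (fun x : mR => (1 - x) `^ (-1) : R)); last exact: measurable_funTS.
by move=> x /set_mem /I01P /andP[x0 x1]; rewrite powR_inv1 // subr_ge0 ltW.
Qed.

(** The loss of mass of h, up to the factor [kk], when the limit kernel is replaced by the kernel
    with parameter Y. *)
Let S0 Y : R := fine (\int[mu]_(x in I01) (mn Y x * Om0 x)%:E)%E.

Let mnOm_ge0 Y (x : R) : 0 <= Y -> 0 < x < 1 -> 0 <= mn Y x * Om0 x.
Proof. by move=> Y0 hx; rewrite mulr_ge0 ?Om0_ge0 //; case/andP: (mn01 Y0 hx). Qed.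

Let measurable_mnOm Y : measurable_fun I01 (fun x : mR => (mn Y x * Om0 x)%:E).
Proof. by apply/measurable_EFinP; apply: measurable_funM; [exact: measurable_mn|exact: measurable_Om0]. Qed.

Let S0E Y : 0 <= Y -> (\int[mu]_(x in I01) (mn Y x * Om0 x)%:E = (S0 Y)%:E)%E.
Proof.
move=> Y0; rewrite fineK // ge0_fin_numE.
  apply: (@le_lt_trans _ _ M0%:E); last exact: ltry.
  rewrite -M0E; apply: ge0_le_integral => //.
  - by move=> x /I01P hx; rewrite lee_fin mnOm_ge0.
  - exact/measurable_EFinP.
  - move=> x /I01P hx; rewrite lee_fin ler_piMl ?Om0_ge0 //.
    by case/andP: (mn01 Y0 hx).
by apply: integral_ge0 => x /I01P hx; rewrite lee_fin mnOm_ge0.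
Qed.

Let S0_ge0 Y : 0 < Y -> 0 <= S0 Y.
Proof.
move=> Y0; rewrite fine_ge0 //.
by apply: integral_ge0 => x /I01P hx; rewrite lee_fin mnOm_ge0 // ltW.
Qed.

Let S0_mono (y Y : R) : 0 < y -> y <= Y -> y / Y * S0 Y <= S0 y.
Proof.
move=> y0 yY; have Y0 : 0 < Y by apply: lt_le_trans yY.
have r0 : 0 <= y / Y by rewrite divr_ge0 // ltW.
have r1 : y / Y <= 1 by rewrite ler_pdivrMr // mul1r.
rewrite -lee_fin EFinM -!S0E ?(ltW y0) ?(ltW Y0) //.
rewrite -ge0Zl01 //; last by move=> x /I01P hx; rewrite lee_fin mnOm_ge0 // ltW.
apply: ge0_le_integral => //.
- by move=> x /I01P hx; rewrite mule_ge0 ?lee_fin // mnOm_ge0 // ltW.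
- exact: emeasurable_funM.
- move=> x /I01P hx; have /andP[x0 x1] := hx.
  rewrite -EFinM lee_fin mulrA ler_wpM2r ?Om0_ge0 // /mn le_min; apply/andP; split.
    apply: (@le_trans _ _ (y / Y * 1)); last by rewrite mulr1.
    by rewrite ler_wpM2l // ge_min lexx.
  apply: (@le_trans _ _ (y / Y * (Y * x / (1 - x)))).
    by rewrite ler_wpM2l // ge_min lexx orbT.
  by rewrite !mulrA divfK ?gt_eqF.
Qed.

(** [KY_le] integrated against h, with the first integral evaluated by [int_hkY]. It bounds Psi(x)
    from below as soon as the total mass [M0] is small or the loss [S0] is large. *)
Let Psi_ineq (x : R) : 0 < x < 1 ->
  ib q p * x * (1 - c * Psi x) + kk q p * S0 ((1 - x) / x) <= M0.
Proof.
move=> hx; have /andP[x0 x1] := hx; set Y := (1 - x) / x.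
have Y0 : 0 <= Y by rewrite divr_ge0 ?subr_ge0 // ltW.
rewrite -lee_fin EFinD [X in (_ + X)%E]EFinM -int_hkY // -/Y -S0E // -M0E.
rewrite -ge0Zl01 ?(ltW kk0) //; last by move=> y /I01P hy; rewrite lee_fin mnOm_ge0.
have mhk : measurable_fun I01 (fun y : mR => (hh y * kY Y y)%:E).
  by apply/measurable_EFinP; apply: measurable_funM; [exact: measurable_hh|exact: measurable_kY].
rewrite -ge0_integralD //.
- apply: ge0_le_integral => //.
  + move=> y /I01P hy; apply: adde_ge0; first by rewrite lee_fin mulr_ge0 ?hh0.
    by apply: mule_ge0; rewrite lee_fin ?mnOm_ge0 // ltW.
  + apply: emeasurable_funD => //; exact: emeasurable_funM.
  + exact/measurable_EFinP.
  move=> y /I01P hy; have := KY_le q1 Y0 p0 hy; rewrite KY_fin // -EFinM -!EFinD !lee_fin => hk.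
  have := ler_wpM2l (hh0 hy) hk; rewrite /Om0 /mn /kY; congr (_ <= _); ring.
- by move=> y /I01P hy; rewrite lee_fin mulr_ge0 ?hh0.
- by move=> y /I01P hy; apply: mule_ge0; rewrite lee_fin ?mnOm_ge0 // ltW.
- exact: emeasurable_funM.
Qed.

Let Psi_le (x : R) : 0 < x < 1 -> Psi x <= c^-1.
Proof.
move=> hx; have /andP[x0 x1] := hx; have := int_hkY hx.
have : (0 <= \int[mu]_(y in I01) (hh y * kY ((1 - x) / x) y)%:E)%E.
  by apply: integral_ge0 => y /I01P hy; rewrite lee_fin mulr_ge0 ?hh0.
move=> + E; rewrite E lee_fin pmulr_rge0 ?mulr_gt0 // subr_ge0 => h1.
by rewrite -[c^-1]mulr1 ler_pdivlMl.
Qed.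

Hypothesis pq : p + 1 < q.
Let e := q - p - 1.

(** On [1 - s, 1 - s / 2] the factor [mn] equals 1 and [Om0] is at least 2^(- q) s^(p - q) b. The
    length s / 2 completes the exponent to - e. *)
Let Om0_sub (s b : R) : 0 < s -> s <= 2^-1 -> 0 <= b ->
  (forall x : R, 1 - s <= x <= 1 - s / 2 -> b <= Psi x) ->
  2^-1 `^ q / 2 * b * s `^ (- e) <= S0 (s / (1 - s)).
Proof.
move=> s0 s2 b00 hb; have s1 : 0 < 1 - s by move: s2; lra.
have Y0 : 0 <= s / (1 - s) by rewrite divr_ge0 // ltW.
rewrite -lee_fin -S0E //.
pose D : set mR := `[1 - s, 1 - s / 2]%classic.
have DI (x : R) : D x -> 0 < x < 1.
  by rewrite /D /= in_itv /= => /andP[h1 h2]; move: s0 s1 h1 h2 => *; apply/andP; split; lra.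
have DI1 : D `<=` I01 by move=> x /DI; rewrite /= in_itv.
pose v := 2^-1 `^ q * s `^ (p - q) * b.
apply: (@le_trans _ _ (\int[mu]_(x in D) (cst v%:E x))%E).
  rewrite integral_cst; last exact: measurable_itv.
  rewrite [X in (_ * X)%E]lebesgue_measure_itv /= lte_fin ifT; last by move: s0; lra.
  rewrite -EFinD -EFinM lee_fin le_eqVlt; apply/orP; left; apply/eqP.
  have -> : - e = (p - q) + 1 by rewrite /e; ring.
  rewrite (@powRD _ s (p - q) 1) ?(gt_eqF s0) ?implybT // powRr1 ?(ltW s0) // /v.
  by field.
apply: (@le_trans _ _ (\int[mu]_(x in D) (mn (s / (1 - s)) x * Om0 x)%:E)%E).
  have mD : measurable D by exact: measurable_itv.
  apply: ge0_le_integral => //.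
  - by move=> x _; rewrite lee_fin !mulr_ge0 ?powR_ge0.
  - exact: (measurable_funS (measurable_itv _) DI1 (measurable_mnOm _)).
  - move=> x hx; have hx1 := DI x hx; have /andP[x0 x1] := hx1.
    have hxx : 1 - s <= x <= 1 - s / 2 by move: hx; rewrite /D /= in_itv.
    have /andP[h1 h2] := hxx; have x10 : 0 < 1 - x by rewrite subr_gt0.
    have -> : mn (s / (1 - s)) x = 1.
      apply/min_idPl; rewrite ler_pdivlMr // mul1r mulrAC ler_pdivlMr //.
      by move: h1 s0; move=> *; nra.
    rewrite mul1r lee_fin Om0E // /v.
    have x2 : 2^-1 <= x by move: h1 s2; lra.
    apply: ler_pM; rewrite ?mulr_ge0 ?powR_ge0 //; last exact: hb.
    apply: ler_pM; rewrite ?powR_ge0 //.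
      by apply: ge0_ler_powR; rewrite ?nnegrE ?(ltW q0) ?(ltW x0) ?invr_ge0.
    rewrite -[p - q]opprB !powRN lef_pV2 ?posrE ?powR_gt0 //.
    apply: ge0_ler_powR; rewrite ?nnegrE ?(ltW x10) ?(ltW s0) //.
      by rewrite subr_ge0 ltW // (le_lt_trans _ pq) // lerDl.
    by move: h1; lra.
apply: ge0_subset_integral => //; first exact: measurable_itv.
- by move=> x /I01P hx; rewrite lee_fin mnOm_ge0.
Qed.

(** For 1 - x <= 1 / (1 + L) the factor [mn] is at least s L, so that mass is controlled by [S0].
    Further from 1, [Psi_le] bounds [Om0] by (1 + L)^(q - p) / c, which is small for large c. *)
Let M0_split (s L : R) : 0 < s -> s < 1 -> 0 < L -> s * L <= 1 ->
  M0 <= S0 (s / (1 - s)) / (s * L) + (1 + L) `^ (q - p) / c.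
Proof.
move=> s0 s1 L0 sL; have sL0 : 0 < s * L by rewrite mulr_gt0.
have h1s : 0 < 1 - s by rewrite subr_gt0.
have Y0 : 0 <= s / (1 - s) by rewrite divr_ge0 // ltW.
have L1 : 0 < 1 + L by rewrite addr_gt0.
set D := _ / c; have D0 : 0 <= D by rewrite divr_ge0 ?powR_ge0 // ltW.
have i0 : 0 <= (s * L)^-1 by rewrite invr_ge0 ltW.
rewrite -lee_fin EFinD -M0E [S0 _ / _]mulrC EFinM -S0E //.
rewrite -ge0Zl01 //; last by move=> x /I01P hx; rewrite lee_fin mnOm_ge0.
have -> : D%:E = (\int[mu]_(x in I01) (cst D%:E x))%E.
  rewrite integral_cst //= [X in (_ * X)%E]lebesgue_measure_itv /= lte_fin ltr01.
  by rewrite oppr0 adde0 mule1.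
rewrite -ge0_integralD //.
- apply: ge0_le_integral => //.
  + exact/measurable_EFinP.
  + by apply: emeasurable_funD => //; exact: emeasurable_funM.
  move=> x /I01P hx; have /andP[x0 x1] := hx; have h1 : 0 < 1 - x by rewrite subr_gt0.
  rewrite /= -EFinM -EFinD lee_fin; have O0 := Om0_ge0 hx; have mO := mnOm_ge0 Y0 hx.
  have [hL|hL] := leP ((1 + L) * (1 - x)) 1.
    have : s * L <= mn (s / (1 - s)) x.
      rewrite /mn le_min sL /= ler_pdivlMr // [s / (1 - s) * x]mulrAC ler_pdivlMr // -!mulrA ler_pM2l //.
      have h2 : L * (1 - x) <= x by move: hL; rewrite mulrDl mul1r; lra.
      apply: le_trans h2; rewrite mulrA ler_piMr ?mulr_ge0 ?(ltW h1) ?(ltW L0) //.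
      by rewrite gerBl ltW.
    move=> h2; apply: (@le_trans _ _ ((s * L)^-1 * (mn (s / (1 - s)) x * Om0 x))); last by rewrite lerDl.
    by rewrite mulrA ler_peMl // ler_pdivlMl // mulr1.
  apply: (@le_trans _ _ D); last by rewrite lerDr mulr_ge0.
  rewrite Om0E // /D; apply: ler_pM; rewrite ?mulr_ge0 ?powR_ge0 ?Psi0 ?wI //; last exact: Psi_le.
  apply: (@le_trans _ _ ((1 - x) `^ (p - q))).
    by rewrite ler_piMl ?powR_ge0 // powR_le1 ?(ltW q0) // x0 ltW.
  rewrite -[p - q]opprB powRN -[X in X <= _]mul1r ler_pdivrMr ?powR_gt0 //.
  rewrite -powRM ?(ltW h1) ?(ltW L1) //.
  have pq0 : 0 <= q - p by rewrite subr_ge0 ltW // (le_lt_trans _ pq) // lerDl.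
  by have := ler_powR (ltW hL) pq0; rewrite powRr0.
- by move=> x /I01P hx; apply: mule_ge0; rewrite lee_fin ?mnOm_ge0.
- exact: emeasurable_funM.
Qed.

Hypothesis c_large : (1 + 64 / kk q p) `^ (q - p) / c / ib q p <= 4^-1.

Lemma kernel_contradiction : False.
Proof.
have e0 : 0 < e by rewrite /e -addrA -opprD subr_gt0.
have A0 : 0 < 2^-1 `^ q / 2 / ib q p by rewrite !divr_gt0 // powR_gt0 // invr_gt0.
have m1 : M0 / ib q p <= 1 by rewrite ler_pdivrMr // mul1r.
have L0 : 0 < 64 / kk q p by rewrite divr_gt0.
apply: (@blowup_false R c (kk q p) _ _ e (M0 / ib q p) (fun Y => S0 Y / ib q p) Psi
  c0 kk0 A0 c_large e0 m1).
- by move=> Y Y0; rewrite divr_ge0 ?S0_ge0 // ltW.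
- by move=> y Y y0 yY; rewrite mulrA ler_pM2r ?invr_gt0 // S0_mono.
- move=> x hx; rewrite ler_pdivlMr //; apply: le_trans (Psi_ineq hx).
  by rewrite le_eqVlt; apply/orP; left; apply/eqP; field; rewrite gt_eqF.
- move=> s b s0 s2 b00 hb; have := Om0_sub s0 s2 b00 hb.
  rewrite ler_pdivlMr //; congr (_ <= _).
  by field; rewrite gt_eqF.
- move=> s s0 s1 sk; have := M0_split s0 s1 L0 sk.
  rewrite -(ler_pM2r (_ : 0 < (ib q p)^-1)) ?invr_gt0 // mulrDl; congr (_ <= _ + _).
  by rewrite mulrAC.
Qed.

End Contradiction.

Theorem not_Beurling_seq (R : realType) (al : R) : 2 < al ->
  ~ Beurling_type (l2w (bw al)) (lip (bw al)) (@sshift R).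
Proof.
move=> al2 HB.
(* With q = al / 2 + ee and p = al - q - 1: ee <= 1/4 gives 2 q < al + 1, ee <= (al - 2) / 4 gives p
   > 0, and ee > 0 gives p + 1 < q. *)
pose ee := Num.min 4^-1 ((al - 2) / 4).
have e0 : 0 < ee by rewrite lt_min invr_gt0 ltr0n divr_gt0 ?subr_gt0.
have e1 : ee <= 4^-1 by rewrite ge_min lexx.
have e2 : ee <= (al - 2) / 4 by rewrite ge_min lexx orbT.
move: ee e0 e1 e2 => ee e0 e1 e2.
have [q qE] : exists q, q = al / 2 + ee by exists (al / 2 + ee).
have [p pE] : exists p, p = al - q - 1 by exists (al - q - 1).
have q1 : 1 <= q by move: al2 e0 qE; lra.
have p0 : 0 < p by move: al2 e0 e2 qE pE; lra.
have alE : q + p + 1 = al by rewrite pE; ring.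
have hq : 2 * q < al + 1 by move: e1 qE; lra.
have pq : p + 1 < q by move: e0 qE pE; lra.
have b0 : 0 < ib q p.
  by rewrite ib_gt0 //; [apply: le_trans q1|apply: lt_trans p0].
(* c = 4 N makes the bound on the mass away from 1, divided by [ib q p], equal to 1/4, as
   [kernel_contradiction] requires. *)
pose N := (1 + 64 / kk q p) `^ (q - p) / ib q p.
have N0 : 0 < N.
  have k0 := kk_gt0 q1 p0.
  by rewrite divr_gt0 // powR_gt0 // addr_gt0 // divr_gt0.
have c0 : 0 < 4 * N by rewrite mulr_gt0.
have a1 : 1 <= al by move: al2; lra.
have [psi [psiB hl2 psi0 psiE]] := limit_equation a1 c0 q1 hq HB.
rewrite -alE in psiB hl2 psiE hq.
apply: (@kernel_contradiction R q p (4 * N) psi) => //.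
rewrite mulrAC -/N invfM mulrCA mulfV ?mulr1 //.
by rewrite gt_eqF.
Qed.

Theorem corollary1p2 (R : realType) (alpha : R) (halpha : -1 < alpha) :
  Beurling_type (bergman alpha) (bergman_ip alpha) shift_op <-> alpha <= 1.
Proof.
have a0 : 0 < alpha + 1 by rewrite -ltrBlDr sub0r.
apply: (iff_trans (Beurling_bergman_seq halpha)); split => [h|h].
  by rewrite leNgt; apply/negP => a1; apply: (not_Beurling_seq _ h); rewrite ltrD2r.
by apply: Beurling_seq_le => //; rewrite lerD2r.
Qed.
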